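(* Let $\{S_i\}_{i\in\mathcal I}$ be a conformal system on $\overline U$ and let $\Sigma_A$ be a subshift of finite type such that $F_A$ satisfies the strong separation property. Let $\mu$ be a Gibbs measure for $F_A$. Then there exist a conformal map $S$ on $U$ and a measure $\mu_0\equiv\mu_i$ for some $i\in\mathcal I$, such that $\mu_0\circ S^{-1}$ generates an ergodic CP-chain of dimension at least $\dim_{\mathrm H}\mu$.
   Context: **Conformal systems.** $\mathcal I=\{0,\dots,M-1\}$ is a finite alphabet, $\Sigma=\mathcal I^{\mathbb N}$, $\sigma$ the left shift on $\Sigma$. For $\alpha=(\alpha_0,\alpha_1,\dots)\in\Sigma$ write $\alpha|_k=(\alpha_0,\dots,\alpha_{k-1})$. $U=\{x+iy\in\mathbb C: x,y\in(0,1)\}$, $X=\overline U$, identified with $[0,1]^2$. A map is conformal on an open set if it is holomorphic there with non-vanishing derivative. A conformal system is a finite family $\{S_i\}_{i\in\mathcal I}$ of contracting self-maps of $X$, each conformal on $U$. Put $S_{\alpha|_k}=S_{\alpha_0}\circ\cdots\circ S_{\alpha_{k-1}}$ and let $\mathrm{Lip}^{+}(T)$, $\mathrm{Lip}^-(T)$ be the supremum, infimum of $|T(x)-T(y)|/|x-y|$ over $x\ne y$ in $X$. Bounded distortion holds: there is $L\ge1$ with $\mathrm{Lip}^+(S_{\alpha|_k})\le L\,\mathrm{Lip}^-(S_{\alpha|_k})$ (with $\mathrm{Lip}^->0$) for all $\alpha\in\Sigma$, $k\in\mathbb N$. The coding map $\Pi:\Sigma\to X$ is given by $\{\Pi(\alpha)\}=\bigcap_{k\ge1}S_{\alpha|_k}(X)$.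 **Subshifts.** For an $M\times M$ matrix $A$ with entries in $\{0,1\}$, $\Sigma_A=\{\alpha\in\Sigma: A_{\alpha_l,\alpha_{l+1}}=1\ \forall l\ge 0\}$ is the subshift of finite type; $[\alpha|_n]=\{\beta\in\Sigma_A:\beta|_n=\alpha|_n\}$ are the cylinders. $F_A=\Pi(\Sigma_A)$ and $F_A^i=\Pi(\Sigma_A\cap[i])$ for $i\in\mathcal I$. **Strong separation property.** Two finite words are incomparable if neither is a subword of the other. $F_A$ satisfies the strong separation property if for all $\alpha,\beta\in\Sigma_A$ and $k,l\in\mathbb N$ with $\alpha|_k,\beta|_l$ incomparable, $S_{\alpha|_k}(X)\cap S_{\beta|_l}(X)=\emptyset$. **Gibbs measures.** Let $\phi:\Sigma_A\to\mathbb R$ be continuous with summable variations: $\sum_{l\ge0}\mathrm{var}_l(\phi)<\infty$, where $\mathrm{var}_n(\phi)=\sup\{|\phi(\alpha)-\phi(\beta)|:\alpha,\beta\in\Sigma_A,\ \alpha|_n=\beta|_n\}$. Let $\phi^n=\sum_{l=0}^{n-1}\phi\circ\sigma^l$ and let $P(\phi)=\lim_n\frac1n\log\sum_{[w],\,|w|=n}\sup_{[w]}e^{\phi^n}$ be the pressure. A Borel probability measure $\mu_{\rm sym}$ on $\Sigma_A$ is a Gibbs measure for $\phi$ if there are constants $C_1,C_2>0$ with $C_1\le \mu_{\rm sym}([\alpha|_n])/\exp(\phi^n(\alpha)-nP(\phi))\le C_2$ for all $\alpha\in\Sigma_A$, $n\in\mathbb N$ (shift-invariance is not assumed). A Gibbs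 measure for $F_A$ is a measure $\mu=\mu_{\rm sym}\circ\Pi^{-1}$ with $\mu_{\rm sym}$ a Gibbs measure for such a $\phi$; $\mu_i$ denotes $\mu$ restricted to $F_A^i$. $\mu_0\equiv\mu_i$ means mutual absolute continuity. **Dimension of measures.** $\dim_{\mathrm H}\mu=\inf\{\dim_{\mathrm H}E:\mu(E)>0\}$. **CP-chains (Furstenberg; Hochman–Shmerkin).** Fix an integer $b\ge2$. For $x\in[0,1)^d$, $\Delta_b^n(x)$ is the half-open $b$-adic cube of side $b^{-n}$ containing $x$; for a half-open $b$-adic cube $B\subseteq[0,1)^d$, $T_B$ is the rotation- and reflection-free similarity mapping $B$ onto $[0,1)^d$, and for a Borel probability measure $\mu$ on $[0,1]^d$ with $\mu(B)>0$, $\mu^B=\mu(B)^{-1}\mu|_B\circ T_B^{-1}$. A ($b$-adic) CP-chain is a stationary Markov chain $(\mu_n,B_n)_{n}$, where $\mu_n$ is a Borel probability measure on $[0,1]^d$ (almost surely giving full mass to $[0,1)^d$) and $B_n$ is one of the $b^d$ first-generation $b$-adic cubes, whose transition is $(\mu,B)\mapsto(\mu^{A},A)$ with probability $\mu(A)$, for $A$ ranging over the first-generation $b$-adic cubes. It is ergodic if this stationary process is ergodic. Its measure component $Q$ is the distribution of $\mu_n$, a Borel probability measure on the space $\mathcal P([0,1]^d)$ of Borel probability measures (with the weak-$*$ topology). The dimension of the CP-chain is $\int\dim_{\mathrm H}\nu\,dQ(\nu)$. A Borel probability measure $\mu$ on $[0,1]^d$ (with $\mu([0,1)^d)=1$)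 generates the ergodic CP-chain with measure component $Q$ if for $\mu$-a.e. $x$, $\frac1N\sum_{n=0}^{N-1}\delta_{\mu^{\Delta_b^n(x)}}\to Q$ weakly as $N\to\infty$, and for every $q\in\mathbb N$ there is a distribution $Q_q$ (possibly different from $Q$) such that for $\mu$-a.e. $x$, $\frac1N\sum_{n=0}^{N-1}\delta_{\mu^{\Delta_b^{qn}(x)}}\to Q_q$ weakly. Here $d=2$ and $\mathbb C$ is identified with $\mathbb R^2$; that $\mu_0\circ S^{-1}$ generates a CP-chain includes that it is a probability measure on $[0,1]^2$. *)

(* Defs.v *)
From HB Require Import structures.
From mathcomp Require Import all_boot all_order all_algebra complex.
From mathcomp Require Import ring lra.
From mathcomp Require Import all_classical all_reals all_analysis.

Set Implicit Arguments.
Unset Strict Implicit.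
Unset Printing Implicit Defensive.

Import Order.TTheory GRing.Theory Num.Theory numFieldNormedType.Exports.

Local Open Scope classical_set_scope.
Local Open Scope ring_scope.

Notation borel T := (g_sigma_algebraType (@open T)).

Section borel_lemmas.

Lemma open_borel (T : ptopologicalType) (A : set T) :
  open A -> measurable (A : set (borel T)).
Proof. by move=> oA; exact: sub_sigma_algebra. Qed.

Lemma closed_borel (T : ptopologicalType) (A : set T) :
  closed A -> measurable (A : set (borel T)).
Proof.
move=> cA; rewrite -(setCK A); apply: (@measurableC _ (borel T)).
by apply: open_borel; exact: closed_openC.
Qed.

Lemma continuous_borel (T T' : ptopologicalType) (f : T -> T') :
  continuous f -> measurable_fun [set: borel T] (f : borel T -> borel T').
Proof.
move=> /continuousP cf.
apply: (@measurability _ _ (borel T) (borel T') setT f (@open T')) => //.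
by move=> _ [B oB <-]; rewrite setTI; apply: open_borel; exact: cf.
Qed.

End borel_lemmas.

Section plane.
Context (R : realType).

(* A normed module over the field R[i]: [derivable f z 1] and ['D_1 f z] are
   complex differentiability and the complex derivative. *)
Definition plane : Type := R[i]^o.
HB.instance Definition _ := NormedModule.copy plane R[i]^o.
HB.instance Definition _ := Pointed.copy plane R[i]^o.

Definition cdist (z w : plane) : R := ComplexField.Normc.normc (z - w).

Definition open_square : set plane :=
  [set z | 0 < complex.Re z < 1 /\ 0 < complex.Im z < 1].

Definition closed_square : set plane :=
  [set z | 0 <= complex.Re z <= 1 /\ 0 <= complex.Im z <= 1].

Definition half_open_square : set plane :=
  [set z | 0 <= complex.Re z < 1 /\ 0 <= complex.Im z < 1].

Definition conformal_on (U : set plane) (f : plane -> plane) : Prop :=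
  forall z, U z -> derivable f z 1 /\ 'D_1 f z != 0.


Lemma nbhs_plane (z : plane) (V : set plane) (e : R) : 0 < e ->
  (forall w, cdist z w < e -> V w) -> nbhs z V.
Proof.
move=> e0 zV; apply/nbhs_ballP; exists (e%:C)%C; first by rewrite /= ltcR.
move=> w; rewrite -ball_normE /= => zw; apply: zV.
by move: zw; rewrite /cdist -[`|_|]/((ComplexField.Normc.normc _)%:C)%C ltcR.
Qed.

Lemma continuous_Re : continuous (@complex.Re R : plane -> R).
Proof.
move=> z; apply: ((@cvgrPdist_lt R R^o plane (nbhs z) _ _ _).2) => e e0; apply: (nbhs_plane e0) => w.
apply: le_lt_trans; rewrite /cdist; case: z w => [a b] [c d] /=.
by rewrite -sqrtr_sqr ler_sqrt ?addr_ge0 ?sqr_ge0// lerDl sqr_ge0.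
Qed.

Lemma continuous_Im : continuous (@complex.Im R : plane -> R).
Proof.
move=> z; apply: ((@cvgrPdist_lt R R^o plane (nbhs z) _ _ _).2) => e e0; apply: (nbhs_plane e0) => w.
apply: le_lt_trans; rewrite /cdist; case: z w => [a b] [c d] /=.
by rewrite -sqrtr_sqr ler_sqrt ?addr_ge0 ?sqr_ge0// lerDr sqr_ge0.
Qed.


Lemma plane_nbhs (z : plane) (V : set plane) : nbhs z V ->
  exists2 e : R, 0 < e & forall w, cdist z w < e -> V w.
Proof.
move=> /nbhs_ballP[[e e']] /=; rewrite ltcE/= => /andP[/eqP -> e0] zV.
exists e => // w zw; apply: zV; rewrite -ball_normE /=.
by rewrite -[`|_|]/((ComplexField.Normc.normc _)%:C)%C ltcR.
Qed.

Lemma closed_closed_square : closed closed_square.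
Proof.
rewrite (_ : closed_square =
  (@complex.Re R : plane -> R) @^-1` `[0, 1] `&`
  (@complex.Im R : plane -> R) @^-1` `[0, 1]).
  apply: closedI.
    by apply: closed_comp => [z _|]; [exact: continuous_Re|exact: interval_closed].
  by apply: closed_comp => [z _|]; [exact: continuous_Im|exact: interval_closed].
by apply/seteqP; split=> z; rewrite /closed_square/= !in_itv.
Qed.

Lemma closure_open_square : closure open_square = closed_square.
Proof.
apply/seteqP; split=> [|z [za zb] V /plane_nbhs[e e0 zV]].
  rewrite [X in _ `<=` X](closure_id _).1; last exact: closed_closed_square.
  apply: closure_subset => z [/andP[a b] /andP[c d]].
  by split; rewrite ?(ltW a) ?(ltW b) ?(ltW c) ?(ltW d).
pose t := Num.min e 1 / 2.
have t0 : 0 < t by rewrite divr_gt0// lt_min e0 ltr01.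
have te : t < e by rewrite /t; case: (leP e 1) => *; lra.
have t1 : t <= 1 / 2 by rewrite /t; case: (leP e 1) => *; lra.
exists (complex.Complex (complex.Re z + t * (1 / 2 - complex.Re z))
                        (complex.Im z + t * (1 / 2 - complex.Im z))); split.
  by split => /=; apply/andP; split; nra.
apply: zV; apply: lt_trans te; rewrite /cdist; case: z za zb => a b /= za zb.
rewrite -[ltRHS]gtr0_norm// -sqrtr_sqr.
rewrite ltr_sqrt ?exprn_gt0//.
rewrite (_ : _ + _ = t ^+ 2 * ((1 / 2 - a) ^+ 2 + (1 / 2 - b) ^+ 2)); last by ring.
rewrite -[ltRHS]mulr1 ltr_pM2l ?exprn_gt0//.
move: za zb => /andP[? ?] /andP[? ?].
by rewrite !expr2; nra.
Qed.

Lemma measurable_plane_rect (a a' c c' : R) :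
  measurable ([set z : plane | a <= complex.Re z < a' /\
                               c <= complex.Im z < c'] : set (borel plane)).
Proof.
rewrite (_ : [set _ | _] =
  ((@complex.Re R : plane -> R) @^-1` `[a, +oo[ `&`
   (@complex.Re R : plane -> R) @^-1` `]-oo, a'[) `&`
  ((@complex.Im R : plane -> R) @^-1` `[c, +oo[ `&`
   (@complex.Im R : plane -> R) @^-1` `]-oo, c'[)); last first.
  apply/seteqP; split=> z /=; rewrite !in_itv/= !andbT.
    by move=> [/andP[-> ->] /andP[-> ->]].
  by move=> [[-> ->] [-> ->]].
apply: (@measurableI _ (borel plane)); apply: (@measurableI _ (borel plane)).
- apply: closed_borel; apply: closed_comp => [z _|]; first exact: continuous_Re.
  exact: interval_closed.
- apply: open_borel; apply: open_comp => [z _|]; first exact: continuous_Re.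
  exact: interval_open.
- apply: closed_borel; apply: closed_comp => [z _|]; first exact: continuous_Im.
  exact: interval_closed.
- apply: open_borel; apply: open_comp => [z _|]; first exact: continuous_Im.
  exact: interval_open.
Qed.

End plane.

Arguments cdist {R}.
Arguments open_square : clear implicits.
Arguments closed_square : clear implicits.
Arguments half_open_square : clear implicits.
Arguments conformal_on {R}.

Section hausdorff_dimension.
Context (R : realType).
Local Open Scope ereal_scope.
Implicit Types (E : set (plane R)) (s delta : R).

Definition diam E : \bar R := ereal_sup [set (cdist z w)%:E | z in E & w in E].

(* The empty set weighs 0, also for s = 0. *)
Definition hausdorff_weight s E : \bar R :=
  if E == set0 then 0 else diam E `^ s.

Definition hausdorff_premeasure s delta E : \bar R :=
  ereal_inf [set \sum_(0 <= k <oo) hausdorff_weight s (F k) | F in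
    [set F : (set (plane R))^nat |
      E `<=` \bigcup_k F k /\ forall k, diam (F k) <= delta%:E]].

Definition hausdorff_measure s E : \bar R :=
  ereal_sup [set hausdorff_premeasure s delta E | delta in [set d | (0 < d)%R]].

Definition hausdorff_dim E : \bar R :=
  ereal_inf [set s%:E | s in [set s | (0 <= s)%R /\ hausdorff_measure s E = 0]].

Definition measure_dim (mu : set (borel (plane R)) -> \bar R) : \bar R :=
  ereal_inf [set hausdorff_dim E |
             E in [set E : set (borel (plane R)) | measurable E /\ 0 < mu E]].

End hausdorff_dimension.

Section symbolic.
Context (R : realType) (M : nat).

(* Sequences over the (nonempty) alphabet {0, ..., M}, with the product of the
   discrete topologies. *)
Definition shift_space : Type := {ptws nat -> discrete_topology 'I_M.+1}.
HB.instance Definition _ :=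
  Topological.copy shift_space {ptws nat -> discrete_topology 'I_M.+1}.
HB.instance Definition _ :=
  isPointed.Build shift_space (fun=> ord0 : 'I_M.+1).

Implicit Types (alpha beta : shift_space) (A : 'M[bool]_M.+1)
  (phi : shift_space -> R).

Definition prefix_word alpha (k : nat) : seq 'I_M.+1 := mkseq alpha k.

Definition left_shift alpha : shift_space := fun l => alpha l.+1.

Definition subshift A : set shift_space :=
  [set alpha | forall l, A (alpha l) (alpha l.+1)].

Definition cylinder A (w : seq 'I_M.+1) : set shift_space :=
  [set beta | subshift A beta /\ prefix_word beta (size w) = w].

Definition variation A phi (n : nat) : \bar R :=
  ereal_sup [set r | exists alpha beta,
    [/\ subshift A alpha, subshift A beta,
        prefix_word alpha n = prefix_word beta n &
        r = `|phi alpha - phi beta|%:E]].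

Definition summable_variations A phi : Prop :=
  (\sum_(0 <= l <oo) variation A phi l < +oo)%E.

Definition birkhoff_sum phi (n : nat) alpha : R :=
  \sum_(l < n) phi (iter l left_shift alpha).

Definition pressure A phi : R :=
  limn (fun n : nat => n%:R^-1 *
    ln (\sum_(w : n.-tuple 'I_M.+1 | `[< cylinder A w !=set0 >])
          sup [set expR (birkhoff_sum phi n alpha) | alpha in cylinder A w])).

Definition gibbs A phi (m : probability (borel shift_space) R) : Prop :=
  m (subshift A) = 1%E /\
  exists C1 C2 : R, [/\ 0 < C1, 0 < C2 & forall alpha n, subshift A alpha ->
    C1 <= fine (m (cylinder A (prefix_word alpha n))) /
          expR (birkhoff_sum phi n alpha - n%:R * pressure A phi) <= C2].

End symbolic.

Arguments left_shift {M}.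

Section conformal_system.
Context (R : realType) (M : nat).
Implicit Types (S : 'I_M.+1 -> plane R -> plane R) (T : plane R -> plane R)
  (A : 'M[bool]_M.+1).
Local Notation X := (closed_square R).

Definition difference_quotients T : set (\bar R) :=
  [set r | exists x y, [/\ X x, X y, x <> y &
                           r = (cdist (T x) (T y) / cdist x y)%:E]].

Definition lip_sup T : \bar R := ereal_sup (difference_quotients T).
Definition lip_inf T : \bar R := ereal_inf (difference_quotients T).

Definition word_map S (w : seq 'I_M.+1) : plane R -> plane R :=
  foldr (fun i f => S i \o f) id w.

Definition bounded_distortion S : Prop :=
  exists2 L : R, 1 <= L & forall (alpha : shift_space M) k,
    let T := word_map S (prefix_word alpha k) in
    (0 < lip_inf T /\ lip_sup T <= L%:E * lip_inf T)%E.

(* Only the values of the S i on X matter. *)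
Definition conformal_system S : Prop :=
  [/\ forall i z, X z -> X (S i z),
      forall i, (lip_sup (S i) < 1)%E,
      forall i, conformal_on (open_square R) (S i) &
      bounded_distortion S].

(* The intersection is a singleton for a conformal system. *)
Definition coding S (alpha : shift_space M) : plane R :=
  get (\bigcap_(k in [set k | (1 <= k)%N])
         (word_map S (prefix_word alpha k) @` X)).

Definition limit_piece S A (i : 'I_M.+1) : set (plane R) :=
  coding S @` (subshift A `&` [set alpha | alpha 0%N = i]).

(* Incomparable: neither word is a (contiguous) subword of the other. *)
Definition incomparable (v w : seq 'I_M.+1) : bool :=
  ~~ infix v w && ~~ infix w v.

Definition strong_separation S A : Prop :=
  forall (alpha beta : shift_space M) k l, subshift A alpha -> subshift A beta ->
    incomparable (prefix_word alpha k) (prefix_word beta l) ->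
    word_map S (prefix_word alpha k) @` X `&`
    word_map S (prefix_word beta l) @` X = set0.

Definition gibbs_for S A (mu : probability (borel (plane R)) R) : Prop :=
  exists (phi : shift_space M -> R)
         (mu_sym : probability (borel (shift_space M)) R),
    [/\ {within subshift A, continuous phi}, summable_variations A phi,
        gibbs A phi mu_sym &
        forall E : set (borel (plane R)), measurable E ->
          mu E = mu_sym (subshift A `&` coding S @^-1` E)].

End conformal_system.

Section square_probability.
Context (R : realType).
Local Notation X := (closed_square R).

(* P([0,1]^2): the Borel probability measures carried by the closed square. *)
Record square_prob := SquareProb {
  square_law :> probability (borel (plane R)) R;
  square_lawP : square_law X = 1%E }.

Lemma dirac0_square : (\d_(0 : borel (plane R)) : probability _ R) X = 1%E.
Proof. by rewrite /= diracE mem_set//; split; rewrite /= lexx ler01. Qed.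

HB.instance Definition _ := gen_eqMixin square_prob.
HB.instance Definition _ := gen_choiceMixin square_prob.
HB.instance Definition _ := isPointed.Build square_prob (SquareProb dirac0_square).

(* C([0,1]^2) *)
Definition square_test : Type :=
  {f : plane R -> R | {within X, continuous f}}.

Definition square_pairing (nu : square_prob) : {ptws square_test -> R} :=
  fun f => \int[nu]_(z in X) (sval f z).

(* The weak-* topology is the initial topology of nu |-> (f |-> \int f d nu). *)
HB.instance Definition _ :=
  Topological.copy square_prob (initial_topology square_pairing).

End square_probability.

Section zooming.
Context (R : realType) (b : nat).
Local Notation X := (closed_square R).
Implicit Types (n : nat) (k : nat * nat) (nu : square_prob R).

(* The half-open b-adic cube [k.1/b^n, (k.1+1)/b^n) x [k.2/b^n, (k.2+1)/b^n). *)
Definition bcube n k : set (plane R) :=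
  [set z | k.1%:R / b%:R ^+ n <= complex.Re z < k.1.+1%:R / b%:R ^+ n /\
           k.2%:R / b%:R ^+ n <= complex.Im z < k.2.+1%:R / b%:R ^+ n].

(* Index of the level-n cube containing z, for z in [0,1)^2. *)
Definition bcube_index n (z : plane R) : nat * nat :=
  (Num.truncn (b%:R ^+ n * complex.Re z), Num.truncn (b%:R ^+ n * complex.Im z)).

(* The similarity T_B for B = bcube n k. *)
Definition bcube_map n k (z : plane R) : plane R :=
  ((b%:R : R) ^+ n)%:C%C *: z - complex.Complex k.1%:R k.2%:R.

Lemma measurable_bcube n k : measurable (bcube n k : set (borel (plane R))).
Proof. exact: measurable_plane_rect. Qed.

Lemma measurable_bcube_map n k :
  measurable_fun [set: borel (plane R)]
    (bcube_map n k : borel (plane R) -> borel (plane R)).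
Proof.
apply: continuous_borel => z; apply: continuousB; last exact: cst_continuous.
exact: scaler_continuous.
Qed.

Lemma bcube_map_square n k : bcube n k `<=` bcube_map n k @^-1` X.
Proof.
have [b0|b0] := posnP (b ^ n)%N.
  by rewrite /bcube -natrX b0 invr0 => z /=; rewrite !mulr0; case; lra.
have bn0 : 0 < b%:R ^+ n :> R by rewrite -natrX ltr0n.
case=> x y []/=; rewrite !ler_pdivrMr// !ltr_pdivlMr// -!natr1.
move=> /andP[? ?] /andP[? ?]; rewrite /closed_square/=.
by split; apply/andP; split; lra.
Qed.

Section blowup.
Context (nu : square_prob R) (n : nat) (k : nat * nat).

Definition blowup_mass : set (borel (plane R)) -> \bar R :=
  pushforward (mrestr nu (measurable_bcube n k))
    (bcube_map n k : borel (plane R) -> borel (plane R)).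

Let blowup_mass0 : blowup_mass set0 = 0%E.
Proof. by rewrite /blowup_mass /pushforward preimage_set0 measure0. Qed.

Let blowup_mass_ge0 E : (0 <= blowup_mass E)%E.
Proof. exact: (measure_ge0 (mrestr nu (measurable_bcube n k))). Qed.

Let blowup_mass_sigma_additive : semi_sigma_additive blowup_mass.
Proof.
exact: (@measure_semi_sigma_additive _ _ _
  (@measure_function_pushforward__canonical__measure_function_Measure _ _ _ _ _
    (mrestr nu (measurable_bcube n k)) _ (measurable_bcube_map n k))).
Qed.

HB.instance Definition _ := isMeasure.Build _ _ _ blowup_mass
  blowup_mass0 blowup_mass_ge0 blowup_mass_sigma_additive.

Lemma mnormalize_blowup_square : mnormalize blowup_mass nu X = 1%E.
Proof.
rewrite /mnormalize; case: ifPn => [_|]; first exact: square_lawP.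
have XT : blowup_mass X = blowup_mass setT.
  rewrite /blowup_mass /pushforward /mrestr preimage_setT setTI; congr (nu _).
  by apply/setIidPr; exact: bcube_map_square.
rewrite negb_or => /andP[m0 moo].
have mfin : blowup_mass setT \is a fin_num.
  by rewrite ge0_fin_numE ?measure_ge0// ltey.
rewrite [X in (X * _)%E = _](XT : _ = blowup_mass setT).
by rewrite -[X in (X * _)%E = _](fineK mfin) -EFinM divff// fine_eq0.
Qed.

(* nu^B = nu(B)^-1 nu|_B o T_B^-1 for B = bcube n k; it is nu when nu(B) = 0. *)
Definition magnify : square_prob R := SquareProb mnormalize_blowup_square.

End blowup.

End zooming.

Section cp_chain.
Context (R : realType) (b : nat).
Implicit Types (n : nat) (nu : square_prob R)
  (Q : probability (borel (square_prob R)) R).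
Local Open Scope ereal_scope.

(* Bounded continuous test functions, in general; the space P([0,1]^2) of
   interest here is compact. *)
Definition weakly_converges (T : ptopologicalType)
    (m : {measure set (borel T) -> \bar R}^nat)
    (Q : probability (borel T) R) : Prop :=
  forall F : T -> R, continuous F -> [bounded F x | x in [set: T]] ->
    \int[m N]_x (F x)%:E @[N --> \oo] --> \int[Q]_x (F x)%:E.

(* The pair (i, j) with i, j < b stands for the first-generation cube
   bcube b 1 (i, j). *)
Definition cp_state := (borel (square_prob R) * (nat * nat))%type.

Definition coordinate_events (K : set nat) : set (set (nat -> cp_state)) :=
  [set [set w | F (w k)] | k in K & F in measurable].

Definition cp_path := g_sigma_algebraType (coordinate_events setT).

Definition past_event n : set (set cp_path) :=
  <<s coordinate_events [set k | (k <= n)%N] >>.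

Definition path_shift (w : cp_path) : cp_path := fun n => w n.+1.

(* (nu, B) |-> (nu^A, A) with probability nu(A). *)
Definition cp_kernel (x : cp_state) (F : set cp_state) : \bar R :=
  \sum_(i < b) \sum_(j < b)
    (x.1 : square_prob R) (bcube b 1 (i : nat, j : nat)) *
    \d_((magnify b x.1 1 (i : nat, j : nat), (i : nat, j : nat)) : cp_state) F.

Definition cp_valid_state (x : cp_state) : Prop :=
  [/\ (x.1 : square_prob R) (half_open_square R) = 1,
      (x.2.1 < b)%N & (x.2.2 < b)%N].

(* P is the joint law of the sequence (mu_n, B_n)_n. *)
Definition cp_chain (P : probability cp_path R) : Prop :=
  [/\ {ae P, forall w : cp_path, forall n, cp_valid_state (w n)},
      forall E : set cp_path, measurable E -> P (path_shift @^-1` E) = P E &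
      forall n (E : set cp_path) (F : set cp_state), past_event n E ->
        measurable F ->
        P (E `&` [set w | F (w n.+1)]) = \int[P]_(w in E) cp_kernel (w n) F].

Definition cp_ergodic (P : probability cp_path R) : Prop :=
  forall E : set cp_path, measurable E -> path_shift @^-1` E = E ->
    P E = 0 \/ P E = 1.

Definition measure_component (P : probability cp_path R) Q : Prop :=
  forall E : set (borel (square_prob R)), measurable E ->
    Q E = P [set w | E (w 0%N).1].

Definition cp_dim Q : \bar R := \int[Q]_nu measure_dim (nu : square_prob R).

Definition scenery nu (z : plane R) n : square_prob R :=
  magnify b nu n (bcube_index b n z).

Definition empirical nu (q : nat) (z : plane R) (N : nat) :
    {measure set (borel (square_prob R)) -> \bar R} :=
  mscale (N%:R^-1 : R)%R%:nng%R
    (msum (fun n => \d_(scenery nu z (q * n)%N : borel (square_prob R))) N).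

Definition generates nu Q : Prop :=
  [/\ nu (half_open_square R) = 1,
      {ae nu, forall z, weakly_converges (empirical nu 1 z) Q} &
      forall q : nat, exists Qq : probability (borel (square_prob R)) R,
        {ae nu, forall z, weakly_converges (empirical nu q z) Qq}].

End cp_chain.

(* Main.v *)
(* A measure on the square is coded by the bits of its conditional cell weights,
   and a pair (measure, typical point) by a sequence [om] of (digit, bits)
   letters, on which magnification is a continuous map [T] on a compact space.
   Averaging the codes of the magnifications of many small translates of [mu]
   (so that no mass escapes to the cell boundaries) and passing to the limit
   along an ultrafilter gives a [T]-invariant law whose fibres over the bits are
   the coded measures; its mean entropy is at least dim [mu], and almost every
   orbit generates an ergodic component. Some component keeps the entropy bound,
   which yields the dimension of its chain by the mass distribution principle.
   A typical measure of this component is a limit of magnifications of [mu].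
   By strong separation each of them is, in a neighbourhood, the image of [mu]
   conditioned on a cylinder under a rescaled branch [S_w]. The branches are
   uniformly bi-Lipschitz, so a limit [f] of them exists and is conformal by
   Cauchy's formula, and the conditioned Gibbs measures converge to a law
   equivalent to [mu_i]. Hence the image of that law under [f] is locally a
   multiple of the typical measure, and has eventually the same sceneries. *)
Require Import Defs.
From HB Require Import structures.
From mathcomp Require Import all_boot all_order all_algebra complex.
From mathcomp Require Import ring lra zify.
From mathcomp Require Import all_classical all_reals all_analysis measurable_realfun.
Set Implicit Arguments.
Unset Strict Implicit.
Unset Printing Implicit Defensive.
Import Order.TTheory GRing.Theory Num.Theory numFieldNormedType.Exports.
Local Open Scope classical_set_scope.
Local Open Scope ring_scope.

(** Magnification of measures is discontinuous where cell boundaries are charged and undefined on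
    null cells. On codes it only re-indexes a table of bits, so limits can be taken before anything
    is known about boundaries; afterwards a bound on long runs of equal digits shows that typical
    codes stay away from them. What has to survive every limit is that the digits, given the bits,
    follow the coded measure. This is expressed by a kernel that preserves continuous functions, so
    it is closed under weak limits; it passes to ergodic components because its defect is orthogonal
    to its own later iterates. The same kernel gives the Markov property of the chain and, through a
    variance estimate on the fibres, convergence along every arithmetic progression of scales, where
    the limit may vary with the fibre. Rescaled branches describe a typical measure only near one
    piece of the attractor; the comparison is therefore made on an open set, which is enough because
    sceneries are local. *)

Notation pfx := prefix_word.
Notation meas_fun := (measurable_fun setT).
Tactic Notation "via" uconstr(mid) := refine (@le_trans _ _ mid _ _ _ _).
Ltac premeas := match goal with |- measurable ?E => rewrite -(setTI E) end.

(** * Probability and shift spaces *)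

Section ultralimit.
Context (R : realType).

Lemma free_ultrafilter :
  exists U : set_system nat, UltraFilter U /\ (\oo : set_system nat) `<=` U.
Proof. exact: ultraFilterLemma. Qed.

(** Compactness of a segment in ultrafilter form: bounded sequences converge along [U], which
    replaces the extraction of subsequences throughout. *)
Lemma ultra_cvg (U : set_system nat) (u : nat -> R) (K : R) : UltraFilter U ->
  (forall n, `|u n| <= K) -> cvg (u @ U).
Proof.
move=> UU uK.
have := @segment_compact R (- K) K; rewrite compact_ultra.
have UI : UltraFilter (u @ U).
 split; first exact: fmap_proper_filter.
 move=> G GG sub; apply/seteqP; split=> [A GA|]//.
 case: (@in_ultra_setVsetC _ U (u @^-1` A) UU)=> // UnA.
 have /filter_ex[x []//] : G (A `&` ~` A).
 by apply: filterI=> //; apply: sub.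
move=> /(_ (u @ U) UI)[|p [_ up]]; last by apply/cvg_ex; exists p.
rewrite /= /fmap; apply: filterS filterT=> n _ /=.
by rewrite in_itv/= -ler_norml.
Qed.

Lemma ultra_pick (I : finType) (U : set_system nat) (f : nat -> I) :
  UltraFilter U -> exists i, U [set n | f n = i].
Proof.
move=> UU; apply: contrapT=> /forallNP h.
have : U [set n | forall i, f n <> i].
 apply: filter_forall=> i.
 by have [/h|] := @in_ultra_setVsetC _ U [set n | f n = i] UU.
by move=> /filter_ex[n /(_ (f n))].
Qed.
End ultralimit.

Section expectation.
Context d (T : measurableType d) (R : realType).
Implicit Types (P : probability T R) (f g : T -> R).

(** Bounded measurable functions form an algebra on which the real-valued expectation is linear with
    no integrability to check. *)
Definition bmf f := meas_fun f /\ exists K : R, forall x, `|f x| <= K.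

Definition Ex P f : R := \int[P]_x f x.

Lemma bmf_int P f : bmf f -> P.-integrable setT (EFin \o f).
Proof.
move=> [mf [K fK]]; apply: (@le_integrable _ _ _ _ _ _ _ (EFin \o cst K))=> //.
- exact/measurable_EFinP.
- move=> x _ /=; rewrite lee_fin (le_trans (fK x))// ler_norm//.
- exact: finite_measure_integrable_cst.
Qed.

Lemma bmf_cst c : bmf (cst c).
Proof. by split; [by []|exists `|c|]. Qed.

Lemma bmfD f g : bmf f -> bmf g -> bmf (fun x => f x + g x).
Proof.
move=> [mf [K fK]] [mg [L gL]]; split; first exact: measurable_funD.
by exists (K + L)=> x; rewrite (le_trans (ler_normD _ _))// lerD.
Qed.

Lemma bmfM f g : bmf f -> bmf g -> bmf (fun x => f x * g x).
Proof.
move=> [mf [K fK]] [mg [L gL]]; split; first exact: measurable_funM.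
by exists (K * L)=> x; rewrite normrM ler_pM.
Qed.

Lemma bmfN f : bmf f -> bmf (fun x => - f x).
Proof.
move=> [mf [K fK]]; split; first exact: measurableT_comp.
by exists K=> x; rewrite normrN.
Qed.

Lemma bmfB f g : bmf f -> bmf g -> bmf (fun x => f x - g x).
Proof. by move=> bf bg; apply: bmfD=> //; exact: bmfN. Qed.

Lemma bmfZ c f : bmf f -> bmf (fun x => c * f x).
Proof. by move=> bf; apply: bmfM=> //; exact: bmf_cst. Qed.

Lemma bmf_norm f : bmf f -> bmf (fun x => `|f x|).
Proof.
move=> [mf [K fK]]; split; first exact: measurableT_comp.
by exists K=> x; rewrite normr_id.
Qed.

Lemma bmf_sum (I : Type) (s : seq I) (p : pred I) (F : I -> T -> R) :
  (forall i, bmf (F i)) -> bmf (fun x => \sum_(i <- s | p i) F i x).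
Proof.
move=> bF; elim: s=> [|i s ih].
 by rewrite (_ : (fun x=> _) = 0); [exact: bmf_cst|apply/funext=> x; rewrite big_nil].
rewrite (_ : (fun x=> _) = fun x=> (if p i then F i x else 0) + \sum_(j <- s | p j) F j x).
 by apply: bmfD=> //; case: (p i); [by []|exact: bmf_cst].
by apply/funext=> x; rewrite big_cons; case: (p i)=> //; rewrite add0r.
Qed.

Lemma bmf_indic (A : set T) : measurable A -> bmf (\1_A : T -> R).
Proof.
move=> mA; split=> //.
by exists 1=> x; rewrite indicE; case: (x \in A); rewrite ?normr1 ?normr0.
Qed.

Lemma Ex_cst P c : Ex P (cst c) = c.
Proof. by rewrite /Ex Rintegral_cst// [X in fine X](probability_setT P) mulr1. Qed.

Lemma ExD P f g : bmf f -> bmf g -> Ex P (fun x => f x + g x) = Ex P f + Ex P g.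
Proof. by move=> bf bg; rewrite /Ex RintegralD//; exact: bmf_int. Qed.

Lemma ExB P f g : bmf f -> bmf g -> Ex P (fun x => f x - g x) = Ex P f - Ex P g.
Proof. by move=> bf bg; rewrite /Ex RintegralB//; exact: bmf_int. Qed.

Lemma ExZ P c f : bmf f -> Ex P (fun x => c * f x) = c * Ex P f.
Proof. by move=> bf; rewrite /Ex RintegralZl//; exact: bmf_int. Qed.

Lemma Ex_sum P (I : Type) (s : seq I) (p : pred I) (F : I -> T -> R) :
  (forall i, bmf (F i)) ->
  Ex P (fun x => \sum_(i <- s | p i) F i x) = \sum_(i <- s | p i) Ex P (F i).
Proof.
move=> bF; elim: s=> [|i s ih].
 rewrite big_nil (_ : (fun x=> _) = cst 0) ?Ex_cst//.
 by apply/funext=> x; rewrite big_nil.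
rewrite (_ : (fun x=> _) = fun x=> (if p i then F i x else 0) + \sum_(j <- s | p j) F j x).
 rewrite ExD ?ih ?big_cons; last 2 first.
 - by case: (p i); [by []|exact: bmf_cst].
 - exact: bmf_sum.
 by case: (p i)=> //; rewrite (Ex_cst P 0) add0r.
by apply/funext=> x; rewrite big_cons; case: (p i)=> //; rewrite add0r.
Qed.

Lemma Ex_le P f g : bmf f -> bmf g -> (forall x, f x <= g x) -> Ex P f <= Ex P g.
Proof. by move=> bf bg fg; apply: le_Rintegral=> //; exact: bmf_int. Qed.

Lemma Ex_ge0 P f : (forall x, 0 <= f x) -> 0 <= Ex P f.
Proof. by move=> f0; exact: Rintegral_ge0. Qed.

Lemma Ex_norm P f : bmf f -> `|Ex P f| <= Ex P (fun x => `|f x|).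
Proof. by move=> bf; apply: le_normr_Rintegral=> //; exact: bmf_int. Qed.

Lemma Ex_normK P f K : bmf f -> (forall x, `|f x| <= K) -> `|Ex P f| <= K.
Proof.
move=> bf fK; rewrite (le_trans (Ex_norm P bf))// -[leRHS](Ex_cst P).
by apply: Ex_le=> //; [exact: bmf_norm|exact: bmf_cst].
Qed.

Lemma EFin_Ex P f : bmf f -> (\int[P]_x (f x)%:E = (Ex P f)%:E)%E.
Proof.
move=> bf; rewrite /Ex /Rintegral fineK//.
apply: integrable_fin_num=> //; exact: bmf_int.
Qed.

Lemma Ex_indic P (A : set T) : measurable A -> Ex P (\1_A : T -> R) = fine (P A).
Proof. by move=> mA; rewrite /Ex /Rintegral integral_indic// setIT. Qed.

Lemma Ex_ae P f g : bmf f -> bmf g -> {ae P, forall x, f x = g x} ->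
  Ex P f = Ex P g.
Proof.
move=> [mf _] [mg _] fg; rewrite /Ex /Rintegral; congr fine.
apply: ae_eq_integral=> //; try exact/measurable_EFinP.
by apply: filterS fg=> x /= ->.
Qed.

Lemma Ex_dct P (f_ : nat -> T -> R) f K : (forall n, meas_fun (f_ n)) ->
  (forall n x, `|f_ n x| <= K) -> bmf f ->
  {ae P, forall x, f_ n x @[n --> \oo] --> f x} ->
  Ex P (f_ n) @[n --> \oo] --> Ex P f.
Proof.
move=> mf fK bf cf.
have bfn n : bmf (f_ n) by split=> //; exists K.
have [] := @dominated_convergence _ T R P setT (@measurableT _ T)
 (fun n x=> (f_ n x)%:E) (EFin \o f) (EFin \o cst K) _ _ _ _.
- by move=> n; exact/measurable_EFinP.
- by apply/measurable_EFinP; case: bf.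
- apply: filterS cf=> x cfx _.
 by apply/fine_cvgP; split; [exact: nearW|].
- exact: finite_measure_integrable_cst.
- by apply: aeW=> x n _ /=; rewrite lee_fin.
move=> _ _ h.
have {h} : (Ex P (f_ n))%:E @[n --> \oo] --> (Ex P f)%:E.
 by rewrite -EFin_Ex//; apply: cvg_trans h; apply: near_eq_cvg; apply: nearW=> n /=; rewrite -EFin_Ex.
by move/fine_cvg.
Qed.

Lemma Ex_ae0 P f : bmf f -> (forall x, 0 <= f x) -> Ex P f = 0 ->
  {ae P, forall x, f x = 0}.
Proof.
move=> bf f0 E0; have := EFin_Ex P bf; rewrite E0=> h.
have mf : meas_fun (EFin \o f) by apply/measurable_EFinP; case: bf.
have := @ae_eq_integral_abs _ T R P setT measurableT (EFin \o f) mf.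
case=> + _; rewrite (_ : (\int[P]_(x in setT) _ = 0)%E); last first.
 by rewrite -[RHS]h; apply: eq_integral=> x _ /=; rewrite ger0_norm.
by move=> /(_ erefl); apply: filterS=> x /(_ Logic.I) /= [].
Qed.

End expectation.

Create HintDb tame.
Hint Resolve bmf_cst bmfD bmfM bmfN bmfB bmfZ bmf_norm bmf_sum bmf_indic : tame.
Ltac tame := solve [auto 8 with tame nocore].

Lemma Ex_push d d' (T : measurableType d) (T' : measurableType d') (R : realType)
  (P : probability T R) (Q : probability T' R) (h : T -> T') (f : T' -> R) :
  meas_fun h -> (forall E, measurable E -> Q E = P (h @^-1` E)) ->
  bmf f -> Ex P (f \o h) = Ex Q f.
Proof.
move=> mh PQ bf; congr fine.
have mf : meas_fun (EFin \o f) by apply/measurable_EFinP; case: bf.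
transitivity (\int[pushforward P h]_x (f x)%:E)%E.
 rewrite (@integral_pushforward _ _ _ _ _ _ mh P setT (EFin \o f))//.
 rewrite preimage_setT.
 have [mfb [K fK]] := bf.
 apply: (@bmf_int _ _ _ P (f \o h)); split; first exact: measurableT_comp.
 exists K=> x; exact: fK.
by apply: eq_measure_integral=> A mA _; exact/esym/PQ.
Qed.

Lemma ae_forallc d (T : measurableType d) (R : realType)
  (mu : {measure set T -> \bar R}) (I : countType) (Q : I -> T -> Prop) :
  (forall i, {ae mu, forall x, Q i x}) -> {ae mu, forall x, forall i, Q i x}.
Proof.
move=> h.
have : {ae mu, forall x, forall n, forall i, unpickle n = Some i -> Q i x}.
 apply: ae_foralln=> n; case e : (unpickle n)=> [i|].
  by apply: filterS (h i)=> x hx j [<-].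
 exact: aeW.
by apply: filterS=> x hx i; apply: (hx (pickle i)); rewrite pickleK.
Qed.

Lemma ae_mono d (T : measurableType d) (R : realType)
  (mu : {measure set T -> \bar R}) (Q Q' : T -> Prop) :
  {ae mu, forall x, Q x} -> (forall x, Q x -> Q' x) -> {ae mu, forall x, Q' x}.
Proof. by move=> h QQ'; apply: filterS h. Qed.

Lemma ae_and d (T : measurableType d) (R : realType)
  (mu : {measure set T -> \bar R}) (Q Q' : T -> Prop) :
  {ae mu, forall x, Q x} -> {ae mu, forall x, Q' x} -> {ae mu, forall x, Q x /\ Q' x}.
Proof. by move=> h h'; apply: filterS2 h h'. Qed.

Lemma indic_ge0 (R : realType) (T : Type) (A : set T) (x : T) : 0 <= (\1_A x : R).
Proof. by []. Qed.

Lemma indic_norm_le1 (R : realType) (T : Type) (A : set T) (x : T) : `|\1_A x : R| <= 1.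
Proof. by rewrite indicE; case: (_ \in _); rewrite ?normr1 ?normr0. Qed.

Section pushforward_probability.
Context d d' (T : measurableType d) (T' : measurableType d') (R : realType).
Variables (P : probability T R) (h : T -> T').
Hypothesis mh : meas_fun h.

Lemma push_exists : exists Q : probability T' R, forall E, Q E = P (h @^-1` E).
Proof.
pose m := @measure_function_pushforward__canonical__measure_function_Measure _ _ _ _ _ P _ mh.
have m1 : m setT = 1%E by rewrite /m/= /pushforward probability_setT.
pose Q : probability T' R := HB.pack (Measure.sort m) (Measure.class m)
 (Measure_isProbability.Build _ _ _ m m1).
by exists Q.
Qed.

Definition pushP : probability T' R := projT1 (cid push_exists).

Lemma pushPE E : pushP E = P (h @^-1` E).
Proof. exact: (projT2 (cid push_exists)). Qed.

Lemma Ex_pushP f : bmf f -> Ex pushP f = Ex P (f \o h).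
Proof. by move=> bf; apply/esym/Ex_push=> // E _; exact: pushPE. Qed.

End pushforward_probability.

Lemma prob_ltoo d (T : measurableType d) (R : realType) (P : probability T R) :
  (P setT < +oo)%E.
Proof. by rewrite ltey_eq fin_num_measure. Qed.

Lemma ae_ex d (T : measurableType d) (R : realType) (P : probability T R) (Q : T -> Prop) :
  {ae P, forall x, Q x} -> exists x, Q x.
Proof.
move=> [N [mN N0 QN]]; apply: contrapT=> /forallNP h.
have : P setT = 0%E.
 rewrite -N0; congr (P _); apply/esym/seteqP; split=> // x _; apply: QN=> /=; exact: h.
by rewrite [X in X = _]probability_setT=> -[] /eqP; rewrite oner_eq0.
Qed.

(** * Cylinders of the shift space *)

Section words.
Context (M : nat).
Notation Sp := (shift_space M).
Notation word := (seq 'I_M.+1).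
Implicit Types (al be : Sp) (w : word) (k : nat).

Definition cyl w : set Sp := [set al | pfx al (size w) = w].

Definition ext_word w : Sp := fun n => nth ord0 w n.

Lemma pfxS al k : pfx al k.+1 = rcons (pfx al k) (al k).
Proof. exact: mkseqS. Qed.

Lemma size_pw al k : size (pfx al k) = k.
Proof. by rewrite size_mkseq. Qed.

Lemma pfxP al be k :
  pfx al k = pfx be k <-> (forall n, (n < k)%N -> al n = be n).
Proof.
split=> [h n nk|h].
 have := congr1 (fun s=> nth ord0 s n) h.
 by rewrite !nth_mkseq.
apply/eq_in_map=> n; rewrite mem_iota=> /andP[_]; exact: h.
Qed.

Lemma prefix_le al be k l : (k <= l)%N -> pfx al l = pfx be l ->
  pfx al k = pfx be k.
Proof.
move=> kl /pfxP h; apply/pfxP=> n nk; apply: h.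
exact: leq_trans kl.
Qed.

Lemma prefix_ext w : pfx (ext_word w) (size w) = w.
Proof. by rewrite /pfx /ext_word; exact: mkseq_nth. Qed.

Lemma prefix_ext_prefix al k :
  pfx (ext_word (pfx al k)) k = pfx al k.
Proof. by rewrite -{2}(size_pw al k) prefix_ext. Qed.

Lemma cyl_prefix al k : cyl (pfx al k) al.
Proof. by rewrite /cyl /= size_pw. Qed.

Lemma cylP al be k : cyl (pfx al k) be <-> pfx be k = pfx al k.
Proof. by rewrite /cyl /= size_pw. Qed.

Lemma cyl_nil : cyl [::] = setT.
Proof. by apply/seteqP. Qed.

Lemma prefix_nbhs al k : nbhs al [set be : Sp | pfx be k = pfx al k].
Proof.
elim: k=> [|k ih]; first by apply: filterS filterT=> be _.
have : nbhs al [set be : Sp | be k = al k].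
 have /(_ [set al k]) := @proj_continuous nat (fun _=> discrete_topology 'I_M.+1) k al.
 by apply.
by apply: filterS2 ih=> be h1 h2; rewrite /= !pfxS h1 h2.
Qed.

Lemma nbhs_prefix al (V : set Sp) : nbhs al V ->
  exists k, forall be, pfx be k = pfx al k -> V be.
Proof.
pose F : set_system Sp := [set V | exists k, forall be,
 pfx be k = pfx al k -> V be].
have FF : Filter F.
 split; first by exists 0%N.
 - move=> A B [k hk] [l hl]; exists (maxn k l)=> be h; split.
   apply: hk; apply: prefix_le h; exact: leq_maxl.
  apply: hl; apply: prefix_le h; exact: leq_maxr.
 - by move=> A B AB [k hk]; exists k=> be /hk /AB.
suff : F --> al by apply.
apply/cvg_sup=> n A /=.
rewrite (@nbhsE (initial_topology (fun f : nat -> discrete_topology 'I_M.+1=> f n))).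
move=> [B [[C oC <-]] Cal] BA; exists n.+1=> be; rewrite !pfxS.
by move=> /rcons_inj[_ h]; apply: BA; rewrite /= h.
Qed.

Lemma cyl_open w : open (cyl w).
Proof.
rewrite openE=> al alw; rewrite /interior.
by apply: filterS (prefix_nbhs al (size w))=> be; rewrite /cyl /= => ->.
Qed.

Lemma cylM w : measurable (cyl w : set (borel Sp)).
Proof. by apply: open_borel; exact: cyl_open. Qed.

(** The empty set is adjoined so that the family is stable under intersection and hence determines
    finite Borel measures. *)
Definition cyls : set (set Sp) := [set C | C = set0 \/ exists w, C = cyl w].

Lemma cyl_sub w v : cyl (w ++ v) `<=` cyl w.
Proof.
move=> al h; apply: (@eq_from_nth _ ord0); rewrite ?size_pw// => n nw.
have := congr1 (fun s=> nth ord0 s n) h; rewrite !nth_mkseq//.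
 by rewrite nth_cat nw.
by rewrite size_cat (leq_trans nw)// leq_addr.
Qed.

Lemma cylsI : setI_closed cyls.
Proof.
move=> A B [->|[w ->]]; first by left; rewrite set0I.
case=> [->|[v ->]]; first by left; rewrite setI0.
wlog wv : w v / (size w <= size v)%N.
 move=> h; case: (leqP (size w) (size v))=> wv; first tame.
 rewrite setIC; apply: h; exact: ltnW.
have [vw|vw] := eqVneq (take (size w) v) w.
 right; exists v; apply/setIidPr; rewrite -{1}(cat_take_drop (size w) v) vw.
 exact: cyl_sub.
left; apply/seteqP; split=> // al [wal val]; move/eqP: vw; apply.
move: wal val; rewrite /cyl /= => {2}<- <-.
by rewrite /pfx /mkseq -map_take take_iota (minn_idPl _)//.
Qed.

Lemma borel_cyls : measurable = <<s cyls >> :> set (set (borel Sp)).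
Proof.
apply/seteqP; split; last first.
 apply: smallest_sub; first exact: (sigma_algebra_measurable (borel Sp)).
 by move=> C [->|[w ->]]; [by []|exact: cylM].
apply: smallest_sub=> //.
move=> U oU; pose W := [set w : word | cyl w `<=` U].
have -> : U = \bigcup_(w in W) cyl w.
 apply/seteqP; split=> [al Ual|al [w Ww]]; last tame.
 have /nbhs_prefix[k hk] : nbhs al U by apply: open_nbhs_nbhs.
 exists (pfx al k); last exact: cyl_prefix.
 move=> be /cylP; exact: hk.
rewrite bigcup_mkcond.
apply: (@countable_bigcupT_measurable _ (g_sigma_algebraType cyls) word (fun w=> if w \in W then cyl w else set0))=> //.
move=> w; case: ifP=> _//.
by apply: sub_sigma_algebra; right; exists w.
Qed.

Lemma measurable_to_shift d (T : measurableType d) (h : T -> borel Sp) :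
  (forall w, measurable (h @^-1` cyl w)) -> meas_fun h.
Proof.
move=> mh; apply: (@measurability _ _ T (borel Sp) setT h cyls); first exact: borel_cyls.
move=> _ [C [->|[w ->]] <-]; rewrite setTI; first by rewrite preimage_set0.
by [].
Qed.

Lemma shift_measure_unique (R : realType)
  (m1 m2 : {measure set (borel Sp) -> \bar R}) :
  (m1 setT < +oo)%E -> (forall w, m1 (cyl w) = m2 (cyl w)) ->
  forall E, measurable E -> m1 E = m2 E.
Proof.
move=> m1fin h; apply: (@measure_unique _ R (borel Sp) cyls (fun=> setT)).
- exact: borel_cyls.
- exact: cylsI.
- by move=> _; right; exists [::]; rewrite cyl_nil.
- by rewrite bigcup_const//.
- by move=> A [->|[w ->]]; rewrite ?measure0.
- by [].
Qed.

(** Compactness of the shift space: each coordinate ranges over a finite alphabet, hence is constant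
    on a member of the ultrafilter. *)
Lemma seq_ultra (U : set_system nat) (al_ : nat -> Sp) : UltraFilter U ->
  exists al, forall j, U [set k | pfx (al_ k) j = pfx al j].
Proof.
move=> UU; have h n := ultra_pick (fun k=> al_ k n) UU.
exists (fun n=> projT1 (cid (h n))); elim=> [|j ih]; first exact: filterS filterT.
have := projT2 (cid (h j)); apply: filterS2 ih=> k h1 h2.
by rewrite /= !pfxS h1 h2.
Qed.

Definition dshift n al : Sp := fun l => al (n + l)%N.

Lemma prefix_cat al n m : pfx al (n + m) = pfx al n ++ pfx (dshift n al) m.
Proof.
rewrite /pfx /mkseq iotaD map_cat add0n; congr (_ ++ _).
by rewrite -[X in iota X m](addn0 n) iotaDl -map_comp.
Qed.

Lemma cyl_cat u v : cyl (u ++ v) = cyl u `&` dshift (size u) @^-1` cyl v.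
Proof.
apply/seteqP; split=> y; rewrite /cyl /= size_cat prefix_cat.
 by move=> /eqP; rewrite eqseq_cat ?size_pw// => /andP[/eqP -> /eqP ->].
by move=> [-> ->].
Qed.

End words.
Arguments cyl {M}.

Section ordinal_partition.
Context (R : realType).

Lemma ord_partition (m : nat) (q : 'I_m -> R) (v : R) :
  (forall i, 0 <= q i) -> 0 <= v -> v < \sum_i q i ->
  exists i : 'I_m, \sum_(j < m | (j < i)%N) q j <= v < \sum_(j < m | (j < i)%N) q j + q i.
Proof.
move=> q0 v0 vq.
pose s k := \sum_(j < m | (j < k)%N) q j.
have sS (i : 'I_m) : s i.+1 = s i + q i.
 rewrite /s (bigD1 i)//= addrC; congr (_ + _); apply: eq_bigl=> j.
 by rewrite ltnS ltn_neqAle andbC.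
have ex : exists k, v < s k.
 by exists m; rewrite /s; under eq_bigl do rewrite ltn_ord.
have [k vk kmin] := ex_minnP ex.
have k0 : (0 < k)%N.
 by rewrite lt0n; apply: contraL vk=> /eqP ->; rewrite -leNgt /s big_pred0.
have km : (k <= m)%N by apply: kmin; rewrite /s; under eq_bigl do rewrite ltn_ord.
have km1 : (k.-1 < m)%N by rewrite prednK.
exists (Ordinal km1); rewrite -[X in _ < X]sS /= prednK// vk andbT leNgt.
by apply/negP=> /kmin; rewrite leqNgt prednK// leqnn.
Qed.

Lemma ler_sum_sub (m : nat) (q : 'I_m -> R) (P Q : pred 'I_m) :
  (forall i, 0 <= q i) -> (forall i, P i -> Q i) ->
  \sum_(j | P j) q j <= \sum_(j | Q j) q j.
Proof.
move=> q0 PQ; rewrite big_mkcond [leRHS]big_mkcond/=; apply: ler_sum=> i _.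
by case: (boolP (P i))=> [/PQ -> //|_]; case: (Q i).
Qed.

Lemma sum_ord_ltS (m : nat) (q : 'I_m -> R) (i : 'I_m) :
  \sum_(j < m | (j < i)%N) q j + q i = \sum_(j < m | (j < i.+1)%N) q j.
Proof.
rewrite [RHS](bigD1 i)//= addrC; congr (_ + _); apply: eq_bigl=> j.
by rewrite ltn_neqAle andbC.
Qed.

Lemma sum_ord_lt (m : nat) (q : 'I_m -> R) (i : 'I_m) : (forall i, 0 <= q i) ->
  \sum_(j < m | (j < i)%N) q j + q i <= \sum_j q j.
Proof. by move=> q0; rewrite sum_ord_ltS; exact: ler_sum_sub. Qed.

Lemma ord_partition_uniq (m : nat) (q : 'I_m -> R) (v : R) (i i' : 'I_m) :
  (forall i, 0 <= q i) ->
  \sum_(j < m | (j < i)%N) q j <= v < \sum_(j < m | (j < i)%N) q j + q i ->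
  \sum_(j < m | (j < i')%N) q j <= v < \sum_(j < m | (j < i')%N) q j + q i' -> i = i'.
Proof.
move=> q0.
have aux (a c : 'I_m) : (a < c)%N ->
  \sum_(j < m | (j < a)%N) q j + q a <= \sum_(j < m | (j < c)%N) q j.
 move=> ac; rewrite sum_ord_ltS; apply: ler_sum_sub=> // i0; rewrite ltnS=> ia; exact: leq_ltn_trans ia ac.
move=> /andP[h1 h2] /andP[h3 h4]; apply: val_inj=> /=.
case: (ltngtP i i')=> // /aux h; exfalso; move: h h1 h2 h3 h4; lra.
Qed.

End ordinal_partition.

(** * Measures with prescribed cylinder masses *)

Section tree_measure.
Context (R : realType) (M : nat).
Notation Sp := (shift_space M).
Notation word := (seq 'I_M.+1).
Variable p : word -> R.
Hypotheses (p0 : forall w, 0 <= p w) (p1 : p [::] = 1)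
  (pS : forall w, p w = \sum_i p (rcons w i)).

(** Left end of the interval of length [p w] that a word owns in [0, 1), the children of a node
    being laid side by side in the order of the alphabet. *)
Let left_from := fix aux (u w : word) : R :=
  if w is i :: w' then
    \sum_(j < M.+1 | (j < i)%N) p (rcons u j) + aux (rcons u i) w'
  else 0.

Let left_end w := left_from [::] w.

Let left_end_rcons w i :
  left_end (rcons w i) = left_end w + \sum_(j < M.+1 | (j < i)%N) p (rcons w j).
Proof.
suff h u : left_from u (rcons w i) =
  left_from u w + \sum_(j < M.+1 | (j < i)%N) p (rcons (u ++ w) j) by exact: h.
elim: w u=> [|j w ih] u /=; first by rewrite addr0 add0r cats0.
by rewrite ih addrA cat_rcons.
Qed.

Let next (w : word) (t : R) : 'I_M.+1 :=
  odflt ord0 [pick i | left_end (rcons w i) <= t < left_end (rcons w i) + p (rcons w i)].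

Let nested (t : R) := fix aux (n : nat) : word :=
  if n is n'.+1 then rcons (aux n') (next (aux n') t) else [::].

Let branch (t : R) : Sp := fun n => next (nested t n) t.

Let prefix_branch t n : pfx (branch t) n = nested t n.
by elim: n=> // n ih; rewrite pfxS ih. Qed.

Let nestedP w t : 0 <= t < 1 ->
  nested t (size w) = w <-> left_end w <= t < left_end w + p w.
Proof.
move=> t01; elim/last_ind: w=> [|w i ih]; first by rewrite /left_end /= add0r p1.
have eqI j : (left_end (rcons w j) <= t < left_end (rcons w j) + p (rcons w j)) =
  (\sum_(k < M.+1 | (k < j)%N) p (rcons w k) <= t - left_end w <
  \sum_(k < M.+1 | (k < j)%N) p (rcons w k) + p (rcons w j)).
 by rewrite left_end_rcons lerBrDl ltrBlDl addrA.
rewrite size_rcons /=; split.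
 move=> /rcons_inj[hw hi]; have /ih := hw; rewrite pS=> /andP[t1 t2].
 move: hi; rewrite hw /next; case: pickP=> /= [j hj <- //|none _].
 have [|||j hj] := @ord_partition R M.+1 (fun j=> p (rcons w j)) (t - left_end w).
 - by [].
 - lra.
 - lra.
 by have := eqI j; rewrite [LHS](none j) hj.
move=> hi; have hw : left_end w <= t < left_end w + p w.
 move: hi; rewrite left_end_rcons=> /andP[t1 t2]; apply/andP; split.
  by apply: le_trans t1; rewrite lerDl sumr_ge0.
 apply: lt_le_trans t2 _; rewrite -addrA lerD2l [leRHS]pS; exact: (@sum_ord_lt R M.+1 (fun j=> p (rcons w j))).
rewrite (ih.2 hw); congr rcons; rewrite /next; case: pickP=> /= [j hj|/(_ i)].
 apply: (@ord_partition_uniq R M.+1 (fun j=> p (rcons w j)) (t - left_end w))=> //.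
  by rewrite -eqI.
 by rewrite -eqI.
by rewrite hi.
Qed.

Let left_end_ge0 w : 0 <= left_end w.
Proof.
elim/last_ind: w=> [|w i ih]//.
by rewrite left_end_rcons addr_ge0// sumr_ge0.
Qed.

Let left_end_le1 w : left_end w + p w <= 1.
Proof.
elim/last_ind: w=> [|w i ih]; first by rewrite /left_end /= p1.
apply: le_trans ih; rewrite left_end_rcons -addrA lerD2l [leRHS]pS.
exact: (@sum_ord_lt R M.+1 (fun j=> p (rcons w j))).
Qed.

Let branch_cyl w : (`[0, 1[%classic : set R) `&` branch @^-1` cyl w =
  [set` `[left_end w, left_end w + p w[].
Proof.
apply/seteqP; split=> t /=; rewrite !in_itv/=.
 by move=> [t01]; rewrite /cyl /= prefix_branch=> /nestedP; exact.
move=> tw; have t01 : 0 <= t < 1.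
 move/andP: tw=> [t1 t2]; rewrite (le_trans _ t1)//=.
 exact: lt_le_trans t2 (left_end_le1 w).
by split=> //; rewrite /cyl /= prefix_branch; apply/nestedP.
Qed.

Let unit_itv : set (g_sigma_algebraType R.-ocitv.-measurable) := [set` `[(0:R), 1[].
Let munit : measurable unit_itv.
exact: measurable_itv. Qed.

(** The itinerary matters on [0, 1) only; a constant value elsewhere makes it measurable on the
    whole line. *)
Let branch' (t : g_sigma_algebraType R.-ocitv.-measurable) : borel Sp :=
  if (0 <= t < 1) then branch t else point.

Let branch'E (E : set Sp) : branch' @^-1` E `&` unit_itv = `[0, 1[%classic `&` branch @^-1` E.
Proof.
apply/seteqP; split=> t; rewrite /unit_itv /branch' /= in_itv/=.
 by move=> [+ h]; rewrite h.
by move=> [h]; rewrite h.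
Qed.

Let measurable_branch' : meas_fun branch'.
Proof.
apply: measurable_to_shift=> w.
rewrite -(setIT (_ @^-1` _)) -(setUv unit_itv) setIUr; apply: measurableU.
 by rewrite branch'E branch_cyl.
have [pw|pw] := pselect (cyl w (point : Sp)).
 rewrite (_ : _ `&` _ = ~` unit_itv); first exact: measurableC.
 apply/seteqP; split=> t; rewrite /unit_itv /= in_itv/=; first by case.
 by move=> h; rewrite /branch'; move/negP: h=> /negbTE ->.
rewrite (_ : _ `&` _ = set0)//.
apply/seteqP; split=> t //; rewrite /unit_itv /= in_itv/= => [[+ h]].
by rewrite /branch'; move/negP: h=> /negbTE ->.
Qed.

Let law : {measure set (borel Sp) -> \bar R} :=
  @measure_function_pushforward__canonical__measure_function_Measure _ _ _ _ _
    (mrestr (@lebesgue_measure R) munit) _ measurable_branch'.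

(** Lebesgue measure on [0, 1) is pushed forward by the itinerary map, under which a cylinder pulls
    back to an interval of the prescribed length. Fibre laws, weak limits and components are all
    constructed from their cylinder masses in this way. *)
Lemma tree_measure : exists P : probability (borel Sp) R, forall w, P (cyl w) = (p w)%:E.
Proof.
have lawE w : law (cyl w) = (p w)%:E.
 rewrite /law /= /pushforward /mrestr branch'E branch_cyl lebesgue_measure_itv/=.
 rewrite lte_fin ltrDl; case: ltP=> pw; first by rewrite -EFinB addrC addKr.
 by congr EFin; apply/eqP; rewrite eq_le p0.
have law1 : law setT = 1%E by rewrite -cyl_nil lawE p1.
pose P : probability (borel Sp) R := HB.pack (Measure.sort law) (Measure.class law)
 (Measure_isProbability.Build _ _ _ law law1).
by exists P.
Qed.

End tree_measure.

Lemma cvg_sumr (R : realType) (I : Type) (G : set_system nat) (s : seq I) (P : pred I)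
  (f : I -> nat -> R) (l : I -> R) : Filter G ->
  (forall i, f i n @[n --> G] --> l i) ->
  (\sum_(i <- s | P i) f i n) @[n --> G] --> \sum_(i <- s | P i) l i.
Proof.
move=> FG h; elim: s=> [|i s ih].
 rewrite big_nil; under eq_fun do rewrite big_nil; exact: cvg_cst.
rewrite big_cons; under eq_fun do rewrite big_cons.
case: (P i)=> //; apply: cvgD=> //; exact: h.
Qed.

(** * Continuous functions and means on the shift space *)

Section uniformly_continuous.
Context (R : realType) (M : nat).
Notation Sp := (shift_space M).
Implicit Types (F G : Sp -> R) (P : probability (borel Sp) R).

Definition ucont F := forall e, 0 < e -> exists k, forall al be : Sp,
  pfx al k = pfx be k -> `|F al - F be| <= e.

(** Heine's theorem for the prefix topology: in a sequence of bad pairs both members would converge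
    to one point along an ultrafilter. *)
Lemma continuous_ucont F : continuous F -> ucont F.
Proof.
move=> cF e e0; apply: contrapT=> /forallNP h.
have [U [UU Uoo]] := free_ultrafilter.
have h1 k : exists ab : Sp * Sp, pfx ab.1 k = pfx ab.2 k /\
  e < `|F ab.1 - F ab.2|.
 have /existsNP[al /existsNP[be /not_implyP[hab /negP]]] := h k.
 by rewrite -ltNge=> ?; exists (al, be).
pose a k := (projT1 (cid (h1 k))).1; pose c k := (projT1 (cid (h1 k))).2.
have ha k : pfx (a k) k = pfx (c k) k /\ e < `|F (a k) - F (c k)|.
 exact: projT2 (cid (h1 k)).
have [al hal] := seq_ultra a UU.
have /nbhs_prefix[k hk] : nbhs al [set be | `|F al - F be| < e / 2].
 by have /cvgrPdist_lt := cF al; apply; rewrite divr_gt0.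
have /filter_ex[n [h2 h3]] : U ([set n | pfx (a n) k = pfx al k] `&`
  [set n | (k <= n)%N]).
 by apply: filterI=> //; apply: Uoo; exists k.
have [h4 h5] := ha n.
have h6 := hk _ h2; have h7 : `|F al - F (c n)| < e / 2.
 by apply: hk; rewrite -h2; apply/esym; apply: prefix_le h4.
have : `|F (a n) - F (c n)| < e; last by rewrite ltNge (ltW h5).
rewrite (_ : _ - _ = (F al - F (c n)) - (F al - F (a n))); last by lra.
rewrite (le_lt_trans (ler_normB _ _))//.
move: h6 h7=> /=; lra.
Qed.

Lemma ucont_continuous F : ucont F -> continuous F.
Proof.
move=> uF al; apply: ((@cvgrPdist_le R R^o Sp (nbhs al) _ _ _).2)=> e e0; have [k hk] := uF _ e0.
by apply: filterS (prefix_nbhs al k)=> be h; apply: hk; rewrite h.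
Qed.

Definition step k (F : Sp -> R) : Sp -> R := fun al =>
  \sum_(w : k.-tuple 'I_M.+1) F (ext_word w) * \1_(cyl w) al.

Lemma stepE k F al : step k F al = F (ext_word (pfx al k)).
Proof.
have pk : size (pfx al k) == k by rewrite size_pw.
rewrite /step (bigD1 (Tuple pk))//= big1=> [|w wk].
 rewrite addr0 indicE mem_set ?mulr1//; exact: cyl_prefix.
rewrite indicE memNset ?mulr0// /cyl /= size_tuple=> h.
by move/eqP: wk; apply; apply: val_inj=> /=.
Qed.

Lemma ucont_bmf F : ucont F -> bmf (F : borel Sp -> R).
Proof.
move=> uF; split.
 apply: (@measurable_fun_cvg _ (borel Sp) R setT (fun k=> step k F))=> [k|x _].
  rewrite /step; apply: measurable_sum=> w.
  apply: measurable_funM=> //; apply: measurable_indic; exact: cylM.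
 apply: ((@cvgrPdist_le R R^o nat \oo _ _ _).2)=> e e0; have [k hk] := uF _ e0.
 exists k=> // n /= kn; rewrite stepE; apply: hk.
 by apply: (prefix_le kn); rewrite prefix_ext_prefix.
have [k hk] := uF 1 ltr01.
exists (\sum_(w : k.-tuple 'I_M.+1) `|F (ext_word w)| + 1)=> al.
have pk : size (pfx al k) == k by rewrite size_pw.
have := hk al (ext_word (Tuple pk)); rewrite /= prefix_ext_prefix=> /(_ erefl).
rewrite (bigD1 (Tuple pk))//= => h1.
have : 0 <= \sum_(i | i != Tuple pk) `|F (ext_word i)| by exact: sumr_ge0.
set s := \sum_(_ | _) _=> s0.
have : `|F al| <= `|F al - F (ext_word (pfx al k))| + `|F (ext_word (pfx al k))|.
 by rewrite -{1}[F al](subrK (F (ext_word (pfx al k)))) ler_normD.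
lra.
Qed.

Lemma ucont_cst c : ucont (cst c).
Proof. by move=> e e0; exists 0%N=> *; rewrite subrr normr0 ltW. Qed.

Lemma ucont_dep F k : (forall al be, pfx al k = pfx be k -> F al = F be) ->
  ucont F.
Proof. by move=> h e e0; exists k=> al be /h ->; rewrite subrr normr0 ltW. Qed.

Lemma ucont_cyl w : ucont (\1_(cyl w)).
Proof.
apply: (@ucont_dep _ (size w))=> al be h; rewrite !indicE.
suff -> : (al \in cyl w) = (be \in cyl w) by [].
by apply/idP/idP; rewrite !inE /cyl /= h.
Qed.

Lemma ucontD F G : ucont F -> ucont G -> ucont (fun x => F x + G x).
Proof.
move=> uF uG e e0; have e2 : 0 < e / 2 by rewrite divr_gt0.
have [k hk] := uF _ e2; have [l hl] := uG _ e2.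
exists (maxn k l)=> al be h.
have h1 := hk _ _ (prefix_le (leq_maxl k l) h).
have h2 := hl _ _ (prefix_le (leq_maxr k l) h).
rewrite (_ : _ - _ = (F al - F be) + (G al - G be)); last by ring.
rewrite (le_trans (ler_normD _ _))//; lra.
Qed.

Lemma ucontM F G : ucont F -> ucont G -> ucont (fun x => F x * G x).
Proof.
move=> uF uG e e0.
have [_ [K hK]] := ucont_bmf uF; have [_ [L hL]] := ucont_bmf uG.
have K0 : 0 <= K by apply: le_trans (hK point).
have L0 : 0 <= L by apply: le_trans (hL point).
pose d := e / (K + L + 1).
have d0 : 0 < d by rewrite divr_gt0//; lra.
have [k hk] := uF _ d0; have [l hl] := uG _ d0.
exists (maxn k l)=> al be h.
have h1 := hk _ _ (prefix_le (leq_maxl k l) h).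
have h2 := hl _ _ (prefix_le (leq_maxr k l) h).
rewrite (_ : _ - _ = F al * (G al - G be) + (F al - F be) * G be); last by ring.
have e1 : K * d + d * L <= e.
 rewrite (_ : e = d * (K + L + 1)); last by rewrite /d divfK////; lra.
 lra.
apply: le_trans e1; rewrite (le_trans (ler_normD _ _))// !normrM.
by apply: lerD; apply: ler_pM.
Qed.

Lemma ucontN F : ucont F -> ucont (fun x => - F x).
Proof.
by move=> uF e /uF[k hk]; exists k=> al be h; rewrite -opprD normrN hk.
Qed.

Lemma ucontB F G : ucont F -> ucont G -> ucont (fun x => F x - G x).
Proof. by move=> uF uG; apply: ucontD=> //; exact: ucontN. Qed.

Lemma ucontZ c F : ucont F -> ucont (fun x => c * F x).
Proof. by move=> uF; apply: ucontM=> //; exact: ucont_cst. Qed.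

Lemma ucont_sum (I : Type) (s : seq I) (P : pred I) (F : I -> Sp -> R) :
  (forall i, ucont (F i)) -> ucont (fun x => \sum_(i <- s | P i) F i x).
Proof.
move=> uF; elim: s=> [|i s ih].
 rewrite (_ : (fun x=> _) = cst 0); first exact: ucont_cst.
 by apply/funext=> x; rewrite big_nil.
rewrite (_ : (fun x=> _) = fun x=> (if P i then F i x else 0) + \sum_(j <- s | P j) F j x).
 by apply: ucontD=> //; case: (P i); [tame|exact: ucont_cst].
by apply/funext=> x; rewrite big_cons; case: (P i)=> //; rewrite add0r.
Qed.

Lemma ucont_lip (g : R -> R) F : (exists K, forall a c, `|g a - g c| <= K * `|a - c|) ->
  ucont F -> ucont (g \o F).
Proof.
move=> [K hK] uF e e0; pose K' := `|K| + 1.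
have K0 : 0 < K' by rewrite /K'.
have [k hk] := uF (e / K') (divr_gt0 e0 K0); exists k=> al be /hk h.
rewrite /= (le_trans (hK _ _))// (le_trans (ler_wpM2r _ (_ : K <= K')))//.
 by rewrite /K' (le_trans (ler_norm K))// lerDl.
by rewrite mulrC -ler_pdivlMr.
Qed.

Definition ushift (T : Sp -> Sp) := forall k, exists l, forall al be,
  pfx al l = pfx be l -> pfx (T al) k = pfx (T be) k.

Lemma ucont_comp F T : ucont F -> ushift T -> ucont (F \o T).
Proof.
move=> uF uT e /uF[k hk]; have [l hl] := uT k; exists l=> al be /hl; exact: hk.
Qed.

Lemma ushift_comp (T T' : Sp -> Sp) : ushift T -> ushift T' -> ushift (T \o T').
Proof.
move=> uT uT' k; have [l hl] := uT k; have [m hm] := uT' l.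
by exists m=> al be /hm /hl.
Qed.

Lemma ushift_iter n (T : Sp -> Sp) : ushift T -> ushift (iter n T).
Proof.
move=> uT; elim: n=> [|n ih]; first by move=> k; exists k.
exact: ushift_comp.
Qed.

Lemma ushift_dshift n : ushift (@dshift M n).
Proof.
move=> k; exists (n + k)%N=> al be /pfxP h.
by apply/pfxP=> l lk; apply: h; rewrite ltn_add2l.
Qed.

Lemma ushift_measurable (T : Sp -> Sp) : ushift T ->
  meas_fun (T : borel Sp -> borel Sp).
Proof.
move=> uT; apply: continuous_borel=> al V /nbhs_prefix[k hk].
have [l hl] := uT k; apply: filterS (prefix_nbhs al l)=> be h; apply: hk; exact: hl.
Qed.

Lemma measurable_dshift n : meas_fun (dshift n : borel Sp -> borel Sp).
Proof. exact: ushift_measurable (ushift_dshift n). Qed.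

(* [m] is only evaluated on finite linear combinations of indicators of cylinders
   and on uniformly continuous functions. *)
Definition mean (m : (Sp -> R) -> R) :=
  [/\ forall F G, ucont F -> ucont G -> m (fun x => F x + G x) = m F + m G,
      forall c F, ucont F -> m (fun x => c * F x) = c * m F &
      forall F G e, ucont F -> ucont G -> (forall x, `|F x - G x| <= e) -> `|m F - m G| <= e].

Lemma mean_Ex P : mean (Ex P).
Proof.
split.
- by move=> F G /ucont_bmf bF /ucont_bmf bG; rewrite ExD.
- by move=> c F /ucont_bmf bF; rewrite ExZ.
- move=> F G e /ucont_bmf bF /ucont_bmf bG h; rewrite -ExB//.
 apply: Ex_normK=> //; exact: bmfB.
Qed.

Lemma ucont_step k F : ucont (step k F).
Proof.
apply: (@ucont_dep _ k)=> al be h; by rewrite !stepE h.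
Qed.

Lemma mean0 m : mean m -> m (cst 0) = 0.
Proof.
move=> [_ mZ _]; rewrite (_ : cst 0 = fun x=> 0 * (cst 0 : Sp -> R) x).
 rewrite mZ ?mul0r//; exact: ucont_cst.
by apply/funext=> x; rewrite mul0r.
Qed.

Lemma mean_sum m (I : Type) (s : seq I) (F : I -> Sp -> R) : mean m -> (forall i, ucont (F i)) ->
  m (fun x => \sum_(i <- s) F i x) = \sum_(i <- s) m (F i).
Proof.
move=> mm uF; have [mD _ _] := mm; elim: s=> [|i s ih].
 rewrite big_nil (_ : (fun x=> _) = cst 0) ?mean0//.
 by apply/funext=> x; rewrite big_nil.
rewrite big_cons -ih -mD//; last exact: ucont_sum.
by congr m; apply/funext=> x; rewrite big_cons.
Qed.

Lemma mean_step m k F : mean m ->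
  m (step k F) = \sum_(w : k.-tuple 'I_M.+1) F (ext_word w) * m (\1_(cyl w)).
Proof.
move=> mm; have [_ mZ _] := mm; rewrite /step mean_sum//.
 apply: eq_bigr=> w _; rewrite mZ//; exact: ucont_cyl.
move=> w; apply: ucontZ; exact: ucont_cyl.
Qed.

(** Step functions on cylinders are uniformly dense and means are contractions for the uniform norm,
    so an e/3 argument reduces convergence to cylinders. *)
Lemma mean_cvg (I : set_system nat) (m_ : nat -> (Sp -> R) -> R) (m : (Sp -> R) -> R) :
  Filter I -> (\forall n \near I, mean (m_ n)) -> mean m ->
  (forall w, m_ n (\1_(cyl w)) @[n --> I] --> m (\1_(cyl w))) ->
  forall F, ucont F -> m_ n F @[n --> I] --> m F.
Proof.
move=> FI hm_ hm hw F uF; apply/cvgrPdist_le=> e e0.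
have e3 : 0 < e / 3 by lra.
have [k hk] := uF _ e3.
have FS x : `|F x - step k F x| <= e / 3.
 by rewrite stepE hk// prefix_ext_prefix.
have : m_ n (step k F) @[n --> I] --> m (step k F).
 rewrite (mean_step k F hm).
 have : (\sum_(w : k.-tuple 'I_M.+1) F (ext_word w) * m_ n (\1_(cyl w))) @[n --> I] -->
     \sum_(w : k.-tuple 'I_M.+1) F (ext_word w) * m (\1_(cyl w)).
  by apply: cvg_sumr=> w; apply: cvgM; [exact: cvg_cst|tame].
 apply: cvg_trans; apply: near_eq_cvg; apply: filterS hm_=> n hn.
 by rewrite mean_step.
move=> /cvgrPdist_le/(_ _ e3); apply: filterS2 hm_=> n hn h.
have [_ _ /(_ F (step k F) (e / 3) uF (ucont_step k F) FS) h1] := hm.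
have [_ _ /(_ F (step k F) (e / 3) uF (ucont_step k F) FS) h2] := hn.
rewrite (_ : _ - _ = (m F - m (step k F)) + (m (step k F) - m_ n (step k F))
 - (m_ n F - m_ n (step k F))); last by ring.
rewrite (le_trans (ler_normB _ _))// (le_trans (lerD (ler_normD _ _) (lexx _)))//.
lra.
Qed.

Lemma mean_eq m m' : mean m -> mean m' -> (forall w, m (\1_(cyl w)) = m' (\1_(cyl w))) ->
  forall F, ucont F -> m F = m' F.
Proof.
move=> hm hm' hw F uF; have cv : m F @[n --> \oo] --> m' F.
 apply: (@mean_cvg \oo (fun=> m) m')=> //; first exact: nearW.
 move=> w; rewrite hw; exact: cvg_cst.
by rewrite -(cvg_lim _ cv)// lim_cst.
Qed.

End uniformly_continuous.

Hint Resolve cylM ucont_bmf ucont_cst ucont_cyl ucontD ucontM ucontN ucontB ucontZ ucont_sum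
  ucont_comp ushift_comp ushift_iter ucont_step : tame.

(** * Ergodic theory *)

Section oscillation.
Context (R : realType).

Lemma rat_between (x y : R) : x < y -> exists q : rat, x < ratr q < y.
Proof. by move=> /rat_in_itvoo[q]; rewrite/=; exists q. Qed.

(** The limit along an ultrafilter is approached infinitely often, and a divergent sequence leaves
    some neighbourhood of it infinitely often on one side. Rational levels make the exceptional set
    of Birkhoff's theorem a countable union. *)
Lemma noncvg_osc (u : nat -> R) (K : R) : (forall n, `|u n| <= K) -> ~ cvg (u @ \oo) ->
  exists a c : rat, [/\ a < c,
    forall N, exists n, (N <= n)%N /\ ratr c < u n &
    forall N, exists n, (N <= n)%N /\ u n < ratr a].
Proof.
move=> uK ncv; have [U [UU Uoo]] := free_ultrafilter.
have /cvg_ex[l ul] := ultra_cvg UU uK.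
have : ~ (u @ \oo --> l) by move=> h; apply: ncv; apply/cvg_ex; exists l.
move=> /(contra_not ((@cvgrPdist_le R R^o nat \oo _ u l).2)).
move=> /existsNP[e /not_implyP[e0 he]].
have far N : exists n, (N <= n)%N /\ e < `|l - u n|.
 apply: contrapT=> /forallNP h; apply: he; exists N=> // n /= Nn.
 by have /not_andP[//|/negP] := h n; rewrite -leNgt.
have close d : 0 < d -> forall N, exists n, (N <= n)%N /\ `|l - u n| < d.
 move=> d0 N; have /cvgrPdist_lt/(_ _ d0) h := ul.
 have /filter_ex[n [h1 h2]] : U ([set n | `|l - u n| < d] `&` [set n | (N <= n)%N]).
  by apply: filterI=> //; apply: Uoo; exists N.
 by exists n.
have [up|up] := pselect (forall N, exists n, (N <= n)%N /\ l + e < u n).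
 have [a /andP[la ale]] := @rat_between l (l + e) (ltac:(lra)).
 have [c /andP[ac ce]] := @rat_between (ratr a) (l + e) ale.
 exists a, c; split; first by move: ac; rewrite ltr_rat.
  move=> N; have [n [Nn h]] := up N; exists n; split=> //; exact: lt_trans h.
 move=> N; have := close (ratr a - l); rewrite subr_gt0=> /(_ la N)[n [Nn h]].
 exists n; split=> //; move: h; rewrite ltr_norml; lra.
have down : forall N, exists n, (N <= n)%N /\ u n < l - e.
 move=> N; move/existsNP: up=> [N0 /forallNP up].
 have [n [Nn h]] := far (maxn N N0); exists n; split.
  apply: leq_trans Nn; exact: leq_maxl.
 have /not_andP[|/negP] := up n; first by rewrite (leq_trans (leq_maxr N N0)).
 rewrite -leNgt=> h2; move: h; rewrite lter_normr=> /orP[]; lra.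
have [c /andP[lc ce]] := @rat_between (l - e) l (ltac:(lra)).
have [a /andP[la ac]] := @rat_between (l - e) (ratr c) lc.
exists a, c; split; first by move: ac; rewrite ltr_rat.
 move=> N; have := close (l - ratr c); rewrite subr_gt0=> /(_ ce N)[n [Nn h]].
 exists n; split=> //; move: h; rewrite ltr_norml; lra.
move=> N; have [n [Nn h]] := down N; exists n; split=> //; exact: lt_trans h la.
Qed.

End oscillation.

Section averages.
Context (T : Type) (R : realType) (h : T -> T).
Implicit Types f : T -> R.

Definition bsum f n x : R := \sum_(i < n) f (iter i h x).
Definition avg f n x : R := n%:R^-1 * bsum f n x.
(** The upper limit is total, and measurable in [x] for bounded measurable [f]; it equals the
    Birkhoff limit wherever that limit exists. *)
Definition freq f x : R := limn_sup (fun n => avg f n x).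

Lemma bsumS f n x : bsum f n.+1 x = f x + bsum f n (h x).
Proof.
by rewrite /bsum big_ord_recl; congr (_ + _); apply: eq_bigr=> i _; rewrite -iterSr.
Qed.

Lemma avg_le f K n x : 0 <= K -> (forall x, `|f x| <= K) -> `|avg f n x| <= K.
Proof.
move=> K0 fK; rewrite /avg /bsum normrM; case: n=> [|n].
 by rewrite big_ord0 normr0 mulr0.
rewrite ger0_norm// mulrC ler_pdivrMr//.
rewrite (le_trans (ler_norm_sum _ _ _))// (le_trans (ler_sum _ (fun i _=> fK _)))//.
by rewrite sumr_const card_ord mulr_natr.
Qed.

Lemma freq_cvg f x l : avg f n x @[n --> \oo] --> l -> freq f x = l.
Proof. by move=> cv; rewrite /freq cvg_limn_supE ?(cvg_lim _ cv)//; apply/cvg_ex; exists l. Qed.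

Lemma avg_comp f n x :
  avg (f \o h) n x = avg f n x + n%:R^-1 * (f (iter n h x) - f x).
Proof.
rewrite /avg -mulrDr; congr (_ * _).
have h1 : bsum (f \o h) n x = bsum f n (h x).
 by apply: eq_bigr=> i _; rewrite /= -iterS iterSr.
have h2 : bsum f n.+1 x = bsum f n x + f (iter n h x) by rewrite /bsum big_ord_recr.
rewrite h1; move: h2; rewrite bsumS; lra.
Qed.

Lemma avg_comp_cvg f x (l : R) : (exists K, forall y, `|f y| <= K) ->
  avg f n x @[n --> \oo] --> l -> avg (f \o h) n x @[n --> \oo] --> l.
Proof.
move=> [K fK] cf; have K0 : 0 <= K by exact: le_trans (fK x).
have -> : (fun n=> avg (f \o h) n x) = (fun n=> avg f n x + n%:R^-1 * (f (iter n h x) - f x)).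
 apply/funext=> n; exact: avg_comp.
rewrite -[l]addr0; apply: cvgD=> //; apply/cvgrPdist_le=> e e0.
exists (Num.truncn ((2 * K) / e)).+1=> // n /= hn.
have n0 : 0 < n%:R :> R by rewrite ltr0n; exact: leq_trans hn.
have hn' : (2 * K) / e < n%:R by rewrite (lt_le_trans (truncnS_gt _))// ler_nat.
rewrite sub0r normrN normrM ger0_norm// mulrC ler_pdivrMr//.
move: hn'; rewrite ltr_pdivrMr// mulrC=> hn'.
rewrite (le_trans (ler_normB _ _))//; move: (fK (iter n h x)) (fK x); lra.
Qed.

End averages.

(** * Birkhoff's theorem *)

Section birkhoff.
Context d (T : measurableType d) (R : realType) (P : probability T R) (h : T -> T).
Hypotheses (mh : meas_fun h)
  (hP : forall E, measurable E -> P (h @^-1` E) = P E).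
Implicit Types (f g : T -> R).
Notation bsum := (bsum h).
Notation avg := (avg h).
Notation freq := (freq h).

Lemma measurable_iter n : meas_fun (iter n h).
Proof. by elim: n=> [|n ih]; [exact: measurable_id|exact: measurableT_comp]. Qed.

Lemma preserve_iter n E : measurable E -> P (iter n h @^-1` E) = P E.
Proof.
elim: n E=> // n ih E mE; rewrite -[RHS](hP mE) -(ih (h @^-1` E))//.
premeas; exact: mh.
Qed.

Lemma bmf_comp_iter f n : bmf f -> bmf (f \o iter n h).
Proof.
move=> [mf [K fK]]; split; last by exists K=> x /=.
apply: measurableT_comp=> //; exact: measurable_iter.
Qed.

Lemma Ex_iter f n : bmf f -> Ex P (f \o iter n h) = Ex P f.
Proof.
move=> bf; apply: Ex_push=> //; first exact: measurable_iter.
by move=> E mE; rewrite preserve_iter.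
Qed.

Lemma bmf_bsum f n : bmf f -> bmf (bsum f n).
Proof. by move=> bf; apply: bmf_sum=> i; exact: (bmf_comp_iter i). Qed.

Lemma bmf_avg f n : bmf f -> bmf (avg f n).
Proof. by move=> bf; apply: bmfZ; exact: bmf_bsum. Qed.

Lemma Ex_avg f n : (0 < n)%N -> bmf f -> Ex P (avg f n) = Ex P f.
Proof.
move=> n0 bf; rewrite /avg ExZ; last exact: bmf_bsum.
rewrite /bsum Ex_sum; last by move=> i; exact: (bmf_comp_iter i).
rewrite (eq_bigr (fun=> Ex P f))=> [|i _]; last exact: (Ex_iter i).
by rewrite sumr_const card_ord -[X in _ * X]mulr_natl mulrA mulVf ?mul1r// pnatr_eq0 -lt0n.
Qed.

(** Maximum of the Birkhoff sums of orders 0 to [n], defined through the recursion on which Garsia's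
    argument rests. *)
Fixpoint gmax f n x : R :=
  if n is n'.+1 then Num.max 0 (f x + gmax f n' (h x)) else 0.

Lemma gmax_ge0 f n x : 0 <= gmax f n x.
Proof. by case: n=> //= n; rewrite le_max lexx. Qed.

Lemma gmaxS f n x : gmax f n x <= gmax f n.+1 x.
Proof.
elim: n x=> [|n ih] x; first exact: gmax_ge0.
by rewrite /= -/(gmax f n.+1 _) ge_max le_max lexx/= le_max lerD2l ih orbT.
Qed.

Lemma bsum_gmax f n x : bsum f n x <= gmax f n x.
Proof.
elim: n x=> [|n ih] x; first by rewrite /bsum big_ord0.
by rewrite bsumS /= le_max lerD2l ih orbT.
Qed.

Lemma bmf_gmax f n : bmf f -> bmf (gmax f n).
Proof.
move=> bf; elim: n=> [|n [mg [K gK]]] /=; first exact: bmf_cst.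
have [mf [L fL]] := bf; split.
 apply: measurable_maxr=> //.
 apply: measurable_funD=> //; exact: measurableT_comp.
exists (L + K)=> x; rewrite ger0_norm; last by rewrite le_max lexx.
rewrite ge_max; apply/andP; split.
 by rewrite addr_ge0//; [exact: le_trans (fL x)|exact: le_trans (gK x)].
rewrite (le_trans (ler_norm _))// (le_trans (ler_normD _ _))// lerD//.
Qed.

Lemma gmax_pos_measurable f n : bmf f -> measurable [set y | 0 < gmax f n.+1 y].
Proof.
move=> bf; have [mg _] := bmf_gmax n.+1 bf.
rewrite (_ : [set y | _] = setT `&` gmax f n.+1 @^-1` `]0, +oo[); first exact: mg.
by apply/seteqP; split=> y; rewrite /= in_itv/= andbT//; case.
Qed.

(* Garsia's maximal inequality: [f >= gmax f n.+1 - gmax f n.+1 \o h] where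
   [gmax f n.+1 > 0]. *)
Lemma garsia f n : bmf f -> 0 <= Ex P (fun x => f x * \1_[set y | 0 < gmax f n.+1 y] x).
Proof.
move=> bf; have bg := bmf_gmax n.+1 bf.
have bgh : bmf (gmax f n.+1 \o h) by exact: (bmf_comp_iter 1).
have e0 : Ex P (fun x=> gmax f n.+1 x - (gmax f n.+1 \o h) x) = 0.
 by rewrite ExB// (Ex_iter 1)// subrr.
have b1 : bmf (\1_[set y | 0 < gmax f n.+1 y] : T -> R).
 apply: bmf_indic; exact: gmax_pos_measurable.
rewrite -[X in X <= _]e0; apply: Ex_le; [tame|tame|].
move=> x; case: (ltP 0 (gmax f n.+1 x))=> g0; rewrite indicE; last first.
 rewrite memNset ?mulr0 /comp; last by apply/negP; rewrite -leNgt.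
 have := gmax_ge0 f n.+1 (h x); lra.
rewrite mem_set// mulr1 lerBlDr.
have -> : gmax f n.+1 x = f x + gmax f n (h x).
 have e1 : gmax f n.+1 x = Num.max 0 (f x + gmax f n (h x)) by [].
 by move: g0; rewrite e1; case: (leP 0 (f x + gmax f n (h x)))=> // _; rewrite ltxx.
rewrite lerD2l; exact: gmaxS.
Qed.

(** Garsia's inequality for [f] multiplied by the indicator of [E]: invariance leaves the sums on
    [E] unchanged, the sets where the maxima are positive exhaust [E], and dominated convergence
    concludes. *)
Lemma maximal_ergodic f (E : set T) : bmf f -> measurable E -> h @^-1` E = E ->
  (forall x, E x -> exists n, 0 < bsum f n x) -> 0 <= Ex P (fun x => f x * \1_E x).
Proof.
move=> bf mE hE Ef; pose g x := f x * \1_E x.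
have bg : bmf g by apply: bmfM=> //; exact: bmf_indic.
have Eh x : E (h x) = E x by rewrite -[LHS]/((h @^-1` E) x) hE.
have Ei i x : E (iter i h x) = E x by elim: i=> //= i ih; rewrite Eh.
have gE n x : E x -> bsum g n x = bsum f n x.
 by move=> xE; apply: eq_bigr=> i _; rewrite /g indicE mem_set ?Ei// mulr1.
have gnE n x : ~ E x -> gmax g n x = 0.
 elim: n x=> //= n ih x nEx; rewrite /g indicE memNset// mulr0 add0r ih ?maxxx//.
 by rewrite Eh.
have [mg [K gK]] := bg.
suff : Ex P (fun x=> g x * \1_[set y | 0 < gmax g n.+1 y] x) @[n --> \oo] --> Ex P g.
 move=> cE; rewrite -(cvg_lim _ cE)//; apply: limr_ge.
  by apply/cvg_ex; exists (Ex P g).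
 apply: nearW=> n; exact: garsia.
apply: (@Ex_dct _ _ _ P _ g K)=> //.
- move=> n; apply: measurable_funM=> //; apply: measurable_indic.
 exact: gmax_pos_measurable.
- move=> n x; rewrite normrM (le_trans _ (gK x))// ler_piMr// indicE.
 by case: (_ \in _); rewrite ?normr1 ?normr0.
apply: aeW=> x; apply: cvg_near_cst.
have [xE|nEx] := pselect (E x); last first.
 by apply: nearW=> n; rewrite /g indicE (memNset nEx) mulr0 mul0r.
have [n0 hn0] := Ef x xE; exists n0=> // n /= n0n.
rewrite [X in _ * X]indicE mem_set ?mulr1//=.
have mono k l y : (k <= l)%N -> gmax g k y <= gmax g l y.
 elim: l=> [|l ih]; first by rewrite leqn0=> /eqP ->.
 rewrite leq_eqVlt=> /predU1P[-> //|kl]; exact: le_trans (ih kl) (gmaxS _ _ _).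
apply: lt_le_trans (mono _ _ x (leqW n0n)).
by apply: lt_le_trans (bsum_gmax g n0 x); rewrite gE.
Qed.

(** Unboundedness of the sums is exactly invariant, since a shift changes them by a bounded amount,
    and it provides the positive sum that the maximal inequality asks for. *)
Let unb f : set T := [set x | forall K : nat, exists n, K%:R < bsum f n x].

Let unb_measurable f : bmf f -> measurable (unb f).
Proof.
move=> bf; rewrite (_ : unb f = \bigcap_(K : nat) \bigcup_n
  (setT `&` bsum f n @^-1` `]K%:R, +oo[)).
 apply: bigcapT_measurable=> K; apply: bigcupT_measurable=> n.
 have [mb _] := bmf_bsum n bf; exact: mb.
apply/seteqP; split=> x h1 K.
 by move=> _; have [n hn] := h1 K; exists n=> //; split=> //=; rewrite in_itv/= hn.
by have [n _ [_ /=]] := h1 K Logic.I; rewrite in_itv/= andbT=> ?; exists n.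
Qed.

Let unb_invariant f : bmf f -> h @^-1` unb f = unb f.
Proof.
move=> [_ [L fL]].
have [N LN] : exists N : nat, L <= N%:R.
 exists (Num.truncn L).+1; apply: ltW; exact: truncnS_gt.
have fN x : `|f x| <= N%:R by exact: le_trans (fL x) LN.
apply/seteqP; split=> x /= h1 K.
 have [n hn] := h1 (K + N)%N; exists n.+1; rewrite bsumS.
 move: hn (fN x); rewrite ler_norml=> ? /andP[]; lra.
have [[|n] hn] := h1 (K + N)%N.
 by move: hn; rewrite /bsum big_ord0 ltNge ler0n.
exists n; move: hn (fN x); rewrite bsumS natrD ler_norml=> ? /andP[]; lra.
Qed.

Let unb_avg f (c : R) x : (forall N, exists n, (N <= n)%N /\ c < avg f n x) ->
  forall c', c' < c -> unb (fun y => f y - c') x.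
Proof.
move=> h1 c' cc K.
have [N hN] : exists N : nat, K%:R / (c - c') < N%:R.
 exists (Num.truncn (K%:R / (c - c'))).+1; exact: truncnS_gt.
have [n [Nn hn]] := h1 N.+1; exists n.
have n0 : (0 < n)%N by exact: leq_trans Nn.
have n0' : 0 < n%:R :> R by rewrite ltr0n.
rewrite /bsum sumrB sumr_const card_ord -mulr_natl.
have h2 : n%:R * c < bsum f n x.
 by move: hn; rewrite /avg mulrC ltr_pdivlMr// mulrC.
have h3 : K%:R < N%:R * (c - c') by move: hN; rewrite ltr_pdivrMr ?subr_gt0.
have h4 : N%:R * (c - c') <= n%:R * (c - c').
 by rewrite ler_wpM2r ?subr_ge0 ?(ltW cc)// ler_nat ltnW.
move: h2 h3 h4; rewrite /bsum; nra.
Qed.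

Let avgN f n x : avg (fun y => - f y) n x = - avg f n x.
by rewrite /avg /bsum sumrN mulrN. Qed.

Theorem birkhoff f : bmf f -> {ae P, forall x, avg f n x @[n --> \oo] --> freq f x}.
Proof.
move=> bf; have [mf [K0 fK0]] := bf; pose K := Num.max 0 K0.
have K_ge0 : 0 <= K by rewrite le_max lexx.
have fK x : `|f x| <= K by rewrite (le_trans (fK0 x))// le_max lexx orbT.
have bfc c : bmf (fun x=> f x - c) by apply: bmfB=> //; exact: bmf_cst.
have bcf c : bmf (fun x=> c - f x) by apply: bmfB=> //; exact: bmf_cst.
pose E (ac : rat * rat) := unb (fun x=> f x - ratr ac.2) `&` unb (fun x=> ratr ac.1 - f x).
have mE ac : measurable (E ac) by apply: measurableI; exact: unb_measurable.
have iE ac : h @^-1` E ac = E ac by rewrite /E preimage_setI !unb_invariant.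
(* On this invariant set the maximal inequality gives [f - c] and [a - f] nonnegative integrals,
   while they add up to the negative constant [a - c]. *)
have E0 ac : ac.1 < ac.2 -> P (E ac) = 0.
 case: ac=> a c /= ac; set F := E (a, c).
 have mF : measurable F := mE (a, c).
 have iF : h @^-1` F = F := iE (a, c).
 have b1 : bmf (\1_F : T -> R) by tame.
 have h1 : 0 <= Ex P (fun x=> (f x - ratr c) * \1_F x).
  by apply: maximal_ergodic=> // x [/(_ 0%N) [n hn] _]; exists n.
 have h2 : 0 <= Ex P (fun x=> (ratr a - f x) * \1_F x).
  by apply: maximal_ergodic=> // x [_ /(_ 0%N) [n hn]]; exists n.
 have h3 : Ex P (fun x=> (f x - ratr c) * \1_F x + (ratr a - f x) * \1_F x) =
   (ratr a - ratr c) * fine (P F).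
  rewrite -Ex_indic// -ExZ//; congr Ex; apply/funext=> x; ring.
 have := addr_ge0 h1 h2; rewrite -ExD ?h3; try exact: bmfM.
 have ac' : ratr a - ratr c < 0 :> R by rewrite subr_lt0 ltr_rat.
 rewrite nmulr_rge0// => h4; have : fine (P F) = 0.
  by apply/eqP; rewrite eq_le h4 fine_ge0.
 by move/eqP; rewrite fine_eq0 ?fin_num_measure// => /eqP.
have aeE : {ae P, forall x, forall ac : rat * rat, ac.1 < ac.2 -> ~ E ac x}.
 apply: ae_forallc=> ac; have [ac12|ac12] := boolP (ac.1 < ac.2); last exact: aeW.
 by exists (E ac); split=> //; [exact: E0|move=> x /= /not_implyP[_ /contrapT]].
apply: filterS aeE=> x hx.
have cv : cvg (avg f n x @[n --> \oo]).
 apply: contrapT=> ncv.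
 have [a [c [ac hc ha]]] := noncvg_osc (fun n=> avg_le h n x K_ge0 fK) ncv.
 have ac' : (ratr a : R) < ratr c by rewrite ltr_rat.
 (* [unb_avg] loses a little at each level, hence the inner pair of rationals [a' < c']. *)
 have [a' /andP[aa' a'c]] := rat_between ac'.
 have [c' /andP[ac1 c'c]] := rat_between a'c.
 apply: (hx (a', c')); first by rewrite -(ltr_rat R).
 split; first exact: unb_avg hc _ c'c.
 have := @unb_avg (fun y=> - f y) (- ratr a) x _ (- ratr a').
 rewrite (_ : (fun y=> - f y - - ratr a') = fun y=> ratr a' - f y); last first.
  by apply/funext=> y; rewrite opprK addrC.
 apply; last by rewrite ltrN2.
 by move=> N; have [n [Nn hn]] := ha N; exists n; rewrite avgN ltrN2.
by rewrite /freq cvg_limn_supE.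
Qed.

Lemma freq_bmf f : bmf f -> bmf (freq f).
Proof.
move=> bf; have [mf [K0 fK0]] := bf; pose K := Num.max 0 K0.
have K_ge0 : 0 <= K by rewrite le_max lexx.
have fK x : `|f x| <= K by rewrite (le_trans (fK0 x))// le_max lexx orbT.
have bd x : bounded_fun (fun n=> avg f n x).
 by exists K; split=> [|M KM n _]; [exact: num_real|apply: le_trans (ltW KM); exact: avg_le].
split.
 apply: measurable_fun_limn_sup=> [x _|x _|n].
 - exact: bounded_fun_has_ubound.
 - exact: bounded_fun_has_lbound.
 - by case: (bmf_avg n bf).
exists K=> x; rewrite /freq limn_supE//.
have ub : has_ubound (range (fun n=> avg f n x)) := bounded_fun_has_ubound (bd x).
have lb : has_lbound (range (fun n=> avg f n x)) := bounded_fun_has_lbound (bd x).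
have sl n : - K <= sups (fun n=> avg f n x) n <= K.
 apply/andP; split.
  via (avg f n x).
   by move: (avg_le h n x K_ge0 fK); rewrite ler_norml=> /andP[].
  by apply: ub_le_sup; [exact: has_ubound_sdrop|exists n=> /=].
 apply: sup_le_ub; first by exists (avg f n x), n=> /=.
 by move=> _ [m _ <-]; move: (avg_le h m x K_ge0 fK); rewrite ler_norml=> /andP[].
rewrite ler_norml; apply/andP; split.
 apply: lb_le_inf; first by exists (sups (fun n=> avg f n x) 0%N), 0%N.
 by move=> _ [n _ <-]; have /andP[] := sl n.
apply: le_trans (_ : sups (fun n=> avg f n x) 0%N <= _); last by have /andP[] := sl 0%N.
apply: ge_inf=> //.
by exists (- K)=> _ [n _ <-]; have /andP[] := sl n.
Qed.

Lemma Ex_freq f : bmf f -> Ex P (freq f) = Ex P f.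
Proof.
move=> bf; have [mf [K0 fK0]] := bf; pose K := Num.max 0 K0.
have K_ge0 : 0 <= K by rewrite le_max lexx.
have fK x : `|f x| <= K by rewrite (le_trans (fK0 x))// le_max lexx orbT.
have : Ex P (avg f n) @[n --> \oo] --> Ex P (freq f).
 apply: (@Ex_dct _ _ _ P _ _ K).
 - by move=> n; case: (bmf_avg n bf).
 - move=> n x; exact: avg_le.
 - exact: freq_bmf.
 - exact: birkhoff.
move=> /cvg_lim <- //; apply: (@lim_near_cst R^o)=> //.
by exists 1%N=> // n /= n0; rewrite Ex_avg.
Qed.

(** If [W n] exceeded a fixed positive level for all late [n] on a set of positive mass, its means
    could not tend to 0. Only a subsequence becomes small, which is enough wherever a limit is
    already known to exist. *)
Lemma ae_inf_small (W : nat -> T -> R) : (forall n, bmf (W n)) ->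
  (forall n x, 0 <= W n x) -> Ex P (W n) @[n --> \oo] --> 0 ->
  {ae P, forall x, forall e, 0 < e -> forall N, exists n, (N <= n)%N /\ W n x < e}.
Proof.
move=> bW W0 cW.
suff : {ae P, forall x, forall kN : nat * nat, exists n, (kN.2 <= n)%N /\ W n x < kN.1.+1%:R^-1}.
 apply: filterS=> x hx e e0 N.
 have [n [Nn hn]] := hx (Num.truncn e^-1, N); exists n; split=> //.
 apply: lt_trans hn _; rewrite invf_plt ?posrE//; exact: truncnS_gt.
apply: ae_forallc=> -[k N] /=.
pose B n : set T := setT `&` W n @^-1` `[k.+1%:R^-1, +oo[.
have mB n : measurable (B n) by case: (bW n)=> mW _; exact: mW.
pose C : set T := \bigcap_n B (n + N)%N.
have mC : measurable C by apply: bigcapT_measurable=> n.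
exists C; split=> //; last first.
 move=> x /= /forallNP h1 n _; split=> //=; rewrite in_itv/= andbT leNgt.
 apply/negP=> h2; apply: (h1 (n + N)%N); split=> //; exact: leq_addl.
apply/eqP; rewrite -fine_eq0 ?fin_num_measure// eq_le fine_ge0// andbT.
have k0 : 0 < k.+1%:R^-1 :> R by [].
rewrite -(pmulr_rle0 _ k0).
rewrite -(cvg_lim _ cW)//; apply: limr_ge; first by apply/cvg_ex; exists 0.
exists N=> // n /= Nn; rewrite -Ex_indic// -ExZ; last tame.
apply: Ex_le=> //; first tame.
move=> x; rewrite indicE; have [/set_mem xC|] := boolP (x \in C); last by rewrite mulr0.
by have [_ /=] := xC (n - N)%N Logic.I; rewrite subnK// in_itv/= andbT mulr1.
Qed.

End birkhoff.

(** * Generic points and ergodic components *)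

Section generic_points.
Context (R : realType) (M : nat).
Notation Sp := (shift_space M).
Variables (T : Sp -> Sp).
Hypothesis uT : ushift T.
Implicit Types (P : probability (borel Sp) R) (F : Sp -> R) (om : Sp).

Definition preserves P := forall E : set (borel Sp), measurable E -> P (T @^-1` E) = P E.

Definition generic P om := forall F, ucont F -> avg T F n om @[n --> \oo] --> Ex P F.

Definition ergodic P := forall E : set (borel Sp), measurable E -> T @^-1` E = E ->
  P E = 0%E \/ P E = 1%E.

Let mT : meas_fun (T : borel Sp -> borel Sp).
exact: ushift_measurable. Qed.

Lemma ucont_avg F n : ucont F -> ucont (avg T F n).
Proof.
move=> uF; apply: ucontZ; apply: ucont_sum=> i.
apply: ucont_comp=> //; exact: ushift_iter.
Qed.

Lemma mean_avg n om : (0 < n)%N -> mean (fun F => avg T F n om).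
Proof.
move=> n0; split.
- by move=> F G _ _; rewrite /avg /bsum big_split mulrDr.
- by move=> c F _; rewrite /avg /bsum -mulr_sumr mulrCA.
- move=> F G e uF uG h; rewrite -mulrBr -sumrB.
 exact: (@avg_le _ R T (fun x=> F x - G x) e n om (le_trans (normr_ge0 _) (h point)) h).
Qed.

Lemma generic_cyl P om :
  (forall w, avg T \1_(cyl w) n om @[n --> \oo] --> Ex P \1_(cyl w)) -> generic P om.
Proof.
move=> h F uF; apply: (@mean_cvg _ _ \oo (fun n F=> avg T F n om) (Ex P))=> //.
 exists 1%N=> // n /= n0; exact: mean_avg.
exact: mean_Ex.
Qed.

Lemma indic_cyl_children w (x : Sp) :
  \1_(cyl w) x = \sum_(i < M.+1) \1_(cyl (rcons w i)) x :> R.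
Proof.
rewrite (bigD1 (x (size w)))//= big1 ?addr0=> [|i ix]; rewrite !indicE; last first.
 rewrite memNset// /cyl /= size_rcons pfxS=> /rcons_inj[_ h].
 by move: ix; rewrite h eqxx.
suff -> : (x \in cyl w) = (x \in cyl (rcons w (x (size w)))) by [].
apply/idP/idP; rewrite !inE /cyl /= size_rcons pfxS; first by move=> ->.
by move=> /rcons_inj[].
Qed.

Lemma Ex_preserves P : (forall F, ucont F -> Ex P (F \o T) = Ex P F) -> preserves P.
Proof.
move=> h E mE; rewrite -(pushPE P mT); apply: shift_measure_unique=> //.
 exact: prob_ltoo.
move=> w; have mw : measurable (cyl w : set (borel Sp)) := cylM w.
rewrite -[LHS](@fineK _ (pushP P mT (cyl w))) ?fin_num_measure//.
rewrite -[RHS](@fineK _ (P (cyl w))) ?fin_num_measure//.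
rewrite -!Ex_indic// Ex_pushP ?h//; tame.
Qed.

Section preserved.
Variable P : probability (borel Sp) R.
Hypothesis hP : preserves P.

(** The limit frequencies of cylinders are nonnegative, consistent and of total mass 1, so they are
    the cylinder masses of a law; convergence on cylinders extends to continuous functions. *)
Lemma generic_exists : {ae P, forall om, exists P0, generic P0 om}.
Proof.
have : {ae P, forall om, forall w, avg T (\1_(cyl w) : Sp -> R) n om @[n --> \oo] --> freq T \1_(cyl w) om}.
 apply: ae_forallc=> w; apply: (birkhoff mT hP).
 tame.
move=> h; apply: (ae_mono h)=> om hom {h}; pose p w := freq T \1_(cyl w) om : R.
have p0 w : 0 <= p w.
 rewrite /p -(cvg_lim _ (hom w))//; apply: limr_ge.
  by apply/cvg_ex; eexists.
 apply: nearW=> n; apply: mulr_ge0=> //.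
 by apply: sumr_ge0=> i _.
have p1 : p [::] = 1.
 rewrite /p; apply: freq_cvg; apply: cvg_near_cst; exists 1%N=> // n /= n0.
 rewrite /avg /bsum (eq_bigr (fun=> 1))=> [|i _].
  by rewrite sumr_const card_ord -mulr_natl mulr1 mulVf// pnatr_eq0 -lt0n.
 by rewrite indicE mem_set.
have pS w : p w = \sum_i p (rcons w i).
 apply: freq_cvg.
 have -> : (fun n=> avg T \1_(cyl w) n om) =
   (fun n=> \sum_i avg T \1_(cyl (rcons w i)) n om : R).
  apply/funext=> n; rewrite /avg -mulr_sumr /bsum exchange_big/=; congr (_ * _).
  apply: eq_bigr=> i _; exact: indic_cyl_children.
 by apply: cvg_sumr=> i.
have [P0 hP0] := tree_measure p0 p1 pS; exists P0; apply: generic_cyl=> w.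
rewrite Ex_indic; last tame.
by rewrite hP0.
Qed.

Lemma generic_freq P0 om F : generic P0 om -> ucont F -> freq T F om = Ex P0 F.
Proof. by move=> h uF; exact: (@freq_cvg _ R T F om _ (h F uF)). Qed.

Lemma generic_preserves P0 om : generic P0 om -> preserves P0.
Proof.
move=> g; apply: Ex_preserves=> F uF; have uFT : ucont (F \o T) by exact: ucont_comp.
apply: (@cvg_unique R^o _ _ _ _ _ (g _ uFT))=> //.
apply: (@avg_comp_cvg _ R T); last tame.
by case: (ucont_bmf uF).
Qed.

(** Under the law generated by [om], the variance of [avg T F n] is itself a difference of
    frequencies at [om]. Its mean under [P] tends to 0 by Birkhoff's theorem, so it is small
    infinitely often at almost every [om]. *)
Let var_small F : ucont F ->
  {ae P, forall om, forall P0, generic P0 om -> forall e, 0 < e -> forall N,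
     exists n, (N <= n)%N /\ Ex P0 (fun x : Sp => (avg T F n x - Ex P0 F) ^+ 2) < e}.
Proof.
move=> uF; have bF := ucont_bmf uF; have [K FK] := bF.2.
have K0 : 0 <= K by exact: le_trans (FK point).
pose V n (om : borel Sp) : R := `|freq T (fun x : Sp=> avg T F n x ^+ 2) om - freq T F om ^+ 2|.
have uA n : ucont (fun x : Sp=> avg T F n x ^+ 2).
 under eq_fun do rewrite expr2; apply: ucontM; exact: ucont_avg.
have bA n := ucont_bmf (uA n).
have bfF := freq_bmf mT bF.
have bfF2 : bmf (fun x : borel Sp=> freq T F x ^+ 2) by under eq_fun do rewrite expr2; exact: bmfM.
have bV0 n : bmf (fun om : borel Sp=> freq T (fun x : Sp=> avg T F n x ^+ 2) om - freq T F om ^+ 2).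
 apply: bmfB=> //; exact: freq_bmf.
have bV n : bmf (V n) by exact: bmf_norm.
have VE P0 om n : generic P0 om ->
  Ex P0 (fun x : Sp=> (avg T F n.+1 x - Ex P0 F) ^+ 2) =
  freq T (fun x : Sp=> avg T F n.+1 x ^+ 2) om - freq T F om ^+ 2.
 move=> g; rewrite !(generic_freq g)//.
 rewrite (_ : (fun x=> _) = fun x=> (avg T F n.+1 x ^+ 2 - 2 * Ex P0 F * avg T F n.+1 x) +
   cst (Ex P0 F ^+ 2) x); last by apply/funext=> x; rewrite /cst; ring.
 have bavg := bmf_avg mT n.+1 bF.
 rewrite ExD; [|tame|tame].
 rewrite ExB; [|tame|tame].
 rewrite (@ExZ _ _ _ P0 (2 * Ex P0 F) (avg T F n.+1))// Ex_cst.
 rewrite (Ex_avg mT (generic_preserves g))//; ring.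
have sq_ge0 P0 n : 0 <= Ex P0 (fun x : Sp=> (avg T F n x - Ex P0 F) ^+ 2).
 apply: Ex_ge0=> x; exact: sqr_ge0.
have cV : Ex P (V n) @[n --> \oo] --> 0.
 have -> : 0 = Ex P (fun x : Sp=> freq T F x ^+ 2) - Ex P (fun x : Sp=> freq T F x ^+ 2) by lra.
 have : (Ex P (fun x : Sp=> avg T F n x ^+ 2) - Ex P (fun x : Sp=> freq T F x ^+ 2)) @[n --> \oo] -->
   Ex P (fun x : Sp=> freq T F x ^+ 2) - Ex P (fun x : Sp=> freq T F x ^+ 2).
  apply: cvgB; last exact: cvg_cst.
  apply: (@Ex_dct _ _ _ P _ _ (K ^+ 2))=> //.
  - by move=> n; case: (bA n).
  - move=> n x; rewrite normrX lerXn2r//.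
   by apply: avg_le=> // y.
  - apply: (ae_mono (birkhoff mT hP bF))=> x cx.
   under eq_fun do rewrite expr2; exact: cvgM.
 apply: cvg_trans; apply: near_eq_cvg; exists 1%N=> // -[//|n] _ /=.
 rewrite -(Ex_freq mT hP (bA n.+1)) -ExB//; last exact: freq_bmf.
 apply: Ex_ae=> //.
 apply: (ae_mono generic_exists)=> om [P0 g].
 by rewrite /V ger0_norm// -(VE P0).
apply: (ae_mono (ae_inf_small bV (fun n x=> normr_ge0 _) cV))=> om hom P0 g e e0 N.
have [[|n] [Nn hn]] := hom e e0 N.+1=> //.
by exists n.+1; split; [exact: ltnW|rewrite (VE P0 om)// (le_lt_trans (ler_norm _))].
Qed.

(** Small variance along a subsequence forces the Birkhoff limit of each cylinder indicator to be
    constant almost everywhere for [P0]. This plays the part of the ergodic decomposition. *)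
Theorem ergodic_component :
  {ae P, forall om, forall P0, generic P0 om -> {ae P0, forall om', generic P0 om'}}.
Proof.
have : {ae P, forall om, forall w P0, generic P0 om -> forall e, 0 < e -> forall N,
  exists n, (N <= n)%N /\ Ex P0 (fun x=> (avg T (\1_(cyl w) : Sp -> R) n x - Ex P0 \1_(cyl w)) ^+ 2) < e}.
 apply: ae_forallc=> w; apply: var_small; exact: ucont_cyl.
move=> h; apply: (ae_mono h)=> om hom P0 g; have hP0 := generic_preserves g.
suff : {ae P0, forall om', forall w, avg T (\1_(cyl w) : Sp -> R) n om' @[n --> \oo] --> Ex P0 \1_(cyl w)}.
 move=> h1; apply: (ae_mono h1)=> om' h2; exact: generic_cyl.
apply: ae_forallc=> w; set F := \1_(cyl w); set c := Ex P0 F.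
have uF : ucont F := @ucont_cyl R M w; have bF := ucont_bmf uF.
have F1 x : `|F x| <= 1 by rewrite /F indicE; case: (_ \in _); rewrite ?normr1 ?normr0.
have bfF := freq_bmf mT bF.
have bsq G : bmf G -> bmf (fun x : borel Sp=> (G x - c) ^+ 2).
 move=> bG; under eq_fun do rewrite expr2.
 apply: bmfM; apply: bmfB=> //; exact: bmf_cst.
have cv : Ex P0 (fun x : Sp=> (avg T F n x - c) ^+ 2) @[n --> \oo] -->
  Ex P0 (fun x : Sp=> (freq T F x - c) ^+ 2).
 apply: (@Ex_dct _ _ _ P0 _ _ ((1 + `|c|) ^+ 2)).
 - by move=> n; case: (bsq _ (bmf_avg mT n bF)).
 - move=> n x; rewrite normrX lerXn2r ?nnegrE//.
  rewrite (le_trans (ler_normB _ _))// lerD2r; exact: avg_le.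
 - tame.
 - apply: (ae_mono (birkhoff mT hP0 bF))=> x cx.
  under eq_fun do rewrite expr2; rewrite expr2.
  apply: cvgM; apply: cvgB=> //; exact: cvg_cst.
have e0 : Ex P0 (fun x : Sp=> (freq T F x - c) ^+ 2) = 0.
 apply/eqP; rewrite eq_le Ex_ge0 ?andbT; last by move=> x; exact: sqr_ge0.
 apply/ler_addgt0Pr=> e e0; rewrite add0r leNgt; apply/negP=> h2.
 have /cvgrPdist_lt/(_ (Ex P0 (fun x : Sp=> (freq T F x - c) ^+ 2) - e)) := cv.
 rewrite subr_gt0=> /(_ h2)[N _ hN].
 have [n [Nn hn]] := hom w P0 g e e0 N.
 have := hN n Nn; rewrite /= ltr_norml; lra.
have h0 := Ex_ae0 (bsq _ bfF) (fun x=> sqr_ge0 _) e0.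
apply: (ae_mono (ae_and (birkhoff mT hP0 bF) h0))=> x [cx /eqP]; rewrite sqrf_eq0 subr_eq0=> /eqP h3.
by rewrite -h3.
Qed.

End preserved.

(** Averaging over time the correlation of an invariant set with a cylinder shows that they are
    independent; cylinders determine measures, so the set is independent of itself. *)
Lemma generic_ergodic P0 : preserves P0 -> {ae P0, forall om, generic P0 om} -> ergodic P0.
Proof.
move=> hP0 ge E mE TE; have bE : bmf (\1_E : borel Sp -> R) := bmf_indic R mE.
have TiE i x : E (iter i T x) = E x.
 by elim: i=> //= i ih; rewrite -ih -{2}TE.
have key w : P0 (E `&` cyl w) = (fine (P0 E) * fine (P0 (cyl w)))%:E.
 have mw : measurable (cyl w : set (borel Sp)) := cylM w.
 have bw := ucont_bmf (@ucont_cyl R M w).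
 have mEw : measurable (E `&` cyl w : set (borel Sp)) by exact: measurableI.
 rewrite -[LHS]fineK ?fin_num_measure//.
 congr EFin; rewrite -(Ex_indic P0 mEw).
 rewrite indicI.
 have e1 n : (0 < n)%N -> Ex P0 (fun x=> \1_E x * avg T \1_(cyl w) n x) =
   Ex P0 (\1_E \* \1_(cyl w)).
  move=> n0; rewrite -(Ex_avg mT hP0 n0 (bmfM bE bw)); congr Ex; apply/funext=> x.
  rewrite /avg mulrCA; congr (_ * _); rewrite /bsum mulr_sumr; apply: eq_bigr=> i _.
  congr (_ * _); rewrite !indicE.
  suff -> : (x \in E) = (iter i T x \in E) by [].
  by apply/idP/idP; rewrite !inE TiE.
 have : Ex P0 (fun x=> \1_E x * avg T \1_(cyl w) n x) @[n --> \oo] -->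
   Ex P0 (fun x=> \1_E x * cst (fine (P0 (cyl w))) x).
  apply: (@Ex_dct _ _ _ P0 _ _ 1).
  - by move=> n; case: (bmfM bE (bmf_avg mT n bw)).
  - move=> n x; rewrite normrM; apply: mulr_ile1=> //.
    exact: indic_norm_le1.
   apply: avg_le=> // y; exact: indic_norm_le1.
  - tame.
  - apply: (ae_mono ge)=> x gx; apply: cvgM; first exact: cvg_cst.
   rewrite /cst -Ex_indic//; apply: gx; exact: ucont_cyl.
 rewrite (_ : (fun x=> \1_E x * _) = fun x=> fine (P0 (cyl w)) * \1_E x); last first.
  by apply/funext=> x; rewrite mulrC.
 rewrite ExZ// Ex_indic// mulrC=> cv; apply: (@cvg_unique R^o _ _ _ _ _ _ cv)=> //.
 by apply: cvg_near_cst; exists 1%N=> // n /= n0.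
pose m1 : {measure set (borel Sp) -> \bar R} := mrestr P0 mE.
pose k : {nonneg R} := NngNum (fine_ge0 (measure_ge0 P0 E)).
pose m2 : {measure set (borel Sp) -> \bar R} := mscale k P0.
have : m1 E = m2 E.
 apply: shift_measure_unique=> //.
  by rewrite /m1/= /mrestr setTI ltey_eq fin_num_measure.
 move=> w; rewrite /m1 /m2 /= /mrestr /mscale/= setIC key EFinM.
 have mw : measurable (cyl w : set (borel Sp)) := cylM w.
 by rewrite (fineK (fin_num_measure P0 _ mE)) (fineK (fin_num_measure P0 _ mw)).
rewrite /m1 /m2 /= /mrestr /mscale/= setIid -[P0 E]fineK ?fin_num_measure// => -[].
move: (fine (P0 E))=> p /eqP; rewrite -subr_eq0 -{1}[p]mulr1 -mulrBr mulf_eq0 subr_eq0.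
by case/orP=> /eqP; [left; congr EFin|right; congr EFin].
Qed.

End generic_points.

(** * Codes of measures *)

Section expansion.
Context (R : realType) (be : nat).
Hypothesis be1 : (1 < be)%N.
Implicit Types (s : nat -> nat) (y : R).

Let be0 : 0 < be%:R :> R. by rewrite ltr0n ltnW. Qed.

Definition part s n : R := \sum_(l < n) (s l)%:R / be%:R ^+ l.+1.

Definition ev s : R := limn (part s).

Lemma partS s n : part s n.+1 = part s n + (s n)%:R / be%:R ^+ n.+1.
Proof. by rewrite /part big_ord_recr. Qed.

Lemma part_le s n m : (n <= m)%N -> part s n <= part s m.
Proof.
elim: m=> [|m ih]; first by rewrite leqn0=> /eqP ->.
rewrite leq_eqVlt=> /predU1P[-> //|nm]; rewrite partS.
by rewrite (le_trans (ih nm))// lerDl////.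
Qed.

Lemma part_ub s n m : (forall l, (s l < be)%N) -> (n <= m)%N ->
  part s m <= part s n + be%:R ^- n - be%:R ^- m.
Proof.
move=> sb; elim: m=> [|m ih].
 by rewrite leqn0=> /eqP ->; rewrite addrK.
rewrite leq_eqVlt=> /predU1P[->|nm]; first by rewrite addrK.
have h1 := ih nm; rewrite partS.
have : (s m)%:R / be%:R ^+ m.+1 <= be%:R ^- m - be%:R ^- m.+1 :> R.
 rewrite ler_pdivrMr ?exprn_gt0// mulrBl mulVf ?gt_eqF ?exprn_gt0//.
 rewrite exprS mulrCA mulVf ?gt_eqF ?exprn_gt0// mulr1 lerBrDr.
 by rewrite natr1 ler_nat.
lra.
Qed.

Lemma part_cvg s : (forall l, (s l < be)%N) -> part s @ \oo --> ev s.
Proof.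
move=> sb; apply: nondecreasing_is_cvgn; first by move=> n m; exact: part_le.
exists 1=> _ [n _ <-]; have := part_ub sb (leq0n n).
rewrite /part big_ord0 add0r invr1.
have : 0 <= be%:R ^- n :> R by rewrite//.
lra.
Qed.

Lemma ev_part s n : (forall l, (s l < be)%N) ->
  part s n <= ev s <= part s n + be%:R ^- n.
Proof.
move=> sb; have cv : cvgn (part s) by apply/cvg_ex; exists (ev s); exact: part_cvg.
apply/andP; split.
 apply: limr_ge=> //; exists n=> // m /= nm; exact: part_le.
apply: limr_le=> //; exists n=> // m /= nm; apply: le_trans (part_ub sb nm) _.
by rewrite lerBlDr lerDl//.
Qed.

Lemma ev_ge0 s : (forall l, (s l < be)%N) -> 0 <= ev s.
Proof. by move=> /ev_part=> /(_ 0); rewrite /part big_ord0=> /andP[]. Qed.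

Lemma ev_le1 s : (forall l, (s l < be)%N) -> ev s <= 1.
Proof.
by move=> /ev_part=> /(_ 0); rewrite /part big_ord0 add0r invr1=> /andP[].
Qed.

Lemma expb_small e : 0 < e -> exists n, be%:R ^- n < e :> R.
Proof.
move=> e0; exists (Num.truncn e^-1); rewrite invf_plt ?posrE ?exprn_gt0//.
have h := truncnS_gt (e^-1 : R); apply: lt_le_trans h _.
rewrite -natrX ler_nat; exact: ltn_expl.
Qed.

Lemma ev_close s s' n : (forall l, (s l < be)%N) -> (forall l, (s' l < be)%N) ->
  (forall l, (l < n)%N -> s l = s' l) -> `|ev s - ev s'| <= be%:R ^- n.
Proof.
move=> sb sb' h; have := ev_part n sb; have := ev_part n sb'.
have -> : part s' n = part s n by apply: eq_bigr=> i _; rewrite h.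
rewrite ler_norml; lra.
Qed.

Definition bdig y l : nat := (Num.truncn (be%:R ^+ l.+1 * y) %% be)%N.

Lemma bdig_lt y l : (bdig y l < be)%N.
Proof. by rewrite ltn_mod ltnW. Qed.

Lemma truncn_div (x : R) : 0 <= x -> (Num.truncn (be%:R * x) %/ be)%N = Num.truncn x.
Proof.
move=> x0; have bx0 : 0 <= be%:R * x by rewrite mulr_ge0.
have /andP[h1 h2] := truncn_itv x0; have /andP[h3 h4] := truncn_itv bx0.
apply/eqP; rewrite eqn_leq; apply/andP; split.
 rewrite -ltnS ltn_divLR ?(ltnW be1)// -(ltr_nat R) natrM.
 by apply: le_lt_trans h3 _; rewrite mulrC ltr_pM2r.
rewrite leq_divRL ?(ltnW be1)// -ltnS -(ltr_nat R) natrM.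
by apply: le_lt_trans h4; rewrite mulrC ler_pM2l.
Qed.

Lemma part_bdig y n : 0 <= y < 1 -> part (bdig y) n = (Num.truncn (be%:R ^+ n * y))%:R / be%:R ^+ n.
Proof.
move=> /andP[y0 y1]; elim: n=> [|n ih].
 rewrite /part big_ord0 mul1r divr1.
 have /truncn_itv := y0; case: Num.truncn=> [|k]; rewrite//; have := ler0n R k; lra.
rewrite partS ih /bdig -truncn_div; last first.
 by rewrite mulr_ge0////.
rewrite mulrA -exprS [in RHS](divn_eq (Num.truncn _) be) natrD natrM mulrDl; congr (_ + _).
set t := _%:R; rewrite exprSr; field; by rewrite !gt_eqF// exprn_gt0.
Qed.

Lemma ev_bdig y : 0 <= y < 1 -> ev (bdig y) = y.
Proof.
move=> y01; have /andP[y0 y1] := y01; have h : part (bdig y) @ \oo --> y.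
 apply/cvgrPdist_le=> e e0; have [n hn] := expb_small e0.
 exists n=> // m /= nm; rewrite part_bdig//.
 have bm : 0 < be%:R ^+ m :> R by rewrite exprn_gt0.
 have /truncn_itv /andP[h1 h2] : 0 <= be%:R ^+ m * y by rewrite mulr_ge0.
 have le1 : (Num.truncn (be%:R ^+ m * y))%:R / be%:R ^+ m <= y by rewrite ler_pdivrMr// [y * _]mulrC.
 have le2 : y <= (Num.truncn (be%:R ^+ m * y))%:R / be%:R ^+ m + be%:R ^- m.
  by rewrite -[X in _ + X]mul1r -mulrDl ler_pdivlMr// mulrC natr1 ltW.
 have : be%:R ^- m <= be%:R ^- n :> R.
  by rewrite lef_pV2 ?posrE ?exprn_gt0// ler_weXn2l// ler1n ltnW.
 rewrite ger0_norm; lra.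
by rewrite /ev (cvg_lim _ h).
Qed.

End expansion.

(** * Codes: digit sequences with bit tables *)

Section codes.
Context (R : realType) (D : nat).
Notation digit := ('I_D.+1).
Notation Om := (shift_space D.*2.+1).
Notation Y := (shift_space D).
Implicit Types (om : Om) (y : Y) (w u : seq digit) (d l : nat).

(* A letter of [Om] is a digit together with a bit. *)
Definition dig (a : 'I_D.*2.+2) : digit := inord a./2.
Definition bit (a : 'I_D.*2.+2) : bool := odd a.
Definition comb (c : digit) (e : bool) : 'I_D.*2.+2 := inord (e + c.*2).

Lemma comb_val c e : comb c e = (e + c.*2)%N :> nat.
Proof.
rewrite inordK// -doubleS (leq_trans (_ : _ < c.+1.*2))%N//.
 by rewrite doubleS; case: e=> //=.
by rewrite leq_double.
Qed.

Lemma dig_comb c e : dig (comb c e) = c.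
Proof. by rewrite /dig comb_val half_bit_double inord_val. Qed.

Lemma bit_comb c e : bit (comb c e) = e.
Proof. by rewrite /bit comb_val oddD odd_double; case: e. Qed.

Lemma comb_dig a : comb (dig a) (bit a) = a.
Proof.
apply: val_inj; rewrite /= comb_val /dig inordK ?odd_double_half//.
by rewrite -ltn_double (leq_ltn_trans _ (ltn_ord a))// -{2}(odd_double_half a) leq_addl.
Qed.

Definition xs om : Y := fun n => dig (om n).

(** Bit number [l] of the [d]-th stick-breaking proportion at the node [w]; the table is laid along
    the sequence through [pickle]. *)
Definition bits om w d l : bool := bit (om (pickle (w, d, l))).

(** Parametrises by digit sequences the fibre of all codes that share the bits of [om]. *)
Definition splice om y : Om := fun n => comb (y n) (bit (om n)).

Definition samebits om om' := forall n, bit (om n) = bit (om' n).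

(** Magnification in the cell of the first digit: the digits move by one place and the table is read
    below that digit. Places that encode no triple get a default bit. *)
Definition tailT om : Om := fun n => comb (xs om n.+1)
  (if unpickle n is Some (w, d, l) then bits om (xs om 0%N :: w) d l else false).

Lemma xs_splice om y : xs (splice om y) = y.
Proof. by apply/funext=> n; rewrite /xs /splice dig_comb. Qed.

Lemma bits_splice om y n : bit (splice om y n) = bit (om n).
Proof. by rewrite /splice bit_comb. Qed.

Lemma samebits_splice om y : samebits (splice om y) om.
Proof. by move=> n; rewrite bits_splice. Qed.

Lemma splice_xs om om' : samebits om om' -> splice om (xs om') = om'.
Proof. by move=> h; apply/funext=> n; rewrite /splice h comb_dig. Qed.

Lemma splice_splice om y y' : splice (splice om y) y' = splice om y'.
Proof. by apply/funext=> n; rewrite /splice bit_comb. Qed.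

Lemma splice_same om om' y : samebits om om' -> splice om y = splice om' y.
Proof. by move=> h; apply/funext=> n; rewrite /splice h. Qed.

Lemma xs_tailT om n : xs (tailT om) n = xs om n.+1.
Proof. by rewrite {1}/xs /tailT dig_comb. Qed.

Lemma bits_tailT om w d l : bits (tailT om) w d l = bits om (xs om 0%N :: w) d l.
Proof. by rewrite {1}/bits /tailT bit_comb pickleK. Qed.

Lemma xs_iter m om n : xs (iter m tailT om) n = xs om (m + n)%N.
Proof. by elim: m om n=> [|m ih] om n; rewrite// iterSr ih xs_tailT. Qed.

Lemma bits_iter m om w d l :
  bits (iter m tailT om) w d l = bits om (pfx (xs om) m ++ w) d l.
Proof.
elim: m w=> // m ih w; rewrite iterS bits_tailT ih xs_iter addn0.
by rewrite pfxS cat_rcons.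
Qed.

Lemma prefix_xs om om' k : pfx om k = pfx om' k ->
  pfx (xs om) k = pfx (xs om') k.
Proof.
by move=> /pfxP h; apply/pfxP=> n /h; rewrite /xs=> ->.
Qed.

Lemma prefix_omP om om' k : pfx om k = pfx om' k <->
  (pfx (xs om) k = pfx (xs om') k /\
   forall n, (n < k)%N -> bit (om n) = bit (om' n)).
Proof.
split=> [h|[/pfxP h1 h2]].
 by split; [exact: prefix_xs|move/pfxP: h=> h n /h ->].
apply/pfxP=> n nk; rewrite -(comb_dig (om n)) -(comb_dig (om' n)).
rewrite h2//; congr comb; exact: h1.
Qed.

Lemma ushift_splice y : ushift (splice ^~ y).
Proof.
move=> k; exists k=> om om' /prefix_omP[_ h]; apply/pfxP=> n nk.
by rewrite /splice h.
Qed.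

Lemma ushift_tailT : ushift tailT.
Proof.
move=> k.
(* The bit written at place [n] is read at a place depending on the first digit, so the maximum runs
   over all digits. *)
pose need n c := if (unpickle n : option (seq digit * nat * nat)) is Some (w, d, l) then (pickle (c :: w, d, l)).+1 else 0%N.
exists (maxn k.+1 (\max_(n < k) \max_(c < D.+1) need n c))=> om om' h.
have h1 : pfx om k.+1 = pfx om' k.+1 by apply: prefix_le h; exact: leq_maxl.
have /prefix_omP[/pfxP hx _] := h1.
have /prefix_omP[_ hb] := h.
apply/pfxP=> n nk; rewrite /tailT hx// hx//; congr comb.
case e : unpickle=> [[[w d] l]|//]; rewrite /bits hb//.
apply: leq_trans (leq_maxr _ _).
apply: leq_trans (leq_bigmax (Ordinal nk)).
apply: leq_trans (leq_bigmax (xs om' 0)).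
by rewrite /need /= e.
Qed.

Definition yval om w d : R := ev R 2 (fun l => bits om w d l).

Let bit_lt2 (e : bool) : (e < 2)%N. by case: e. Qed.

Lemma yval_ge0 om w d : 0 <= yval om w d.
Proof. by apply: ev_ge0=> // l. Qed.

Lemma yval_le1 om w d : yval om w d <= 1.
Proof. by apply: ev_le1=> // l. Qed.

Lemma ucont_yval w d : ucont (fun om => yval om w d).
Proof.
move=> e e0; have [n hn] := @expb_small R 2 isT e e0.
exists (\max_(l < n) (pickle (w, d, val l)).+1)=> om om' /prefix_omP[_ h].
apply: le_trans (ltW hn); apply: ev_close=> // l ln.
rewrite /bits h//; exact: (leq_trans _ (leq_bigmax (Ordinal ln))).
Qed.

(* Stick breaking: any choice of the bits defines a probability vector. *)
Definition stick om w d : R := if (d < D)%N then yval om w d else 1.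

Definition ratio om w (c : digit) : R :=
  stick om w c * \prod_(j < c) (1 - stick om w j).

Lemma stick_ge0 om w d : 0 <= stick om w d.
Proof. by rewrite /stick; case: ifP=> // _; exact: yval_ge0. Qed.

Lemma stick_le1 om w d : stick om w d <= 1.
Proof. by rewrite /stick; case: ifP=> // _; exact: yval_le1. Qed.

Lemma ratio_ge0 om w c : 0 <= ratio om w c.
Proof.
rewrite mulr_ge0 ?stick_ge0// prodr_ge0// => j _.
by rewrite subr_ge0 stick_le1.
Qed.

Let stick_sum (v : nat -> R) n :
  \sum_(c < n) v c * \prod_(j < c) (1 - v j) = 1 - \prod_(j < n) (1 - v j).
Proof.
elim: n=> [|n ih]; first by rewrite !big_ord0 subrr.
rewrite big_ord_recr/= ih [in RHS]big_ord_recr/=; ring.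
Qed.

Lemma ratio_sum om w : \sum_c ratio om w c = 1.
Proof.
rewrite stick_sum big_ord_recr/= {2}/stick ltnn subrr mulr0 subr0//.
Qed.

Lemma ratio_le1 om w c : ratio om w c <= 1.
Proof.
rewrite -(ratio_sum om w) (bigD1 c)//= lerDl; apply: sumr_ge0=> i _.
exact: ratio_ge0.
Qed.

Fixpoint wt om u w : R :=
  if w is c :: w' then ratio om u c * wt om (rcons u c) w' else 1.

Lemma wt_ge0 om u w : 0 <= wt om u w.
Proof. by elim: w u=> //= c w ih u; rewrite mulr_ge0// ratio_ge0. Qed.

Lemma wt_le1 om u w : wt om u w <= 1.
Proof.
elim: w u=> //= c w ih u; rewrite mulr_ile1 ?ratio_ge0 ?wt_ge0 ?ratio_le1//.
Qed.

Lemma wt_cat om u w w' : wt om u (w ++ w') = wt om u w * wt om (u ++ w) w'.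
Proof.
elim: w u=> [|c w ih] u /=; first by rewrite mul1r cats0.
by rewrite ih cat_rcons mulrA.
Qed.

Lemma wt_rcons om u w c : wt om u (rcons w c) = wt om u w * ratio om (u ++ w) c.
Proof. by rewrite -cats1 wt_cat /= mulr1. Qed.

Lemma wt_sum om u w : wt om u w = \sum_c wt om u (rcons w c).
Proof.
under eq_bigr do rewrite wt_rcons.
by rewrite -mulr_sumr ratio_sum mulr1.
Qed.

Lemma bits_eq_wt om om' u u' : (forall w d l, bits om (u ++ w) d l = bits om' (u' ++ w) d l) ->
  forall w, wt om u w = wt om' u' w.
Proof.
move=> h w; elim: w u u' h=> //= c w ih u u' h; congr (_ * _).
 have hs d : stick om u d = stick om' u' d.
  rewrite /stick; case: ifP=> // _; congr ev; apply/funext=> l.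
  by have := h [::] d l; rewrite !cats0=> ->.
 by rewrite /ratio hs; congr (_ * _); apply: eq_bigr=> j _; rewrite hs.
by apply: ih=> w' d l; rewrite !cat_rcons.
Qed.

Lemma wt_iter m om w : wt (iter m tailT om) [::] w = wt om (pfx (xs om) m) w.
Proof. by apply: bits_eq_wt=> w' d l; rewrite bits_iter. Qed.

Lemma wt_samebits om om' u w : samebits om om' -> wt om u w = wt om' u w.
Proof. by move=> h; apply: bits_eq_wt=> w' d l; rewrite /bits. Qed.

Lemma ucont_ratio w c : ucont (fun om => ratio om w c).
Proof.
have us d : ucont (fun om=> stick om w d).
 rewrite /stick; case: (d < D)%N; [exact: ucont_yval|exact: ucont_cst].
apply: ucontM=> //.
elim: nat_of_ord=> [|n ih].
 rewrite (_ : (fun om=> _) = cst 1); first tame.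
 by apply/funext=> om; rewrite big_ord0.
rewrite (_ : (fun om=> _) = fun om=> \prod_(j < n) (1 - stick om w j) * (1 - stick om w n)).
 apply: ucontM=> //; apply: ucontB=> //; exact: ucont_cst.
by apply/funext=> om; rewrite big_ord_recr.
Qed.

Lemma ucont_wt u w : ucont (fun om => wt om u w).
Proof.
elim: w u=> [|c w ih] u /=; first exact: ucont_cst.
apply: ucontM=> //; exact: ucont_ratio.
Qed.

End codes.

Section code.
Context (R : realType) (D : nat).
Notation digit := ('I_D.+1).
Notation Om := (shift_space D.*2.+1).

(* Binary digits of a number of [0, 1], 1 included. *)
Definition bits_of (v : R) (l : nat) : bool := (v == 1) || odd (Num.truncn (2 ^+ l.+1 * v)).

Lemma ev_pred be : (1 < be)%N -> ev R be (fun=> be.-1) = 1.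
Proof.
move=> be1; have be0 : (0 < be)%N by exact: ltnW.
have lt (l : nat) : ((fun=> be.-1) l < be)%N by rewrite prednK.
apply/eqP; rewrite eq_le ev_le1//=.
apply/ler_addgt0Pl=> e e0; have [n hn] := expb_small be1 e0.
have /andP[+ _] := ev_part R be1 n lt.
suff -> : part R be (fun=> be.-1) n = 1 - be%:R ^- n.
 by move=> h; rewrite -lerBlDl; apply: le_trans h; rewrite lerD2l lerN2 ltW.
elim: n {hn} => [|n ih]; first by rewrite /part big_ord0 invr1 subrr.
have b0 : be%:R != 0 :> R by rewrite pnatr_eq0 -lt0n.
have e1 : be.-1%:R = be%:R - 1 :> R by rewrite -[in RHS](prednK be0) -natr1 addrK.
by rewrite partS ih e1 exprSr; field; rewrite b0 expf_neq0.
Qed.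

Lemma ev_bits_of (v : R) : 0 <= v <= 1 -> ev R 2 (bits_of v) = v.
Proof.
move=> /andP[v0]; rewrite le_eqVlt=> /predU1P[->|v1].
 rewrite -[RHS](@ev_pred 2 isT); congr ev; apply/funext=> l.
 by rewrite /bits_of eqxx.
have v01 : 0 <= v < 1 by lra.
rewrite -[RHS](@ev_bdig R 2 isT v v01); congr ev; apply/funext=> l.
by rewrite /bdig modn2 /bits_of lt_eqF.
Qed.

Lemma measurable_bits_of l : measurable [set v : R | bits_of v l].
Proof.
rewrite (_ : [set v | _] = [set 1] `|` \bigcup_(n in [set n | odd n])
  [set` `[n%:R / 2 ^+ l.+1, n.+1%:R / 2 ^+ l.+1[]); last first.
 have p0 : 0 < 2 ^+ l.+1 :> R by [].
 apply/seteqP; split=> v /=; rewrite /bits_of.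
  case/orP=> [/eqP ->|h]; [by left|right].
  exists (Num.truncn (2 ^+ l.+1 * v))=> //; rewrite /= in_itv/= ler_pdivrMr// ltr_pdivlMr// mulrC.
  have [x0|x0] := leP 0 (2 ^+ l.+1 * v); first by move/truncn_itv: x0; rewrite mulrC.
  by move: h; rewrite (_ : Num.truncn _ = 0)//; apply/truncn0Pn; rewrite -ltNge (lt_trans x0).
 case=> [->|[n no]]; first by rewrite eqxx.
 rewrite /= in_itv/= ler_pdivrMr// ltr_pdivlMr// mulrC=> /truncn_def ->.
 by rewrite no orbT.
apply: measurableU=> //.
by apply: bigcup_measurable=> n _.
Qed.

Section weights.
Variable eta : seq digit -> R.

Let rest w d : R := eta w - \sum_(j < D.+1 | (j < d)%N) eta (rcons w j).

Definition break w d : R := if (d < D.+1)%N then eta (rcons w (inord d)) / rest w d else 0.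

Definition code : Om := fun n => comb ord0 (if (unpickle n : option (seq digit * nat * nat))
  is Some (w, d, l) then bits_of (break w d) l else false).

Hypotheses (eta0 : forall w, 0 <= eta w) (eta1 : eta [::] = 1)
  (etaS : forall w, eta w = \sum_c eta (rcons w c)).

Let rest_ge w (c : digit) : eta (rcons w c) <= rest w c.
Proof.
rewrite /rest lerBrDl [leRHS]etaS; exact: sum_ord_lt.
Qed.

Let break01 w d : 0 <= break w d <= 1.
Proof.
rewrite /break; case: ifPn=> [dD|_]; last by rewrite lexx ler01.
have := rest_ge w (inord d); rewrite inordK// => h.
have := le_trans (eta0 _) h; rewrite le_eqVlt=> /predU1P[<-|r0].
 lra.
by rewrite divr_ge0 ?(ltW r0)//= ler_pdivrMr// mul1r.
Qed.

(** [break] is the share of a child in the mass left over by the earlier ones, so stick breaking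
    restores the weights. When nothing is left, the quotient by zero is harmless because the
    remaining children are null. *)
Lemma code_wt w : wt R code [::] w = eta w.
Proof.
have yE w' d : yval R code w' d = break w' d.
 rewrite -(ev_bits_of (break01 w' d)) /yval; congr ev; apply/funext=> l.
 by rewrite /bits /code bit_comb pickleK.
have vr w' (c : digit) : break w' c * rest w' c = eta (rcons w' c).
 rewrite /break ltn_ord inord_val; have [r0|r0] := eqVneq (rest w' c) 0; last by rewrite divfK.
 by apply/eqP; rewrite r0 mulr0 eq_le eta0 -r0 rest_ge.
have sr w' (c : digit) : stick R code w' c * rest w' c = eta (rcons w' c).
 rewrite /stick; case: ltnP=> cD; first by rewrite yE.
 (* The last stick is 1: the last child takes exactly what is left. *)
 have cD' : val c = D by apply/eqP; rewrite eqn_leq cD -ltnS ltn_ord.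
 rewrite mul1r /rest etaS (bigD1 c)//= [X in _ + X - _](_ : _ = \sum_(j < D.+1 | (j < c)%N) eta (rcons w' j)) ?addrK//.
 by apply: eq_bigl=> j; have := ltn_ord j; rewrite ltnS -val_eqE /= neq_ltn cD' [(D < j)%N]ltnNge=> ->; rewrite orbF.
have pr w' d : (d <= D)%N -> eta w' * \prod_(j < d) (1 - stick R code w' j) = rest w' d.
 elim: d=> [|d ih] dD; first by rewrite big_ord0 mulr1 /rest big_pred0// subr0.
 have dD1 : (d < D.+1)%N by rewrite ltnW.
 rewrite big_ord_recr/= mulrA ih// mulrBr mulr1 mulrC.
 have := sr w' (Ordinal dD1); rewrite /= => ->.
 by rewrite /rest -(@sum_ord_ltS R D.+1 (fun j=> eta (rcons w' j)) (Ordinal dD1))/= opprD addrA.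
have er w' c : eta w' * ratio R code w' c = eta (rcons w' c).
 by rewrite /ratio mulrCA pr// -ltnS.
elim/last_ind: w=> [|w c ih]//.
by rewrite wt_rcons ih.
Qed.

End weights.

End code.

(** * Conditional expectation given the bits *)

Section kernel_operator.
Context (R : realType) (D : nat).
Notation digit := ('I_D.+1).
Notation Om := (shift_space D.*2.+1).
Notation Y := (shift_space D).
Notation wt := (wt R).
Implicit Types (om : Om) (y : Y) (w u : seq digit) (d l : nat) (F G : Om -> R)
  (P : probability (borel Om) R).

Lemma digit_law_exists om :
  exists P : probability (borel Y) R, forall w, P (cyl w) = (wt om [::] w)%:E.
Proof.
by apply: tree_measure; [exact: wt_ge0|by []|exact: wt_sum].
Qed.

Definition digit_law om : probability (borel Y) R := projT1 (cid (digit_law_exists om)).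

Lemma digit_lawE om w : digit_law om (cyl w) = (wt om [::] w)%:E.
Proof. exact: (projT2 (cid (digit_law_exists om))). Qed.

Lemma digit_law_eqwt om om' (E : set (borel Y)) :
  (forall w, wt om [::] w = wt om' [::] w) -> measurable E ->
  digit_law om E = digit_law om' E.
Proof.
move=> sb mE; apply: shift_measure_unique=> // [|w].
 exact: prob_ltoo.
have h := digit_lawE om w; have h' := digit_lawE om' w.
by rewrite [LHS]h [RHS]h' sb.
Qed.

Lemma measurable_splice om : meas_fun (splice om : borel Y -> borel Om).
Proof.
apply: measurable_to_shift=> a.
have [h|h] := pselect (forall n, (n < size a)%N -> bit (om n) = bit (nth ord0 a n)).
 rewrite (_ : _ @^-1` _ = cyl (map (@dig D) a)); first tame.
 apply/seteqP; split=> y; rewrite /cyl /= size_map.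
  move=> /(congr1 (map (@dig D))) <-; rewrite /pfx /mkseq -map_comp.
  by apply: eq_map=> n; rewrite /= dig_comb.
 move=> hy; apply: (@eq_from_nth _ ord0); first exact: size_pw.
 rewrite size_pw=> n na.
 rewrite nth_mkseq// /splice h// -[RHS]comb_dig; congr comb.
 by rewrite -(nth_map _ ord0)// -hy nth_mkseq.
rewrite (_ : _ @^-1` _ = set0)//.
apply/seteqP; split=> y //=; rewrite /cyl /= => hy; apply: h=> n na.
by rewrite -hy nth_mkseq// bits_splice.
Qed.

(** Conditional expectation given the bits of [om]: the digits are redrawn from the coded
    measure. *)
Definition cexp om F : R := Ex (digit_law om) (F \o splice om).

Lemma ucont_splice F om : ucont F -> ucont (F \o splice om : Y -> R).
Proof.
move=> uF e /uF[k hk]; exists k=> y y' /pfxP h; apply: hk.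
by apply/pfxP=> n /h; rewrite /splice=> ->.
Qed.

Lemma mean_cexp om : mean (cexp om).
Proof.
have [m1 m2 m3] := mean_Ex (digit_law om); split.
- move=> F G uF uG; rewrite /cexp -m1//; exact: ucont_splice.
- move=> c F uF; rewrite /cexp -m2//; exact: ucont_splice.
- by move=> F G e uF uG h; apply: m3=> [||x]; [exact: ucont_splice..|exact: h].
Qed.

(** The bits may enter without restriction; only the dependence on the digits is limited to the
    first [k]. *)
Definition depth k F := forall om y y', pfx y k = pfx y' k ->
  F (splice om y) = F (splice om y').

Lemma cexp_depth k F om : ucont F -> depth k F -> cexp om F =
  \sum_(w : k.-tuple digit) F (splice om (ext_word w)) * wt om [::] w.
Proof.
move=> uF dF.
have -> : cexp om F = Ex (digit_law om) (step k (F \o splice om)).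
 congr Ex; apply/funext=> y; rewrite stepE /=; apply: dF.
 by rewrite prefix_ext_prefix.
rewrite (mean_step _ _ (mean_Ex _)); apply: eq_bigr=> w _; congr (_ * _).
rewrite Ex_indic; last tame.
by rewrite digit_lawE.
Qed.

Lemma depth_step k F : depth k (step k F).
Proof.
move=> om y y' h; rewrite !stepE; congr (F (ext_word _)).
by apply/prefix_omP; rewrite !xs_splice; split=> // n _; rewrite !bits_splice.
Qed.

Lemma depth_cyl a : depth (size a) (\1_(cyl a)).
Proof.
move=> om y y' h; rewrite !indicE.
suff -> : (splice om y \in cyl a) = (splice om y' \in cyl a) by [].
have e : pfx (splice om y) (size a) = pfx (splice om y') (size a).
 by apply/prefix_omP; rewrite !xs_splice; split=> // n _; rewrite !bits_splice.
by apply/idP/idP; rewrite !inE /cyl /= e.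
Qed.

Lemma ucont_unif F : (forall e, 0 < e -> exists2 G, ucont G & forall x, `|F x - G x| <= e) ->
  ucont F.
Proof.
move=> h e e0; have e3 : 0 < e / 3 by rewrite divr_gt0.
have [G uG FG] := h _ e3; have [k hk] := uG _ e3; exists k=> x x' /hk hx.
rewrite (_ : _ - _ = (F x - G x) + (G x - G x') - (F x' - G x')); last by ring.
rewrite (le_trans (ler_normB _ _))// (le_trans (lerD (ler_normD _ _) (lexx _)))//.
have := FG x; have := FG x'; lra.
Qed.

(** At finite depth the kernel is a finite sum of values times weights, both continuous in the bits;
    the general case is a uniform limit. This continuity is what lets [disint] pass to weak
    limits. *)
Lemma ucont_cexp F : ucont F -> ucont (fun om => cexp om F).
Proof.
move=> uF; apply: ucont_unif=> e e0; have [k hk] := uF _ e0.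
exists (fun om=> cexp om (step k F)).
 under eq_fun do rewrite (cexp_depth _ (ucont_step k F) (@depth_step k F)).
 apply: ucont_sum=> w; apply: ucontM; last exact: ucont_wt.
 have h := @ucont_comp R D.*2.+1 (step k F) (fun x=> splice x (ext_word w)) (ucont_step k F) (@ushift_splice D (ext_word w)).
 exact: h.
move=> om; have [_ _ h] := mean_cexp om; apply: h=> //; first tame.
by move=> x; rewrite stepE; apply: hk; rewrite prefix_ext_prefix.
Qed.

Lemma cexp_samebits om om' F : ucont F -> samebits om om' -> cexp om F = cexp om' F.
Proof.
move=> uF h.
have sp : splice om = splice om' by apply/funext=> y; exact: splice_same.
rewrite /cexp sp /Ex /Rintegral; congr fine.
apply: eq_measure_integral=> E mE _; apply: digit_law_eqwt=> // w; exact: wt_samebits.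
Qed.

Definition disint P := forall F, ucont F -> Ex P F = Ex P (fun om => cexp om F).

End kernel_operator.

Section disintegration.
Context (R : realType) (D : nat).
Notation digit := ('I_D.+1).
Notation Om := (shift_space D.*2.+1).
Notation Y := (shift_space D).
Notation wt := (wt R).
Notation T := (@tailT D).
Implicit Types (om : Om) (y : Y) (w u : seq digit) (d l : nat) (F G : Om -> R)
  (P : probability (borel Om) R).

Lemma cexp_splice om y F : ucont F -> cexp (splice om y) F = cexp om F.
Proof. by move=> uF; apply: cexp_samebits=> // n; rewrite bits_splice. Qed.

Lemma cexpM om F G : ucont F -> ucont G -> depth 0 F ->
  cexp om (fun x => F x * G x) = F om * cexp om G.
Proof.
move=> uF uG dF; have [_ mZ _] := mean_cexp R om; rewrite -mZ//.
congr Ex; apply/funext=> y /=; congr (_ * _).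
rewrite -{2}(splice_xs (fun n=> erefl (bit (om n)))); exact: dF.
Qed.

Lemma depth_cexp F : ucont F -> depth 0 (fun om => cexp om F).
Proof. by move=> uF om y y' _; rewrite !cexp_splice. Qed.

Lemma cexp1 om : cexp om (cst 1) = 1 :> R.
Proof. exact: Ex_cst. Qed.

Lemma cexpK om F : ucont F -> cexp om (fun x => cexp x F) = cexp om F.
Proof.
move=> uF; have := @cexpM om (fun x=> cexp x F) (cst 1) (ucont_cexp uF)
 (ucont_cst _ 1) (depth_cexp uF).
rewrite cexp1 mulr1=> <-.
by congr cexp; apply/funext=> x; rewrite /cst mulr1.
Qed.

Lemma cexpB om F G : ucont F -> ucont G ->
  cexp om (fun x => F x - G x) = cexp om F - cexp om G.
Proof.
move=> uF uG; have [mD mZ _] := mean_cexp R om.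
have -> : (fun x=> F x - G x) = fun x=> F x + -1 * G x.
 by apply/funext=> x; rewrite mulN1r.
rewrite mD ?mZ ?mulN1r//; exact: ucontZ.
Qed.

Lemma samebits_iter m om om' : samebits om om' ->
  pfx (xs om) m = pfx (xs om') m ->
  samebits (iter m T om) (iter m T om').
Proof.
move=> h; elim: m=> // m ih /pfxP hm n.
have hm' : pfx (xs om) m = pfx (xs om') m.
 apply/pfxP=> j jm; apply: hm; exact: ltnW.
have {}ih := ih hm'; have h0 : xs (iter m T om) 0%N = xs (iter m T om') 0%N.
 rewrite !xs_iter addn0; exact: hm.
rewrite /= /tailT !bit_comb h0; case: unpickle=> [[[w d] l]|//].
by rewrite /bits.
Qed.

Let ucont_cylxs w : ucont (fun x : Om => \1_(cyl w) (xs x) : R).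
Proof.
apply: (@ucont_dep _ _ _ (size w))=> x x' h; rewrite !indicE.
suff -> : (xs x \in cyl w) = (xs x' \in cyl w) by [].
by apply/idP/idP; rewrite !inE /cyl /= (prefix_xs h).
Qed.

Let uTm m F : ucont F -> ucont (fun x => F (iter m T x)).
Proof.
move=> uF; apply: ucont_comp=> //; apply: ushift_iter; exact: ushift_tailT.
Qed.

(* Self-similarity of the digit laws. *)
Lemma cexp_node om w F : ucont F ->
  cexp om (fun x => \1_(cyl w) (xs x) * F (iter (size w) T x)) =
  wt om [::] w * cexp (iter (size w) T (splice om (ext_word w))) F.
Proof.
set m := size w; set om' := iter m T _=> uF.
have hx : xs (splice om (ext_word w)) = ext_word w by exact: xs_splice.
pose m1 (G : Y -> R) := Ex (digit_law R om) (fun y=> \1_(cyl w) y * G (dshift m y)).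
pose m2 (G : Y -> R) := wt om [::] w * Ex (digit_law R om') G.
have uI (G : Y -> R) : ucont G -> ucont (fun y=> \1_(cyl w) y * G (dshift m y) : R).
 move=> uG; apply: ucontM; first tame.
 exact: (@ucont_comp R D G (dshift m) uG (@ushift_dshift D m)).
have [c1 c2 c3] := mean_Ex (digit_law R om); have [d1 d2 d3] := mean_Ex (digit_law R om').
have mm1 : mean m1.
 split=> [G H uG uH|c G uG|G H e uG uH h].
 - by rewrite /m1 -c1; [congr Ex; apply/funext=> x; rewrite mulrDr|exact: uI..].
 - by rewrite /m1 -c2; [congr Ex; apply/funext=> x; rewrite mulrCA|tame].
 - apply: c3; [exact: uI..|move=> x].
  rewrite -mulrBr normrM -[e]mul1r; apply: ler_pM=> //; exact: indic_norm_le1.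
have mm2 : mean m2.
 split=> [G H uG uH|c G uG|G H e uG uH h]; first by rewrite /m2 d1// mulrDr.
  by rewrite /m2 d2// mulrCA.
 rewrite -mulrBr normrM -[e]mul1r; apply: ler_pM=> //; last tame.
 by rewrite ger0_norm ?wt_ge0 ?wt_le1.
have -> : cexp om (fun x=> \1_(cyl w) (xs x) * F (iter m T x)) = m1 (F \o splice om').
 congr Ex; apply/funext=> y /=; rewrite xs_splice !indicE.
 case: (boolP (y \in cyl w)); last by rewrite !mul0r.
 rewrite inE=> yw; congr (_ * F _); rewrite -[LHS](@splice_xs _ om'); last first.
  apply: samebits_iter; first by move=> n; rewrite !bits_splice.
  rewrite hx xs_splice yw; exact: prefix_ext.
 by congr splice; apply/funext=> n; rewrite xs_iter xs_splice.
rewrite (mean_eq mm1 mm2)=> [//|v|]; last exact: ucont_splice.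
rewrite /m1 (_ : (fun y=> _) = \1_(cyl (w ++ v))); last first.
 by apply/funext=> y; rewrite cyl_cat indicI.
rewrite /m2 !Ex_indic; try exact: cylM.
have h1 := digit_lawE R om (w ++ v); have h2 := digit_lawE R om' v.
rewrite [X in fine X = _]h1 [X in _ = _ * fine X]h2 /= wt_cat; congr (_ * _).
by rewrite /om' wt_iter hx prefix_ext -(wt_samebits R _ _ (samebits_splice om (ext_word w))).
Qed.

Lemma depth_le k m F : (k <= m)%N -> depth k F -> depth m F.
Proof. by move=> km dF om y y' h; apply: dF; exact: prefix_le h. Qed.

(* Conditioning on the bits and on the first [m] digits. *)
Lemma cexp_tower om m F G : ucont F -> ucont G -> depth m F ->
  cexp om (fun x => F x * G (iter m T x)) =
  cexp om (fun x => F x * cexp (iter m T x) G).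
Proof.
move=> uF uG dF.
have key H : ucont H -> cexp om (fun x=> F x * H (iter m T x)) =
  \sum_(w : m.-tuple digit) F (splice om (ext_word w)) * (wt om [::] w *
    cexp (iter m T (splice om (ext_word w))) H).
 move=> uH; have [mD mZ _] := mean_cexp R om.
 have uw w : ucont (fun x=> \1_(cyl w) (xs x) * H (iter m T x) : R).
  tame.
 transitivity (cexp om (fun x=> \sum_(w : m.-tuple digit) F (splice om (ext_word w)) *
    (\1_(cyl w) (xs x) * H (iter m T x)))).
  congr Ex; apply/funext=> y /=; rewrite xs_splice.
  have py : size (pfx y m) == m by rewrite size_pw.
  rewrite (bigD1 (Tuple py))//= big1 ?addr0=> [|w wy].
   rewrite indicE mem_set ?mul1r; last exact: cyl_prefix.
   by congr (_ * _); apply: dF; rewrite prefix_ext_prefix.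
  rewrite indicE memNset ?mul0r ?mulr0// /cyl /= size_tuple=> hy.
  by move/eqP: wy; apply; apply: val_inj=> /=.
 rewrite (mean_sum _ (mean_cexp R om)); last tame.
 apply: eq_bigr=> w _; rewrite mZ//; congr (_ * _).
 by have := cexp_node om w uH; rewrite size_tuple.
rewrite key// [RHS](key (fun x=> cexp x G) (ucont_cexp uG)).
by apply: eq_bigr=> w _; rewrite cexpK.
Qed.

End disintegration.

Hint Resolve ucont_ratio ucont_wt ucont_cexp ucont_splice ushift_tailT ushift_splice : tame.

(** * Limits and ergodic components of code families *)

Section limit_chain.
Context (R : realType) (D : nat).
Notation Om := (shift_space D.*2.+1).
Notation T := (@tailT D).
Implicit Types (om : Om) (F G : Om -> R) (P : probability (borel Om) R).

Let uT : ushift T. by tame. Qed.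

Let mT : meas_fun (T : borel Om -> borel Om).
exact: ushift_measurable. Qed.

Section family.
Variable J : nat -> seq Om.
Hypothesis J0 : forall N, (0 < size (J N))%N.

(** Joint average over the codes of the family, over the digits of each, and over the first [N]
    magnifications. *)
Definition lam N F : R := (size (J N))%:R^-1 * \sum_(om <- J N) cexp om (avg T F N).

Lemma lam_mean N : (0 < N)%N -> mean (lam N).
Proof.
move=> N0; have s0 : (size (J N))%:R != 0 :> R by rewrite pnatr_eq0 -lt0n.
split.
- move=> F G uF uG; rewrite /lam -mulrDr -big_split/=; congr (_ * _).
 apply: eq_bigr=> om _; have [mD _ _] := mean_cexp R om.
 rewrite -mD; try exact: ucont_avg.
 by congr cexp; apply/funext=> x; have [-> ] := @mean_avg R D.*2.+1 T N x N0.
- move=> c F uF; rewrite /lam [RHS]mulrCA; congr (_ * _); rewrite mulr_sumr.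
 apply: eq_bigr=> om _; have [_ mZ _] := mean_cexp R om.
 rewrite -mZ; last exact: ucont_avg.
 by congr cexp; apply/funext=> x; have [_ ->] := @mean_avg R D.*2.+1 T N x N0.
- move=> F G e uF uG h; rewrite /lam -mulrBr -sumrB normrM ger0_norm//.
 rewrite mulrC ler_pdivrMr ?ltr0n//.
 apply: le_trans (ler_norm_sum _ _ _) _.
 via (\sum_(om <- J N) e); last by rewrite big_const_seq iter_addr_0 mulr_natr.
 apply: ler_sum=> om _; have [_ _ mB] := mean_cexp R om.
 apply: mB; try exact: ucont_avg.
 move=> x; have [_ _ mA] := @mean_avg R D.*2.+1 T N x N0; exact: mA.
Qed.

Theorem limit_chain : exists (U : set_system nat) P,
  [/\ UltraFilter U, (\oo : set_system nat) `<=` U &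
      forall F, ucont F -> lam N F @[N --> U] --> Ex P F].
Proof.
have [U [UU Uoo]] := free_ultrafilter; exists U.
have Upos : U [set N | (0 < N)%N] by apply: Uoo; exists 1%N.
have cvc a : cvg (lam N \1_(cyl a) @[N --> U]).
 apply: (@ultra_cvg _ _ _ 1)=> // -[|N].
  rewrite /lam big1 ?mulr0 ?normr0// => om _.
  rewrite -[RHS](Ex_cst (digit_law R om) 0); congr Ex; apply/funext=> y.
  by rewrite /= /avg /bsum big_ord0 mulr0.
 have [mD mZ mB] := lam_mean (ltn0Sn N).
 have l0 : lam N.+1 (cst 0) = 0 := mean0 (lam_mean (ltn0Sn N)).
 rewrite -[lam _ _]subr0 -l0; apply: mB; [tame|tame|].
 move=> x; rewrite subr0; exact: indic_norm_le1.
pose p a : R := lim (lam N \1_(cyl a) @[N --> U]).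
have p0 a : 0 <= p a.
 apply: limr_ge=> //; apply: nearW=> N; rewrite /lam mulr_ge0//.
 apply: sumr_ge0=> om _; apply: Ex_ge0=> y; apply: mulr_ge0=> //.
 by apply: sumr_ge0=> i _.
have p1 : p [::] = 1.
 apply: (@lim_near_cst R^o)=> //; apply: filterS Upos=> N N0.
 rewrite cyl_nil /lam (_ : \sum_(om <- J N) _ = (size (J N))%:R).
  by rewrite mulVf// pnatr_eq0 -lt0n.
 rewrite (eq_bigr (fun=> 1))=> [|om _]; first by rewrite big_const_seq iter_addr_0.
 rewrite -[RHS](Ex_cst (digit_law R om) 1); congr Ex; apply/funext=> y.
 rewrite /= /avg /bsum (eq_bigr (fun=> 1))=> [|i _]; last by rewrite indicE mem_set.
 by rewrite sumr_const card_ord mulVf// pnatr_eq0 -lt0n.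
have pS a : p a = \sum_i p (rcons a i).
 apply/cvg_lim=> //.
 have cs : (\sum_(i < D.*2.+2) lam N \1_(cyl (rcons a i))) @[N --> U] --> \sum_(i < D.*2.+2) p (rcons a i).
  by apply: cvg_sumr=> i.
 apply: cvg_trans cs; apply: near_eq_cvg; apply: filterS Upos=> N N0.
 rewrite -(mean_sum _ (lam_mean N0)); last tame.
 by congr lam; apply/funext=> x; rewrite -indic_cyl_children.
have [P hP] := tree_measure p0 p1 pS; exists P; split=> // F uF.
apply: (@mean_cvg _ _ U lam (Ex P))=> //.
- apply: filterS Upos=> N; exact: lam_mean.
- exact: mean_Ex.
- move=> a; rewrite Ex_indic; last tame.
 rewrite [X in fine X]hP; exact: cvc.
Qed.

Lemma lam_shift N F K : (0 < N)%N -> ucont F -> (forall x, `|F x| <= K) ->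
  `|lam N (F \o T) - lam N F| <= 2 * K / N%:R.
Proof.
move=> N0 uF FK; have Nr : 0 < N%:R :> R by rewrite ltr0n.
rewrite /lam -mulrBr -sumrB normrM ger0_norm// mulrC ler_pdivrMr ?ltr0n//.
apply: le_trans (ler_norm_sum _ _ _) _.
via (\sum_(om <- J N) (2 * K / N%:R)); last first.
 by rewrite big_const_seq iter_addr_0 mulr_natr.
apply: ler_sum=> om _; have [_ _ mB] := mean_cexp R om.
apply: mB; [by apply: ucont_avg=> //; exact: ucont_comp|exact: ucont_avg|].
move=> x; rewrite avg_comp addrAC subrr add0r normrM ger0_norm// mulrC.
rewrite ler_wpM2r// (le_trans (ler_normB _ _))//.
have := FK (iter N T x); have := FK x; lra.
Qed.

(** Each time [i] is handled by the tower property with the constant function 1, so the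
    disintegration is exact before the limit is taken. *)
Lemma lam_cexp N F : ucont F -> lam N F = lam N (fun om => cexp om F).
Proof.
move=> uF; rewrite /lam; congr (_ * _); apply: eq_bigr=> om _.
have uK := ucont_cexp uF; have mm := mean_cexp R om; have [_ mZ _] := mm.
have uI G i : ucont G -> ucont (fun x=> G (iter i T x)).
 move=> uG; apply: (@ucont_comp _ _ G (iter i T))=> //; exact: ushift_iter.
have e G : ucont G -> cexp om (avg T G N) = N%:R^-1 * \sum_(i < N) cexp om (fun x=> G (iter i T x)).
 move=> uG; rewrite -mean_sum//; last tame.
 rewrite -mZ//; apply: ucont_sum=> i; exact: uI.
rewrite !e//; congr (_ * _); apply: eq_bigr=> i _.
have := @cexp_tower R D om i (cst 1) F (ucont_cst _ 1) uF (fun _ _ _ _=> erefl).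
rewrite /cst=> h; transitivity (cexp om (fun x=> 1 * F (iter i T x))).
 by congr cexp; apply/funext=> x; rewrite mul1r.
by rewrite h; congr cexp; apply/funext=> x; rewrite mul1r.
Qed.

Section limit_properties.
Variables (U : set_system nat) (P : probability (borel Om) R).
Hypotheses (UU : UltraFilter U) (Uoo : (\oo : set_system nat) `<=` U)
  (lamP : forall F, ucont F -> lam N F @[N --> U] --> Ex P F).

Lemma limit_preserves : preserves T P.
Proof.
apply: Ex_preserves=> // F uF; have [_ [K FK]] := ucont_bmf uF.
have uFT : ucont (F \o T) by tame.
apply: (@cvg_unique R^o _ (lam N (F \o T) @[N --> U])); [by []|exact: lamP|].
have : lam N F + (lam N (F \o T) - lam N F) @[N --> U] --> Ex P F + 0.
 apply: cvgD; first tame.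
 apply/cvgrPdist_le=> e e0; apply: Uoo; exists (Num.truncn ((2 * K) / e)).+1=> // N /= hN.
 have N0 : (0 < N)%N by exact: leq_trans hN.
 have Nr : 0 < N%:R :> R by rewrite ltr0n.
 rewrite sub0r normrN (le_trans (lam_shift N0 uF FK))// ler_pdivrMr// [leRHS]mulrC -ler_pdivrMr//.
 by apply: ltW; rewrite (lt_le_trans (truncnS_gt _))// ler_nat.
by rewrite addr0; under eq_fun do rewrite addrC subrK.
Qed.

Lemma limit_disint : disint P.
Proof.
move=> F uF; apply: (@cvg_unique R^o _ (lam N F @[N --> U])); [by []|exact: lamP|].
have := lamP (ucont_cexp uF); apply: cvg_trans; apply: near_eq_cvg; apply: nearW=> N.
by rewrite /= -lam_cexp.
Qed.

Lemma limit_le F c : ucont F -> (forall N, (0 < N)%N -> lam N F <= c) -> Ex P F <= c.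
Proof.
move=> uF h; rewrite -(cvg_lim _ (lamP uF))//; apply: limr_le.
 apply/cvg_ex; eexists; exact: lamP.
by apply: Uoo; exists 1%N=> // N /= N0.
Qed.

Lemma limit_ge F c : ucont F -> (\forall N \near \oo, c <= lam N F) -> c <= Ex P F.
Proof.
move=> uF h; rewrite -(cvg_lim _ (lamP uF))//; apply: limr_ge.
 apply/cvg_ex; eexists; exact: lamP.
exact: Uoo.
Qed.

(** A cylinder charged in the limit has positive average at some finite stage, hence is reached by a
    magnification at a node of positive weight. This later exhibits typical codes as limits of
    magnifications. *)
Lemma limit_support a : P (cyl a) != 0%E -> exists N om u y,
  [/\ (0 < N)%N, om \in J N, pfx y (size u) = u, 0 < wt R om [::] u &
      cyl a (iter (size u) T (splice om y))].
Proof.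
move=> Pa; apply: contrapT=> hn.
have ua := @ucont_cyl R D.*2.+1 a.
suff h0 : Ex P \1_(cyl a) <= 0.
 move/eqP: Pa; apply; have ma : measurable (cyl a : set (borel Om)) := cylM a.
 rewrite -(fineK (fin_num_measure P _ ma)); congr EFin; rewrite -Ex_indic//.
 by apply/eqP; rewrite eq_le h0 Ex_ge0// => x.
apply: limit_le=> // N N0; rewrite /lam big_seq big1// => om omJ.
have mm := mean_cexp R om; have [_ mZ _] := mm.
have uI i : ucont (fun x=> \1_(cyl a) (iter i T x) : R).
 apply: (@ucont_comp _ _ \1_(cyl a) (iter i T))=> //; exact: ushift_iter.
rewrite [LHS]mZ; last exact: ucont_sum.
rewrite mean_sum// big1 ?mulr0// => i _.
(* The event at time [i] depends on the first [i + size a] digits, so its mean is a finite sum over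
   words of that length. *)
pose k := (i + size a)%N.
have dk : depth k (fun x=> \1_(cyl a) (iter i T x) : R).
 move=> o y y' h.
 have hi : pfx (xs (splice o y)) i = pfx (xs (splice o y')) i.
  rewrite !xs_splice; apply: prefix_le h; exact: leq_addr.
 have sb : samebits (iter i T (splice o y)) (iter i T (splice o y')).
  by apply: samebits_iter=> // n; rewrite !bits_splice.
 have pe : pfx (iter i T (splice o y)) (size a) = pfx (iter i T (splice o y')) (size a).
  apply/prefix_omP; split=> [|n _]//.
  apply/pfxP=> n na; rewrite !xs_iter !xs_splice.
  by move/pfxP: h; apply; rewrite ltn_add2l.
 rewrite !indicE; suff -> : (iter i T (splice o y) \in cyl a) = (iter i T (splice o y') \in cyl a) by [].
 by apply/idP/idP; rewrite !inE /cyl /= pe.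
rewrite (cexp_depth _ (uI i) dk) big1// => w _.
have [->|wt0] := eqVneq (wt R om [::] w) 0; first by rewrite mulr0.
rewrite indicE memNset ?mul0r// => hc; apply: hn.
pose y := ext_word w : shift_space D.
exists N, om, (pfx y i), y; split=> //; rewrite ?size_pw//.
rewrite lt_neqAle wt_ge0 andbT eq_sym; apply: contra wt0=> /eqP w0.
have : pfx y k = w by have := prefix_ext w; rewrite size_tuple.
rewrite /k /pfx /mkseq iotaD map_cat=> <-.
by rewrite wt_cat -[X in wt R om [::] X]/(pfx y i) w0 mul0r.
Qed.

End limit_properties.
End family.
End limit_chain.

(** * A law of large numbers for orthogonal orbits *)

Section orthogonal_orbit.
Context d (T : measurableType d) (R : realType) (P : probability T R) (h : T -> T).
Hypotheses (mh : meas_fun h)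
  (hP : forall E, measurable E -> P (h @^-1` E) = P E).

Lemma freq_invariant (f : T -> R) : bmf f ->
  {ae P, forall x, forall m, freq h f (iter m h x) = freq h f x}.
Proof.
move=> bf; have [_ fK] := bf; apply: (ae_mono (birkhoff mh hP bf))=> x cx m.
apply: freq_cvg; elim: m=> [//|m ih].
have -> : avg h f ^~ (iter m.+1 h x) = (avg h (f \o h)) ^~ (iter m h x).
 apply/funext=> n; rewrite /avg /bsum; congr (_ * _); apply: eq_bigr=> i _.
 by rewrite /= -!iterSr.
exact: avg_comp_cvg.
Qed.

(** Let [g] be the Birkhoff limit. Averaging the correlations of [f] gives [f * g] mean 0; since [g]
    is invariant, averaging again gives [g * g] mean 0. *)
Lemma freq_zero (f : T -> R) k : bmf f ->
  (forall i, (k <= i)%N -> Ex P (fun x => f x * f (iter i h x)) = 0) ->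
  {ae P, forall x, freq h f x = 0}.
Proof.
move=> bf f0; have [mf [K fK]] := bf.
have K0 : 0 <= K by exact: le_trans (normr_ge0 _) (fK point).
set g := freq h f; have bg : bmf g by exact: freq_bmf.
have [mg [K' gK]] := bg.
have bi i : bmf (fun x=> f (iter i h x)) by exact: (bmf_comp_iter mh i bf).
have lim (u : T -> R) L : bmf u -> (forall x, `|u x| <= L) ->
  Ex P (fun x=> u x * avg h f n x) @[n --> \oo] --> Ex P (fun x=> u x * g x).
 move=> bu uL; apply: (@Ex_dct _ _ _ P _ _ (L * K)).
 - by move=> n; apply: measurable_funM; [case: bu|case: (bmf_avg mh n bf)].
 - by move=> n x; rewrite normrM ler_pM// avg_le.
 - tame.
 - apply: (ae_mono (birkhoff mh hP bf))=> x cx; apply: cvgM=> //; exact: cvg_cst.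
have avgE (u : T -> R) n : bmf u -> Ex P (fun x=> u x * avg h f n x) =
  n%:R^-1 * \sum_(i < n) Ex P (fun x=> u x * f (iter i h x)).
 move=> bu; rewrite -Ex_sum; last tame.
 rewrite -ExZ; last tame.
 by congr Ex; apply/funext=> x; rewrite /avg /bsum mulrCA mulr_sumr.
have fg0 : Ex P (fun x=> f x * g x) = 0.
 apply: (@cvg_unique R^o _ (Ex P (fun x=> f x * avg h f n x) @[n --> \oo])).
 - by [].
 - exact: lim fK.
 set c := \sum_(i < k) Ex P (fun x=> f x * f (iter i h x)).
 have sE n : (k <= n)%N -> \sum_(i < n) Ex P (fun x=> f x * f (iter i h x)) = c.
  move=> kn; rewrite -(subnKC kn) big_split_ord/= [X in _ + X]big1 ?addr0// => i _.
  apply: f0; exact: leq_addr.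
 apply/cvgrPdist_le=> e e0; exists (maxn k.+1 (Num.truncn (`|c| / e)).+1)=> // n /=.
 rewrite geq_max=> /andP[kn cn]; have n0 : 0 < n%:R :> R by rewrite ltr0n (leq_trans _ kn).
 rewrite avgE// sE ?(ltnW kn)// sub0r normrN normrM ger0_norm// mulrC.
 rewrite ler_pdivrMr// [leRHS]mulrC -ler_pdivrMr//.
 by apply: ltW; rewrite (lt_le_trans (truncnS_gt _))// ler_nat.
have gg0 : Ex P (fun x=> g x * g x) = 0.
 apply: (@cvg_unique R^o _ (Ex P (fun x=> g x * avg h f n x) @[n --> \oo])).
 - by [].
 - exact: lim gK.
 rewrite (_ : (fun n=> _) = cst 0); first exact: cvg_cst.
 apply/funext=> n; rewrite avgE// big1 ?mulr0// => i _.
 transitivity (Ex P ((fun x=> f x * g x) \o iter i h)); last first.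
  rewrite Ex_iter//; exact: bmfM.
 apply: Ex_ae; first tame.
  apply: (bmf_comp_iter mh i); exact: bmfM.
 by apply: (ae_mono (freq_invariant bf))=> x /(_ i) e; rewrite /= /g e mulrC.
apply: (ae_mono (Ex_ae0 (bmfM bg bg) _ gg0))=> [|x]; last by move=> /eqP; rewrite mulf_eq0 orbb=> /eqP.
by move=> x; rewrite sqr_ge0.
Qed.

End orthogonal_orbit.

(** * Passage to ergodic components *)

Section component.
Context (R : realType) (D : nat).
Notation Om := (shift_space D.*2.+1).
Notation T := (@tailT D).
Implicit Types (om : Om) (F G : Om -> R) (P : probability (borel Om) R).

Let uT : ushift T. by tame. Qed.

Let mT : meas_fun (T : borel Om -> borel Om).
exact: ushift_measurable. Qed.

Let uTi F i : ucont F -> ucont (fun x => F (iter i T x)).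
by move=> uF; apply: (@ucont_comp _ _ F (iter i T))=> //; exact: ushift_iter. Qed.

Lemma disint_cyl P : (forall a, Ex P \1_(cyl a) = Ex P (fun om => cexp om \1_(cyl a))) -> disint P.
Proof.
move=> h F uF; pose m G := Ex P (fun om=> cexp om G).
have mm : mean m.
 split.
 - move=> F' G uF' uG; rewrite /m -ExD; try by apply: ucont_bmf; exact: ucont_cexp.
  by congr Ex; apply/funext=> x; have [-> ] := mean_cexp R x.
 - move=> c F' uF'; rewrite /m -ExZ; last tame.
  by congr Ex; apply/funext=> x; have [_ ->] := mean_cexp R x.
 - move=> F' G e uF' uG hFG; rewrite /m -ExB; try by apply: ucont_bmf; exact: ucont_cexp.
  apply: Ex_normK.
   tame.
  by move=> x; have [_ _] := mean_cexp R x; apply.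
exact: (mean_eq (mean_Ex P) mm).
Qed.

Section components.
Variable P : probability (borel Om) R.
Hypotheses (TP : preserves T P) (KP : disint P).

(** The defect, a cylinder indicator minus its conditional expectation, has finite depth and zero
    mean on fibres. The tower property makes it orthogonal to its late iterates, so its frequency
    vanishes; that frequency is the integral of the defect against the component. *)
Lemma disint_component :
  {ae P, forall om, forall P0 : probability (borel Om) R, generic T P0 om -> disint P0}.
Proof.
have h : {ae P, forall om, forall a,
  freq T (fun x=> \1_(cyl a) x - cexp x \1_(cyl a) : R) om = 0}.
 apply: ae_forallc=> a; pose F : Om -> R := \1_(cyl a).
 have uF : ucont F := @ucont_cyl R D.*2.+1 a; have uK := ucont_cexp uF.
 pose f x := F x - cexp x F.
 have uf : ucont f by exact: ucontB.
 have df : depth (size a) f.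
  move=> om y y' hy; rewrite /f /F (depth_cyl R om hy); congr (_ - _).
  exact: depth_cexp.
 apply: (freq_zero mT TP (k := size a)); first tame.
 move=> i ki; have ufi := uTi i uf.
 rewrite KP; last tame.
 rewrite (_ : (fun om=> _) = cst 0) ?Ex_cst//; apply/funext=> om.
 rewrite (cexp_tower om uf uf (depth_le ki df)) (_ : (fun x=> _) = cst 0).
  by rewrite /cst (mean0 (mean_cexp R om)).
 by apply/funext=> x; rewrite cexpB// cexpK// subrr mulr0.
apply: (ae_mono h)=> om hom P0 g; apply: disint_cyl=> a.
have uF := @ucont_cyl R D.*2.+1 a; have uK := ucont_cexp uF.
have := hom a; rewrite (generic_freq g) ?ExB//; try exact: ucont_bmf.
 lra.
tame.
Qed.

(** The mean of [F k] under the component of [om] is its frequency at [om], and the integral of this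
    frequency over [om] tends to 0. *)
Lemma small_component (F : nat -> Om -> R) : (forall k, ucont (F k)) ->
  (forall k x, 0 <= F k x) -> Ex P (F k) @[k --> \oo] --> 0 ->
  {ae P, forall om, forall P0 : probability (borel Om) R, generic T P0 om ->
     forall e, 0 < e -> forall N, exists k, (N <= k)%N /\ Ex P0 (F k) < e}.
Proof.
move=> uF F0 FP.
have bg k : bmf (freq T (F k) : borel Om -> R) by apply: (freq_bmf mT); exact: ucont_bmf.
(* Nonnegativity of the frequency is known only where a component exists; the maximum extends it to
   all points. *)
pose W k om := Num.max 0 (freq T (F k) om).
have ge := generic_exists uT TP.
have fr0 om (P0 : probability (borel Om) R) k : generic T P0 om -> 0 <= freq T (F k) om.
 move=> g; rewrite (generic_freq g)//; exact: Ex_ge0.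
have bW k : bmf (W k : borel Om -> R).
 have [mg [K gK]] := bg k; split; first by apply: measurable_maxr=> //; exact: measurable_cst.
 exists K=> x; rewrite /W; case: (leP 0 (freq T (F k) x))=> _ //.
 by rewrite normr0 (le_trans _ (gK x)).
have W0 : Ex P (W k) @[k --> \oo] --> 0.
 rewrite (_ : (fun k=> _) = fun k=> Ex P (F k))//; apply/funext=> k.
 rewrite -[RHS](Ex_freq mT TP); last tame.
 apply: Ex_ae=> //; apply: (ae_mono ge)=> om [P0 g].
 by rewrite /W max_r// (fr0 om P0).
have W00 k x : 0 <= W k x by rewrite /W le_max lexx.
apply: (ae_mono (ae_inf_small bW W00 W0))=> om hom P0 g e e0 N.
have [k [Nk Wk]] := hom e e0 N; exists k; split=> //.
by rewrite -(generic_freq g)// (le_lt_trans _ Wk)// /W le_max lexx orbT.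
Qed.

Lemma null_component :
  {ae P, forall om, forall P0 : probability (borel Om) R, generic T P0 om ->
     forall a, P (cyl a) = 0%E -> P0 (cyl a) = 0%E}.
Proof.
have h : {ae P, forall om, forall a, P (cyl a) = 0%E ->
  forall P0 : probability (borel Om) R, generic T P0 om -> P0 (cyl a) = 0%E}.
 apply: ae_forallc=> a; have [Pa|] := pselect (P (cyl a) = 0%E); last by move=> ?; exact: aeW.
 have ua := @ucont_cyl R D.*2.+1 a; have ma : measurable (cyl a : set (borel Om)) := cylM a.
 have s := @small_component (fun=> \1_(cyl a)) (fun=> ua) (fun _ x=> indic_ge0 R (cyl a) x).
 apply: (ae_mono (s _))=> [|om hom _ P0 g].
  rewrite Ex_indic// (_ : P _ = 0%E)//; exact: cvg_cst.
 rewrite -(fineK (fin_num_measure P0 _ ma)); congr EFin; rewrite -Ex_indic//.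
 apply/eqP; rewrite eq_le Ex_ge0 ?andbT//.
 by rewrite leNgt; apply/negP=> h; have [_ [_]] := hom P0 g _ h 0%N; rewrite ltxx.
apply: (ae_mono h)=> om hom P0 g a Pa; exact: (hom a Pa P0 g).
Qed.

(** Otherwise the frequency would be below its own mean almost everywhere. The property [Q] is
    carried along so that all requirements hold at one point. *)
Lemma large_component F (Q : Om -> Prop) : ucont F -> {ae P, forall om, Q om} ->
  exists2 om, Q om & exists2 P0 : probability (borel Om) R, generic T P0 om & Ex P F <= Ex P0 F.
Proof.
move=> uF hQ; apply: contrapT=> hn; have bF := ucont_bmf uF.
have bg : bmf (freq T F : borel Om -> R) by exact: (freq_bmf mT).
have bd : bmf (fun x : borel Om=> Ex P F - freq T F x) by apply: bmfB=> //; exact: bmf_cst.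
have lt0 : {ae P, forall om, freq T F om < Ex P F}.
 apply: (ae_mono (ae_and hQ (generic_exists uT TP)))=> om [Qom [P0 g]].
 rewrite ltNge; apply/negP=> h; apply: hn; exists om=> //; exists P0=> //.
 by rewrite -(generic_freq g).
have E0 : Ex P (fun x=> `|Ex P F - freq T F x|) = 0.
 transitivity (Ex P (fun x=> Ex P F - freq T F x)).
  apply: Ex_ae=> //; first tame.
  by apply: (ae_mono lt0)=> x h; rewrite gtr0_norm// subr_gt0.
 by rewrite ExB//; [rewrite Ex_cst (Ex_freq mT TP)// subrr|exact: bmf_cst].
have := ae_and lt0 (Ex_ae0 (bmf_norm bd) (fun=> normr_ge0 _) E0).
by move=> /ae_ex[x [h1 /normr0_eq0 /eqP]]; rewrite subr_eq0=> /eqP h2; rewrite h2 ltxx in h1.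
Qed.

Theorem component_exists (I : countType) (F : I -> nat -> Om -> R) H :
  (forall i k, ucont (F i k)) -> (forall i k x, 0 <= F i k x) ->
  (forall i, Ex P (F i k) @[k --> \oo] --> 0) -> ucont H ->
  exists P0 : probability (borel Om) R,
    [/\ preserves T P0, disint P0, {ae P0, forall om, generic T P0 om} &
       [/\ forall i e, 0 < e -> forall N, exists k, (N <= k)%N /\ Ex P0 (F i k) < e,
        Ex P H <= Ex P0 H & forall a, P (cyl a) = 0%E -> P0 (cyl a) = 0%E]].
Proof.
move=> uF F0 FP uH.
have s : {ae P, forall om, forall i, forall P0 : probability (borel Om) R, generic T P0 om ->
   forall e, 0 < e -> forall N, exists k, (N <= k)%N /\ Ex P0 (F i k) < e}.
 apply: ae_forallc=> i; exact: small_component.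
have [om [[h1 h2] [h3 h4]] [P0 g hH]] := large_component uH
 (ae_and (ae_and disint_component s) (ae_and null_component (ergodic_component uT TP))).
exists P0; split; [exact: generic_preserves g|tame|tame|split=> //].
 tame.
tame.
Qed.

End components.
End component.

Lemma Ex_variance d (T : measurableType d) (R : realType) (P : probability T R) (f : T -> R) : bmf f ->
  Ex P (fun x => (f x - Ex P f) * (f x - Ex P f)) = Ex P (fun x => f x * f x) - Ex P f * Ex P f.
Proof.
move=> bf; set c := Ex P f.
rewrite (_ : (fun x=> _) = fun x=> f x * f x + (- (2 * c) * f x + c * c)); last by apply/funext=> x; ring.
rewrite ExD; [|tame|by apply: bmfD; [exact: bmfZ|exact: bmf_cst]].
rewrite ExD; [|tame|exact: bmf_cst].
have ec : Ex P (fun=> c * c) = c * c := Ex_cst P _.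
rewrite ec ExZ// -/c; ring.
Qed.

(** * Fibres of the disintegration *)

Section fibres.
Context (R : realType) (D : nat).
Notation Om := (shift_space D.*2.+1).
Notation T := (@tailT D).
Implicit Types (om : Om) (F G : Om -> R) (P : probability (borel Om) R).

Definition kap om : probability (borel Om) R := pushP (digit_law R om) (measurable_splice om).

Lemma Ex_kap om F : bmf (F : borel Om -> R) -> Ex (kap om) F = cexp om F.
Proof. exact: Ex_pushP. Qed.

Section disintegration_measurable.
Variable P : probability (borel Om) R.
Hypothesis KP : disint P.

(** On cylinders the kernel is continuous and the formula is [disint]; Dynkin induction extends both
    to Borel sets. *)
Lemma disint_measurable (E : set (borel Om)) : measurable E ->
  meas_fun (fun om : borel Om => kap om E) /\
  P E = (\int[P]_om kap om E)%E.
Proof.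
pose G : set (set (borel Om)) := @cyls D.*2.+1.
pose C : set_system (borel Om) := fun E=>
 meas_fun (fun om : borel Om=> kap om E) /\ P E = (\int[P]_om kap om E)%E.
move=> mE; have {}mE : <<s G >> E by rewrite -borel_cyls.
have mkap (A : set (borel Om)) om : measurable A -> (fine (kap om A))%:E = kap om A.
 by move=> mA; rewrite (@fineK _ (kap om A))// fin_num_measure.
apply: (@dynkin_induction _ (borel Om) G C _ _ _ _ _ _ E mE).
- exact: borel_cyls.
- exact: cylsI.
- rewrite /C; split.
  under eq_fun do rewrite [kap _ _]probability_setT; exact: measurable_cst.
 under eq_integral do rewrite [kap _ _]probability_setT.
 by rewrite integral_cst// mul1e [LHS]probability_setT [X in _ = X]probability_setT.
- move=> _ [->|[a ->]].
  rewrite /C; split; first by under eq_fun do rewrite measure0; exact: measurable_cst.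
  by rewrite measure0; under eq_integral do rewrite measure0; rewrite integral0.
 have ma : measurable (cyl a : set (borel Om)) := cylM a.
 have ua := @ucont_cyl R D.*2.+1 a; have uK := ucont_cexp ua.
 have e om : kap om (cyl a) = (cexp om \1_(cyl a) : R)%:E.
  by rewrite -Ex_kap; [rewrite Ex_indic// mkap|exact: bmf_indic].
 split; first by under eq_fun do rewrite e; apply/measurable_EFinP; case: (ucont_bmf uK).
 under eq_integral do rewrite e.
 rewrite EFin_Ex; last exact: ucont_bmf.
 by rewrite -KP// Ex_indic// (@fineK _ (P (cyl a)))// fin_num_measure.
- move=> A mA [mkA PA].
 have e om : kap om (~` A) = (1 - kap om A)%E by rewrite [LHS]probability_setC.
 split.
  under eq_fun do rewrite e; apply: emeasurable_funB=> //; exact: measurable_cst.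
 under eq_integral do rewrite e.
 rewrite integralB//; first last.
 - apply: (@le_integrable _ _ _ P setT _ _ (EFin \o cst 1))=> //.
   move=> om _; rewrite gee0_abs ?measure_ge0// /= normr1.
   exact: (@probability_le1 _ _ _ (kap om)).
  exact: finite_measure_integrable_cst.
 - exact: finite_measure_integrable_cst.
 rewrite integral_cst// mul1e -PA [X in (X - _)%E](probability_setT P).
 by rewrite [LHS]probability_setC.
- move=> A mA tA hA.
 have mU : measurable (\bigcup_k A k) by exact: bigcupT_measurable.
 have e om : kap om (\bigcup_k A k) = (\sum_(0 <= k <oo) kap om (A k))%E.
  exact: measure_semi_bigcup.
 split.
  under eq_fun do rewrite e; apply: ge0_emeasurable_sum=> [k om _ _|k _]; first exact: measure_ge0.
  by case: (hA k).
 under eq_integral do rewrite e.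
 rewrite integral_nneseries//; first last.
  by move=> k; case: (hA k).
 rewrite measure_semi_bigcup//; apply: eq_eseriesr=> k _.
 by case: (hA k).
Qed.

Lemma ae_fibre (Q : Om -> Prop) : {ae P, forall om, Q om} ->
  {ae P, forall om, {ae kap om, forall om', Q om'}}.
Proof.
move=> [N [mN N0 QN]]; have [mk PN] := disint_measurable mN.
have := @ae_eq_integral_abs _ _ R P setT measurableT (fun om=> kap om N) mk.
case=> + _; rewrite (_ : (\int[P]_(x in setT) _ = 0)%E); last first.
 rewrite -[RHS]N0 PN; apply: eq_integral=> x _.
 by rewrite gee0_abs// measure_ge0.
move=> /(_ erefl); apply: filterS=> om /(_ Logic.I) h.
by exists N; split.
Qed.

End disintegration_measurable.

Section skeletons.
Variable P : probability (borel Om) R.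
Hypotheses (TP : preserves T P) (KP : disint P).

Let uT : ushift T. exact: ushift_tailT. Qed.

Let uTq q : ushift (iter q T). exact: ushift_iter. Qed.

Let mTq q : meas_fun (iter q T : borel Om -> borel Om).
exact: ushift_measurable. Qed.

Let TqP q (E : set (borel Om)) : measurable E -> P (iter q T @^-1` E) = P E.
by apply: preserve_iter=> //; exact: ushift_measurable. Qed.

Let uTi F i : ucont F -> ucont (fun x => F (iter i T x)).
by move=> uF; apply: (@ucont_comp _ _ F (iter i T)). Qed.

Let iter_iter q i (x : Om) : iter i (iter q T) x = iter (i * q)%N T x.
by elim: i=> //= i ih; rewrite ih mulSn iterD. Qed.

Lemma depth_iter k i F : depth k F -> depth (i + k) (fun x => F (iter i T x)).
Proof.
move=> dF om y y' h.
have hi : pfx (xs (splice om y)) i = pfx (xs (splice om y')) i.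
 rewrite !xs_splice; apply: prefix_le h; exact: leq_addr.
have sb : samebits (iter i T (splice om y)) (iter i T (splice om y')).
 by apply: samebits_iter=> // n; rewrite !bits_splice.
rewrite -[X in F X = _](splice_xs (om := iter i T (splice om y)) (om' := iter i T (splice om y)))//.
rewrite -[X in _ = F X](splice_xs sb).
apply: dF; apply/pfxP=> n nk; rewrite !xs_iter !xs_splice.
by move/pfxP: h; apply; rewrite ltn_add2l.
Qed.

(* The variance of [G] on the fibres is dominated by the variation of [G] along
   any sufficiently distant time, since [G o T^m] is nearly independent of [G]. *)
Lemma fibre_variance G k m : ucont G -> depth k G -> (k <= m)%N ->
  Ex P (fun om => cexp om (fun x => G x * G x) - cexp om G * cexp om G) <=
  Ex P (fun x => (G (iter m T x) - G x) * (G (iter m T x) - G x)).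
Proof.
move=> uG dG km; have uK := ucont_cexp uG; have uGm := uTi m uG; have uKm := uTi m uK.
have [uGG uKK] := (ucontM uG uG, ucontM uK uK).
have inv F : ucont F -> Ex P (fun x=> F (iter m T x)) = Ex P F.
 move=> uF; apply: (Ex_iter (ushift_measurable uT) TP (f := F) m); exact: ucont_bmf.
have e1 : Ex P (fun om=> cexp om (fun x=> G x * G x) - cexp om G * cexp om G) =
  Ex P (fun x=> G x * G x) - Ex P (fun x=> cexp x G * cexp x G).
 rewrite ExB -?KP//; apply: ucont_bmf=> //; exact: ucont_cexp.
have tower : Ex P (fun x=> G x * G (iter m T x)) = Ex P (fun x=> G x * cexp (iter m T x) G).
 rewrite KP; last exact: ucontM.
 rewrite [RHS]KP; last exact: ucontM.
 congr Ex; apply/funext=> om; exact: cexp_tower (depth_le km dG).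
have e2 : Ex P (fun x=> (G (iter m T x) - G x) * (G (iter m T x) - G x)) =
  Ex P (fun x=> G x * G x) + Ex P (fun x=> G x * G x) - 2 * Ex P (fun x=> G x * cexp (iter m T x) G).
 rewrite -tower -{1}(inv _ uGG) -ExD//; first last.
 - exact: ucont_bmf.
 - exact: (ucont_bmf (uTi m uGG)).
 rewrite -ExZ; last by apply: ucont_bmf; exact: ucontM.
 rewrite -ExB; first last.
 - apply: ucont_bmf; apply: ucontZ; exact: ucontM.
 - apply: ucont_bmf; apply: ucontD=> //; exact: (uTi m uGG).
 congr Ex; apply/funext=> x; ring.
have e3 : 2 * Ex P (fun x=> G x * cexp (iter m T x) G) <=
  Ex P (fun x=> G x * G x) + Ex P (fun x=> cexp x G * cexp x G).
 rewrite -(inv _ uKK) -ExD//; first last.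
 - exact: (ucont_bmf (uTi m uKK)).
 - exact: ucont_bmf.
 rewrite -ExZ; last by apply: ucont_bmf; exact: ucontM.
 apply: Ex_le=> [||x].
 - apply: ucont_bmf; apply: ucontZ; exact: ucontM.
 - apply: ucont_bmf; apply: ucontD=> //; exact: (uTi m uKK).
 have := sqr_ge0 (G x - cexp (iter m T x) G); rewrite sqrrB !expr2; lra.
rewrite e1 e2; move: e3; set a := Ex P _; set c := Ex P _; set e := Ex P _; lra.
Qed.

(** The Birkhoff limit [J] along the skeleton is invariant, so [A n] at a remote time is close to
    [A n] in mean square; by [fibre_variance] it is then almost constant on fibres. The skeleton may
    fail to be ergodic, hence a constant that depends on the fibre. *)
Lemma freq_fibre q F k : (0 < q)%N -> ucont F -> depth k F ->
  {ae P, forall om, exists c, {ae kap om, forall x, avg (iter q T) F n x @[n --> \oo] --> (c : R)}}.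
Proof.
move=> q0 uF dF; set S := iter q T; set J := freq S F.
have bF := ucont_bmf uF; have bJ : bmf (J : borel Om -> R) by exact: (freq_bmf (mTq q)).
have [_ [K JK]] := bJ; have [_ [K' FK]] := bF.
have K0 : 0 <= K' by exact: le_trans (normr_ge0 _) (FK point).
pose A n := avg S F n; have uA n : ucont (A n) by exact: (@ucont_avg R _ S (uTq q)).
have AK n x : `|A n x| <= K' by exact: avg_le.
have bA n := ucont_bmf (uA n).
have cA : {ae P, forall x, A n x @[n --> \oo] --> J x} by have := birkhoff (mTq q) (TqP q) bF.
pose W n om := cexp om (fun x=> A n x * A n x) - cexp om (A n) * cexp om (A n).
have uW n : ucont (W n).
 by apply: ucontB; [apply: ucont_cexp; exact: ucontM|apply: ucontM; exact: ucont_cexp].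
have W0 n om : 0 <= W n om.
 rewrite /W -!Ex_kap//; last exact: bmfM.
 by rewrite -Ex_variance//; apply: Ex_ge0=> x; rewrite -expr2 sqr_ge0.
have JS : {ae P, forall x, forall m, J (iter m S x) = J x}.
 have := freq_invariant (mTq q) (TqP q) bF; exact.
(* The square of a difference is at most twice the sum of the squares; it is applied to the errors
   at times 0 and [m * q], which have equal means. *)
pose e n := 4 * Ex P (fun x=> (A n x - J x) * (A n x - J x)).
have bAJ n : bmf (fun x : borel Om=> (A n x - J x) * (A n x - J x)) by apply: bmfM; apply: bmfB.
have We n : Ex P (W n) <= e n.
 have dA : depth (n * q + k) (A n).
  move=> om y y' h; rewrite /A /avg /bsum; congr (_ * _); apply: eq_bigr=> i _.
  rewrite !iter_iter; apply: (depth_iter (i := (i * q)%N) dF).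
  by apply: prefix_le h; rewrite leq_add2r leq_mul2r ltnW// orbT.
 (* The time [m * q] is at least the depth of [A n] and is a multiple of [q], so [J] takes the same
    value there. *)
 pose m := (n * q + k)%N.
 apply: le_trans (fibre_variance (m := (m * q)%N) (uA n) dA _) _.
  by rewrite /m -{1}[(_ + _)%N]muln1 leq_mul2l q0 orbT.
 rewrite /e (_ : 4 = 2 + 2 :> R); last by ring.
 rewrite mulrDl -!ExZ// -{1}(Ex_iter (mTq q) (TqP q) m (bmfZ 2 (bAJ n))).
 rewrite -ExD; first last.
 - exact: bmfZ.
 - apply: (bmf_comp_iter (mTq q) m); exact: bmfZ.
 pose g x := 2 * ((A n (iter m S x) - J x) * (A n (iter m S x) - J x)) + 2 * ((A n x - J x) * (A n x - J x)).
 have bAm : bmf (fun x : borel Om=> A n (iter m S x)) by exact: (bmf_comp_iter (mTq q) m (bA n)).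
 have bg : bmf (g : borel Om -> R).
  apply: bmfD; apply: bmfZ=> //; apply: bmfM; exact: bmfB.
 rewrite (_ : Ex P _ = Ex P (fun x=> (A n (iter m S x) - A n x) * (A n (iter m S x) - A n x))); last first.
  by congr Ex; apply/funext=> x; rewrite /S iter_iter.
 rewrite [leRHS](_ : _ = Ex P g); last first.
  apply: Ex_ae=> //.
   by apply: bmfD; [apply: (bmf_comp_iter (mTq q) m)|]; apply: bmfZ.
  by apply: (ae_mono JS)=> x /(_ m) hx; rewrite /g /= -/S hx.
 apply: Ex_le=> // [|x]; first by apply: bmfM; exact: bmfB.
 rewrite /g; have := sqr_ge0 ((A n (iter m S x) - J x) + (A n x - J x)).
 rewrite sqrrD !expr2; lra.
have e0 : e n @[n --> \oo] --> 0.
 rewrite -(mulr0 4); apply: cvgM; first exact: cvg_cst.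
 rewrite -(Ex_cst P 0); apply: (@Ex_dct _ _ _ P _ _ ((K' + K) * (K' + K))).
 - by move=> n; case: (bAJ n).
 - move=> n x; rewrite normrM.
  have h : `|A n x - J x| <= K' + K by rewrite (le_trans (ler_normB _ _))// lerD.
  exact: ler_pM.
 - exact: bmf_cst.
 - apply: (ae_mono cA)=> x cx; rewrite /cst /= -(mulr0 0).
  have h : A n x - J x @[n --> \oo] --> J x - J x by apply: cvgB=> //; exact: cvg_cst.
  rewrite subrr in h; exact: cvgM.
have EW : Ex P (W n) @[n --> \oo] --> 0.
 apply: (squeeze_cvgr _ (cvg_cst 0) e0).
 by apply: nearW=> n; rewrite We andbT Ex_ge0.
have := ae_inf_small (fun n=> ucont_bmf (uW n)) W0 EW.
move=> h; apply: (ae_mono (ae_and h (ae_fibre KP cA)))=> om [{}h cJ] {W0 We e0 e EW}.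
have EA : Ex (kap om) (A n) @[n --> \oo] --> Ex (kap om) J.
 apply: (@Ex_dct _ _ _ (kap om) _ _ K')=> //.
 by move=> n; case: (bA n).
have EAA : Ex (kap om) (fun x=> A n x * A n x) @[n --> \oo] --> Ex (kap om) (fun x=> J x * J x).
 apply: (@Ex_dct _ _ _ (kap om) _ _ (K' * K'))=> //.
 - by move=> n; case: (bmfM (bA n) (bA n)).
 - by move=> n x; rewrite normrM ler_pM.
 - exact: bmfM.
 - apply: (ae_mono cJ)=> x cx; exact: cvgM.
set c := Ex (kap om) J; exists c.
have cW : W n om @[n --> \oo] --> Ex (kap om) (fun x=> J x * J x) - c * c.
 have : Ex (kap om) (fun x=> A n x * A n x) - Ex (kap om) (A n) * Ex (kap om) (A n) @[n --> \oo] -->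
   Ex (kap om) (fun x=> J x * J x) - c * c by apply: cvgB=> //; exact: cvgM.
 apply: cvg_trans; apply: near_eq_cvg; apply: nearW=> n.
 rewrite /W /= !Ex_kap//; exact: bmfM.
have v0 : Ex (kap om) (fun x=> J x * J x) - c * c <= 0.
 rewrite leNgt; apply/negP=> v0; set v := (X in 0 < X) in v0 cW.
 have v2 : 0 < v / 2 by rewrite divr_gt0.
 have /cvgrPdist_lt /(_ _ v2) [N _ hN] := cW.
 have [n [Nn Wn]] := h _ v2 N.
 have := hN n Nn; rewrite /= -/v ltr_norml=> /andP[_]; move: Wn; set z := W n om; lra.
have bJc : bmf (fun x : borel Om=> J x - c) by apply: bmfB=> //; exact: bmf_cst.
have E0 : Ex (kap om) (fun x=> (J x - c) * (J x - c)) = 0.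
 apply/eqP; rewrite eq_le Ex_ge0 ?andbT; last by move=> x; rewrite -expr2 sqr_ge0.
 by rewrite Ex_variance.
have p0 x : 0 <= (J x - c) * (J x - c) by rewrite -expr2 sqr_ge0.
have hJ := Ex_ae0 (bmfM bJc bJc) p0 E0.
apply: (ae_mono (ae_and cJ hJ))=> x [cx] /eqP; rewrite mulf_eq0 orbb subr_eq0=> /eqP <-.
exact: cx.
Qed.

(** On one fibre the limits of all cylinder averages are constants; a single point of the fibre that
    is generic for some law identifies them as its cylinder masses. *)
Theorem skeleton_generic : {ae P, forall om, forall q, (0 < q)%N ->
  exists Pq : probability (borel Om) R, {ae kap om, forall x, generic (iter q T) Pq x}}.
Proof.
have h : {ae P, forall om, forall qa : nat * seq 'I_D.*2.+2, (0 < qa.1)%N -> exists c,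
  {ae kap om, forall x, avg (iter qa.1 T) \1_(cyl qa.2) n x @[n --> \oo] --> (c : R)}}.
 apply: ae_forallc=> -[q a] /=; case: (posnP q)=> [->|q0]; first exact: aeW.
 have := freq_fibre q0 (@ucont_cyl R D.*2.+1 a) (depth_cyl R (a := a)).
 by move=> h; apply: (ae_mono h)=> om hom _.
have h2 : {ae P, forall om, forall q, {ae kap om, forall x, exists Pq, @generic R _ (iter q T) Pq x}}.
 apply: ae_foralln=> q; apply: (ae_fibre KP).
 exact: (generic_exists (uTq q) (TqP q)).
apply: (ae_mono (ae_and h h2))=> om [h1 {}h2] q q0.
have h3 : {ae kap om, forall x, forall a, exists2 c, projT1 (cid (h1 (q, a) q0)) = c &
  avg (iter q T) \1_(cyl a) n x @[n --> \oo] --> (c : R)}.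
 apply: ae_forallc=> a; have := projT2 (cid (h1 (q, a) q0))=> hc.
 by apply: (ae_mono hc)=> x hx; exists (projT1 (cid (h1 (q, a) q0))).
have [x0 [hx0 [Pq gq]]] := ae_ex (ae_and h3 (h2 q)).
exists Pq; apply: (ae_mono h3)=> x hx; apply: generic_cyl=> a.
have [c ec cc] := hx a; have [c' ec' cc'] := hx0 a.
have -> : Ex Pq \1_(cyl a) = c.
 apply: (@cvg_unique R^o _ (avg (iter q T) \1_(cyl a) n x0 @[n --> \oo])); [exact: Rhausdorff| |].
  apply: gq; exact: ucont_cyl.
 by rewrite -ec ec'.
exact: cc.
Qed.

End skeletons.
End fibres.

Section almost_everywhere.
Context d (T : measurableType d) (R : realType) (P : probability T R).

Lemma prob_ae_eq (A B : set T) : measurable A -> measurable B ->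
  {ae P, forall x, A x <-> B x} -> P A = P B.
Proof.
move=> mA mB h; rewrite -[LHS](@fineK _ (P A)) ?fin_num_measure//.
rewrite -[RHS](@fineK _ (P B)) ?fin_num_measure//; congr EFin; rewrite -!Ex_indic//.
apply: Ex_ae; [tame|tame|].
apply: (ae_mono h)=> x AB; rewrite !indicE; suff -> : (x \in A) = (x \in B) by [].
by apply/idP/idP; rewrite !inE=> /AB.
Qed.

Lemma prob_ae1 (A : set T) : measurable A -> {ae P, forall x, A x} -> P A = 1%E.
Proof.
move=> mA h; rewrite -(probability_setT P); apply: prob_ae_eq=> //.
exact: (ae_mono h).
Qed.

Lemma prob1_ae (A : set T) : measurable A -> P A = 1%E -> {ae P, forall x, A x}.
Proof.
move=> mA PA; exists (~` A); split=> //; first exact: measurableC.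
by rewrite probability_setC// PA subee.
Qed.

End almost_everywhere.

(** * Planar measures and CP-chains *)

Section plane_geometry.
Context (R : realType).
Notation pl := (plane R).
Notation X := (closed_square R).
Implicit Types (z w : pl).

Lemma cdistE z w : cdist z w =
  Num.sqrt ((complex.Re z - complex.Re w) ^+ 2 + (complex.Im z - complex.Im w) ^+ 2).
Proof. by rewrite /cdist; case: z w=> [a c] [a' c']. Qed.

Lemma cdist_ge0 z w : 0 <= cdist z w.
Proof. by rewrite cdistE. Qed.

Lemma cdistC z w : cdist z w = cdist w z.
Proof. by rewrite !cdistE -[complex.Re z - _]opprB -[complex.Im z - _]opprB !sqrrN. Qed.

Lemma cdistxx z : cdist z z = 0.
Proof. by rewrite cdistE !subrr expr0n addr0 sqrtr0. Qed.

Lemma cdist_triangle u z w : cdist z w <= cdist z u + cdist u w.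
Proof.
rewrite /cdist (_ : z - w = (z - u) + (u - w)); last by rewrite addrA subrK.
rewrite -lecR rmorphD; exact: (@ler_normD R[i] R[i] (z - u) (u - w)).
Qed.

Lemma le_Re z w : `|complex.Re z - complex.Re w| <= cdist z w.
Proof. by rewrite cdistE -sqrtr_sqr ler_wsqrtr// lerDl sqr_ge0. Qed.

Lemma le_Im z w : `|complex.Im z - complex.Im w| <= cdist z w.
Proof. by rewrite cdistE -sqrtr_sqr ler_wsqrtr// lerDr sqr_ge0. Qed.

Lemma cdist_le z w : cdist z w <= `|complex.Re z - complex.Re w| + `|complex.Im z - complex.Im w|.
Proof.
rewrite cdistE -[leRHS]ger0_norm// -sqrtr_sqr ler_wsqrtr//.
rewrite [leRHS]sqrrD !real_normK ?num_real// -addrA lerD2l [leRHS]addrC lerDl.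
by [].
Qed.

Lemma cdist_eq0 z w : cdist z w = 0 -> z = w.
Proof.
move=> h; have := le_Re z w; have := le_Im z w; rewrite h !normr_le0 !subr_eq0.
by case: z w {h} => [a c] [a' c'] /= /eqP -> /eqP ->.
Qed.

Lemma cdist_sq z w : X z -> X w -> cdist z w <= 2.
Proof.
move=> [za zb] [wa wb]; apply: le_trans (cdist_le z w) _.
have : `|complex.Re z - complex.Re w| <= 1 by rewrite ler_norml; lra.
have : `|complex.Im z - complex.Im w| <= 1 by rewrite ler_norml; lra.
lra.
Qed.

Lemma plane_continuous (T : ptopologicalType) (g : T -> pl) :
  (forall x e, 0 < e -> \forall y \near x, cdist (g x) (g y) < e) -> continuous g.
Proof.
move=> h x V /plane_nbhs[e e0 eV]; apply: filterS (h x e e0)=> y; exact: eV.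
Qed.

Lemma lip_continuous (g : pl -> pl) K : (forall z w, cdist (g z) (g w) <= K * cdist z w) ->
  continuous g.
Proof.
move=> gK; apply: plane_continuous=> x e e0; pose K' := `|K| + 1.
have K0 : 0 < K' by rewrite /K'.
apply: (@nbhs_plane _ x _ (e / K')); first by rewrite divr_gt0.
move=> w xw; apply: le_lt_trans (gK x w) _.
apply: le_lt_trans (ler_wpM2r (cdist_ge0 x w) (_ : K <= K')) _.
 by rewrite /K' (le_trans (ler_norm K))// lerDl.
by rewrite mulrC -ltr_pdivlMr.
Qed.

Definition clampR (x : R) : R := if x <= 0 then 0 else if 1 <= x then 1 else x.

Lemma clampR_itv x : 0 <= clampR x <= 1.
Proof. by rewrite /clampR; case: (leP x 0)=> ?; case: (leP 1 x)=> ?; apply/andP; split; lra. Qed.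

Lemma clampR_id x : 0 <= x <= 1 -> clampR x = x.
Proof. by rewrite /clampR=> ?; case: leP=> ?; [lra|case: leP=> ?; lra]. Qed.

Lemma clampR_lip x y : `|clampR x - clampR y| <= `|x - y|.
Proof.
rewrite ler_norml /clampR; have := ler_norm (x - y); have := ler_norm (- (x - y)); rewrite normrN.
case: (leP x 0)=> ?; case: (leP y 0)=> ?; case: (leP 1 x)=> ?; case: (leP 1 y)=> ?; move=> ? ?; apply/andP; split; lra.
Qed.

(** Nearest-point retraction onto the closed square; it turns continuity on the square into
    continuity on the plane and is 1-Lipschitz. *)
Definition clamp z : pl := complex.Complex (clampR (complex.Re z)) (clampR (complex.Im z)).

Lemma clampX z : X (clamp z).
Proof. by split=> /=; exact: clampR_itv. Qed.

Lemma clamp_id z : X z -> clamp z = z.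
Proof. by case: z=> a c [/= ? ?]; rewrite /clamp /= !clampR_id. Qed.

Lemma clamp_lip z w : cdist (clamp z) (clamp w) <= cdist z w.
Proof.
rewrite !cdistE ler_wsqrtr//; apply: lerD.
 rewrite -[leLHS]real_normK ?num_real// -[leRHS]real_normK ?num_real// lerXn2r//; exact: clampR_lip.
rewrite -[leLHS]real_normK ?num_real// -[leRHS]real_normK ?num_real// lerXn2r//; exact: clampR_lip.
Qed.

Lemma clamp_continuous : continuous clamp.
Proof. by apply: (@lip_continuous _ 1)=> z w; rewrite mul1r; exact: clamp_lip. Qed.

Lemma within_clamp (f : pl -> R) : {within X, continuous f} -> continuous (f \o clamp).
Proof.
move=> /subspace_continuousP cf z V /(cf _ (clampX z)) hV.
have hV' : nbhs (clamp z) [set x | X x -> V (f x)] := hV.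
have hz : nbhs z (clamp @^-1` [set x | X x -> V (f x)]) by exact: clamp_continuous hV'.
exact: (@filterS pl (nbhs z) (nbhs_filter z) _ _ (fun w h=> h (clampX w)) hz).
Qed.

Lemma square_ultra (U : set_system nat) (z_ : nat -> pl) : UltraFilter U ->
  (forall n, X (z_ n)) -> exists2 z, X z & forall e, 0 < e -> U [set n | cdist (z_ n) z < e].
Proof.
move=> UU Xz.
have [c1 c2] : cvg (complex.Re (z_ n) @[n --> U]) /\ cvg (complex.Im (z_ n) @[n --> U]).
 split; apply: (@ultra_cvg _ _ _ 1)=> // n; have [] := Xz n; rewrite ler_norml; lra.
exists (complex.Complex (lim (complex.Re (z_ n) @[n --> U])) (lim (complex.Im (z_ n) @[n --> U]))).
 split=> /=; apply/andP; split.
 - by apply: limr_ge=> //; apply: nearW=> n; have [/andP[]] := Xz n.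
 - by apply: limr_le=> //; apply: nearW=> n; have [/andP[]] := Xz n.
 - by apply: limr_ge=> //; apply: nearW=> n; have [_ /andP[]] := Xz n.
 - by apply: limr_le=> //; apply: nearW=> n; have [_ /andP[]] := Xz n.
move=> e e0; have e2 : 0 < e / 2 by rewrite divr_gt0.
have /cvgrPdist_lt /(_ _ e2) h1 := c1; have /cvgrPdist_lt /(_ _ e2) h2 := c2.
apply: filterS2 h1 h2=> n h1 h2; rewrite /=.
apply: le_lt_trans (cdist_le _ _) _=> /=; rewrite [ltRHS]splitr distrC [X in _ + X]distrC.
lra.
Qed.

Lemma within_bounded (f : pl -> R) : {within X, continuous f} ->
  exists K, forall z, X z -> `|f z| <= K.
Proof.
move=> /within_clamp cf; apply: contrapT=> /forallNP h.
have h1 n : exists z, X z /\ n%:R < `|f z|.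
 by have /existsNP[z /not_implyP[Xz /negP]] := h n%:R; rewrite -ltNge=> ?; exists z.
pose z_ n := projT1 (cid (h1 n)).
have hz n : X (z_ n) /\ n%:R < `|f (z_ n)| by exact: projT2 (cid (h1 n)).
have [U [UU Uoo]] := free_ultrafilter.
have [z Xz zU] := @square_ultra U z_ UU (fun n=> (hz n).1).
have /cvgrPdist_lt /(_ _ ltr01) /plane_nbhs[e e0 he] := cf z.
pose N := (Num.truncn (`|f z| + 1)).+1.
have /filter_ex[n [n1 n2]] : U ([set n | cdist (z_ n) z < e] `&` [set n | (N <= n)%N]).
 by apply: filterI; [tame|apply: Uoo; exists N].
have /he /= : cdist z (z_ n) < e by rewrite cdistC.
rewrite !clamp_id//; last by have [] := hz n.
have := (hz n).2; have : `|f z| + 1 < n%:R by rewrite (lt_le_trans (truncnS_gt _))// ler_nat.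
move=> h2 h3 h4.
have : `|f (z_ n)| <= `|f z| + `|f z - f (z_ n)|.
 by rewrite -[X in `|X|](subKr (f z)) (le_trans (ler_normB _ _)).
lra.
Qed.

Lemma measurable_continuous (T : ptopologicalType) (f : T -> R) : continuous f ->
  meas_fun (f : borel T -> R).
Proof.
move=> /continuousP cf.
apply: (measurability _ (RGenOInfty.measurableE R))=> // _ [_ [x ->] <-]; rewrite setTI.
by apply: open_borel; apply: cf.
Qed.

Lemma bmf_clamp (f : pl -> R) : {within X, continuous f} -> bmf (f \o clamp : borel pl -> R).
Proof.
move=> cf; split; first by apply: measurable_continuous; exact: within_clamp.
have [K hK] := within_bounded cf; exists K=> z; apply: hK; exact: clampX.
Qed.

Lemma prob_full (P : probability (borel pl) R) (A B : set (borel pl)) :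
  measurable A -> measurable B -> P A = 1%E -> P (B `&` A) = P B.
Proof.
move=> mA mB PA; have PC : P (~` A) = 0%E by rewrite probability_setC// PA subee.
rewrite -[in RHS](setIT B) -(setUv A) setIUr measureU//; first last.
- by rewrite setIACA setICr setI0.
- apply: measurableI=> //; exact: measurableC.
- exact: measurableI.
have h : P (B `&` ~` A) = 0%E; last by rewrite [X in (_ = _ + X)%E]h adde0.
apply: (subset_measure0 _ _ _ PC)=> //; [apply: measurableI=> //|]; exact: measurableC.
Qed.

Lemma square_pairingE (nu : square_prob R) (f : square_test R) :
  square_pairing nu f = Ex nu (sval f \o clamp).
Proof.
have mX : measurable (X : set (borel pl)) by apply: closed_borel; exact: closed_closed_square.
have bf := bmf_clamp (svalP f).
rewrite /square_pairing /Ex.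
transitivity (\int[nu]_(z in X) (sval f \o clamp) z).
 by apply: eq_Rintegral=> z; rewrite inE=> Xz /=; rewrite clamp_id.
have -> : (\int[nu]_x (sval f \o clamp) x) = \int[nu]_(z in X) (sval f \o clamp) z + \int[nu]_(z in ~` X) (sval f \o clamp) z.
 rewrite -Rintegral_setU//; first by rewrite setUv.
 - exact: measurableC.
 - rewrite setUv; exact: bmf_int.
 - by apply/disj_set2P; rewrite setICr.
rewrite [X in _ + X](_ : _ = 0) ?addr0//.
have nuC : nu (~` X) = 0%E by rewrite [LHS](probability_setC nu mX) (square_lawP nu) subee.
rewrite /Rintegral (_ : (\int[nu]_(x in ~` X) _)%E = 0%E)//.
apply: null_set_integral=> //; first exact: measurableC.
by apply: measurable_funTS; apply/measurable_EFinP; case: bf.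
Qed.

(** Bundled measures carry proofs and values on arbitrary sets, so equality of records is too
    strong. Borel sets of measures and continuous functions do not distinguish measures that agree
    on Borel sets. *)
Definition sim (nu nu' : square_prob R) := forall E : set (borel pl), measurable E -> nu E = nu' E.

Lemma simC nu nu' : sim nu nu' -> sim nu' nu.
Proof. by move=> h E /h. Qed.

Lemma sim_pairing nu nu' : sim nu nu' -> square_pairing nu = square_pairing nu'.
Proof.
move=> h; apply/funext=> f; congr fine.
apply: eq_measure_integral=> A mA _; exact: h.
Qed.

Lemma sim_borel nu nu' (E : set (borel (square_prob R))) : sim nu nu' -> measurable E ->
  E nu -> E nu'.
Proof.
move=> h mE; pose C : set_system (square_prob R) := [set E | E nu <-> E nu'].
suff : C E by case.
apply: (smallest_sub (X := C) _ _ mE)=> [|V].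
 split.
 - by [].
 - move=> A [a1 a2]; split=> -[_ n]; split=> // ?; apply: n; tame.
 - rewrite /C /= => A hA; split=> -[i _ Ai]; exists i=> //; by case: (hA i)=> h1 h2; auto.
by move=> [W oW <-]; rewrite /C /= (sim_pairing h).
Qed.

Lemma sim_continuous (F : square_prob R -> R) nu nu' : continuous F -> sim nu nu' -> F nu = F nu'.
Proof.
move=> cF h; apply/esym.
have mE : measurable ([set x | F x = F nu] : set (borel (square_prob R))).
 have := measurable_continuous cF measurableT (measurable_set1 (F nu)).
 by rewrite setTI.
exact: (sim_borel h mE).
Qed.

Lemma sim_dim nu nu' : sim nu nu' -> measure_dim nu = measure_dim nu'.
Proof.
move=> h; rewrite /measure_dim; congr (ereal_inf (image _ _)).
by apply/seteqP; split=> E [mE]; rewrite /= ?h// => ?; split; rewrite //.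
Qed.

End plane_geometry.

Lemma ptws_continuous (T : topologicalType) (U : Type) (R : realType) (g : T -> {ptws U -> R}) :
  (forall x t, g y t @[y --> x] --> g x t) -> continuous g.
Proof.
move=> h x; apply/cvg_sup=> t A /=.
rewrite (@nbhsE (initial_topology (fun g : U -> R=> g t))).
move=> [B [[C oC <-]] Cf] BA; apply: filterS BA _.
by apply: (h x t); apply: open_nbhs_nbhs.
Qed.

(** * Planar base-[b] digits and coded planar measures *)

Section planar_digits.
Context (R : realType) (b : nat).
Hypothesis hb : (1 < b)%N.
Notation pl := (plane R).
Notation X := (closed_square R).
Notation half := (half_open_square R).
Notation D := (b ^ 2).-1.
Notation digit := ('I_D.+1).
Notation Om := (shift_space D.*2.+1).
Notation Y := (shift_space D).
Implicit Types (om : Om) (y : Y) (z : pl) (w u : seq digit).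

Let b0 : (0 < b)%N. exact: ltnW. Qed.
Let bR : 0 < b%:R :> R. by rewrite ltr0n. Qed.
Let bnR n : 0 < b%:R ^+ n :> R. by rewrite exprn_gt0. Qed.

Lemma digit_num : D.+1 = (b * b)%N.
Proof. by rewrite prednK ?expn_gt0 ?b0//. Qed.

Definition dre (c : digit) : nat := (c %% b)%N.
(** Digit of the imaginary part, cells being numbered [i + j * b]; the name does not refer to a
    dimension. *)
Definition dim (c : digit) : nat := (c %/ b)%N.
Definition mkd (i j : nat) : digit := inord (i + j * b).

Lemma dre_lt c : (dre c < b)%N. Proof. by rewrite ltn_mod. Qed.

Lemma dim_lt c : (dim c < b)%N.
Proof. by rewrite /dim ltn_divLR// -digit_num. Qed.

Lemma mkd_val i j : (i < b)%N -> (j < b)%N -> mkd i j = (i + j * b)%N :> nat.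
Proof.
move=> ib jb; rewrite /mkd inordK// digit_num.
apply: (@leq_trans (b + j * b)); first by rewrite ltn_add2r.
by rewrite -mulSn leq_mul2r jb orbT.
Qed.

Lemma dre_mkd i j : (i < b)%N -> (j < b)%N -> dre (mkd i j) = i.
Proof. by move=> ib jb; rewrite /dre mkd_val// addnC modnMDl modn_small. Qed.

Lemma dim_mkd i j : (i < b)%N -> (j < b)%N -> dim (mkd i j) = j.
Proof. by move=> ib jb; rewrite /dim mkd_val// addnC divnMDl// divn_small// addn0. Qed.

Lemma mkd_eta c : mkd (dre c) (dim c) = c.
Proof. by apply: val_inj; rewrite /= mkd_val ?dre_lt ?dim_lt// addnC -divn_eq. Qed.

Lemma digit_eq c c' : dre c = dre c' -> dim c = dim c' -> c = c'.
Proof. by move=> h h'; rewrite -[c]mkd_eta h h' mkd_eta. Qed.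

Definition pt y : pl := complex.Complex (ev R b (fun n => dre (y n))) (ev R b (fun n => dim (y n))).

(** On the half-open square the expansion follows half-open cells, as [bcube] does; the zero
    sequence is a default value elsewhere. *)
Definition digits z : Y := if `[< half z >] then
  (fun n => mkd (bdig b (complex.Re z) n) (bdig b (complex.Im z) n)) else (fun=> ord0).

Lemma pt_square y : X (pt y).
Proof.
by split=> /=; rewrite ?(ev_ge0 R hb) ?(ev_le1 R hb)// => l; rewrite ?dre_lt ?dim_lt.
Qed.

Lemma pt_digits z : half z -> pt (digits z) = z.
Proof.
move=> hz; rewrite /pt /digits asboolT//; case: z hz=> a c [/= ha hc].
congr complex.Complex.
 rewrite -[RHS](ev_bdig hb ha); congr ev; apply/funext=> n.
 by rewrite dre_mkd ?bdig_lt.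
rewrite -[RHS](ev_bdig hb hc); congr ev; apply/funext=> n.
by rewrite dim_mkd ?bdig_lt.
Qed.

Lemma pt_close y y' n : pfx y n = pfx y' n ->
  cdist (pt y) (pt y') <= 2 * b%:R ^- n.
Proof.
move=> /pfxP h; apply: le_trans (cdist_le _ _) _; rewrite mulr_natl mulr2n.
apply: lerD.
 exact: (@ev_close R b hb (fun l=> dre (y l)) (fun l=> dre (y' l)) n
  (fun=> dre_lt _) (fun=> dre_lt _) (fun l ln=> congr1 dre (h l ln))).
exact: (@ev_close R b hb (fun l=> dim (y l)) (fun l=> dim (y' l)) n
 (fun=> dim_lt _) (fun=> dim_lt _) (fun l ln=> congr1 dim (h l ln))).
Qed.

Lemma pt_continuous : continuous pt.
Proof.
apply: plane_continuous=> y e e0; have e2 : 0 < e / 2 by rewrite divr_gt0.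
have [n hn] := expb_small hb e2; apply: filterS (prefix_nbhs y n)=> y' h.
apply: le_lt_trans (pt_close (esym h)) _.
lra.
Qed.

Lemma measurable_pt : meas_fun (pt : borel Y -> borel pl).
Proof. by apply: continuous_borel; exact: pt_continuous. Qed.

Lemma ucont_pt (f : pl -> R) : {within X, continuous f} -> ucont (f \o pt).
Proof.
move=> cf; apply: continuous_ucont.
rewrite (_ : f \o pt = (f \o @clamp R) \o pt); last first.
 apply/funext=> y; rewrite /= clamp_id//; exact: pt_square.
by move=> y; apply: continuous_comp; [exact: pt_continuous|exact: within_clamp].
Qed.

Lemma ev_shift s n : (forall l, (s l < b)%N) ->
  ev R b s = part R b s n + b%:R ^- n * ev R b (fun l => s (n + l)%N).
Proof.
move=> sb; have c1 := @part_cvg R b hb (fun l=> s (n + l)%N) (fun l=> sb _).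
have c2 := @part_cvg R b hb s sb.
apply: (@cvg_unique R^o _ (part R b s (m + n) @[m --> \oo]))=> //.
 exact: (cvg_comp _ _ (cvg_addnr n) c2).
have -> : (fun m=> part R b s (m + n)) = fun m=> part R b s n + b%:R ^- n * part R b (fun l=> s (n + l)%N) m.
 apply/funext=> m; rewrite /part addnC big_split_ord/=; congr (_ + _).
 rewrite mulr_sumr; apply: eq_bigr=> i _.
 by rewrite mulrCA -addnS exprD invfM.
by apply: cvgD; [exact: cvg_cst|apply: cvgM=> //; exact: cvg_cst].
Qed.

(** Horner's scheme for the integer index of a cell along one coordinate. *)
Fixpoint keyr (f : digit -> nat) (k : nat) w : nat :=
  if w is c :: w' then keyr f (k * b + f c) w' else k.
Definition key w := (keyr dre 0 w, keyr dim 0 w).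

Lemma keyr_rcons f k w c : keyr f k (rcons w c) = (keyr f k w * b + f c)%N.
Proof. by elim: w k=> //= a w ih k. Qed.

Lemma keyr_part f y n : (keyr f 0 (pfx y n))%:R = b%:R ^+ n * part R b (fun l => f (y l)) n :> R.
Proof.
elim: n=> [|n ih]; first by rewrite /part big_ord0 mulr0.
rewrite pfxS keyr_rcons natrD natrM ih partS mulrDr exprSr; congr (_ + _).
 lra.
by rewrite mulrCA divff ?mulr1// mulf_neq0// gt_eqF.
Qed.

Lemma keyr_lt f w : (forall c, (f c < b)%N) -> (keyr f 0 w < b ^ size w)%N.
Proof.
move=> fb; elim/last_ind: w=> //= w c ih; rewrite keyr_rcons size_rcons expnSr.
apply: (@leq_trans ((keyr f 0 w).+1 * b)); last by rewrite leq_mul2r ih orbT.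
by rewrite addnC ltn_add2r.
Qed.

Lemma key_inj w w' : size w = size w' -> key w = key w' -> w = w'.
Proof.
elim/last_ind: w w'=> [|w c ih] w'; first by case: w'.
case/lastP: w'=> [|w' c']; rewrite !size_rcons// => -[sw].
rewrite /key !keyr_rcons=> -[h1 h2].
have e1 : keyr dre 0 w = keyr dre 0 w'.
 by have := congr1 (fun n=> n %/ b)%N h1; rewrite !divnMDl// !divn_small ?dre_lt// !addn0.
have e2 : keyr dim 0 w = keyr dim 0 w'.
 by have := congr1 (fun n=> n %/ b)%N h2; rewrite !divnMDl// !divn_small ?dim_lt// !addn0.
rewrite (ih w')// /key; last by rewrite e1 e2.
congr rcons; apply: digit_eq.
 by have := congr1 (fun n=> n %% b)%N h1; rewrite !modnMDl !modn_small ?dre_lt.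
by have := congr1 (fun n=> n %% b)%N h2; rewrite !modnMDl !modn_small ?dim_lt.
Qed.

Lemma bcube_index_digits z n : half z -> bcube_index b n z = key (pfx (digits z) n).
Proof.
move=> hz; have [ha hc] := hz.
have e (f : digit -> nat) (x : R) : 0 <= x < 1 -> (forall l, f (digits z l) = bdig b x l) ->
  Num.truncn (b%:R ^+ n * x) = keyr f 0 (pfx (digits z) n).
 move=> hx hf; apply/eqP; rewrite -(eqr_nat R); apply/eqP.
 rewrite keyr_part; under eq_fun do rewrite hf.
 by rewrite (part_bdig hb)// mulrCA divff ?mulr1// gt_eqF.
rewrite /bcube_index /key; congr pair; apply: e=> // l; rewrite /digits asboolT//.
 by rewrite dre_mkd ?bdig_lt.
by rewrite dim_mkd ?bdig_lt.
Qed.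

Lemma bcube_indexP n (k : nat * nat) z : 0 <= complex.Re z -> 0 <= complex.Im z ->
  bcube b n k z <-> bcube_index b n z = k.
Proof.
move=> z1 z2; rewrite /bcube /bcube_index /=; case: k=> i j /=.
have p1 : 0 <= b%:R ^+ n * complex.Re z by rewrite mulr_ge0//.
have p2 : 0 <= b%:R ^+ n * complex.Im z by rewrite mulr_ge0//.
rewrite !ler_pdivrMr// !ltr_pdivlMr// ![complex.Re z * _]mulrC ![complex.Im z * _]mulrC.
by rewrite -!truncn_eq//; split=> [[/eqP -> /eqP ->]//|[-> ->]]; rewrite !eqxx.
Qed.

Lemma bcube_half w : bcube b (size w) (key w) `<=` half.
Proof.
move=> z [] /=; rewrite !ler_pdivrMr// !ltr_pdivlMr// => /andP[h1 h2] /andP[h3 h4].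
have aux (k : nat) (x : R) : (k < b ^ size w)%N -> k%:R <= x * b%:R ^+ size w ->
  x * b%:R ^+ size w < k.+1%:R -> 0 <= x < 1.
 move=> kb k1 k2; apply/andP; split; first by rewrite -(pmulr_lge0 _ (bnR (size w))) (le_trans _ k1).
 rewrite -(ltr_pM2r (bnR (size w))) mul1r (lt_le_trans k2)// -natrX ler_nat.
 by [].
by split; [apply: aux h1 h2|apply: aux h3 h4]; apply: keyr_lt=> c; rewrite ?dre_lt ?dim_lt.
Qed.

Lemma bcube_key w : bcube b (size w) (key w) = half `&` digits @^-1` cyl w.
Proof.
apply/seteqP; split=> z.
 move=> hz; have h := bcube_half hz; split=> //.
 move/bcube_indexP: hz=> hz; apply: key_inj; rewrite ?size_pw//.
 by rewrite -bcube_index_digits// hz//; case: h=> /andP[? _] /andP[? _].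
move=> [h]; rewrite /cyl /= => hw; apply/bcube_indexP; try by case: h=> /andP[? _] /andP[? _].
by rewrite bcube_index_digits// hw.
Qed.

Lemma measurable_half : measurable (half : set (borel pl)).
Proof. exact: measurable_plane_rect. Qed.

Lemma measurable_digits : meas_fun (digits : borel pl -> borel Y).
Proof.
apply: measurable_to_shift=> w.
rewrite -(setTI (_ @^-1` _)) -(setUv half) setIUl -bcube_key; apply: measurableU.
 exact: measurable_bcube.
have [pw|pw] := pselect (cyl w (fun=> ord0 : digit)).
 rewrite (_ : _ `&` _ = ~` half); first by apply: measurableC; exact: measurable_half.
 apply/seteqP; split=> z; first by case.
 by move=> nh; rewrite /= /digits asboolF.
rewrite (_ : _ `&` _ = set0)//.
by apply/seteqP; split=> z // -[nh]; rewrite /= /digits asboolF.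
Qed.

Definition mpt_law om : probability (borel pl) R := pushP (digit_law R om) measurable_pt.

Lemma mpt_law_square om : mpt_law om X = 1%E.
Proof.
rewrite [LHS]pushPE (_ : _ @^-1` _ = setT); first exact: (probability_setT (digit_law R om)).
apply/seteqP; split=> y // _; exact: pt_square.
Qed.

Definition Phi om : square_prob R := SquareProb (mpt_law_square om).

Lemma PhiE om E : Phi om E = digit_law R om (pt @^-1` E).
Proof. exact: pushPE. Qed.

Lemma Phi_pairing om (f : square_test R) : square_pairing (Phi om) f = cexp om (sval f \o pt \o @xs D).
Proof.
rewrite square_pairingE /Phi /= (Ex_pushP (digit_law R om) measurable_pt); last exact: bmf_clamp (svalP f).
rewrite /cexp; congr Ex; apply/funext=> y; rewrite /= xs_splice clamp_id//.
exact: pt_square.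
Qed.

Lemma ucont_xs (F : Y -> R) : ucont F -> ucont (F \o @xs D).
Proof. by move=> uF e /uF[k hk]; exists k=> al be /prefix_xs; exact: hk. Qed.

(** [pt] is continuous on sequences even where expansions are not unique, so integrals of continuous
    functions against [Phi om] are values of the kernel on continuous functions. *)
Lemma Phi_continuous : continuous Phi.
Proof.
have h om f : square_pairing (Phi x) f @[x --> om] --> square_pairing (Phi om) f.
 have uF : ucont (sval f \o pt \o @xs D) by apply: ucont_xs; apply: ucont_pt; exact: svalP f.
 rewrite (_ : (fun x=> square_pairing (Phi x) f) = fun x=> cexp x (sval f \o pt \o @xs D)); last first.
  by apply/funext=> x; rewrite Phi_pairing.
 rewrite Phi_pairing; exact: (@ucont_continuous _ _ _ (ucont_cexp uF) om).
have k := ptws_continuous h.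
exact: continuous_comp_initial k.
Qed.

End planar_digits.

Lemma cyl_children (R : realType) (M : nat) (P : probability (borel (shift_space M)) R) w :
  fine (P (cyl w)) = \sum_c fine (P (cyl (rcons w c))).
Proof.
rewrite -Ex_indic; last tame.
rewrite (_ : \1_(cyl w) = fun x : borel (shift_space M)=> \sum_c \1_(cyl (rcons w c)) x); last first.
 by apply/funext=> x; rewrite -indic_cyl_children.
rewrite Ex_sum=> [|i]; last tame.
apply: eq_bigr=> i _; rewrite Ex_indic//; exact: cylM.
Qed.

(** * Codes of magnified measures *)

Section self_similarity.
Context (R : realType) (D : nat).
Notation digit := ('I_D.+1).
Notation Om := (shift_space D.*2.+1).
Notation Y := (shift_space D).
Notation T := (@tailT D).
Implicit Types (om : Om) (y : Y) (w u : seq digit).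

(** Code of the magnification at [u]; its bits, and hence its measure, are determined by [u] and the
    bits of [om]. *)
Definition node om u : Om := iter (size u) T (splice om (ext_word u)).

Lemma wt_node om u v : wt R (node om u) [::] v = wt R om u v.
Proof.
rewrite /node wt_iter xs_splice prefix_ext.
apply: wt_samebits; exact: samebits_splice.
Qed.

Lemma digit_law_node om u (G : set (borel Y)) : measurable G ->
  digit_law R om (cyl u `&` dshift (size u) @^-1` G) =
  ((wt R om [::] u)%:E * digit_law R (node om u) G)%E.
Proof.
move=> mG; have mu : measurable (cyl u : set (borel Y)) by exact: cylM.
pose m1 : {measure set (borel Y) -> \bar R} :=
 @measure_function_pushforward__canonical__measure_function_Measure _ _ _ _ _
  (mrestr (digit_law R om) mu) _ (measurable_dshift (size u)).
pose c : {nonneg R} := NngNum (wt_ge0 R om [::] u).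
pose m2 : {measure set (borel Y) -> \bar R} := mscale c (digit_law R (node om u)).
have e : m1 G = m2 G.
 apply: (shift_measure_unique (R := R))=> // [|w].
  apply: le_lt_trans (ltry 1%R); rewrite /m1/= /pushforward /mrestr preimage_setT setTI.
  exact: (probability_le1 (digit_law R om)).
 rewrite /m1/= /pushforward /mrestr setIC -cyl_cat.
 have h := digit_lawE R om (u ++ w); rewrite [LHS]h.
 have h' := digit_lawE R (node om u) w; rewrite /m2/= /mscale/= [X in (_ * X)%E]h'.
 by rewrite wt_node wt_cat.
by rewrite setIC.
Qed.

Lemma node_splice om y n : node (splice om y) (pfx y n) = node om (pfx y n).
Proof. by rewrite /node splice_splice. Qed.

Lemma samebits_node om n : samebits (node om (pfx (xs om) n)) (iter n T om).
Proof.
rewrite /node size_pw; apply: samebits_iter; first exact: samebits_splice.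
by rewrite xs_splice prefix_ext_prefix.
Qed.

End self_similarity.

Section planar_measures.
Context (R : realType) (b : nat).
Hypothesis hb : (1 < b)%N.
Notation pl := (plane R).
Notation X := (closed_square R).
Notation half := (half_open_square R).
Notation D := (b ^ 2).-1.
Notation digit := ('I_D.+1).
Notation Om := (shift_space D.*2.+1).
Notation Y := (shift_space D).
Notation pt := (@pt R b).
Notation digits := (@digits R b).
Notation key := (@key b).
Notation Phi := (@Phi R b hb).
Implicit Types (om : Om) (y : Y) (z : pl) (w u : seq digit) (nu : square_prob R).

Let b0 : (0 < b)%N. exact: ltnW. Qed.
Let bR : 0 < b%:R :> R. by rewrite ltr0n. Qed.
Let bnR n : 0 < b%:R ^+ n :> R. by rewrite exprn_gt0. Qed.

Let mpre (E : set (borel pl)) : measurable E -> measurable (pt @^-1` E : set (borel Y)).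
by move=> mE; premeas; apply: (measurable_pt hb). Qed.

Lemma measurable_fixed : measurable [set y : borel Y | digits (pt y) = y].
Proof.
rewrite (_ : [set y | _] = ~` \bigcup_(w in setT) (cyl w `\` pt @^-1` (digits @^-1` cyl w))); last first.
 apply/seteqP; split=> y /=; first by move=> h [w _ []] /=; rewrite h.
 move=> h; apply/funext=> n; apply: contrapT=> hn; apply: h.
 exists (pfx y n.+1)=> //; split; first exact: cyl_prefix.
 by move=> /= /cylP; rewrite !pfxS=> /rcons_inj[].
apply: measurableC; apply: (@countable_bigcupT_measurable _ (borel Y))=> //.
move=> w; apply: measurableD; first tame.
apply: mpre; premeas; apply: (measurable_digits hb)=> //.
tame.
Qed.

(* The cells meeting at a boundary carry no mass. *)
Definition good om := {ae digit_law R om, forall y, digits (pt y) = y}.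

Lemma half_pt y : digits (pt y) = y -> half (pt y).
Proof.
move=> h; apply: contrapT=> nh; have {h} : y = fun=> ord0 by rewrite -h /digits asboolF.
(* The default value of [digits] outside the half-open square codes the origin, which lies
   inside. *)
move=> ey; have h0 : half 0 by split; rewrite /= lexx ltr01.
apply: nh; suff -> : y = digits 0 by rewrite (pt_digits hb).
rewrite ey /digits asboolT//; apply/funext=> n; apply: val_inj; rewrite /= mkd_val//.
- by rewrite /bdig mulr0 truncn0 mod0n.
- by rewrite /bdig ltn_mod.
- by rewrite /bdig ltn_mod.
Qed.

Lemma Phi_half om : good om -> Phi om half = 1%E.
Proof.
move=> g; rewrite PhiE; have mh : measurable (pt @^-1` half : set (borel Y)).
 premeas; apply: (measurable_pt hb)=> //; exact: measurable_half.
apply: (prob_ae1 mh); apply: (ae_mono g)=> y; exact: half_pt.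
Qed.

Lemma pt_dshift y n : pt (dshift n y) = bcube_map b n (key (pfx y n)) (pt y).
Proof.
have e (f : digit -> nat) : (forall c, (f c < b)%N) -> b%:R ^+ n * ev R b (fun l=> f (y l)) - (keyr f 0 (pfx y n))%:R =
  ev R b (fun l=> f (dshift n y l)).
 move=> fb; rewrite (ev_shift R hb n (fun l=> fb (y l))) keyr_part// mulrDr addrAC subrr add0r.
 by rewrite mulrA divff ?mul1r// gt_eqF.
rewrite /bcube_map /pt /key /=.
have -> x x' : (((b%:R : R) ^+ n)%:C%C *: (complex.Complex x x' : pl) : pl) =
  complex.Complex (b%:R ^+ n * x) (b%:R ^+ n * x').
 by rewrite /GRing.scale /= /GRing.mul /= !mul0r subr0 addr0.
have [e1 e2] := (e (@dre b) (dre_lt hb), e (@dim b) (dim_lt hb)).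
by rewrite -e1 -e2.
Qed.

Lemma pt_bcube y u : digits (pt y) = y -> bcube b (size u) (key u) (pt y) <-> cyl u y.
Proof.
move=> h; rewrite (bcube_key R hb); split; first by move=> [_]; rewrite /= h.
by move=> hc; split; [exact: half_pt|rewrite /= h].
Qed.

Lemma Phi_bcube om u : good om -> Phi om (bcube b (size u) (key u)) = (wt R om [::] u)%:E.
Proof.
move=> g; rewrite PhiE; have h := digit_lawE R om u; rewrite -[RHS]h.
have mc : measurable (cyl u : set (borel Y)) by tame.
apply: prob_ae_eq=> //; first by apply: mpre; exact: measurable_bcube.
apply: (ae_mono g)=> y; exact: pt_bcube.
Qed.

Lemma magnifyE nu n k (E : set (borel pl)) : nu (bcube b n k) != 0%E ->
  magnify b nu n k E = (nu (bcube_map b n k @^-1` E `&` bcube b n k) * (fine (nu (bcube b n k)))^-1%:E)%E.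
Proof.
move=> h; rewrite /magnify /= /mnormalize.
have hT : blowup_mass b nu n k setT = nu (bcube b n k).
 by rewrite /blowup_mass /pushforward /mrestr setTI.
have hf := fin_num_measure nu _ (@measurable_bcube R b n k).
case: ifPn=> [/orP[/eqP h0|/eqP h0]|_].
- by move: h; rewrite -hT [X in X != _]h0 eqxx.
- by have h1 : nu (bcube b n k) = +oo%E := etrans (esym hT) h0; move: hf; rewrite [X in X \is a _]h1.
- by rewrite [X in (_ * (fine X)^-1%:E)%E]hT.
Qed.

Lemma magnify_null nu n k (E : set (borel pl)) : nu (bcube b n k) = 0%E -> magnify b nu n k E = nu E.
Proof.
move=> h; rewrite /magnify /= /mnormalize.
have hT : blowup_mass b nu n k setT = 0%E.
 by rewrite /blowup_mass /pushforward /mrestr setTI.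
by case: ifPn=> //; rewrite [X in X == _]hT eqxx.
Qed.

Lemma measurable_blowup n k (E : set (borel pl)) : measurable E ->
  measurable (bcube_map b n k @^-1` E `&` bcube b n k : set (borel pl)).
Proof.
move=> mE; apply: measurableI; last exact: measurable_bcube.
by premeas; apply: measurable_bcube_map.
Qed.

Lemma magnify_sim nu nu' n k : sim nu nu' -> sim (magnify b nu n k) (magnify b nu' n k).
Proof.
move=> h E mE; have hB := h _ (@measurable_bcube R b n k).
have [n0|n0] := eqVneq (nu (bcube b n k)) 0%E.
 rewrite !magnify_null// -?hB//; exact: h.
rewrite !magnifyE// -?hB//; congr (_ * _)%E; apply: h; exact: measurable_blowup.
Qed.

(** For a good code the half-open cell and the cylinder of [u] agree up to a null set, so
    restricting and rescaling the measure amounts to passing to the node. *)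
Lemma magnify_Phi om u : good om -> 0 < wt R om [::] u ->
  sim (magnify b (Phi om) (size u) (key u)) (Phi (node om u)).
Proof.
move=> g w0 E mE; have hB := Phi_bcube u g.
rewrite magnifyE; last by rewrite hB gt_eqF.
rewrite hB /= 2!PhiE.
have mc : measurable (cyl u : set (borel Y)) by tame.
rewrite (_ : digit_law R om _ = digit_law R om (cyl u `&` dshift (size u) @^-1` (pt @^-1` E))).
 have h := digit_law_node R om u (mpre mE); rewrite [X in (X * _)%E]h.
 rewrite muleAC -EFinM divff ?mul1e//; exact: lt0r_neq0.
apply: prob_ae_eq.
- apply: mpre; exact: measurable_blowup.
- apply: measurableI=> //; premeas; apply: measurable_dshift=> //; exact: mpre.
- apply: (ae_mono g)=> y gy; rewrite /= (pt_bcube u gy) pt_dshift.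
 by split; [move=> [h1 h2]|move=> [h2 h1]]; split=> //; move: h1; rewrite (h2 : pfx y (size u) = u).
Qed.

Lemma Phi_sim om om' : (forall w, wt R om [::] w = wt R om' [::] w) -> sim (Phi om) (Phi om').
Proof. by move=> h E mE; rewrite !PhiE; apply: digit_law_eqwt=> //; exact: mpre. Qed.

Section coding_measures.

Definition cell_weight nu w : R := fine (nu (bcube b (size w) (key w))).

(** A Borel section of [Phi] on the measures carried by the half-open square; through it, functions
    of codes are read as measurable functions of measures. *)
Definition codem nu : Om := code (cell_weight nu).

Section valid.
Variable nu : square_prob R.
Hypothesis nuh : nu half = 1%E.

Lemma cell_law w : (cell_weight nu w)%:E = pushP nu (measurable_digits hb) (cyl w).
Proof.
have mc : measurable (digits @^-1` cyl w : set (borel pl)).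
 premeas; apply: (measurable_digits hb)=> //; exact: cylM.
rewrite pushPE /cell_weight (@fineK _ (nu (bcube b (size w) (key w)))); last first.
 rewrite fin_num_measure//; exact: measurable_bcube.
rewrite (bcube_key R hb) setIC; apply: prob_full=> //; exact: measurable_half.
Qed.

Lemma codem_wt w : wt R (codem nu) [::] w = cell_weight nu w.
Proof.
have e v : cell_weight nu v = fine (pushP nu (measurable_digits hb) (cyl v)) by rewrite -cell_law.
apply: code_wt=> [v||v].
- exact: fine_ge0.
- by rewrite e cyl_nil [X in fine X]probability_setT.
- by rewrite e cyl_children; apply: eq_bigr=> c _.
Qed.

Lemma codem_law (E : set (borel Y)) : measurable E -> digit_law R (codem nu) E = nu (digits @^-1` E).
Proof.
move=> mE; rewrite -(pushPE nu (measurable_digits hb)); apply: shift_measure_unique=> // [|w].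
 exact: prob_ltoo.
by have h := digit_lawE R (codem nu) w; rewrite [LHS]h codem_wt cell_law.
Qed.

Let pt_digits_ae : {ae nu, forall z, pt (digits z) = z}.
Proof.
have h := @prob1_ae _ _ _ (square_law nu) _ (@measurable_half R) nuh.
apply: (ae_mono h)=> z; exact: (pt_digits hb).
Qed.

Lemma codem_good : good (codem nu).
Proof.
apply: prob1_ae; first exact: measurable_fixed.
rewrite codem_law; last exact: measurable_fixed.
apply: prob_ae1.
 premeas; apply: (measurable_digits hb)=> //; exact: measurable_fixed.
by apply: (ae_mono pt_digits_ae)=> z /= ->.
Qed.

Lemma Phi_codem : sim (Phi (codem nu)) nu.
Proof.
move=> E mE; rewrite PhiE codem_law; last tame.
apply: prob_ae_eq=> //.
 premeas; apply: (measurable_digits hb)=> //; exact: mpre.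
by apply: (ae_mono pt_digits_ae)=> z /= ->.
Qed.

End valid.
End coding_measures.

End planar_measures.

Section integral_monotonicity.
Import HBNNSimple.
Context d (T : measurableType d) (R : realType) (mu : {measure set T -> \bar R}).
Local Open Scope ereal_scope.

(** The integral of a nonnegative function is a supremum over simple functions below it, which is
    monotone for arbitrary integrands; the dimension of a measure and the transition kernel are
    handled in this way. *)
Lemma integral_mono (f g : T -> \bar R) : (forall x, 0 <= f x) -> (forall x, f x <= g x) ->
  \int[mu]_x f x <= \int[mu]_x g x.
Proof.
move=> f0 fg; rewrite !ge0_integralTE//; last by move=> x; apply: le_trans (fg x).
apply: le_ereal_sup=> _ [h hf <-]; exists h=> // x; exact: le_trans (hf x) (fg x).
Qed.

Lemma integral_mono_ae (N : set T) (f g : T -> \bar R) : measurable N -> mu N = 0 ->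
  (forall x, 0 <= f x) -> (forall x, 0 <= g x) -> (forall x, ~ N x -> f x <= g x) ->
  \int[mu]_x f x <= \int[mu]_x g x.
Proof.
move=> mN N0 f0 g0 fg; rewrite ge0_integralTE//; apply: ub_ereal_sup=> _ [h hf <-].
rewrite -integralT_nnsfun (ge0_negligible_integral mN)//; first last.
- by move=> x _; rewrite lee_fin.
- exact/measurable_EFinP.
rewrite setTD integral_mkcond; apply: integral_mono=> x; rewrite patchE; case: ifPn=> // Nx; first by rewrite lee_fin.
by move: Nx; rewrite inE=> Nx; apply: le_trans (hf x) (fg x Nx).
Qed.

End integral_monotonicity.

Section unit_functions.
Context d (T : measurableType d) (R : realType).
Implicit Types (f : T -> R) (P : probability T R).

(** Layer-cake approximation, within 1/n for functions with values in [0, 1]; it carries integral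
    formulas from sets to functions. *)
Definition layers f n (x : T) : R := n%:R^-1 * \sum_(k < n) \1_[set y | k.+1%:R / n%:R <= f y] x.

Lemma layers_close f n x : (0 < n)%N -> 0 <= f x <= 1 -> `|f x - layers f n x| <= n%:R^-1.
Proof.
move=> n0 /andP[f0 f1]; have nR : 0 < n%:R :> R by rewrite ltr0n.
pose t := Num.truncn (n%:R * f x).
have nf0 : 0 <= n%:R * f x by rewrite mulr_ge0 //.
have tn : (t <= n)%N by rewrite -(ler_nat R) (le_trans (_ : _ <= n%:R * f x)) ?truncn_le// ger_pMr.
have -> : layers f n x = n%:R^-1 * t%:R.
 rewrite /layers; congr (_ * _).
 rewrite (eq_bigr (fun k : 'I_n=> if (k < t)%N then 1 else 0))=> [|k _].
  by rewrite -big_mkcond/= -(big_ord_widen n (fun=> 1) tn) sumr_const card_ord.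
 rewrite indicE; suff -> : (x \in [set y | k.+1%:R / n%:R <= f y]) = (k < t)%N by case: ltnP.
 by apply/idP/idP; rewrite inE /= ler_pdivrMr// mulrC -truncn_ge_nat.
have /andP[h1 h2] := truncn_itv nf0.
rewrite ger0_norm; last by rewrite subr_ge0 -ler_pdivlMl ?invr_gt0// invrK.
by rewrite lerBlDr -[X in X + _]mulr1 -mulrDr mulrC ler_pdivlMr// mulrC addrC natr1 ltW.
Qed.

End unit_functions.

Lemma prefix_ext_tuple (M m : nat) (w : m.-tuple 'I_M.+1) : pfx (ext_word w) m = w.
Proof. by have := prefix_ext w; rewrite size_tuple. Qed.

(** * The Markov property of disintegrated laws *)

Section disintegration_functions.
Context (R : realType) (D : nat).
Notation digit := ('I_D.+1).
Notation Om := (shift_space D.*2.+1).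
Notation Y := (shift_space D).
Notation T := (@tailT D).
Implicit Types (om : Om) (y : Y) (w u : seq digit).

Let uT : ushift T. by tame. Qed.
Let mTm m : meas_fun (iter m T : borel Om -> borel Om).
by apply: ushift_measurable; exact: ushift_iter. Qed.

Variable P : probability (borel Om) R.
Hypothesis KP : disint P.

Lemma disint_unit (f : borel Om -> R) : meas_fun f -> (forall x, 0 <= f x <= 1) ->
  bmf (fun om : borel Om => Ex (kap R om) f) /\ Ex P f = Ex P (fun om => Ex (kap R om) f).
Proof.
move=> mf f01; pose A n k := [set y | k.+1%:R / n%:R <= f y].
have mA n k : measurable (A n k : set (borel Om)).
 by have := mf measurableT `[k.+1%:R / n%:R, +oo[%classic (measurable_itv _); rewrite setTI set_itvE.
have bf : bmf f by split=> //; exists 1=> x; have /andP[h1 h2] := f01 x; rewrite ger0_norm.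
have bl n : bmf (layers f n).
 apply: bmfZ; apply: bmf_sum=> k; exact: (bmf_indic R (mA n k)).
have El (Q : probability (borel Om) R) n : Ex Q (layers f n) = n%:R^-1 * \sum_(k < n) fine (Q (A n k)).
 rewrite ExZ; last by apply: bmf_sum=> k; exact: (bmf_indic R (mA n k)).
 by rewrite Ex_sum=> [|k]; [congr (_ * _); apply: eq_bigr=> k _; exact: (Ex_indic Q (mA n k))|exact: (bmf_indic R (mA n k))].
have close (Q : probability (borel Om) R) n : (0 < n)%N -> `|Ex Q f - Ex Q (layers f n)| <= n%:R^-1.
 move=> n0; rewrite -ExB//; apply: Ex_normK; first tame.
 move=> x; exact: layers_close.
have mk n k : bmf (fun om : borel Om=> fine (kap R om (A n k))).
 split; last by exists 1=> x; rewrite ger0_norm -lee_fin fineK ?fin_num_measure// (probability_le1 (kap R x)).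
 apply: measurableT_comp=> //.
 by have [] := disint_measurable KP (mA n k).
have bk n : bmf (fun om : borel Om=> Ex (kap R om) (layers f n)).
 under eq_fun do rewrite El; apply: bmfZ; apply: bmf_sum=> k; exact: mk.
have bK : bmf (fun om : borel Om=> Ex (kap R om) f).
 split; last by have [_ [K fK]] := bf; exists K=> om; exact: Ex_normK.
 apply: (@measurable_fun_cvg _ (borel Om) R setT (fun n om=> Ex (kap R om) (layers f n.+1)))=> [n|om _].
  by have [] := bk n.+1.
 apply/cvgrPdist_le=> e e0; exists (Num.truncn e^-1)=> // n /= hn.
 apply: le_trans (close _ n.+1 isT) _; rewrite invf_ple ?posrE//.
 by apply: ltW; rewrite (lt_le_trans (truncnS_gt _))// ler_nat.
split=> //; apply/eqP; rewrite -subr_eq0 -normr_le0; apply/ler_addgt0Pl=> e e0; rewrite addr0.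
pose n := (Num.truncn (2 / e)).+1.
have h1 := close P n isT.
have h2 : `|Ex P (fun om=> Ex (kap R om) f) - Ex P (fun om=> Ex (kap R om) (layers f n))| <= n%:R^-1.
 rewrite -ExB//; apply: Ex_normK; first tame.
 move=> x; exact: close.
have h3 : Ex P (layers f n) = Ex P (fun om=> Ex (kap R om) (layers f n)).
 rewrite El (_ : (fun om=> _) = fun om : borel Om=> n%:R^-1 * \sum_(k < n) fine (kap R om (A n k))).
 2: by apply/funext=> om.
 rewrite ExZ; last tame.
 rewrite Ex_sum//.
 congr (_ * _); apply: eq_bigr=> k _; have [_ ->] := disint_measurable KP (mA n k).
 by rewrite /Ex /Rintegral; congr fine; apply: eq_integral=> om _; rewrite fineK// fin_num_measure.
have h4 : n%:R^-1 <= e / 2.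
 rewrite invf_ple ?posrE ?divr_gt0// invf_div.
 apply: ltW; exact: truncnS_gt.
rewrite (_ : _ - _ = (Ex P f - Ex P (layers f n)) -
 (Ex P (fun om=> Ex (kap R om) f) - Ex P (fun om=> Ex (kap R om) (layers f n)))); last by rewrite h3; ring.
rewrite (le_trans (ler_normB _ _))//; lra.
Qed.

Lemma Ex_digit_law om m (G : Y -> R) :
  (forall y y', pfx y m = pfx y' m -> G y = G y') ->
  Ex (digit_law R om) G = \sum_(w : m.-tuple digit) G (ext_word w) * wt R om [::] w.
Proof.
move=> dG; rewrite (_ : G = step m G); last first.
 by apply/funext=> y; rewrite stepE; apply: dG; rewrite prefix_ext_prefix.
rewrite (mean_step _ _ (mean_Ex (digit_law R om))); apply: eq_bigr=> w _.
have mw := @cylM D w; rewrite Ex_indic// stepE prefix_ext_tuple.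
by have h := digit_lawE R om w; rewrite [X in fine X]h.
Qed.

Lemma prob_partition (Q : probability (borel Y) R) m (A : set (borel Y)) : measurable A ->
  fine (Q A) = \sum_(w : m.-tuple digit) fine (Q (A `&` cyl w)).
Proof.
move=> mA; have mw (w : seq digit) : measurable (A `&` cyl w : set (borel Y)).
 apply: measurableI=> //; exact: cylM.
rewrite -Ex_indic//; under eq_bigr do rewrite -Ex_indic//.
rewrite -Ex_sum=> [|w]; last tame.
congr Ex; apply/funext=> y.
have pk : size (pfx y m) == m by rewrite size_pw.
rewrite (bigD1 (Tuple pk))//= big1=> [|w wk].
 rewrite addr0 !indicE; suff -> : (y \in A `&` cyl (pfx y m)) = (y \in A) by [].
 apply/idP/idP=> [/set_mem[h _]|/set_mem h]; apply/mem_set=> //; split=> //; exact: cyl_prefix.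
rewrite indicE memNset// => -[_]; rewrite /cyl /= size_tuple=> h.
by move/eqP: wk; apply; apply: val_inj=> /=.
Qed.

Lemma kap_node om w (G : set (borel Om)) : measurable G ->
  digit_law R om ([set y | G (iter (size w) T (splice om y))] `&` cyl w) =
  ((wt R om [::] w)%:E * kap R (node om w) G)%E.
Proof.
move=> mG; rewrite /kap pushPE -digit_law_node; last first.
 by premeas; apply: measurable_splice.
congr (digit_law R om _); rewrite setIC; apply/seteqP.
have e y : cyl w y -> iter (size w) T (splice om y) = splice (node om w) (dshift (size w) y).
 move=> hy; have sb : samebits (iter (size w) T (splice om y)) (node om w).
  apply: samebits_iter; first by move=> n; rewrite !bits_splice.
  by rewrite !xs_splice prefix_ext.
 rewrite -(splice_same (dshift (size w) y) sb).
 rewrite -[LHS](splice_xs (om := iter (size w) T (splice om y)))//.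
 by congr splice; apply/funext=> l; rewrite xs_iter xs_splice.
by split=> y [h1 h2]; split=> //; move: h2; rewrite /= e.
Qed.

Definition depth_event m (E : set Om) := forall om y y',
  pfx y m = pfx y' m -> E (splice om y) -> E (splice om y').

(** Given the bits and a word of [m] digits, the [m]-th magnification has its digits drawn from the
    node of that word; an event of depth [m] merely selects words, and summing over them gives the
    formula. *)
Lemma markov_property m (E G : set (borel Om)) : measurable E -> depth_event m E ->
  measurable G ->
  P (E `&` iter m T @^-1` G) = (\int[P]_(om in E) kap R (iter m T om) G)%E.
Proof.
move=> mE dE mG.
have [mkG _] := disint_measurable KP mG.
have kfin om : (fine (kap R om G))%:E = kap R om G by rewrite fineK// fin_num_measure.
have mTG : measurable (iter m T @^-1` G : set (borel Om)).
 by premeas; apply: mTm.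
have mEG : measurable (E `&` iter m T @^-1` G : set (borel Om)) by exact: measurableI.
pose h om : R := \1_E om * fine (kap R (iter m T om) G).
have mh : meas_fun (h : borel Om -> R).
 apply: measurable_funM=> //.
 have m1 : meas_fun (fun om : borel Om=> fine (kap R om G)) by apply: measurableT_comp.
 exact: (measurableT_comp m1 (mTm m)).
have h01 om : 0 <= h om <= 1.
 rewrite /h indicE; case: (_ \in _); rewrite ?mul0r ?mul1r ?lexx ?ler01//.
 by rewrite fine_ge0//= -lee_fin kfin (probability_le1 (kap R _)).
have [bk e] := disint_unit mh h01.
have bh : bmf (h : borel Om -> R) by split=> //; exists 1=> x; have /andP[? ?] := h01 x; rewrite ger0_norm.
transitivity (Ex P h)%:E; last first.
 rewrite -(EFin_Ex P bh) [RHS]integral_mkcond; apply: eq_integral=> om _; rewrite patchE /h indicE.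
 by case: ifP=> _; rewrite ?mul1r ?mul0r.
have [_ ->] := disint_measurable KP mEG.
rewrite e -EFin_Ex//; apply: eq_integral=> om _.
rewrite -(@fineK _ (kap R om _)) ?fin_num_measure//; congr EFin.
have mpE : measurable (splice om @^-1` (E `&` iter m T @^-1` G) : set (borel Y)).
 by premeas; apply: measurable_splice.
rewrite {1}/kap pushPE (prob_partition _ m mpE) Ex_kap// /cexp (@Ex_digit_law om m).
 apply: eq_bigr=> w _; rewrite /h /=.
 have -> : iter m T (splice om (ext_word w)) = node om w by rewrite /node size_tuple.
 have hw := kap_node om w mG; rewrite size_tuple in hw.
 have [Ew|Ew] := pselect (E (splice om (ext_word w))).
  rewrite indicE mem_set// mul1r (_ : _ `&` cyl w = [set y | G (iter m T (splice om y))] `&` cyl w).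
   by rewrite [X in fine X]hw fineM// ?fin_num_measure// mulrC.
  apply/seteqP; split=> y /= [h1 h2]; split=> //; first by case: h1.
  split=> //; apply: dE Ew; move: h2; rewrite /cyl /= size_tuple=> ->.
  exact: prefix_ext_tuple.
 rewrite indicE memNset// !mul0r (_ : _ `&` cyl w = set0) ?measure0//.
 apply/seteqP; split=> y //= -[[h1 _] h2]; apply: Ew; apply: dE h1.
 by move: h2; rewrite /cyl /= size_tuple=> ->; rewrite prefix_ext_tuple.
move=> y y' hy; rewrite /= /h; congr (_ * _).
 rewrite !indicE; suff -> : (splice om y \in E) = (splice om y' \in E) by [].
 apply/idP/idP; rewrite !inE; exact: dE.
have sb : samebits (iter m T (splice om y)) (iter m T (splice om y')).
 by apply: samebits_iter; [move=> n; rewrite !bits_splice|rewrite !xs_splice].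
rewrite /kap !pushPE (_ : splice (iter m T (splice om y)) = splice (iter m T (splice om y'))).
 congr fine; apply: digit_law_eqwt=> [w|]; first exact: wt_samebits.
 by premeas; apply: measurable_splice.
apply/funext=> y0; exact: splice_same.
Qed.

End disintegration_functions.

(** * Measurability on the space of measures *)

Section evaluations.
Context (R : realType).
Notation pl := (plane R).
Notation X := (closed_square R).
Notation SP := (square_prob R).

Lemma measurable_pairing (f : square_test R) :
  meas_fun (fun nu : borel SP => square_pairing nu f).
Proof.
apply: (measurability _ (RGenOInfty.measurableE R))=> // _ [_ [x ->] <-]; rewrite setTI.
apply: open_borel; exists ((fun g : {ptws square_test R -> R} => g f) @^-1` `]x, +oo[)=> //.
apply: open_comp=> [g _|]//.
move=> V hV; have /cvg_sup/(_ f) h : nbhs (g : {ptws square_test R -> R}) --> g by [].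
apply: h; exact: (@initial_continuous _ _ (fun g : square_test R -> R=> g f) g).
Qed.

Definition ramp (j : nat) (t : R) : R := clampR (1 + j%:R * t).

Lemma ramp_cvg t : ramp j t @[j --> \oo] --> ((0 <= t)%R%:R : R).
Proof.
have [t0|t0] := leP 0 t.
 rewrite (_ : ramp ^~ t = cst 1); first exact: cvg_cst.
 apply/funext=> j; rewrite /ramp /clampR.
 have h : 0 <= j%:R * t by rewrite mulr_ge0.
 rewrite ifF ?ifT//; lra.
have nt0 : 0 < - t by lra.
apply: cvg_near_cst; exists (Num.truncn (- t)^-1).+1=> // j /= hj.
rewrite /ramp /clampR ifT//.
have : (- t)^-1 <= j%:R by apply: ltW; rewrite (lt_le_trans (truncnS_gt _))// ler_nat.
rewrite -[leLHS]mul1r ler_pdivrMr//; lra.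
Qed.

Lemma ramp_itv j t : 0 <= ramp j t <= 1.
Proof. exact: clampR_itv. Qed.

Lemma ramp_continuous (g : pl -> R) j a : continuous g -> continuous (fun z => ramp j (g z - a)).
Proof.
move=> cg z; apply: ((@cvgrPdist_lt R R^o pl (nbhs z) _ _ _).2)=> e e0.
have j0 : 0 < j%:R + 1 :> R by [].
have /cvgrPdist_lt /(_ _ (divr_gt0 e0 j0)) := cg z; apply: filterS=> w; rewrite ltr_pdivlMr// => h.
apply: le_lt_trans h; rewrite (le_trans (clampR_lip _ _))//.
rewrite (_ : _ - _ = j%:R * (g z - g w)); last by ring.
by rewrite normrM ger0_norm// mulrC ler_wpM2l// lerDl.
Qed.

Section rectangle.
Variables (a a' c c' : R).
Hypotheses (aa' : a <= a') (cc' : c <= c').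

Definition rect : set (borel pl) := [set z | a <= complex.Re z < a' /\ c <= complex.Im z < c'].

Definition bump j (z : pl) : R :=
  (ramp j (complex.Re z - a) - ramp j (complex.Re z - a')) *
  (ramp j (complex.Im z - c) - ramp j (complex.Im z - c')).

Lemma bump_continuous j : continuous (bump j).
Proof.
move=> z; have h (g : pl -> R) x : continuous g -> (fun z=> ramp j (g z - x)) @ z --> ramp j (g z - x).
 move=> cg; exact: ramp_continuous.
exact: (cvgM (cvgB (h _ a (@continuous_Re R)) (h _ a' (@continuous_Re R)))
 (cvgB (h _ c (@continuous_Im R)) (h _ c' (@continuous_Im R)))).
Qed.

Lemma bump_cvg z : bump j z @[j --> \oo] --> (\1_rect z : R).
Proof.
have -> : (\1_rect z : R) = ((0 <= complex.Re z - a)%R%:R - (0 <= complex.Re z - a')%R%:R) *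
  ((0 <= complex.Im z - c)%R%:R - (0 <= complex.Im z - c')%R%:R).
 rewrite indicE (_ : (z \in rect) = (a <= complex.Re z < a') && (c <= complex.Im z < c')); last first.
  by apply/idP/idP; [rewrite inE=> -[-> ->]|move=> /andP[? ?]; rewrite inE].
 rewrite !subr_ge0; case: (leP a')=> h1; case: (leP c')=> h2; rewrite ?andbF ?andbT.
 - by rewrite (le_trans aa' h1) subrr mul0r.
 - by rewrite (le_trans aa' h1) subrr mul0r.
 - by rewrite (le_trans cc' h2) subrr mulr0.
 - by rewrite !subr0 -natrM mulnb.
apply: cvgM; apply: cvgB; exact: ramp_cvg.
Qed.

Lemma measurable_rect_eval : meas_fun (fun nu : borel SP => fine ((nu : SP) rect)).
Proof.
have cb j : {within X, continuous (bump j)} by apply: continuous_subspaceT; exact: bump_continuous.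
pose f j : square_test R := exist _ (bump j) (cb j).
have mr : measurable rect by exact: measurable_plane_rect.
apply: (@measurable_fun_cvg _ (borel SP) R setT (fun j nu=> square_pairing nu (f j)))=> [j|nu _].
 exact: measurable_pairing.
have -> : fine ((nu : SP) rect) = Ex (nu : SP) (\1_rect \o @clamp R).
 have cc : meas_fun (@clamp R : borel pl -> borel pl) by apply: continuous_borel; exact: clamp_continuous.
 rewrite -Ex_indic//; apply: Ex_ae; first tame.
  by split; [apply: measurableT_comp=> //; exact: measurable_indic|exists 1=> z; exact: indic_norm_le1].
 have mX : measurable (X : set (borel pl)) by apply: closed_borel; exact: closed_closed_square.
 by apply: (ae_mono (prob1_ae mX (square_lawP nu)))=> z Xz /=; rewrite clamp_id.
rewrite (_ : (fun j=> _) = fun j=> Ex (nu : SP) (bump j \o @clamp R)); last first.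
 by apply/funext=> j; rewrite square_pairingE.
have cc : meas_fun (@clamp R : borel pl -> borel pl) by apply: continuous_borel; exact: clamp_continuous.
apply: (@Ex_dct _ _ _ (nu : SP) _ _ 1).
- by move=> j; have [] := bmf_clamp (cb j).
- move=> j z; rewrite /= /bump normrM -[leRHS]mulr1.
 have h x y : `|ramp j x - ramp j y| <= 1.
  have := ramp_itv j x; have := ramp_itv j y; rewrite ler_norml; lra.
 exact: ler_pM.
- by split; [apply: measurableT_comp=> //; exact: measurable_indic|exists 1=> z; exact: indic_norm_le1].
- apply: aeW=> z; exact: bump_cvg.
Qed.

End rectangle.

(** The inverse is written as [f x] times the power -1 of its square; the factor [f x] restores the
    value 0 where [f] vanishes. *)
Lemma measurable_inv d (T : measurableType d) (f : T -> R) :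
  meas_fun f -> meas_fun (fun x => (f x)^-1).
Proof.
move=> mf; have -> : (fun x=> (f x)^-1) = fun x=> f x * (f x * f x) `^ (-1).
 apply/funext=> x; rewrite powR_inv1; last by rewrite sqr_ge0.
 by have [->|fx] := eqVneq (f x) 0; rewrite ?invr0 ?mul0r// invfM mulrA divff// mul1r.
apply: measurable_funM=> //.
have h := measurableT_comp (@measurable_powR R (-1)) (measurable_funM mf mf); exact: h.
Qed.

Lemma measurable_cell_eval b n (k : nat * nat) :
  meas_fun (fun nu : borel SP => fine ((nu : SP) (bcube b n k))).
Proof.
have h (i : nat) : i%:R / b%:R ^+ n <= i.+1%:R / b%:R ^+ n :> R.
 by rewrite ler_wpM2r// ler_nat.
exact: (measurable_rect_eval (h k.1) (h k.2)).
Qed.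

Lemma measurable_half_eval : measurable ([set nu | (nu : SP) (half_open_square R) = 1%E] : set (borel SP)).
Proof.
have := measurable_rect_eval (@ler01 R) (@ler01 R).
move=> /(_ measurableT _ (measurable_set1 1)); rewrite setTI.
congr measurable; apply/seteqP; split=> nu /=.
 move=> h; rewrite -[LHS](@fineK _ ((nu : SP) _)) ?h//.
 rewrite fin_num_measure//; exact: measurable_plane_rect.
by move=> h; rewrite [X in fine X]h.
Qed.

Lemma measurable_codem b : meas_fun (@codem R b : borel SP -> borel (shift_space (b ^ 2).-1.*2.+1)).
Proof.
set D := (b ^ 2).-1; pose Om := shift_space D.*2.+1.
have mw (w : seq 'I_D.+1) : meas_fun (fun nu : borel SP=> @cell_weight R b nu w) by exact: measurable_cell_eval.
have mb (w : seq 'I_D.+1) d : meas_fun (fun nu : borel SP=> break (@cell_weight R b nu) w d).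
 rewrite /break; case: (d < D.+1)%N=> //.
 apply: measurable_funM=> //; apply: measurable_inv; apply: measurable_funB=> //.
 under eq_fun do rewrite big_mkcond/=.
 apply: measurable_sum=> j; case: (j < d)%N=> //; exact: measurable_cst.
have ml n (a : 'I_D.*2.+2) : measurable [set nu : borel SP | (codem b nu : Om) n = a].
 rewrite /codem /code; case e : (unpickle n)=> [[[w d] l]|] /=; last first.
  have [h|h] := pselect (comb ord0 false = a).
   by rewrite (_ : [set _ | _] = setT)//; apply/seteqP; split.
  by rewrite (_ : [set _ | _] = set0)//; apply/seteqP; split.
 pose V : set R := [set v | comb ord0 (bits_of v l) = a].
 have mV : measurable V.
  have [h1|h1] := pselect (comb ord0 true = a); have [h2|h2] := pselect (comb ord0 false = a).
  - by rewrite (_ : V = setT)//; apply/seteqP; split=> v // _; rewrite /V /=; case: bits_of.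
  - rewrite (_ : V = [set v | bits_of v l]); first exact: measurable_bits_of.
   by apply/seteqP; split=> v; rewrite /V /=; case: bits_of.
  - rewrite (_ : V = ~` [set v | bits_of v l]); first by apply: measurableC; exact: measurable_bits_of.
   by apply/seteqP; split=> v; rewrite /V /=; case: bits_of.
  - by rewrite (_ : V = set0)//; apply/seteqP; split=> v //; rewrite /V /=; case: bits_of.
 by have := mb w d measurableT V mV; rewrite setTI.
apply: measurable_to_shift=> w; rewrite /cyl /=.
elim/last_ind: w=> [|w c ih]; first by rewrite (_ : _ @^-1` _ = setT)//; apply/seteqP; split.
rewrite (_ : _ @^-1` _ = (@codem R b @^-1` [set al | pfx al (size w) = w]) `&`
  [set nu | (codem b nu : Om) (size w) = c]); first exact: measurableI.
apply/seteqP; split=> nu /=; rewrite size_rcons pfxS.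
 by move=> /rcons_inj[].
by move=> [-> ->].
Qed.

End evaluations.

Section pushforward_integral.
Context d d' (T : measurableType d) (T' : measurableType d') (R : realType).
Variables (P : probability T R) (h : T -> T').
Hypothesis mh : meas_fun h.

Lemma integral_pushP (D : set T') (f : T' -> \bar R) : measurable D ->
  measurable_fun D f -> (forall y, D y -> (0 <= f y)%E) ->
  (\int[pushP P mh]_(y in D) f y = \int[P]_(x in h @^-1` D) f (h x))%E.
Proof.
move=> mD mf f0; rewrite -(@ge0_integral_pushforward _ _ _ _ _ _ mh P D f)//; last first.
 move=> y; rewrite inE; exact: f0.
apply: eq_measure_integral=> A mA _; exact: pushPE.
Qed.

End pushforward_integral.

(** * The CP-chain of an invariant coded law *)

Section chain.
Context (R : realType) (b : nat).
Hypothesis hb : (1 < b)%N.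
Notation half := (half_open_square R).
Notation SP := (square_prob R).
Notation D := (b ^ 2).-1.
Notation digit := ('I_D.+1).
Notation Om := (shift_space D.*2.+1).
Notation Y := (shift_space D).
Notation T := (@tailT D).
Notation Phi := (@Phi R b hb).
Notation good := (@good R b).
Implicit Types (om : Om) (y : Y).

Let uT : ushift T. by tame. Qed.
Let mT : meas_fun (T : borel Om -> borel Om).
exact: ushift_measurable. Qed.

Lemma measurable_Phi : meas_fun (Phi : borel Om -> borel SP).
Proof. by apply: continuous_borel; exact: Phi_continuous. Qed.

Definition dpair (c : digit) : nat * nat := (dre c, dim c).

(** The digit names the cube just chosen and the measure is already magnified in it, whence [T om]
    beside the first digit of [om]. *)
Definition state om : cp_state R := (Phi (T om), dpair (xs om 0%N)).

Lemma measurable_letter d (U : measurableType d) (g : digit -> U) :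
  meas_fun (fun om : borel Om => g (xs om 0%N)).
Proof.
move=> _ B mB; rewrite setTI; apply: open_borel; rewrite openE=> om Bom; rewrite /interior.
apply: filterS (prefix_nbhs om 1)=> om' h; rewrite /= /xs.
have /pfxP/(_ 0%N isT) -> : pfx om' 1 = pfx om 1 by [].
by [].
Qed.

Lemma measurable_state : meas_fun (state : borel Om -> cp_state R).
Proof.
apply: measurable_fun_pair.
 exact: (measurableT_comp measurable_Phi mT).
apply: measurable_fun_pair.
 exact: (measurable_letter (@dre b)).
exact: (measurable_letter (@dim b)).
Qed.

Definition orbit_path om : cp_path R := fun n => state (iter n T om).

Lemma measurable_orbit_path : meas_fun (orbit_path : borel Om -> cp_path R).
Proof.
apply: (@measurability _ _ (borel Om) (cp_path R) setT orbit_path (coordinate_events setT))=> //.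
move=> _ [_ [k _ [F mF <-]] <-].
have mk : meas_fun (iter k T : borel Om -> borel Om).
 apply: ushift_measurable; exact: ushift_iter.
exact: (measurableT_comp measurable_state mk measurableT mF).
Qed.

Lemma state_sim (F : set (cp_state R)) (nu nu' : SP) (k : nat * nat) : measurable F -> sim nu nu' ->
  F (nu, k) -> F (nu', k).
Proof.
move=> mF s h; have := sim_borel s (measurable_ysection k mF).
by rewrite /ysection /= !inE; apply.
Qed.

Lemma Phi_samebits om om' : samebits om om' -> sim (Phi om) (Phi om').
Proof. by move=> sb; apply: Phi_sim=> w; exact: wt_samebits. Qed.

Lemma kap_state om (F : set (cp_state R)) : measurable F ->
  (fine (kap R om (state @^-1` F)) = \sum_(c : digit) wt R om [::] [:: c] *
    \1_F (Phi (node om [:: c]), dpair c)).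
Proof.
move=> mF; have mG : measurable (state @^-1` F : set (borel Om)).
 by have := measurable_state measurableT mF; rewrite setTI.
have mp : measurable (splice om @^-1` (state @^-1` F) : set (borel Y)).
 by premeas; apply: measurable_splice.
rewrite /kap pushPE (prob_partition _ 1 mp).
rewrite (reindex (fun c : digit=> [tuple c])) /=; last first.
 exists (fun w : 1.-tuple digit=> thead w)=> [c _|w _]//.
 by case: (tupleP w)=> c s; apply: val_inj; rewrite /= (tuple0 s).
apply: eq_bigr=> c _.
have sT y : cyl [:: c] y -> samebits (T (splice om y)) (node om [:: c]).
 move=> hy; apply: (samebits_iter (m := 1)); first by move=> n; rewrite !bits_splice.
 by rewrite !xs_splice.
have y0 y : cyl [:: c] y -> y 0%N = c by rewrite /cyl /= /pfx /= => -[].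
have [h|h] := pselect (F (Phi (node om [:: c]), dpair c)).
 rewrite indicE mem_set// mulr1 (_ : _ `&` _ = cyl [:: c]).
  by have e := digit_lawE R om [:: c]; rewrite [X in fine X]e.
 apply/seteqP; split=> y /=; first by case.
 move=> hy; split=> //; rewrite /state xs_splice (y0 _ hy).
 apply: state_sim h=> //; apply: simC; apply: Phi_samebits; exact: sT.
rewrite indicE memNset// mulr0 (_ : _ `&` _ = set0) ?measure0//.
apply/seteqP; split=> y //= -[h1 hy]; apply: h; move: h1.
rewrite /state xs_splice (y0 _ hy); apply: state_sim=> //; apply: Phi_samebits; exact: sT.
Qed.

Lemma key1 (c : digit) : key [:: c] = dpair c.
Proof. by []. Qed.

(** Both sides are sums over first-generation cells: the mass of a cell is the weight of its digit,
    and magnification is passage to the node. Cells of weight 0, where [magnify] takes its default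
    value, contribute nothing. *)
Lemma cp_kernel_kap om (x : cp_state R) (F : set (cp_state R)) : measurable F -> good om ->
  sim x.1 (Phi om) -> cp_kernel b x F = kap R om (state @^-1` F).
Proof.
move=> mF g s; have mG : measurable (state @^-1` F : set (borel Om)).
 by have := measurable_state measurableT mF; rewrite setTI.
rewrite -(@fineK _ (kap R om _)) ?fin_num_measure// kap_state// -sumEFin /cp_kernel pair_big/=.
rewrite (reindex (fun c : digit=> (Ordinal (dre_lt hb c), Ordinal (dim_lt hb c)))) /=; last first.
 exists (fun p : 'I_b * 'I_b=> mkd b p.1 p.2)=> [c _|[i j] _].
  exact: mkd_eta.
 by congr pair; apply: val_inj; rewrite /= ?dre_mkd ?dim_mkd.
apply: eq_bigr=> c _; rewrite -/(dpair c).
have hB : (x.1 : SP) (bcube b 1 (dpair c)) = (wt R om [::] [:: c])%:E.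
 rewrite s; last exact: measurable_bcube.
 by have := Phi_bcube hb [:: c] g; rewrite key1.
rewrite hB (_ : ratio R om [::] c * 1 = wt R om [::] [:: c])//.
have [->|w0] := eqVneq (wt R om [::] [:: c]) 0; first by rewrite mul0r mul0e.
rewrite [RHS]EFinM; congr (_ * _)%E; rewrite indicE; congr (_%:R%:E).
have sm : sim (magnify b x.1 1 (dpair c)) (Phi (node om [:: c])).
 move=> E mE; rewrite (magnify_sim b 1 (dpair c) s mE).
 have := magnify_Phi hb (u := [:: c]) g _ mE; rewrite key1; apply.
 by rewrite lt_neqAle wt_ge0 andbT eq_sym.
congr nat_of_bool; apply/idP/idP; rewrite !inE; apply: state_sim=> //; exact: simC.
Qed.

Variable P : probability (borel Om) R.
Hypotheses (TP : preserves T P) (KP : disint P) (gP : {ae P, forall om, good om}).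

Definition chain_law : probability (cp_path R) R := pushP P measurable_orbit_path.

Definition component_law : probability (borel SP) R := pushP P measurable_Phi.

Lemma ae_iter (Q : Om -> Prop) : {ae P, forall om, Q om} -> {ae P, forall om, forall n, Q (iter n T om)}.
Proof.
move=> [N [mN N0 QN]]; apply: ae_foralln=> n; exists (iter n T @^-1` N); split.
- premeas; apply: ushift_measurable=> //; exact: ushift_iter.
- by have h := preserve_iter mT TP n mN; rewrite [LHS]h.
- by move=> om /QN.
Qed.

Let Vs : set (cp_state R) := [set x | cp_valid_state b x].

Let mVs : measurable Vs.
Proof.
rewrite (_ : Vs = [set nu : borel SP | (nu : SP) half = 1%E] `*` ([set i | (i < b)%N] `*` [set i | (i < b)%N])).
 apply: measurableX; first exact: measurable_half_eval.
 exact: measurableX.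
by apply/seteqP; split=> -[nu [i j]] /=; [case|move=> [? [? ?]]].
Qed.

Lemma state_valid om : good (T om) -> Vs (state om).
Proof. by move=> g; split=> /=; [exact: Phi_half|exact: dre_lt|exact: dim_lt]. Qed.

(** States up to time [n] are read off the bits and the first [n.+1] digits, since the measure at
    time [n] belongs to the code at time [n.+1]. *)
Lemma past_depth n (E : set (cp_path R)) : past_event n E ->
  measurable (orbit_path @^-1` E : set (borel Om)) /\ depth_event n.+1 (orbit_path @^-1` E).
Proof.
pose C : set_system (cp_path R) := [set E | measurable E /\ depth_event n.+1 (orbit_path @^-1` E)].
suff h : past_event n `<=` C.
 move=> /h[mE dE]; split=> //.
 by have := measurable_orbit_path measurableT mE; rewrite setTI.
apply: smallest_sub.
 split.
 - by split=> //.
 - move=> A [mA dA]; split; first exact: measurableD.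
  move=> om y y' hy [_ h]; split=> // h'; apply: h.
  exact: dA (esym hy) h'.
 - move=> A hA; split; first by apply: bigcupT_measurable=> i; case: (hA i).
  by move=> om y y' hy [i _ Ai]; exists i=> //; case: (hA i)=> _; apply; [exact: hy|].
move=> _ [k /= kn [F mF <-]]; split.
 by apply: sub_sigma_algebra; exists k=> //; exists F.
move=> om y y' hy /=; rewrite /orbit_path /state.
have -> : xs (iter k T (splice om y)) 0%N = xs (iter k T (splice om y')) 0%N.
 by rewrite !xs_iter addn0 !xs_splice; move/pfxP: hy; apply.
apply: state_sim=> //; apply: Phi_samebits; rewrite -!iterS.
apply: samebits_iter; first by move=> m; rewrite !bits_splice.
by rewrite !xs_splice; apply: prefix_le hy.
Qed.

Lemma chain_law_cp : cp_chain b chain_law.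
Proof.
have gi := ae_iter gP; split.
- pose V : set (cp_path R) := \bigcap_n [set w : cp_path R | Vs (w n)].
 have mV : measurable V.
  apply: bigcapT_measurable=> n; apply: sub_sigma_algebra; exists n=> //.
  by exists Vs.
 have : chain_law V = 1%E.
  rewrite /chain_law pushPE; apply: prob_ae1.
   by have := measurable_orbit_path measurableT mV; rewrite setTI.
  by apply: (ae_mono gi)=> om h n _; apply: state_valid; rewrite -iterS.
 move=> /(prob1_ae mV) h; apply: (ae_mono h)=> w hw n; exact: hw.
- move=> E mE; rewrite /chain_law !pushPE.
 rewrite (_ : orbit_path @^-1` (@path_shift R @^-1` E) = T @^-1` (orbit_path @^-1` E)).
  by apply: TP; have := measurable_orbit_path measurableT mE; rewrite setTI.
 apply/seteqP; split=> om; rewrite /=; suff -> : path_shift (orbit_path om) = orbit_path (T om) by [].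
  by apply/funext=> n; rewrite /path_shift /orbit_path iterSr.
 by apply/funext=> n; rewrite /path_shift /orbit_path iterSr.
- move=> n E F pE mF; have [mE dE] := past_depth pE.
 have mEp : measurable E.
  have : past_event n `<=` (measurable : set (set (cp_path R))).
   apply: smallest_sub; first exact: (sigma_algebra_measurable (cp_path R)).
   by move=> _ [k _ [G mG <-]]; apply: sub_sigma_algebra; exists k=> //; exists G.
  by apply.
 have mG : measurable (state @^-1` F : set (borel Om)).
  by have := measurable_state measurableT mF; rewrite setTI.
 have [mkG _] := disint_measurable KP mG.
 (* Measurability of the kernel in the measure is not evident; it agrees almost everywhere with the
    kernel of the code of the measure, which is Borel. *)
 pose g (nu : borel SP) := kap R (codem b nu) (state @^-1` F).
 have mg : meas_fun g by have h := measurableT_comp mkG (@measurable_codem R b); exact: h.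
 have mw : meas_fun (fun w : cp_path R=> w n).
  by move=> _ B mB; rewrite setTI; apply: sub_sigma_algebra; exists n=> //; exists B.
 have mgw : meas_fun (fun w : cp_path R=> g (w n).1).
  exact: (measurableT_comp mg (measurableT_comp measurable_fst mw)).
 pose V : set (cp_path R) := [set w | Vs (w n)].
 have mV : measurable V by have := mw measurableT _ mVs; rewrite setTI.
 have V1 : chain_law (~` V) = 0%E.
  rewrite probability_setC// (_ : chain_law V = 1%E) ?subee//.
  rewrite /chain_law pushPE; apply: prob_ae1.
   by have := measurable_orbit_path measurableT mV; rewrite setTI.
  by apply: (ae_mono gi)=> om h; apply: state_valid; rewrite -iterS.
 have gV w : V w -> cp_kernel b (w n) F = g (w n).1.
  move=> [h1 _ _]; rewrite /g; apply: cp_kernel_kap=> //; first exact: codem_good.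
  apply: simC; exact: Phi_codem.
 have k0 (x : cp_state R) : (0 <= cp_kernel b x F)%E.
  rewrite /cp_kernel; apply: sume_ge0=> i _; apply: sume_ge0=> j _; exact: mule_ge0.
 transitivity (\int[chain_law]_(w in E) g (w n).1)%E; last first.
  rewrite integral_mkcond [RHS]integral_mkcond.
  have aux (f1 f2 : cp_path R -> \bar R) : (forall w, 0 <= f1 w)%E -> (forall w, 0 <= f2 w)%E ->
    (forall w, V w -> f1 w = f2 w) ->
    (\int[chain_law]_x (f1 \_ E) x <= \int[chain_law]_x (f2 \_ E) x)%E.
   move=> f10 f20 f12; apply: (@integral_mono_ae _ _ _ chain_law (~` V))=> //.
   - exact: measurableC.
   - by move=> w; rewrite patchE; case: ifP.
   - by move=> w; rewrite patchE; case: ifP.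
   - by move=> w /contrapT Vw; rewrite !patchE; rewrite f12.
  by apply/eqP; rewrite eq_le !aux// => w Vw; rewrite gV.
 rewrite /chain_law integral_pushP//; last exact: measurable_funTS.
 rewrite pushPE (_ : orbit_path @^-1` _ = (orbit_path @^-1` E) `&` iter n.+1 T @^-1` (state @^-1` F))//.
 rewrite (markov_property KP mE dE mG).
 have mkT m : meas_fun (fun om : borel Om=> kap R (iter m T om) (state @^-1` F)).
  have mi : meas_fun (iter m T : borel Om -> borel Om).
   apply: ushift_measurable; exact: ushift_iter.
  exact: (measurableT_comp mkG mi).
 apply: ae_eq_integral=> //; first exact: measurable_funTS.
  apply: measurable_funTS; exact: (measurableT_comp mgw measurable_orbit_path).
 apply: (ae_mono gi)=> om h _; rewrite /orbit_path /state /=.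
 have h1 : good (iter n.+1 T om) by [].
 have h2 : Phi (T (iter n T om)) half = 1%E by exact: (Phi_half hb h1).
 rewrite /g -(cp_kernel_kap (x := (Phi (iter n.+1 T om), (0%N, 0%N))) mF h1)//.
 apply: cp_kernel_kap=> //; first exact: codem_good.
 apply: simC; exact: Phi_codem.
Qed.

Lemma chain_law_ergodic : ergodic T P -> cp_ergodic chain_law.
Proof.
move=> eP E mE hE; rewrite /chain_law pushPE.
have mO : measurable (orbit_path @^-1` E : set (borel Om)).
 by have := measurable_orbit_path measurableT mE; rewrite setTI.
apply: eP=> //; rewrite -{2}hE; apply/seteqP; split=> om; rewrite /=.
 by rewrite (_ : path_shift (orbit_path om) = orbit_path (T om))//; apply/funext=> n; rewrite /path_shift /orbit_path iterSr.
by rewrite (_ : path_shift (orbit_path om) = orbit_path (T om))//; apply/funext=> n; rewrite /path_shift /orbit_path iterSr.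
Qed.

Lemma chain_law_component : measure_component chain_law component_law.
Proof.
move=> E mE; rewrite /chain_law /component_law !pushPE.
have mO : measurable (Phi @^-1` E : set (borel Om)).
 by have := measurable_Phi measurableT mE; rewrite setTI.
by rewrite -(TP mO).
Qed.

End chain.

(** * Dimension and entropy *)

Section hausdorff.
Context (R : realType).
Notation pl := (plane R).
Implicit Types (E : set pl) (t delta : R).
Local Open Scope ereal_scope.

Lemma diam_ge0 E : E !=set0 -> 0 <= diam E.
Proof. by move=> [z Ez]; apply: ereal_sup_ubound; exists z=> //; exists z=> //; rewrite cdistxx. Qed.

Lemma diam_le E (c : R) : (forall z w, E z -> E w -> cdist z w <= c)%R -> diam E <= c%:E.
Proof. by move=> h; apply: ub_ereal_sup=> _ [z Ez [w Ew <-]]; rewrite lee_fin h. Qed.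

Lemma le_diam E z w : E z -> E w -> (cdist z w)%:E <= diam E.
Proof. by move=> Ez Ew; apply: ereal_sup_ubound; exists z=> //; exists w. Qed.

Lemma hausdorff_weight_ge0 t E : 0 <= hausdorff_weight t E.
Proof. by rewrite /hausdorff_weight; case: ifP=> // _; exact: poweR_ge0. Qed.

Lemma hausdorff_weight0 t : hausdorff_weight t set0 = 0 :> \bar R.
Proof. by rewrite /hausdorff_weight eqxx. Qed.

Lemma hausdorff_weight_le t E (c : R) : (0 <= t)%R -> (0 <= c)%R -> diam E <= c%:E ->
  hausdorff_weight t E <= (c `^ t)%:E.
Proof.
move=> t0 c0 h; rewrite /hausdorff_weight; case: ifPn=> [_|/set0P E0].
 by rewrite lee_fin powR_ge0.
have := diam_ge0 E0; move: h; case: (diam E)=> [d| |] //; rewrite !lee_fin=> dc d0.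
by rewrite ge0_ler_powR.
Qed.

Lemma hausdorff_premeasure_ge0 t delta E : 0 <= hausdorff_premeasure t delta E.
Proof.
apply: le_ereal_inf_tmp=> _ [F _ <-]; apply: nneseries_ge0=> k _ _; exact: hausdorff_weight_ge0.
Qed.

(** Covers indexed by words become sequences through [pickle_inv]; the free indices receive the
    empty set, of weight 0 for every exponent. *)
Lemma premeasure_countable (I : countType) (F : I -> set pl) t delta E (c : R) :
  E `<=` \bigcup_i F i -> (forall i, diam (F i) <= delta%:E) ->
  (forall L : seq I, uniq L -> \sum_(i <- L) hausdorff_weight t (F i) <= c%:E) ->
  (0 <= delta)%R -> hausdorff_premeasure t delta E <= c%:E.
Proof.
move=> EF dF sF d0; pose G k := if @pickle_inv I k is Some i then F i else set0.
via (\sum_(0 <= k <oo) hausdorff_weight t (G k)).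
 apply: ereal_inf_lbound; exists G=> //; split.
  by move=> z /EF[i _ Fi]; exists (pickle i)=> //; rewrite /G pickleK_inv.
 move=> k; rewrite /G; case: pickle_inv=> [i|]//.
 exact: diam_le.
apply: lime_le; first by apply: is_cvg_nneseries=> k _ _; exact: hausdorff_weight_ge0.
apply: nearW=> n; rewrite big_mkord -(big_mkord predT (fun k=> hausdorff_weight t (G k))).
rewrite /index_iota subn0.
apply: le_trans (sF (pmap (@pickle_inv I) (iota 0 n)) _); last first.
 apply: (pmap_uniq (@pickle_invK I)); exact: iota_uniq.
elim: (iota 0 n)=> [|k s ih]; first by rewrite !big_nil.
rewrite big_cons /= {1}/G; case: pickle_inv=> [i|] /=; last by rewrite hausdorff_weight0 add0e.
by rewrite big_cons leeD2l.
Qed.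

End hausdorff.

Section geometric_tail.
Context (R : realType).

Lemma geometric_tail (r : R) M n : 0 <= r < 1 ->
  \sum_(N < n | (M <= N)%N) r ^+ N <= r ^+ M / (1 - r).
Proof.
move=> /andP[r0 r1]; have r10 : 0 < 1 - r by lra.
suff -> : \sum_(N < n | (M <= N)%N) r ^+ N = (if (M <= n)%N then r ^+ M - r ^+ n else 0) / (1 - r).
 rewrite ler_pM2r ?invr_gt0//; have := exprn_ge0 n r0; have := exprn_ge0 M r0.
 case: ifP=> _; lra.
elim: n=> [|n ih]; first by rewrite big_ord0 leqn0; case: eqP=> [->|_]; rewrite ?subrr ?mul0r.
rewrite big_mkcond big_ord_recr/= -big_mkcond/= ih.
case: (ltngtP M n.+1)=> Mn.
- by rewrite -ltnS Mn exprS; field; rewrite gt_eqF.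
- by rewrite [(M <= n)%N]leqNgt (ltn_trans _ Mn)//= addr0.
- by rewrite Mn [(n.+1 <= n)%N]ltnn subrr addr0.
Qed.

Definition rho (b : nat) (t : R) : R := b%:R^-1 `^ t.

Lemma rho_gt0 b t : (0 < b)%N -> 0 < rho b t.
Proof. by move=> b0; rewrite powR_gt0// invr_gt0 ltr0n. Qed.

Lemma rho_lt1 b t : (1 < b)%N -> 0 < t -> rho b t < 1.
Proof.
move=> b1 t0; have <- : 1 `^ t = 1 :> R by rewrite powR1.
rewrite /rho; apply: gt0_ltr_powR=> //; rewrite ?nnegrE//.
by rewrite invf_lt1 ?ltr1n// ltr0n ltnW.
Qed.

Lemma rho_exp b t n : (b%:R ^- n) `^ t = rho b t ^+ n.
Proof.
have h : b%:R^-1 ^+ n = b%:R^-1 `^ n%:R :> R by rewrite powR_mulrn//.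
by rewrite -exprVn h /rho -powRrM mulrC powRrM powR_mulrn//.
Qed.

Lemma rhoD b s t : (0 < b)%N -> rho b (s + t) = rho b s * rho b t.
Proof. by move=> b0; rewrite /rho powRD//; apply/implyP=> _; rewrite invr_eq0 pnatr_eq0 -lt0n. Qed.

Lemma expr_small (r e : R) : 0 <= r < 1 -> 0 < e -> exists M, forall n, (M <= n)%N -> r ^+ n < e.
Proof.
move=> /andP[r0 r1] e0; have : r ^+ n @[n --> \oo] --> 0 by apply: cvg_expr; rewrite ger0_norm.
move=> /cvgrPdist_lt /(_ _ e0) [M _ h]; exists M=> n Mn.
by have := h n Mn; rewrite sub0r normrN ger0_norm// exprn_ge0.
Qed.

End geometric_tail.

(** * Cells of large mass *)

Section heavy_cells.
Context (R : realType) (b : nat).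
Hypothesis hb : (1 < b)%N.
Notation pl := (plane R).
Notation X := (closed_square R).
Notation digit := ('I_(b ^ 2).-1.+1).
Notation Y := (shift_space (b ^ 2).-1).

Variables (mu : probability (borel pl) R) (g : nat -> pl -> Y) (K s : R).
Hypotheses (muX : mu X = 1%E)
  (mg : forall N, meas_fun (g N : borel pl -> borel Y))
  (gK : forall N z z', X z -> X z' -> pfx (g N z) N = pfx (g N z') N ->
     cdist z z' <= K * b%:R ^- N)
  (s0 : 0 <= s) (sdim : (s%:E < measure_dim mu)%E).

Let K0 : 0 <= K.
Proof.
have := gK (N := 0) (clampX 0) (clampX 0) erefl.
by rewrite cdistxx invr1 mulr1.
Qed.

Let cell (w : seq digit) : set (borel pl) := X `&` g (size w) @^-1` cyl w.

Let mX : measurable (X : set (borel pl)).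
by apply: closed_borel; exact: closed_closed_square. Qed.

Let mcell w : measurable (cell w).
Proof.
apply: measurableI=> //; premeas; apply: mg=> //.
tame.
Qed.

Definition heavy N : set (borel pl) :=
  [set z | X z /\ rho b s ^+ N <= fine (mu (X `&` g N @^-1` cyl (pfx (g N z) N)))].

Lemma measurable_heavy N : measurable (heavy N).
Proof.
rewrite (_ : heavy N = X `&` g N @^-1` \bigcup_(w in [set w : seq digit |
  size w = N /\ rho b s ^+ N <= fine (mu (X `&` g N @^-1` cyl w))]) cyl w).
 apply: measurableI=> //; premeas; apply: mg=> //.
 apply: open_borel; apply: bigcup_open=> w _; exact: cyl_open.
apply/seteqP; split=> z [Xz h]; split=> //.
 by exists (pfx (g N z) N); [rewrite /= size_pw|exact: cyl_prefix].
case: h=> w [sw hw]; rewrite /cyl /= sw=> e; move: hw.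
by rewrite -e.
Qed.

(** For [t] between [s] and the dimension, at level [N] the diameters of heavy cells to the power
    [t] add up to at most a constant times [r ^+ N]. Points that are heavy infinitely often thus
    form a set of dimension at most [t], which is null. The maps [g N] may change with [N]; this
    gives uniformity over translates. *)
Lemma heavy_small : fine (mu (heavy N)) @[N --> \oo] --> 0.
Proof.
have [t [st tdim]] : exists t : R, s < t /\ (t%:E < measure_dim mu)%E.
 case: (measure_dim mu) sdim=> [r| |] //; last by move=> _; exists (s + 1); rewrite ltry; split=> //; lra.
 rewrite lte_fin=> sr; exists ((s + r) / 2); rewrite lte_fin; split; lra.
have b0 : (0 < b)%N by exact: ltnW.
pose r := rho b (t - s); have r01 : 0 <= r < 1 by rewrite ltW ?rho_gt0//= rho_lt1// subr_gt0.
have [r0 r1] := andP r01.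
pose bad M (w : seq digit) := (M <= size w)%N /\ rho b s ^+ size w <= fine (mu (cell w)).
pose F M (w : seq digit) : set pl := if `[< bad M w >] then cell w else set0.
have mF M w : measurable (F M w : set (borel pl)).
 by rewrite /F; case: asboolP.
have dF M w : (diam (F M w) <= (K * b%:R ^- size w)%:E)%E.
 apply: diam_le=> z z'; rewrite /F; case: asboolP=> // _ [Xz hz] [Xz' hz'].
 by apply: gK=> //; rewrite (hz : pfx _ _ = w).
have m0 M w : 0 <= fine (mu (F M w)) by exact: fine_ge0.
have wF M w : (hausdorff_weight t (F M w) <=
  (K `^ t * (if (M <= size w)%N then r ^+ size w else 0) * fine (mu (F M w)))%:E)%E.
 have [h|h] := pselect (bad M w); last first.
  have -> : F M w = set0 by rewrite /F asboolF.
  by rewrite hausdorff_weight0 measure0 mulr0.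
 have Fc : F M w = cell w by rewrite /F asboolT.
 have [Mw hw] := h; rewrite Mw.
 have t0 : 0 <= t by rewrite (le_trans s0)// ltW.
 have Kb : 0 <= K * b%:R ^- size w by rewrite mulr_ge0//.
 apply: le_trans (hausdorff_weight_le t0 Kb (dF M w)) _.
 rewrite lee_fin powRM// -mulrA ler_wpM2l ?powR_ge0//.
 rewrite rho_exp (_ : t = (t - s) + s); last by rewrite subrK.
 by rewrite rhoD// exprMn ler_wpM2l ?exprn_ge0// Fc.
have sF M (L : seq (seq digit)) : uniq L ->
  (\sum_(w <- L) hausdorff_weight t (F M w) <= (K `^ t * (r ^+ M / (1 - r)))%:E)%E.
 move=> uL; apply: le_trans (lee_sum _ (fun w _=> wF M w)) _.
 rewrite sumEFin lee_fin; under eq_bigr do rewrite -mulrA.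
 rewrite -mulr_sumr ler_wpM2l ?powR_ge0//.
 (* Cells of one level are disjoint, so each point is counted once. *)
 have one N : \sum_(w <- L | size w == N) fine (mu (F M w)) <= 1.
  under eq_bigr do rewrite -Ex_indic//.
  rewrite -Ex_sum=> [|w]; last tame.
  rewrite -[leRHS](Ex_cst mu 1); apply: Ex_le.
  - tame.
  - tame.
  move=> z; pose p := pfx (g N z) N.
  via (\sum_(w <- L) (w == p)%:R).
   rewrite big_mkcond; apply: ler_sum=> w _; case: eqP=> // sw.
   rewrite indicE; case: eqP=> // wp; first by rewrite lern1; case: (_ \in _).
   have nF : ~ F M w z.
    rewrite /F; case: asboolP=> [_ [_ hz]|_ []].
    have hz' : pfx (g (size w) z) (size w) = w by [].
    by apply: wp; rewrite /p -sw hz'.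
   by rewrite memNset.
  rewrite /cst -(natr_sum _ _ _ (fun w=> (w == p) : nat)) lern1.
  have -> : (\sum_(w <- L) (w == p))%N = count (pred1 p) L.
   by elim: {uL} L=> [|a L' ih]; rewrite ?big_nil ?big_cons //= ih.
  by rewrite count_uniq_mem//; case: (_ \in _).
 pose n := (\max_(w <- L) size w).+1.
 apply: le_trans (geometric_tail M n r01).
 rewrite (_ : \sum_(w <- L) _ = \sum_(N < n | (M <= N)%N) r ^+ N * \sum_(w <- L | size w == N) fine (mu (F M w))).
  by apply: ler_sum=> N _; rewrite ler_piMr// exprn_ge0.
 under [RHS]eq_bigr do rewrite mulr_sumr.
 rewrite (exchange_big_dep predT)//= big_seq [RHS]big_seq; apply: eq_bigr=> w wL.
 have wn : (size w < n)%N by rewrite ltnS; exact: (@leq_bigmax_seq _ L predT (fun w : seq digit=> size w) w wL).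
 case: ifP=> Mw; last first.
  rewrite mul0r big1// => N /andP[MN /eqP wN]; by rewrite wN MN in Mw.
 rewrite (big_pred1 (Ordinal wn))// => N /=; rewrite -val_eqE /= eq_sym.
 by apply: andb_idl=> /eqP ->.
have mH N : measurable (heavy N) by exact: measurable_heavy.
pose U M := \bigcup_(N in [set N | (M <= N)%N]) heavy N.
have mU M : measurable (U M) by apply: bigcup_measurable.
pose Lim := \bigcap_M U M.
have mLim : measurable Lim by apply: bigcapT_measurable.
have LF M : Lim `<=` \bigcup_w F M w.
 move=> z /(_ M I)[N MN [Xz hz]]; exists (pfx (g N z) N)=> //.
 rewrite /F asboolT; first by split=> //; rewrite size_pw; exact: cyl_prefix.
 by split; rewrite /= /cell size_pw.
have H0 : hausdorff_measure t Lim = 0%E.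
 apply/eqP; rewrite eq_le; apply/andP; split; last first.
  apply: le_trans (hausdorff_premeasure_ge0 t 1 Lim) _.
  by apply: ereal_sup_ubound; exists 1=> //=.
 apply: ub_ereal_sup=> _ [delta /= d0 <-]; apply/lee_addgt0Pr=> e e0; rewrite add0e.
 have [M1 hM1] : exists M, forall n, (M <= n)%N -> K * b%:R ^- n <= delta.
  have bi : 0 <= (b%:R^-1 : R) < 1 by rewrite invr_ge0 ler0n/= invf_lt1 ?ltr1n ?ltr0n.
  have K1 : 0 < K + 1 by rewrite ltr_wpDl.
  have [M h] := expr_small bi (divr_gt0 d0 K1); exists M=> n /h; rewrite exprVn ltr_pdivlMr// => {}h.
  apply: le_trans (ltW h); rewrite mulrC ler_wpM2l//; lra.
 have [M2 hM2] : exists M, forall n, (M <= n)%N -> K `^ t * (r ^+ n / (1 - r)) <= e.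
  have K1 : 0 < K `^ t / (1 - r) + 1 by rewrite ltr_wpDl// divr_ge0 ?powR_ge0//; lra.
  have [M h] := expr_small r01 (divr_gt0 e0 K1); exists M=> n /h; rewrite ltr_pdivlMr// => {}h.
  apply: le_trans (ltW h); rewrite mulrCA ler_wpM2l ?exprn_ge0//; lra.
 pose M := maxn M1 M2.
 apply: le_trans (premeasure_countable (LF M) _ (sF M) (ltW d0)) _.
  move=> w; have [h|h] := pselect (bad M w); last first.
   by rewrite /F asboolF//; apply: diam_le.
  apply: le_trans (dF M w) _; rewrite lee_fin hM1//; case: h=> h _.
  apply: leq_trans h; exact: leq_maxl.
 by rewrite lee_fin hM2// leq_maxr.
have t0 : 0 <= t by rewrite (le_trans s0)// ltW.
have mu0 : mu Lim = 0%E.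
 apply/eqP; rewrite eq_le measure_ge0 andbT leNgt; apply/negP=> muL.
 have : (measure_dim mu <= t%:E)%E.
  via (hausdorff_dim Lim).
   by apply: ereal_inf_lbound; exists Lim.
  by apply: ereal_inf_lbound; exists t.
 by rewrite leNgt tdim.
apply/cvgrPdist_lt=> e e0.
have : mu (U M) @[M --> \oo] --> mu Lim.
 apply: nonincreasing_cvg_mu=> //; first by rewrite ltey_eq fin_num_measure.
 move=> m n mn; apply/subsetPset=> z [N mN hN]; exists N=> //; exact: leq_trans mn mN.
rewrite mu0=> /fine_cvg /cvgrPdist_lt /(_ _ e0); apply: filterS=> M.
rewrite !sub0r !normrN !ger0_norm ?fine_ge0//; apply: le_lt_trans.
apply: fine_le; rewrite ?fin_num_measure//.
by apply: le_measure; rewrite ?inE//; apply: bigcup_sup=> /=.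
Qed.

End heavy_cells.

(** * The mass distribution principle *)

Section mass_distribution.
Context (R : realType) (b : nat).
Hypothesis hb : (1 < b)%N.
Notation pl := (plane R).
Notation half := (half_open_square R).
Notation digit := ('I_(b ^ 2).-1.+1).
Notation digits := (@digits R b).
Variables (nu : probability (borel pl) R) (tau : R).
Hypothesis nuh : nu half = 1%E.

Let b0 : (0 < b)%N. lia. Qed.
Let bnR n : 0 < b%:R ^+ n :> R. by rewrite exprn_gt0// ltr0n. Qed.

Definition light N : set (borel pl) := [set z | half z /\ forall n, (N <= n)%N ->
  fine (nu (bcube b n (bcube_index b n z))) <= rho b tau ^+ n].

Lemma measurable_light N : measurable (light N).
Proof.
have -> : light N = half `&` digits @^-1` (\bigcap_(n in [set n | (N <= n)%N])
  \bigcup_(w in [set w : seq digit | size w = n /\ fine (nu (bcube b n (key w))) <= rho b tau ^+ n]) cyl w).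
 apply/seteqP; split=> z [hz h]; split=> // n Nn.
  exists (pfx (digits z) n); last exact: cyl_prefix.
  by split; [rewrite size_pw|rewrite -bcube_index_digits//; exact: h].
 have [w [sw hw]] := h n Nn; rewrite /cyl /= sw=> e.
 by rewrite bcube_index_digits// e.
apply: measurableI; first exact: measurable_half.
premeas; apply: (measurable_digits hb)=> //.
apply: bigcap_measurable; first by exists N=> /=.
move=> n _; apply: open_borel; apply: bigcup_open=> w _; exact: cyl_open.
Qed.

(** The neighbouring indices are written [(i + a).-1] with [a < 3], which stays in the naturals at
    the border. *)
Let near_index (x y : R) n : 0 <= x -> 0 <= y -> `|x - y| < b%:R ^- n ->
  exists a : 'I_3, Num.truncn (b%:R ^+ n * y) = (Num.truncn (b%:R ^+ n * x) + a).-1.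
Proof.
move=> x0 y0 xy; set i := Num.truncn _; set j := Num.truncn _.
have bx : 0 <= b%:R ^+ n * x by rewrite mulr_ge0//.
have bb : 0 <= b%:R ^+ n * y by rewrite mulr_ge0//.
have /andP[h1 h2] := truncn_itv bx; have /andP[h3 h4] := truncn_itv bb.
rewrite -/i -/j in h1 h2 h3 h4.
have : `|b%:R ^+ n * x - b%:R ^+ n * y| < 1.
 by rewrite -mulrBr normrM gtr0_norm// -ltr_pdivlMl// mulr1.
rewrite ltr_norml=> /andP[h5 h6].
have ij : (i < j.+2)%N by rewrite -(ltr_nat R); lra.
have ji : (j < i.+2)%N by rewrite -(ltr_nat R); lra.
have a3 : (i.+1 - j < 3)%N by rewrite//; lia.
by exists (Ordinal a3)=> /=; rewrite subnKC.
Qed.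

Let nine (F : set pl) N n : (N <= n)%N -> (diam F < (b%:R ^- n)%:E)%E ->
  exists C : set (borel pl), [/\ measurable C, F `&` light N `<=` C &
    (nu C <= (9 * rho b tau ^+ n)%:E)%E].
Proof.
move=> Nn dF; have [[z0 [Fz0 lz0]]|h0] := pselect (F `&` light N !=set0); last first.
 exists set0; split=> //; first by move=> z hz; apply: h0; exists z.
 by rewrite measure0 lee_fin mulr_ge0// exprn_ge0// ltW// rho_gt0.
have [hz0 _] := lz0; have [i0 j0] := bcube_index b n z0.
pose i0' := Num.truncn (b%:R ^+ n * complex.Re z0); pose j0' := Num.truncn (b%:R ^+ n * complex.Im z0).
pose B (p : 'I_3 * 'I_3) : set (borel pl) := bcube b n ((i0' + p.1).-1, (j0' + p.2).-1) `&` light N.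
have mB p : measurable (B p) by apply: measurableI; [exact: measurable_bcube|exact: measurable_light].
have nB p : fine (nu (B p)) <= rho b tau ^+ n.
 have [[z [zB lz]]|hn] := pselect (B p !=set0); last first.
  rewrite (_ : B p = set0) ?measure0 ?exprn_ge0// ?ltW ?rho_gt0//.
  by apply/seteqP; split=> // z hz; apply: hn; exists z.
 have [[/andP[r1 _] /andP[r2 _]] lz'] := lz.
 have /(bcube_indexP hb n _ r1 r2) e := zB.
 apply: le_trans (lz' n Nn); rewrite e; apply: fine_le.
 - by rewrite fin_num_measure.
 - rewrite fin_num_measure//; exact: measurable_bcube.
 - by apply: le_measure; rewrite ?inE//; [exact: measurable_bcube|exact: subIsetl].
exists (\bigcup_p B p); split.
- by apply: fin_bigcup_measurable=> // p _.
- move=> z [Fz lz]; have [[/andP[r1 _] /andP[r2 _]] _] := lz.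
 have [[/andP[r3 _] /andP[r4 _]] _] := lz0.
 have dz : cdist z0 z < b%:R ^- n by rewrite -lte_fin; apply: le_lt_trans dF; exact: le_diam.
 have [a ha] := near_index r3 r1 (le_lt_trans (le_Re z0 z) dz).
 have [c hc] := near_index r4 r2 (le_lt_trans (le_Im z0 z) dz).
 exists (a, c)=> //; split=> //; apply/(bcube_indexP hb n _ r1 r2).
 by rewrite /bcube_index ha hc.
- have mU : measurable (\bigcup_p B p) by apply: fin_bigcup_measurable=> // p _.
 rewrite -(@fineK _ (nu _)) ?fin_num_measure// lee_fin -Ex_indic//.
 via (\sum_p fine (nu (B p))).
  under eq_bigr do rewrite -Ex_indic//.
  rewrite -Ex_sum=> [|p]; last tame.
  apply: Ex_le; [tame|tame|move=> z].
  rewrite indicE; case: (boolP (z \in _))=> [|_]; last by apply: sumr_ge0=> p _; exact: indic_ge0.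
  rewrite inE=> -[p _ hp]; rewrite (bigD1 p)//= {1}indicE mem_set// lerDl.
  by apply: sumr_ge0=> q _.
 via (\sum_(p : 'I_3 * 'I_3) rho b tau ^+ n); first exact: ler_sum.
 by rewrite sumr_const card_prod !card_ord -[(3 * 3)%N]/9%N mulr_natl.
Qed.

(** The level is chosen by b^-(n+1) <= d < b^-n, whence the factor [(rho b tau)^-1]; the error [e]
    serves a diameter equal to 0, for which the level is just taken large. *)
Let scale (d e t : R) N : 0 <= t < tau -> 0 <= d < b%:R ^- N -> 0 < e ->
  exists n, [/\ (N <= n)%N, d < b%:R ^- n & rho b tau ^+ n <= (rho b tau)^-1 * d `^ t + e].
Proof.
move=> /andP[t0 tt] /andP[d0 dN] e0; have rt : 0 < rho b tau by exact: rho_gt0.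
have bi : 0 <= (b%:R^-1 : R) < 1 by rewrite invr_ge0 ler0n/= invf_lt1 ?ltr1n ?ltr0n.
move: d0; rewrite le_eqVlt=> /predU1P[<-|d0].
 have [M hM] := @expr_small R (rho b tau) e ltac:(by rewrite ltW// rho_lt1// (le_lt_trans t0)) e0.
 exists (maxn N M); split; [exact: leq_maxl|by rewrite invr_gt0|].
 apply: ltW; apply: (lt_le_trans (hM _ (leq_maxr N M))).
 by rewrite lerDr mulr_ge0// invr_ge0 ltW.
have [M hM] := expr_small bi d0.
have ex : exists n, (N <= n)%N && (b%:R ^- n.+1 <= d).
 exists (maxn N M); rewrite leq_maxl/= ltW// -exprVn hM// (leq_trans (leq_maxr N M))//.
pose n := ex_minn ex; exists n.
have [/andP[Nn bn] nmin] : ((N <= n)%N && (b%:R ^- n.+1 <= d)) /\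
  (forall m, (N <= m)%N && (b%:R ^- m.+1 <= d) -> (n <= m)%N) by rewrite /n; case: ex_minnP.
have dn : d < b%:R ^- n.
 move: Nn; rewrite leq_eqVlt=> /predU1P[<- //|Nn].
 rewrite ltNge; apply/negP=> h; have n0 : (0 < n)%N by exact: leq_ltn_trans Nn.
 have := nmin n.-1; rewrite prednK// h andbT -ltnS prednK// => /(_ Nn).
 by rewrite -ltnS prednK// ltnn.
split=> //; via ((rho b tau)^-1 * d `^ t); last by rewrite lerDl ltW.
rewrite ler_pdivlMl// -exprS -rho_exp.
have b1 : b%:R ^- n.+1 <= 1 :> R by rewrite invf_le1// exprn_ege1// ler1n.
via ((b%:R ^- n.+1) `^ t).
 by apply: ger_powR; [rewrite invr_gt0 bnR|exact: ltW].
by apply: ge0_ler_powR=> //; rewrite nnegrE// ltW.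
Qed.

Lemma mass_distribution : {ae nu, forall z, exists N, light N z} -> (tau%:E <= measure_dim nu)%E.
Proof.
move=> hae; apply: le_ereal_inf_tmp=> _ [E [mE E0] <-].
apply: le_ereal_inf_tmp=> _ [t [t0 Ht] <-]; rewrite lee_fin leNgt; apply/negP=> tt.
have rt : 0 < rho b tau by exact: rho_gt0.
have [N N0] : exists N, nu (E `&` light N) != 0%E.
 apply: contrapT=> /forallNP h; move: E0; rewrite lt_neqAle=> /andP[/eqP + _]; apply; apply/esym.
 have h1 : {ae nu, forall z, forall N, ~ (E `&` light N) z}.
  apply: ae_foralln=> N; exists (E `&` light N); split.
  - apply: measurableI=> //; exact: measurable_light.
  - by have /negP := h N; rewrite negbK=> /eqP.
  - by move=> z /contrapT.
 rewrite -(measure0 nu); apply: prob_ae_eq=> //.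
 apply: (ae_mono (ae_and hae h1))=> z [[N lz] hz]; split=> // Ez; exact: (hz N).
have mE' : measurable (E `&` light N) by apply: measurableI=> //; exact: measurable_light.
set m := fine (nu (E `&` light N)).
have m0 : 0 < m by rewrite lt_neqAle fine_ge0// andbT eq_sym fine_eq0// fin_num_measure.
(* The cover will cost 9 e through the Hausdorff sum and 9 e through the error terms, in all m /
   2. *)
pose e := m / 36; have e0 : 0 < e by rewrite divr_gt0.
pose delta : R := b%:R ^- N / 2.
have d0 : 0 < delta by rewrite divr_gt0// invr_gt0.
have dN : delta < b%:R ^- N by rewrite /delta ltr_pdivrMr// ltr_pMr ?invr_gt0// ltr1n.
have P0 : (hausdorff_premeasure t delta E < (rho b tau * e)%:E)%E.
 apply: (@le_lt_trans _ _ 0%E); last by rewrite lte_fin mulr_gt0.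
 by rewrite -Ht; apply: ereal_sup_ubound; exists delta.
have [_ [F [EF dF] <-] sF] := ereal_inf_lt P0.
have hC k : exists C : set (borel pl), [/\ measurable C, F k `&` light N `<=` C &
  (nu C <= (9 * (rho b tau)^-1)%:E * hausdorff_weight t (F k) + (9 * e / (2 ^ k.+1)%:R)%:E)%E].
 have ek : 0 < e / (2 ^ k.+1)%:R by rewrite divr_gt0//.
 have [F0|F0] := eqVneq (F k) set0.
  exists set0; split; rewrite ?F0// measure0 hausdorff_weight0 mule0 add0e lee_fin -mulrA.
  nra.
 have /set0P/diam_ge0 := F0; have := dF k; case eF : (diam (F k))=> [d| |] //.
 rewrite !lee_fin=> dd dd0.
 have td : 0 <= t < tau by rewrite t0.
 have dk : 0 <= d < b%:R ^- N by rewrite dd0 (le_lt_trans dd).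
 have [n [Nn dn hn]] := scale td dk ek.
 have [|C [mC FC nC]] := @nine (F k) N n Nn; first by rewrite eF.
 exists C; split=> //; apply: le_trans nC _.
 rewrite /hausdorff_weight (negbTE F0) eF /= lee_fin.
 rewrite (_ : _ + _ = 9 * ((rho b tau)^-1 * d `^ t + e / (2 ^ k.+1)%:R)); first by rewrite ler_wpM2l.
 set x := _^-1; ring.
pose C k := projT1 (cid (hC k)).
have hC' k : [/\ measurable (C k), F k `&` light N `<=` C k &
  (nu (C k) <= (9 * (rho b tau)^-1)%:E * hausdorff_weight t (F k) + (9 * e / (2 ^ k.+1)%:R)%:E)%E].
 exact: projT2 (cid (hC k)).
have : (nu (E `&` light N) <= \sum_(0 <= k <oo) nu (C k))%E.
 apply: measure_sigma_subadditive=> //; first by move=> k; case: (hC' k).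
 by move=> z [/EF[k _ Fz] lz]; exists k=> //; case: (hC' k)=> _ + _; apply.
have w0 k : (0 <= (9 * (rho b tau)^-1)%:E * hausdorff_weight t (F k))%E.
 by rewrite mule_ge0 ?hausdorff_weight_ge0// lee_fin mulr_ge0// invr_ge0 ltW.
have e9 : 0 <= 9 * e by rewrite mulr_ge0// ltW.
have h1 : (\sum_(0 <= k <oo) nu (C k) <= (9 * (rho b tau)^-1)%:E * (\sum_(0 <= k <oo) hausdorff_weight t (F k)) + (9 * e)%:E)%E.
 rewrite -nneseriesZl; last by move=> k _; exact: hausdorff_weight_ge0.
 apply: le_trans (epsilon_trick xpredT w0 e9).
 by apply: lee_nneseries=> k // _; case: (hC' k).
move=> /le_trans/(_ h1); rewrite leNgt=> /negP; apply.
apply: (@le_lt_trans _ _ ((9 * (rho b tau)^-1)%:E * (rho b tau * e)%:E + (9 * e)%:E)%E).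
 apply: leeD2r; apply: lee_wpmul2l; last exact: ltW.
 by rewrite lee_fin mulr_ge0// invr_ge0 ltW.
rewrite -[ltRHS](@fineK _ (nu _)) ?fin_num_measure// lte_fin -/m.
rewrite -mulrA mulKf ?gt_eqF// /e; lra.
Qed.

End mass_distribution.

(** * Truncated information *)

Section truncated_logarithm.
Context (R : realType).
Implicit Types (K r : R).

Definition eta r : R := - (r * ln r).

(** The information -ln r truncated at height [K]: it is Lipschitz, hence continuous in the code,
    and changes the entropy by at most e^-K per letter. *)
Definition cut K r : R := - ln (Num.max r (expR (- K))).

Let max_gt0 K r : 0 < Num.max r (expR (- K)).
by rewrite lt_max expR_gt0 orbT. Qed.

Let ln_diff (u v c : R) : 0 < c -> c <= v -> v <= u -> ln u - ln v <= (u - v) / c.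
Proof.
move=> c0 cv vu; have v0 : 0 < v by exact: lt_le_trans cv.
have u0 : 0 < u by lra.
have -> : u = v * (1 + (u - v) / v) by field; rewrite gt_eqF.
have h0 : 0 <= (u - v) / v by rewrite divr_ge0 ?subr_ge0// ltW.
rewrite lnM ?posrE//; last by lra.
rewrite [ln v + _]addrC addrK; via ((u - v) / v); first by apply: le_ln1Dx; lra.
have -> : v * (1 + (u - v) / v) - v = u - v by field; rewrite gt_eqF.
by rewrite ler_wpM2l ?subr_ge0// lef_pV2.
Qed.

Lemma cut_lip K r r' : `|cut K r - cut K r'| <= (expR (- K))^-1 * `|r - r'|.
Proof.
wlog h : r r' / r' <= r.
 move=> H; case: (leP r' r)=> [|/ltW]; first tame.
 by move=> /H; rewrite distrC [`|r' - r|]distrC.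
have e0 := expR_gt0 (- K).
set c := expR (- K) in e0 *; rewrite /cut -/c.
have [m1 m2 m3] : [/\ c <= Num.max r' c, Num.max r' c <= Num.max r c &
  Num.max r c - Num.max r' c <= r - r'].
 case: (leP r' c)=> h1; case: (leP r c)=> h2; split; lra.
have m0 : 0 < Num.max r' c by lra.
rewrite -opprB opprK addrC distrC ler0_norm ?opprB.
 rewrite distrC ger0_norm ?subr_ge0// mulrC; apply: (le_trans (ln_diff e0 m1 m2)).
 by rewrite ler_wpM2r// invr_ge0 ltW.
by rewrite subr_le0 ler_ln ?posrE// (lt_le_trans m0 m2).
Qed.

Lemma cut_expR K r : r <= expR (- cut K r).
Proof. by rewrite /cut opprK lnK ?posrE// le_max lexx. Qed.

Lemma eta_ge0 r : 0 <= r <= 1 -> 0 <= eta r.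
Proof. by move=> /andP[r0 r1]; rewrite oppr_ge0 mulr_ge0_le0// ln_le0. Qed.

Lemma cut_eta K r : 0 <= r -> r * cut K r <= eta r <= r * cut K r + expR (- K).
Proof.
rewrite le_eqVlt=> /predU1P[<-|r0]; first by rewrite /eta !mul0r oppr0 add0r lexx expR_ge0.
rewrite /eta -mulrN !(mulrC r).
have [rc|cr] := leP (expR (- K)) r.
 by rewrite /cut (max_idPl rc) lexx lerDl expR_ge0.
rewrite /cut (max_idPr (ltW cr)) expRK opprK.
have h : ln r <= - K by rewrite -(expRK (- K)) ler_ln ?posrE ?expR_gt0// ltW.
apply/andP; split; first by rewrite ler_pM2r//; lra.
have h2 : ln (expR (- K) / r) <= expR (- K) / r - 1.
 have /le_ln1Dx : -1 < expR (- K) / r - 1 by rewrite ltrBrDl subrr divr_gt0// expR_gt0.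
 by rewrite addrC subrK.
rewrite ln_div ?posrE ?expR_gt0// expRK in h2.
have : r * (- K - ln r) <= r * (expR (- K) / r - 1) by rewrite ler_pM2l.
have -> : r * (expR (- K) / r - 1) = expR (- K) - r by field; rewrite gt_eqF.
by nra.
Qed.

Lemma expRN_small (e : R) : 0 < e -> exists2 K, 0 <= K & expR (- K) <= e.
Proof.
move=> e0; exists (Num.max 0 (- ln e)); first by rewrite le_max lexx.
by rewrite -[leRHS](lnK)// ler_expR lerNl le_max lexx orbT.
Qed.

End truncated_logarithm.

(** * Entropy of the digits and decay of weights *)

Section digit_entropy.
Context (R : realType) (D : nat).
Notation digit := ('I_D.+1).
Notation Om := (shift_space D.*2.+1).
Notation Y := (shift_space D).
Notation T := (@tailT D).
Implicit Types (om : Om) (y : Y) (w u : seq digit) (K : R).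

Definition entropy om : R := \sum_(c < D.+1) eta (ratio R om [::] c).

Definition cut_entropy K om : R := \sum_(c < D.+1) ratio R om [::] c * cut K (ratio R om [::] c).

Lemma ucont_cut K c : ucont (fun om : Om => cut K (ratio R om [::] c)).
Proof.
apply: (ucont_lip (g := cut K)); last tame.
exists (expR (- K))^-1=> r r'; exact: cut_lip.
Qed.

Lemma ucont_cut_entropy K : ucont (cut_entropy K).
Proof. by apply: ucont_sum=> c; apply: ucontM; [tame|exact: ucont_cut]. Qed.

Lemma cut_entropy_close K om :
  cut_entropy K om <= entropy om <= cut_entropy K om + D.+1%:R * expR (- K).
Proof.
rewrite /entropy /cut_entropy.
have h (c : digit) := cut_eta K (ratio_ge0 R om [::] c).
apply/andP; split; first by apply: ler_sum=> c _; case/andP: (h c).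
have -> : D.+1%:R * expR (- K) = \sum_(c < D.+1) expR (- K) by rewrite sumr_const card_ord mulr_natl.
rewrite -big_split/=.
by apply: ler_sum=> c _; case/andP: (h c).
Qed.

Lemma ucont_entropy : ucont entropy.
Proof.
apply: ucont_unif=> e e0.
have [K _ Ke] : exists2 K : R, 0 <= K & expR (- K) <= e / D.+1%:R by apply: expRN_small; rewrite divr_gt0.
exists (cut_entropy K)=> [|om]; first exact: ucont_cut_entropy.
have /andP[h1 h2] := cut_entropy_close K om.
rewrite ger0_norm ?subr_ge0// lerBlDl (le_trans h2)// lerD2l.
by rewrite mulrC -ler_pdivlMr.
Qed.

(** A sum over letters, so that continuity holds termwise; one term survives, namely the truncated
    information of the first digit. *)
Definition info K om : R := \sum_(c < D.+1) (xs om 0%N == c)%:R * cut K (ratio R om [::] c).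

Lemma infoE K om : info K om = cut K (ratio R om [::] (xs om 0%N)).
Proof.
rewrite /info (bigD1 (xs om 0%N))//= eqxx mul1r big1 ?addr0// => c /negbTE.
by rewrite eq_sym=> ->; rewrite mul0r.
Qed.

Lemma ucont_letter (g : digit -> R) : ucont (fun om : Om => g (xs om 0%N)).
Proof. by apply: (@ucont_dep _ _ _ 1)=> om om' /prefix_xs/pfxP/(_ 0%N isT) ->. Qed.

Lemma ucont_info K : ucont (info K).
Proof.
apply: ucont_sum=> c; apply: ucontM; last exact: ucont_cut.
exact: (ucont_letter (fun d=> (d == c)%:R)).
Qed.

Lemma cexp_letter (g : Om -> digit -> R) om :
  (forall x y c, g (splice x y) c = g x c) ->
  cexp om (fun x => g x (xs x 0%N)) = \sum_c g om c * ratio R om [::] c.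
Proof.
move=> gd; rewrite /cexp (@Ex_digit_law _ _ om 1); last first.
 by move=> y y' /pfxP/(_ 0%N isT) yy; rewrite /= !gd !xs_splice yy.
rewrite (reindex (fun c : digit=> [tuple c])) /=; last first.
 exists (fun t : 1.-tuple digit=> tnth t ord0)=> [c _|t _]//.
 by case/tupleP: t=> c t; rewrite tuple0.
by apply: eq_bigr=> c _; rewrite gd xs_splice mulr1.
Qed.

Lemma ratio_splice om y u c : ratio R (splice om y) u c = ratio R om u c.
Proof.
have := @wt_samebits R _ _ om u [:: c] (samebits_splice om y).
by rewrite /= !mulr1.
Qed.

Lemma cexp_info K om : cexp om (info K) = cut_entropy K om.
Proof.
rewrite [in LHS](_ : info K = fun x=> (fun x c=> cut K (ratio R x [::] c)) x (xs x 0%N)); last first.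
 by apply/funext=> x; rewrite infoE.
rewrite (cexp_letter (g := fun x c=> cut K (ratio R x [::] c)))=> [|x y c]; last by rewrite ratio_splice.
by apply: eq_bigr=> c _; rewrite mulrC.
Qed.

Lemma ratio_iter n om c : ratio R (iter n T om) [::] c = ratio R om (pfx (xs om) n) c.
Proof. by have := @wt_iter R _ n om [:: c]; rewrite /= !mulr1. Qed.

Definition wtx n om : R := wt R om [::] (pfx (xs om) n).

Lemma wtxS n om : wtx n.+1 om = wtx n om * ratio R (iter n T om) [::] (xs (iter n T om) 0%N).
Proof. by rewrite /wtx pfxS wt_rcons ratio_iter xs_iter addn0. Qed.

Lemma wtx_info K n om : wtx n om <= expR (- bsum T (info K) n om).
Proof.
elim: n=> [|n IH]; first by rewrite /wtx /bsum big_ord0 oppr0 expR0.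
rewrite wtxS /bsum big_ord_recr/= opprD expRD; apply: ler_pM=> //.
- exact: wt_ge0.
- exact: ratio_ge0.
- rewrite infoE; exact: cut_expR.
Qed.

Lemma ucont_wtx n : ucont (wtx n).
Proof.
have uT : ushift T by tame.
elim: n=> [|n IH]; first by rewrite//; exact: ucont_cst.
rewrite (_ : wtx n.+1 = fun om=> wtx n om * ((fun om=> \sum_c (xs om 0%N == c)%:R * ratio R om [::] c) \o iter n T) om).
 apply: ucontM=> //; apply: ucont_comp; last tame.
 apply: ucont_sum=> c; apply: ucontM; last tame.
 exact: (ucont_letter (fun d=> (d == c)%:R)).
apply/funext=> om; rewrite wtxS /=; congr (_ * _).
rewrite (bigD1 (xs (iter n T om) 0%N))//= eqxx mul1r big1 ?addr0// => c /negbTE.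
by rewrite eq_sym=> ->; rewrite mul0r.
Qed.

Definition decaying (s : R) : set (borel Om) :=
  [set om | exists N, forall n, (N <= n)%N -> wtx n om <= expR (- (n%:R * s))].

Lemma measurable_decaying s : measurable (decaying s).
Proof.
rewrite (_ : decaying s = \bigcup_N \bigcap_n
  (if (N <= n)%N then [set om : borel Om | wtx n om <= expR (- (n%:R * s))] else setT)).
 apply: bigcup_measurable=> N _; apply: bigcap_measurable=> [|n _]//.
 case: (N <= n)%N=> //; rewrite -[X in measurable X]setTI.
 have mw : meas_fun (wtx n : borel Om -> R) by case: (ucont_bmf (ucont_wtx n)).
 have := mw measurableT `]-oo, expR (- (n%:R * s))]%classic (measurable_itv _).
 by [].
apply/seteqP; split=> om /=.
 by move=> [N h]; exists N=> // n _; case: (leqP N n)=> // /h.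
by move=> [N _ h]; exists N=> n Nn; have := h n I; rewrite Nn.
Qed.

Section law.
Variable P : probability (borel Om) R.
Hypotheses (TP : preserves T P) (KP : disint P)
  (GP : {ae P, forall om, generic T P om}).

(** The lower half of the Shannon-McMillan-Breiman theorem: truncated information has mean close to
    the entropy, generic points realise this mean, and the weight of a word is at most the
    exponential of minus its summed information. *)
Lemma ae_decaying s : s < Ex P entropy -> {ae P, forall om, decaying s om}.
Proof.
move=> sH; set e := (Ex P entropy - s) / 2.
have e0 : 0 < e by rewrite divr_gt0 ?subr_gt0.
have [K _ Ke] : exists2 K : R, 0 <= K & expR (- K) <= e / D.+1%:R by apply: expRN_small; rewrite divr_gt0.
have bE := ucont_bmf ucont_entropy; have bK := ucont_bmf (ucont_cut_entropy K).
have h : s + e <= Ex P (info K).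
 rewrite KP; last exact: ucont_info.
 rewrite (_ : (fun om=> _) = cut_entropy K); last by apply/funext=> om; exact: cexp_info.
 have : Ex P entropy <= Ex P (fun om=> cut_entropy K om + e).
  apply: Ex_le=> // [|om]; first by apply: bmfD=> //; exact: bmf_cst.
  have /andP[_ /le_trans] := cut_entropy_close K om; apply.
  by rewrite lerD2l mulrC -ler_pdivlMr.
 by rewrite ExD// ?Ex_cst; [rewrite /e; lra|exact: bmf_cst].
apply: (ae_mono GP)=> om gom.
have := gom _ (ucont_info K).
have s1 : s < Ex P (info K) by lra.
move=> /cvgrPdist_lt/(_ (Ex P (info K) - s)); rewrite subr_gt0=> /(_ s1)[N _ hN].
exists N.+1=> n Nn; apply: (le_trans (wtx_info K n om)); rewrite ler_expR lerN2.
have n0 : 0 < n%:R :> R by rewrite ltr0n; exact: leq_ltn_trans Nn.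
have := hN n (ltnW Nn)=> /=; rewrite ltr_norml=> /andP[_]; rewrite /avg=> hh.
rewrite -(ler_pM2l (_ : 0 < n%:R^-1)) ?invr_gt0// mulrA mulVf; lra.
Qed.

End law.
End digit_entropy.

Section chain_dimension.
Context (R : realType) (b : nat).
Hypothesis hb : (1 < b)%N.
Notation half := (half_open_square R).
Notation SP := (square_prob R).
Notation D := (b ^ 2).-1.
Notation Om := (shift_space D.*2.+1).
Notation Y := (shift_space D).
Notation T := (@tailT D).
Notation Phi := (@Phi R b hb).
Notation good := (@good R b).
Implicit Types (om : Om) (y : Y).

Lemma kap_decaying om s : kap R om (decaying s) = 1%E ->
  {ae digit_law R om, forall y, exists N, forall n, (N <= n)%N ->
     wt R om [::] (pfx y n) <= expR (- (n%:R * s))}.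
Proof.
rewrite /kap pushPE=> k1.
have m1 : measurable (splice om @^-1` decaying s : set (borel Y)).
 premeas; apply: measurable_splice=> //; exact: measurable_decaying.
apply: (ae_mono (prob1_ae m1 k1))=> y [N h]; exists N=> n /h.
by rewrite /wtx xs_splice (wt_samebits _ _ _ (samebits_splice om y)).
Qed.

Lemma kap_decaying_eqwt om om' s : (forall w, wt R om [::] w = wt R om' [::] w) ->
  kap R om (decaying s) = kap R om' (decaying (s : R)).
Proof.
move=> ww; have m1 om1 : measurable (splice om1 @^-1` decaying s : set (borel Y)).
 premeas; apply: measurable_splice=> //; exact: measurable_decaying.
rewrite /kap !pushPE (digit_law_eqwt ww)//; congr (digit_law R om' _).
apply/seteqP; split=> y /= [N h]; exists N=> n /h; rewrite /wtx !xs_splice.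
 by rewrite !(wt_samebits _ _ _ (samebits_splice _ y)) ww.
by rewrite !(wt_samebits _ _ _ (samebits_splice _ y)) ww.
Qed.

Lemma rho_expR s n : rho b (s / ln b%:R) ^+ n = expR (- (n%:R * s)) :> R.
Proof.
have b1 : 1 < b%:R :> R by rewrite ltr1n.
have b0 : 0 < b%:R :> R by lra.
have l0 : ln b%:R != 0 :> R by rewrite gt_eqF// ln_gt0.
rewrite /rho /powR invr_eq0 gt_eqF//= lnV// -expRM_natl.
by congr expR; rewrite mulrN divfK// mulrN.
Qed.

Lemma dim_Phi om (s : R) : good om -> kap R om (decaying s) = 1%E ->
  ((s / ln b%:R)%:E <= measure_dim (Phi om))%E.
Proof.
move=> gom /kap_decaying k1; have md := @mass_distribution R b hb (square_law (Phi om)) (s / ln b%:R).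
suff : {ae Phi om, forall z, exists N, light b (Phi om) (s / ln b%:R) N z} by exact: md.
set A : set (borel (plane R)) := \bigcup_N light b (Phi om) (s / ln b%:R) N.
have mA : measurable A by apply: bigcup_measurable=> N _; exact: measurable_light.
suff A1 : Phi om A = 1%E by apply: (ae_mono (prob1_ae mA A1))=> z [N _ h]; exists N.
rewrite PhiE; apply: prob_ae1.
 by premeas; apply: measurable_pt.
apply: (ae_mono (ae_and k1 gom))=> y [[N h] gy]; exists N=> //.
have hy := half_pt hb gy; split=> // n /h.
rewrite rho_expR (bcube_index_digits hb _ hy) gy.
have := Phi_bcube hb (pfx y n) gom; rewrite size_pw=> ->.
by [].
Qed.

Variable P : probability (borel Om) R.
Hypotheses (TP : preserves T P) (KP : disint P) (gP : {ae P, forall om, good om})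
  (GP : {ae P, forall om, generic T P om}).

(** Decay of weights at rate [s] gives dimension at least [s / ln b%:R]. The event is expressed
    through [codem] so as to be a Borel set of measures; for negative [s] the bound 0 is used. *)
Lemma chain_dim_ge s : s < Ex P (@entropy R D) -> ((s / ln b%:R)%:E <= cp_dim (component_law hb P))%E.
Proof.
move=> sH; set V : set (borel SP) := [set nu : SP | nu half = 1%E] `&`
 [set nu : SP | kap R (codem b nu) (decaying s) = 1%E].
have mk := (disint_measurable KP (@measurable_decaying R D s)).1.
have mV : measurable V.
 apply: measurableI; first exact: measurable_half_eval.
 have := measurableT_comp mk (@measurable_codem R b) measurableT (emeasurable_set1 1).
 by rewrite setTI.
have V1 : component_law hb P V = 1%E.
 rewrite /component_law pushPE; apply: prob_ae1.
  by premeas; apply: measurable_Phi.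
 apply: (ae_mono (ae_and gP (ae_fibre KP (ae_decaying KP GP sH))))=> om [gom kom].
 have h1 := Phi_half hb gom; split=> //=.
 rewrite (@kap_decaying_eqwt _ om)=> [|w]; last first.
  by rewrite (codem_wt hb h1) /cell_weight (Phi_bcube hb _ gom).
 apply: prob_ae1=> //; exact: measurable_decaying.
have s0 : (0 <= Num.max s 0) by rewrite le_max lexx orbT.
have l0 : 0 < ln b%:R :> R by rewrite ln_gt0// ltr1n.
have dim0 (nu : SP) : (0 <= measure_dim nu)%E.
 apply: le_ereal_inf_tmp=> _ [E _ <-]; apply: le_ereal_inf_tmp=> _ [t [t0 _] <-].
 by [].
apply: (@le_trans _ _ (Num.max s 0 / ln b%:R)%:E).
 by rewrite lee_fin ler_pM2r ?invr_gt0// le_max lexx.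
rewrite /cp_dim.
have -> : ((Num.max s 0 / ln b%:R)%:E = \int[component_law hb P]_nu (Num.max s 0 / ln b%:R)%:E)%E.
 have ic := @integral_cst _ _ _ (component_law hb P) _ measurableT (Num.max s 0 / ln b%:R)%:E.
 by rewrite [RHS]ic [X in (_ * X)%E]probability_setT mule1.
apply: (@integral_mono_ae _ _ _ _ (~` V))=> //.
- exact: measurableC.
- by have h := probability_setC (component_law hb P) mV; rewrite [LHS]h [X in (_ - X)%E]V1 subee.
- by move=> nu; rewrite lee_fin divr_ge0// ltW.
move=> nu /contrapT[nuh ks]; case: (leP s 0)=> s00; first by rewrite mul0r.
rewrite -(sim_dim (Phi_codem hb nuh)); apply: dim_Phi=> //.
exact: (codem_good hb nuh).
Qed.

End chain_dimension.

(** * Translates of a measure *)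

Section counting.

(** The condition holds on runs of [q] consecutive integers, one per period [q * Q]; an interval of
    length [W] meets at most [W %/ (q * Q) + 2] periods. A solution is determined by its period and
    its remainder modulo [q]. *)
Lemma residue_count (W m q Q v : nat) : (0 < q)%N -> (0 < Q)%N ->
  (\sum_(j < W) ((((m + j) %/ q) %% Q) == v) <= (W %/ (q * Q) + 2) * q)%N.
Proof.
move=> q0 Q0; set L := (q * Q)%N; have L0 : (0 < L)%N by rewrite muln_gt0 q0.
have -> : (\sum_(j < W) ((((m + j) %/ q) %% Q) == v) = #|[set j : 'I_W | (((m + j) %/ q) %% Q)%N == v]%SET|)%N.
 by rewrite -sum1dep_card [RHS]big_mkcond /=; apply: eq_bigr=> j _; case: (_ == v).
set K := (W %/ L + 2)%N.
have i_lt (j : 'I_W) : ((m + j) %/ L - m %/ L < K)%N.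
 have h1 : (m + j < (m %/ L).+1 * L + (W %/ L).+1 * L)%N.
  by apply: (@leq_trans ((m %/ L).+1 * L + j)); [rewrite -addSn leq_add2r ltn_ceil|rewrite leq_add2l ltnW// (ltn_trans (ltn_ord j))// ltn_ceil].
 rewrite -mulnDl -ltn_divLR// in h1; rewrite /K; lia.
pose g (j : 'I_W) : 'I_K * 'I_q := (Ordinal (i_lt j), Ordinal (ltn_pmod (m + j) q0)).
rewrite -[X in (_ <= X)%N]/(K * q)%N -[X in (_ <= X * _)%N]card_ord -[X in (_ <= _ * X)%N]card_ord -card_prod.
apply: (@leq_card_in _ _ g)=> j j'; rewrite !inE=> /eqP hj /eqP hj' [h1 h2].
have hm (x : 'I_W) : (m %/ L <= (m + x) %/ L)%N by rewrite leq_div2r// leq_addr.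
have h3 : ((m + j) %/ L = (m + j') %/ L)%N by rewrite -(subnK (hm j)) h1 subnK.
have dd (x : 'I_W) : ((m + x) %/ L = ((m + x) %/ q) %/ Q)%N by rewrite divnMA.
have : (m + j = m + j')%N.
 rewrite (divn_eq (m + j) q) (divn_eq (m + j') q) h2; congr (_ * _ + _)%N.
 by rewrite (divn_eq ((m + j) %/ q) Q) (divn_eq ((m + j') %/ q) Q) hj hj' -!dd h3.
move/addnI=> jj; exact: val_inj.
Qed.

Section real_counting.
Context (R : realType) (b : nat).
Hypothesis hb : (1 < b)%N.
Let b0 : (0 < b)%N. lia. Qed.
Let bR : 0 < b%:R :> R. by rewrite ltr0n. Qed.

Lemma truncn_divn (x : R) q : 0 <= x -> (0 < q)%N -> Num.truncn (x / q%:R) = (Num.truncn x %/ q)%N.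
Proof.
move=> x0 q0; have qR : 0 < q%:R :> R by rewrite ltr0n.
have /andP[h1 h2] := truncn_itv x0.
apply: truncn_def; rewrite ler_pdivlMr// ltr_pdivrMr// -!natrM; apply/andP; split.
 by apply: le_trans h1; rewrite ler_nat leq_trunc_div.
by apply: (lt_le_trans h2); rewrite ler_nat -ltn_divLR.
Qed.

Lemma truncn_addn (x : R) j : 0 <= x -> Num.truncn (x + j%:R) = (Num.truncn x + j)%N.
Proof.
move=> x0; have /andP[h1 h2] := truncn_itv x0; apply: truncn_def.
lra.
Qed.

Fixpoint repeated (c k : nat) : nat := if k is k'.+1 then (repeated c k' * b + c)%N else 0%N.

Lemma bdig_block (x : R) n c k : 0 <= x -> (c < b)%N ->
  (forall l, (l < k)%N -> bdig b x (n + l) = c) ->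
  (Num.truncn (b%:R ^+ (n + k) * x) %% b ^ k = repeated c k)%N.
Proof.
move=> x0 cb; elim: k=> [|k IH] h; first by rewrite modn1.
have h1 := IH (fun l lk=> h l (ltnW lk)); have := h k (leqnn _).
rewrite /bdig -addnS=> h2; rewrite /= -h1.
have tn : Num.truncn (b%:R ^+ (n + k) * x) = (Num.truncn (b%:R ^+ (n + k.+1) * x) %/ b)%N.
 by rewrite addnS exprS -mulrA truncn_div// mulr_ge0//.
set s := Num.truncn _ in h2 tn *; rewrite tn.
rewrite {1}(divn_eq s b) {1}(divn_eq (s %/ b) (b ^ k)) h2 mulnDl -addnA -mulnA -expnSr modnMDl modn_small//.
rewrite expnSr; apply: (@leq_trans ((s %/ b %% b ^ k).+1 * b)).
 lia.
by rewrite leq_mul2r ltn_mod expn_gt0 b0 orbT.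
Qed.

(** A run of [k] digits [c] from place [n] prescribes a residue modulo [b ^ k] of the integer part
    at level [n + k], while the translations advance the integer part at level [P] one by one. *)
Lemma digit_run_count (x : R) P W n c k : 0 <= x -> (n + k <= P)%N -> (c < b)%N ->
  (\sum_(j < W) [forall l : 'I_k, bdig b (x + j%:R / b%:R ^+ P) (n + l) == c]
     <= (W %/ b ^ (P - n) + 2) * b ^ (P - n - k))%N.
Proof.
move=> x0 nkP cb; set q := (b ^ (P - n - k))%N.
have q0 : (0 < q)%N by rewrite expn_gt0 b0.
have bk0 : (0 < b ^ k)%N by rewrite expn_gt0 b0.
have qQ : (q * b ^ k = b ^ (P - n))%N by rewrite -expnD subnK//; lia.
rewrite -qQ; set m := Num.truncn (b%:R ^+ P * x).
apply: leq_trans (residue_count W m (repeated c k) q0 bk0).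
apply: leq_sum=> j _; case: forallP=> //= h.
have xj : 0 <= x + j%:R / b%:R ^+ P by rewrite addr_ge0//////.
have := @bdig_block (x + j%:R / b%:R ^+ P) n c k xj cb (fun l lk=> eqP (h (Ordinal lk))).
have Px : 0 <= b%:R ^+ P * x by rewrite mulr_ge0////.
have -> : b%:R ^+ (n + k) * (x + j%:R / b%:R ^+ P) = (b%:R ^+ P * x + j%:R) / q%:R.
 have bP (i : nat) : b%:R ^+ i != 0 :> R by rewrite expf_neq0// gt_eqF.
 have -> : b%:R ^+ P = b%:R ^+ (n + k) * q%:R :> R by rewrite /q natrX -exprD; congr (_ ^+ _); lia.
 by rewrite /q natrX; field; rewrite !bP.
rewrite truncn_divn ?addr_ge0// truncn_addn// -/m=> ->.
lia.
Qed.

Lemma digit_run_bound (x : R) N n c k P W : 0 <= x -> (n < N)%N -> (k <= N)%N -> (c < b)%N ->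
  P = (N * 2).+1 -> W = (b ^ P - b ^ P.-1)%N -> (\sum_(j < W) [forall l : 'I_k, bdig b (x + j%:R / b%:R ^+ P) (n + l) == c])%:R / W%:R <= (6 / b%:R ^+ k : R).
Proof.
move=> x0 nN kN cb PE WE.
have nkP : (n + k <= P)%N by rewrite PE; lia.
have W0 : (0 < W)%N by rewrite WE subn_gt0 ltn_exp2l// PE.
(* The offsets fill at least half of the unit interval, so [W + 2 * b ^ P] is at most [6 * W]. *)
have WP : (b ^ P <= 2 * W)%N.
 rewrite WE PE /= expnS; have : (0 < b ^ (N * 2))%N by rewrite expn_gt0 b0.
 by case: b hb=> [|[|b']] // _; nia.
rewrite ler_pdivrMr ?ltr0n// mulrAC ler_pdivlMr ?exprn_gt0//.
suff : ((\sum_(j < W) [forall l : 'I_k, bdig b (x + j%:R / b%:R ^+ P) (n + l) == c]) * b ^ k <= 6 * W)%N.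
 by rewrite -(ler_nat R) !natrM natrX.
apply: (@leq_trans ((W %/ b ^ (P - n) + 2) * b ^ (P - n - k) * b ^ k)).
 by rewrite leq_mul2r digit_run_count// orbT.
have e1 : (b ^ (P - n - k) * b ^ k = b ^ (P - n))%N by rewrite -expnD subnK//; lia.
rewrite -mulnA e1 mulnDl; apply: (@leq_trans (W + 2 * b ^ P)).
 by rewrite leq_add ?leq_trunc_div// leq_mul2l leq_pexp2l// leq_subr.
lia.
Qed.

End real_counting.
End counting.

(** * Shrunken translates of a measure and their entropy *)

Section translated_family.
Context (R : realType) (b : nat).
Hypothesis hb : (1 < b)%N.
Notation pl := (plane R).
Notation X := (closed_square R).
Notation half := (half_open_square R).
Notation D := (b ^ 2).-1.
Notation digit := ('I_D.+1).
Notation Om := (shift_space D.*2.+1).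
Notation Y := (shift_space D).
Notation T := (@tailT D).
Notation digits := (@digits R b).
Implicit Types (om : Om) (y : Y) (w : seq digit).

Variable mu : probability (borel pl) R.
Hypothesis muX : mu X = 1%E.

Let b0 : (0 < b)%N. lia. Qed.
Let bR : 0 < b%:R :> R. by rewrite ltr0n. Qed.
Let bnR n : 0 < b%:R ^+ n :> R. exact: exprn_gt0. Qed.

(** Number of offsets of step b^-(2N+1) in [0, 1 - 1/b), the room left by a square shrunk to side
    1/b. The step is fine enough for every run of length at most [N] that starts before place
    [N]. *)
Definition width N : nat := b ^ (N * 2).+1 - b ^ (N * 2).

Lemma width_gt0 N : (0 < width N)%N.
Proof. by rewrite subn_gt0 ltn_exp2l. Qed.

Definition offset N : finType := ('I_(width N) * 'I_(width N))%type.

Definition shrinkR N (x : R) (j : nat) : R := clampR x / b%:R + j%:R / b%:R ^+ (N * 2).+1.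

Lemma shrinkR_itv N x (j : 'I_(width N)) : 0 <= shrinkR N x j < 1.
Proof.
have /andP[c0 c1] := clampR_itv x.
have h0 : 0 <= clampR x / b%:R by rewrite divr_ge0//.
have h1 : clampR x / b%:R <= b%:R^-1 by rewrite ler_pdivrMr// mulVf ?gt_eqF.
have h2 : j%:R / b%:R ^+ (N * 2).+1 < 1 - b%:R^-1 :> R.
 rewrite ltr_pdivrMr// mulrBl mul1r exprS mulrA mulVf ?gt_eqF// mul1r -exprS -!natrX -natrB ?ltr_nat//.
 by rewrite leq_exp2l.
have h3 : 0 <= j%:R / b%:R ^+ (N * 2).+1 :> R by [].
rewrite /shrinkR//=; lra.
Qed.

Definition shrink N (t : offset N) (z : pl) : pl :=
  complex.Complex (shrinkR N (complex.Re z) t.1) (shrinkR N (complex.Im z) t.2).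

Lemma shrink_half N t z : half (@shrink N t z).
Proof. by split; exact: shrinkR_itv. Qed.

Let shrinkR_sub N x x' j : shrinkR N x j - shrinkR N x' j = (clampR x - clampR x') / b%:R.
by rewrite /shrinkR opprD addrACA subrr addr0 mulrBl. Qed.

Lemma shrink_continuous N (t : offset N) : continuous (shrink t).
Proof.
apply: (@lip_continuous _ _ 2)=> z w; apply: (le_trans (cdist_le _ _))=> /=.
have h (x x' : R) : `|shrinkR N x 0 - shrinkR N x' 0| <= `|x - x'|.
 rewrite shrinkR_sub normrM normfV (gtr0_norm bR) ler_pdivrMr//.
 apply: (le_trans (clampR_lip x x')); rewrite ler_peMr// ler1n //.
by rewrite !shrinkR_sub -(shrinkR_sub N _ _ 0) -(shrinkR_sub N (complex.Im z) _ 0) mulr_natl lerD// (le_trans (h _ _))// ?le_Re ?le_Im.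
Qed.

Definition gdig N (t : offset N) z : Y := digits (shrink t z).

Lemma measurable_gdig N (t : offset N) : meas_fun (gdig t : borel pl -> borel Y).
Proof.
apply: (@measurableT_comp _ _ _ (borel pl) (borel pl) (borel Y) (digits : borel pl -> borel Y)).
 exact: measurable_digits.
apply: continuous_borel; exact: shrink_continuous.
Qed.

Lemma gdig_close N (t : offset N) n z z' : X z -> X z' ->
  pfx (gdig t z) n = pfx (gdig t z') n -> cdist z z' <= 4 * b%:R * b%:R ^- n.
Proof.
move=> Xz Xz' /(pt_close R hb); rewrite !pt_digits//; try exact: shrink_half.
move=> h; apply: (le_trans (cdist_le z z')).
have [z1 z2] := Xz; have [z1' z2'] := Xz'.
have hr (x x' : R) (j : nat) : 0 <= x <= 1 -> 0 <= x' <= 1 -> `|x - x'| = b%:R * `|shrinkR N x j - shrinkR N x' j|.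
 move=> hx hx'; rewrite shrinkR_sub !clampR_id// normrM normfV (gtr0_norm bR).
 by rewrite mulrC divfK// gt_eqF.
rewrite (hr _ _ t.1 z1 z1') (hr _ _ t.2 z2 z2') -mulrDr.
have := le_trans (le_Re (shrink t z) (shrink t z')) h; have := le_trans (le_Im (shrink t z) (shrink t z')) h.
move=> /= h1 h2; rewrite [4 * _]mulrC -mulrA ler_pM2l//; lra.
Qed.

Definition fam_code N (t : offset N) : Om := code (fun w => fine (mu (gdig t @^-1` cyl w))).

Let mgcyl N (t : offset N) w : measurable (gdig t @^-1` cyl w : set (borel pl)).
by premeas; apply: measurable_gdig=> //; exact: cylM. Qed.

Lemma fam_wt N (t : offset N) w : wt R (fam_code t) [::] w = fine (mu (gdig t @^-1` cyl w)).
Proof.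
rewrite /fam_code code_wt// => [u||u]; first by rewrite fine_ge0.
 by rewrite cyl_nil probability_setT.
have := cyl_children (pushP mu (measurable_gdig t)) u; rewrite pushPE=> ->.
by apply: eq_bigr=> c _; rewrite pushPE.
Qed.

Lemma fam_law N (t : offset N) (E : set (borel Y)) : measurable E ->
  digit_law R (fam_code t) E = mu (gdig t @^-1` E).
Proof.
move=> mE; rewrite -(pushPE mu (measurable_gdig t)).
apply: shift_measure_unique=> // [|w]; first by have := prob_ltoo (digit_law R (fam_code t)).
have h := digit_lawE R (fam_code t) w; rewrite [LHS]h fam_wt [RHS]pushPE (@fineK _ (mu _))// ge0_fin_numE//.
by apply: (le_lt_trans (probability_le1 mu (mgcyl t w))); rewrite ltey.
Qed.

Lemma fam_cexp N (t : offset N) (F : Om -> R) : ucont F ->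
  cexp (fam_code t) F = Ex mu (fun z => F (splice (fam_code t) (gdig t z))).
Proof.
move=> uF; rewrite /cexp.
rewrite -(@Ex_push _ _ _ _ _ mu _ (gdig t : borel pl -> borel Y)) //.
- exact: measurable_gdig.
- move=> E mE; exact: fam_law.
- tame.
Qed.

Definition fam N : seq Om := [seq fam_code t | t <- enum (offset N)].

Lemma size_fam N : size (fam N) = (width N * width N)%N.
Proof. by rewrite size_map -cardE card_prod !card_ord. Qed.

Lemma size_fam_gt0 N : (0 < size (fam N))%N.
Proof. by rewrite size_fam muln_gt0 width_gt0. Qed.

Lemma lam_fam N F : lam (R := R) fam N F =
  (width N * width N)%:R^-1 * \sum_(t : offset N) cexp (fam_code t) (avg T F N).
Proof. by rewrite /lam size_fam big_map big_enum. Qed.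

Definition coord (e : bool) : digit -> nat := if e then @dre b else @dim b.

Definition run (e : bool) (c : 'I_b) k om : R := [forall l : 'I_k, coord e (xs om l) == c]%:R.

Lemma ucont_run e c k : ucont (run e c k).
Proof.
apply: (@ucont_dep _ _ _ k)=> om om' /prefix_xs/pfxP h; rewrite /run; congr (_%:R); congr nat_of_bool.
by apply: eq_forallb=> l; rewrite h.
Qed.

Lemma run_ge0 e c k om : 0 <= run e c k om.
Proof. by []. Qed.

Let coordR (e : bool) (z : pl) : R := if e then complex.Re z else complex.Im z.
Let coordI N (e : bool) (t : offset N) : 'I_(width N) := if e then t.1 else t.2.

Let coord_gdig e N (t : offset N) z n :
  coord e (gdig t z n) = bdig b (shrinkR N (coordR e z) (coordI e t)) n.
Proof.
rewrite /gdig /digits; case: asboolP=> [_|[]]; last exact: shrink_half.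
by case: e=> /=; [rewrite dre_mkd ?bdig_lt|rewrite dim_mkd ?bdig_lt].
Qed.

Let sum_coordI e N (g : 'I_(width N) -> R) :
  \sum_(t : offset N) g (coordI e t) = (width N)%:R * \sum_j g j.
Proof.
transitivity (\sum_(i < width N) \sum_(j < width N) g (if e then i else j)); first by rewrite pair_bigA.
case: e=> /=; last by rewrite sumr_const card_ord mulr_natl.
rewrite mulr_sumr; apply: eq_bigr=> i _; by rewrite sumr_const card_ord mulr_natl.
Qed.

Lemma run_iter e c k n om y :
  run e c k (iter n T (splice om y)) = [forall l : 'I_k, coord e (y (n + l)%N) == c]%:R.
Proof.
rewrite /run; congr (_%:R); congr nat_of_bool; apply: eq_forallb=> l.
by rewrite xs_iter xs_splice.
Qed.

Lemma lam_run e c k N : (k <= N)%N -> (0 < N)%N -> lam fam N (run e c k) <= 6 / b%:R ^+ k.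
Proof.
move=> kN N0; rewrite lam_fam.
have ua : ucont (avg T (run e c k) N) by apply: ucont_avg; [tame|exact: ucont_run].
have W0 : 0 < (width N)%:R :> R by rewrite ltr0n width_gt0.
under eq_bigr do rewrite fam_cexp//.
have bm (t : offset N) : bmf (fun z : borel pl=> avg T (run e c k) N (splice (fam_code t) (gdig t z))).
 have [m1 [K hK]] := ucont_bmf (ucont_splice (fam_code t) ua).
 by split; [exact: (measurableT_comp m1 (measurable_gdig t))|exists K=> z; exact: hK].
rewrite -Ex_sum// -ExZ; last tame.
rewrite -[leRHS](Ex_cst mu); apply: Ex_le; [tame|tame|move=> z /=].
have hs (n : 'I_N) : \sum_(t : offset N) run e c k (iter n T (splice (fam_code t) (gdig t z))) <=
  (width N * width N)%:R * (6 / b%:R ^+ k).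
 via ((width N)%:R * \sum_(j < width N) [forall l : 'I_k, bdig b (shrinkR N (coordR e z) j) (n + l) == c]%:R).
  rewrite -(sum_coordI e (fun j : 'I_(width N)=> [forall l : 'I_k, bdig b (shrinkR N (coordR e z) j) (n + l) == c]%:R)) le_eqVlt; apply/orP; left; apply/eqP; apply: eq_bigr=> t _.
  by rewrite run_iter; congr (_%:R); congr nat_of_bool; apply: eq_forallb=> l; rewrite coord_gdig.
 rewrite natrM -mulrA ler_pM2l// mulrC -ler_pdivrMr// -natr_sum.
 have /andP[c0 _] := clampR_itv (coordR e z).
 apply: (@digit_run_bound _ _ hb (clampR (coordR e z) / b%:R) N n c k (N * 2).+1 (width N))=> //.
 by rewrite divr_ge0//.
rewrite /avg /bsum -mulr_sumr exchange_big/= mulrCA ler_pdivrMl ?ltr0n//.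
rewrite ler_pdivrMl ?ltr0n ?muln_gt0 ?width_gt0//.
via (\sum_(n < N) (width N * width N)%:R * (6 / b%:R ^+ k)); first by apply: ler_sum=> n _.
by rewrite sumr_const card_ord -[leLHS]mulr_natl [leLHS]mulrCA.
Qed.

Definition word_entropy N om : R := \sum_(w : N.-tuple digit) eta (wt R om [::] w).

Lemma rcons_reindex n (g : seq digit -> R) :
  \sum_(w : n.+1.-tuple digit) g w = \sum_(w : n.-tuple digit) \sum_(c : digit) g (rcons w c).
Proof.
rewrite pair_bigA/= (reindex (fun p : n.-tuple digit * digit=> [tuple of rcons p.1 p.2]))//=.
apply: onW_bij; apply: inj_card_bij.
 by move=> [w c] [w' c'] /(congr1 val)/= /rcons_inj[/val_inj -> ->].
by rewrite card_prod !card_tuple -expnSr.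
Qed.

Lemma eta_mul (x y : R) : 0 <= x -> 0 <= y -> eta (x * y) = x * eta y + eta x * y.
Proof.
rewrite le_eqVlt=> /predU1P[<-|x0]; first by rewrite /eta !mul0r oppr0 mul0r addr0.
rewrite le_eqVlt=> /predU1P[<-|y0]; first by rewrite /eta !(mul0r, mulr0) oppr0 mulr0 addr0.
rewrite /eta lnM//; ring.
Qed.

Lemma entropy_samebits om om' : samebits om om' -> entropy R om = entropy R om'.
Proof.
move=> h; apply: eq_bigr=> c _; congr eta.
by have := @wt_samebits R _ om om' [::] [:: c] h; rewrite /= !mulr1.
Qed.

Lemma word_entropyS n om :
  word_entropy n.+1 om = word_entropy n om + cexp om (fun x => entropy R (iter n T x)).
Proof.
have uE : ucont (fun x : Om=> entropy R (iter n T x)).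
 by apply: ucont_comp; [exact: ucont_entropy|tame].
rewrite (@cexp_depth _ _ n)//; last first.
 move=> x y y' yy; apply: entropy_samebits; apply: samebits_iter; rewrite ?xs_splice//.
 by move=> i; rewrite !bits_splice.
rewrite /word_entropy (rcons_reindex n (fun w=> eta (wt R om [::] w))) -big_split/=; apply: eq_bigr=> w _.
under eq_bigr do rewrite wt_rcons eta_mul ?wt_ge0 ?ratio_ge0//.
rewrite big_split/= -mulr_sumr -mulr_sumr ratio_sum mulr1 addrC; congr (_ + _); rewrite mulrC; congr (_ * _).
apply: eq_bigr=> c _; congr eta; rewrite ratio_iter xs_splice prefix_ext_tuple.
by rewrite ratio_splice.
Qed.

Lemma word_entropyE N om : word_entropy N om = cexp om (bsum T (@entropy R D) N).
Proof.
have ui n : ucont (fun x : Om=> entropy R (iter n T x)).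
 by apply: ucont_comp; [exact: ucont_entropy|tame].
have [mA _ _] := mean_cexp R om.
elim: N=> [|n IH].
 rewrite (_ : bsum _ _ _ = cst 0); last by apply/funext=> x; rewrite /bsum big_ord0.
 rewrite (mean0 (mean_cexp R om)) /word_entropy big1// => w _.
 by rewrite tuple0 /= /eta ln1 mulr0 oppr0.
rewrite word_entropyS IH -mA//; last by rewrite /bsum; apply: ucont_sum=> i.
by congr (cexp om _); apply/funext=> x; rewrite /bsum big_ord_recr.
Qed.

(** Words of weight below [r] carry information at least [- ln r], and the other terms of the
    entropy are nonnegative. *)
Lemma word_entropy_ge N om (r : R) : 0 < r < 1 ->
  - ln r * (Ex (digit_law R om) (fun y => (wt R om [::] (pfx y N) < r)%R%:R)) <= word_entropy N om.
Proof.
move=> /andP[r0 r1]; rewrite (@Ex_digit_law _ _ om N)=> [|y y' ->]//.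
rewrite mulr_sumr; apply: ler_sum=> w _; rewrite prefix_ext_tuple.
have w0 := wt_ge0 R om [::] w; have w1 := wt_le1 R om [::] w.
case: ltP=> h; last by rewrite mul0r mulr0 eta_ge0// w0.
rewrite mul1r /eta mulNr lerN2 mulrC.
move: w0; rewrite le_eqVlt=> /predU1P[<-|w0]; first by rewrite !mulr0.
by rewrite ler_pM2r// ler_ln// ltW.
Qed.

(** By the chain rule, one-step entropies averaged over [N] times make up 1/N of the entropy of
    words of length [N]; outside heavy cells every word has weight below [rho b s ^+ N]. *)
Lemma lam_entropy (s e : R) : 0 <= s -> (s%:E < measure_dim mu)%E -> 0 < e ->
  \forall N \near \oo, s * ln b%:R * (1 - e) <= lam fam N (@entropy R D).
Proof.
move=> s0 sdim e0.
have o0 N : (0 < width N)%N by exact: width_gt0.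
pose t0 N : offset N := (Ordinal (o0 N), Ordinal (o0 N)).
have key (g : nat -> pl -> Y) (gf : forall N, exists t : offset N, g N = gdig t) :
  fine (mu (heavy mu g s N)) @[N --> \oo] --> 0.
 apply: (@heavy_small _ _ hb _ _ (4 * b%:R))=> // N.
  have [t ->] := gf N; exact: measurable_gdig.
 have [t ->] := gf N=> z z'; exact: gdig_close.
(* For each [N] a bad offset is taken if one exists; [heavy_small] along this choice shows that none
   exists for large [N]. *)
pose bad N : set (offset N) := [set t | e <= fine (mu (heavy mu (fun=> gdig t) s N))].
pose g N := gdig (xget (t0 N) (bad N)).
have /cvgrPdist_lt/(_ e e0)[N0 _ hN] := key g (fun N=> ex_intro _ _ erefl).
have nb N : (N0 <= N)%N -> forall t : offset N, ~ bad N t.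
 move=> /hN /= h t bt; have : bad N (xget (t0 N) (bad N)) by apply: xgetPex; exists t.
 rewrite /bad /=; move: h; rewrite sub0r normrN ger0_norm ?fine_ge0// => h.
 lra.
exists (maxn N0 1)=> // N /=; rewrite geq_max=> /andP[N0N N1].
rewrite lam_fam ler_pdivlMl ?ltr0n ?muln_gt0 ?width_gt0//.
have -> : (width N * width N)%:R = #|offset N|%:R :> R by rewrite card_prod !card_ord.
rewrite mulr_natl -sumr_const; apply: ler_sum=> t _.
have [_ mZ _] := mean_cexp R (fam_code t).
rewrite /avg mZ; last first.
 by rewrite /bsum; apply: ucont_sum=> i; apply: ucont_comp; [exact: ucont_entropy|tame].
rewrite -word_entropyE ler_pdivlMl ?ltr0n//.
have [->|sN0] := eqVneq s 0.
 by rewrite !mul0r mulr0; apply: sumr_ge0=> w _; apply: eta_ge0; rewrite wt_ge0 wt_le1.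
have {s0 sN0} s0 : 0 < s by lra.
have r0 := rho_gt0 s b0 : 0 < rho b s :> R.
have r1 := rho_lt1 hb s0 : rho b s < 1 :> R.
apply: le_trans (word_entropy_ge N (fam_code t) (r := rho b s ^+ N) _); last first.
 by rewrite exprn_gt0//= exprn_ilt1// ?ltW// -lt0n.
have -> : - ln (rho b s ^+ N) = N%:R * (s * ln b%:R).
 rewrite /rho lnXn// ln_powR lnV// mulrN mulNrn opprK mulr_natl; congr (_ *+ _).
rewrite -[leRHS]mulrA ler_wpM2l// ler_wpM2l//; first by rewrite mulr_ge0 ?ln_ge0 ?ler1n// ltW.
set hv := heavy mu (fun=> gdig t) s N.
have mh : measurable hv.
 apply: (@measurable_heavy _ _ _ (fun=> gdig t))=> // [N']; exact: measurable_gdig.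
have hve : fine (mu hv) < e by rewrite ltNge; apply/negP; exact: nb.
via (1 - fine (mu hv)); first by rewrite lerD2l lerN2 ltW.
have um : ucont (fun y : Y=> (wt R (fam_code t) [::] (pfx y N) < rho b s ^+ N)%R%:R : R).
 by apply: (@ucont_dep _ _ _ N)=> y y' ->.
have bu := ucont_bmf um.
rewrite -(@Ex_push _ _ _ _ _ mu _ (gdig t : borel pl -> borel Y)) //; last 2 first.
- exact: measurable_gdig.
- move=> E mE; exact: fam_law.
rewrite -Ex_indic// -[X in X - _](Ex_cst mu) -ExB; [|tame|tame].
rewrite le_eqVlt; apply/orP; left; apply/eqP; apply: Ex_ae.
- tame.
- case: bu=> m1 [K hK]; split; last by exists K=> z; exact: hK.
 exact: (measurableT_comp m1 (measurable_gdig t)).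
have mX : measurable (X : set (borel pl)) by apply: closed_borel; exact: closed_closed_square.
apply: (ae_mono (prob1_ae mX muX))=> z Xz /=.
rewrite fam_wt indicE (_ : (z \in hv) = (rho b s ^+ N <= fine (mu (gdig t @^-1` cyl (pfx (gdig t z) N))))); last first.
 have me : mu (X `&` gdig t @^-1` cyl (pfx (gdig t z) N)) = mu (gdig t @^-1` cyl (pfx (gdig t z) N)).
  by rewrite setIC; apply: prob_full.
 by apply/idP/idP; rewrite inE /hv /heavy /= me; [case|].
by rewrite ltNge; case: (_ <= _); rewrite /= ?subrr ?subr0.
Qed.

End translated_family.

Lemma ae_pushP d d' (T : measurableType d) (T' : measurableType d') (R : realType)
  (P : probability T R) (h : T -> T') (mh : meas_fun h) (Q : T' -> Prop) :
  {ae pushP P mh, forall y, Q y} -> {ae P, forall x, Q (h x)}.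
Proof.
move=> [B [mB B0 QB]]; exists (h @^-1` B); split.
- by have := mh measurableT B mB; rewrite setTI.
- by rewrite -(pushPE P mh).
- by move=> x /= nQ; apply: QB.
Qed.

Section expansion_uniqueness.
Context (R : realType) (b : nat).
Hypothesis hb : (1 < b)%N.
Implicit Types (s : nat -> nat).
Let b0 : (0 < b)%N. lia. Qed.
Let bR : 0 < b%:R :> R. by rewrite ltr0n. Qed.
Let bnR n : 0 < b%:R ^+ n :> R. exact: exprn_gt0. Qed.

Lemma ev_lt1 s l : (forall l, (s l < b)%N) -> s l != b.-1 -> ev R b s < 1.
Proof.
move=> sb sl; have /andP[_ h] := ev_part R hb l.+1 sb.
apply: (le_lt_trans h); rewrite partS.
have h1 := part_ub R hb sb (leq0n l).
rewrite /part big_ord0 add0r invr1 in h1; rewrite -/(part R b s l) in h1.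
have h2 : (s l)%:R + 2 <= b%:R :> R.
 rewrite -natrD ler_nat; have := sb l; move: sl; case: b hb=> [|[|b']] // _; lia.
have h3 : (s l)%:R / b%:R ^+ l.+1 + b%:R ^- l.+1 + b%:R ^- l.+1 <= b%:R ^- l :> R.
 rewrite -[X in _ + X + _]mul1r -[X in _ + X]mul1r -!mulrDl ler_pdivrMr// exprSr mulrA mulVf ?gt_eqF//; lra.
have h4 : 0 < b%:R ^- l.+1 :> R by rewrite invr_gt0.
lra.
Qed.

Lemma ev_gt0 s l : (forall l, (s l < b)%N) -> s l != 0%N -> 0 < ev R b s.
Proof.
move=> sb sl; have /andP[h _] := ev_part R hb l.+1 sb.
apply: lt_le_trans h; rewrite partS ltr_wpDl// ?divr_gt0// ?ltr0n ?lt0n//.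
by apply: sumr_ge0=> i _.
Qed.

Let partN s n : exists K : nat, b%:R ^+ n * part R b s n = K%:R.
Proof.
elim: n=> [|n [K hK]]; first by exists 0%N; rewrite /part big_ord0 mulr0.
exists (b * K + s n)%N; rewrite partS mulrDr exprS -mulrA hK natrD natrM; congr (_ + _).
by rewrite -exprS mulrC divfK// gt_eqF.
Qed.

(** A tail that is not constantly [b.-1] has value below 1, so the integer part at each level is
    exactly that of the truncated expansion. *)
Lemma bdig_ev s : (forall l, (s l < b)%N) -> (forall n, exists l, s (n + l)%N != b.-1) ->
  bdig b (ev R b s) = s.
Proof.
move=> sb h; apply/funext=> n; rewrite /bdig (ev_shift R hb n.+1 sb) mulrDr mulrA mulfV ?gt_eqF// mul1r.
have [K hK] := partN s n.
have -> : b%:R ^+ n.+1 * part R b s n.+1 = (b * K + s n)%:R :> R.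
 rewrite partS mulrDr exprS -mulrA hK natrD natrM; congr (_ + _).
 by rewrite -exprS mulrC divfK// gt_eqF.
have sb' : forall l, (s (n.+1 + l) < b)%N by [].
have [l hl] := h n.+1.
have e0 := ev_ge0 R hb sb'; have e1 := ev_lt1 sb' hl.
rewrite (@truncn_def _ _ (b * K + s n)) ?lerDl ?e0//=; last by rewrite -natr1 ltrD2l.
by rewrite mulnC modnMDl modn_small.
Qed.

End expansion_uniqueness.

(** * A typical ergodic law of codes *)

Section typical_chain.
Context (R : realType) (b : nat).
Hypothesis hb : (1 < b)%N.
Notation pl := (plane R).
Notation X := (closed_square R).
Notation D := (b ^ 2).-1.
Notation digit := ('I_D.+1).
Notation Om := (shift_space D.*2.+1).
Notation Y := (shift_space D).
Notation T := (@tailT D).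
Notation digits := (@digits R b).
Implicit Types (om : Om) (y : Y) (w : seq digit).
Let b0 : (0 < b)%N. lia. Qed.
Let bR : 0 < b%:R :> R. by rewrite ltr0n. Qed.

(** Neither coordinate has eventually constant digits, which excludes cell boundaries and the
    boundary of the square and makes the expansion recoverable from the point. *)
Definition varying y := forall (e : bool) (c : 'I_b) n, exists l, coord e (y (n + l)%N) != c.

Let last_digit : 'I_b := Ordinal (etrans (ltn_predL b) b0).
Let zero_digit : 'I_b := Ordinal b0.

Lemma varying_digits y : varying y -> digits (pt R y (b:=b)) = y.
Proof.
move=> v; have hre := v true last_digit; have him := v false last_digit.
have r1 : forall l, (dre (y l) < b)%N by move=> l; exact: dre_lt.
have r2 : forall l, (dim (y l) < b)%N by move=> l; exact: dim_lt.
rewrite /digits asboolT; last first.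
 split; rewrite /= ev_ge0//=.
 - have [l hl] := hre 0%N; exact: (@ev_lt1 R b hb (fun n=> dre (y n)) l r1 hl).
 - have [l hl] := him 0%N; exact: (@ev_lt1 R b hb (fun n=> dim (y n)) l r2 hl).
by apply/funext=> n /=; rewrite !bdig_ev// mkd_eta.
Qed.

Lemma varying_interior y : varying y -> open_square R (pt R y (b:=b)).
Proof.
move=> v.
have r1 : forall l, (dre (y l) < b)%N by move=> l; exact: dre_lt.
have r2 : forall l, (dim (y l) < b)%N by move=> l; exact: dim_lt.
have [l1 h1] := v true last_digit 0%N; have [l2 h2] := v false last_digit 0%N.
have [l3 h3] := v true zero_digit 0%N; have [l4 h4] := v false zero_digit 0%N.
split; apply/andP; split=> /=.
- exact: (@ev_gt0 R b hb (fun n=> dre (y n)) l3 r1 h3).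
- exact: (@ev_lt1 R b hb (fun n=> dre (y n)) l1 r1 h1).
- exact: (@ev_gt0 R b hb (fun n=> dim (y n)) l4 r2 h4).
- exact: (@ev_lt1 R b hb (fun n=> dim (y n)) l2 r2 h2).
Qed.

Variable mu : probability (borel pl) R.
Hypothesis muX : mu X = 1%E.

Theorem typical_chain : exists P0 : probability (borel Om) R,
  [/\ preserves T P0, disint P0, {ae P0, forall om, generic T P0 om},
      {ae P0, forall om, {ae digit_law R om, forall y, varying y}} &
      (forall s, 0 <= s -> (s%:E < measure_dim mu)%E -> s * ln b%:R <= Ex P0 (@entropy R D)) /\
      forall a, P0 (cyl a) != 0%E -> exists N (t : offset b N) (u : seq digit) y,
        [/\ pfx y (size u) = u, 0 < wt R (fam_code mu t) [::] u &
            cyl a (iter (size u) T (splice (fam_code mu t) y))]].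
Proof.
have [U [P [UU Uoo lamP]]] := limit_chain R (size_fam_gt0 hb mu).
have TP := limit_preserves (size_fam_gt0 hb mu) UU Uoo lamP.
have KP := limit_disint UU lamP.
(* The bound on runs is available for large [N] only, which [limit_ge] allows; hence the passage to
   the opposite function. *)
have small e (c : 'I_b) k : Ex P (run R e c k) <= 6 / b%:R ^+ k.
 have bR' : bmf (run R e c k : borel Om -> R) by apply: ucont_bmf; exact: ucont_run.
 rewrite -lerN2 -(mulN1r (Ex P _)) -(ExZ P (-1) bR').
 apply: (limit_ge UU Uoo lamP (F := fun x=> -1 * run R e c k x)); first by apply: ucontZ; exact: ucont_run.
 exists (maxn k 1)=> // N /=; rewrite geq_max=> /andP[kN N0].
 have [_ mZ _] := lam_mean R (size_fam_gt0 hb mu) N0.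
 by rewrite mZ ?mulN1r ?lerN2; [exact: lam_run|exact: ucont_run].
have to0 e (c : 'I_b) : Ex P (run R e c k) @[k --> \oo] --> 0.
 apply/cvgrPdist_le=> d d0.
 have [n hn] := expb_small hb (divr_gt0 d0 (ltr0n R 6 : 0 < 6)).
 exists n=> // k /= nk; rewrite sub0r normrN ger0_norm; last by apply: Ex_ge0=> x.
 apply: (le_trans (small e c k)); rewrite -ler_pdivlMl// mulrC; apply: le_trans (ltW hn).
 by rewrite lef_pV2 ?posrE ?exprn_gt0// ler_weXn2l// ler1n.
have [P0 [TP0 KP0 GP0 [F0 HP0 N0]]] := @component_exists _ _ P TP KP (bool * 'I_b)%type
 (fun i k=> run R i.1 i.2 k) (@entropy R D) (fun i k=> ltac:(exact: ucont_run))
 (fun i k x=> ltac:(exact: run_ge0)) (fun i=> to0 i.1 i.2) (@ucont_entropy R D).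
exists P0; split=> //.
(* Digits constant from time 0 on form a null event by the bound on runs; invariance carries this to
   every later time. *)
- pose A e (c : 'I_b) : set (borel Om) := \bigcap_l [set om | coord e (xs om l) = c :> nat].
 have mA e c : measurable (A e c).
  apply: bigcap_measurable=> [|l _]//.
  have uF : ucont (fun om : Om=> (coord e (xs om l) == c)%:R : R).
   apply: (@ucont_dep _ _ _ l.+1)=> om om' /prefix_xs/pfxP/(_ l (leqnn _))=> h.
   by rewrite h.
  have [mF _] := ucont_bmf uF.
  have := mF measurableT [set 1] (measurable_set1 1); rewrite setTI.
  rewrite (_ : _ @^-1` [set 1] = [set om : Om | coord e (xs om l) = c :> nat])//.
  apply/seteqP; split=> om /=; last by move/eqP=> ->.
  by case: eqP=> // _ /esym/eqP; rewrite oner_eq0.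
 have A0 e c : P0 (A e c) = 0%E.
  rewrite -(@fineK _ (P0 (A e c))) ?fin_num_measure//; congr (_%:E); apply/eqP.
  rewrite eq_le fine_ge0// andbT; apply/ler_addgt0Pl=> d d0; rewrite addr0.
  have [k [_ hk]] := F0 (e, c) d d0 0%N; apply: le_trans (ltW hk).
  rewrite -Ex_indic//; apply: Ex_le; [tame|by apply: ucont_bmf; exact: ucont_run|].
  move=> om; rewrite indicE; case: (boolP (om \in _))=> [|_]//.
  rewrite inE /run=> h; suff -> : [forall l : 'I_k, coord e (xs om l) == c] by [].
  apply/forallP=> l; apply/eqP; exact: h.
 have nA : {ae P0, forall om, forall i : bool * 'I_b, ~ A i.1 i.2 om}.
  apply: ae_forallc=> -[e c]; exists (A e c); split; [tame|exact: A0|move=> om /=; exact: contrapT].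
 have h : {ae P0, forall om, varying (xs om)}.
  apply: (ae_mono (ae_iter TP0 nA))=> om h e c n; apply: contrapT=> h2.
  apply: (h n (e, c))=> l _ /=; rewrite xs_iter; apply/eqP; apply: contrapT=> /negP h3.
  by apply: h2; exists l.
 apply: (ae_mono (ae_fibre KP0 h))=> om /ae_pushP ho; apply: (ae_mono ho)=> y.
 by rewrite xs_splice.
- split.
  move=> s s0 sd; apply: le_trans HP0.
  have l0 : 0 <= s * ln b%:R by rewrite mulr_ge0// ln_ge0// ler1n.
  (* The relative loss [d / (s * ln b%:R + 1)] costs at most [d] in absolute terms. *)
  apply/ler_addgt0Pl=> d d0.
  via (d + s * ln b%:R * (1 - d / (s * ln b%:R + 1))).
   rewrite mulrBr mulr1 addrC -addrA lerDl addrC subr_ge0 mulrCA ger_pMr// ler_pdivrMr; lra.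
  rewrite lerD2l; apply: (limit_ge UU Uoo lamP); first exact: ucont_entropy.
  apply: lam_entropy=> //; rewrite divr_gt0//; lra.
 move=> a Pa; have Pa' : P (cyl a) != 0%E by apply: contra_neq Pa; exact: N0.
 have [N [om [u [y [_ /mapP[t _ ->] pu wu ca]]]]] := limit_support UU Uoo lamP Pa'.
 by exists N, t, u, y.
Qed.

End typical_chain.

Lemma pos_lower_bound (R : realType) (I : finType) (q : I -> R) : (forall i, 0 < q i) ->
  exists2 c, 0 < c & forall i, c <= q i.
Proof.
move=> q0; have s0 : 0 < 1 + \sum_i (q i)^-1.
 by rewrite ltr_pwDl// sumr_ge0// => i; rewrite invr_ge0 ltW.
exists (1 + \sum_i (q i)^-1)^-1; first by rewrite invr_gt0.
move=> i; rewrite -[leRHS]invrK lef_pV2 ?posrE ?invr_gt0// (bigD1 i)//= addrCA lerDl.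
by rewrite addr_ge0// sumr_ge0// => j; rewrite invr_ge0 ltW.
Qed.

Lemma cdist_small (R : realType) (z w : plane R) : (forall e : R, 0 < e -> cdist z w <= e) -> z = w.
Proof.
move=> h; apply: cdist_eq0; apply/eqP; rewrite eq_le cdist_ge0 andbT.
apply/ler_addgt0Pl=> e e0; rewrite addr0; exact: h.
Qed.

(** * Conformal systems and Gibbs measures *)

Section concatenation.
Context (M : nat).
Notation Sp := (shift_space M).
Implicit Types (al be : Sp) (w v : seq 'I_M.+1).

Definition concat w al : Sp := fun n => if (n < size w)%N then nth ord0 w n else al (n - size w)%N.

Lemma concat_prefix w al : pfx (concat w al) (size w) = w.
Proof.
apply: (@eq_from_nth _ ord0); first by rewrite size_pw.
by move=> i; rewrite size_pw=> iw; rewrite nth_mkseq// /concat iw.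
Qed.

Lemma dshift_concat w al : dshift (size w) (concat w al) = al.
Proof. by apply/funext=> n; rewrite /dshift /concat ltnNge leq_addr addKn. Qed.

Lemma concat_prefix_add w al k : pfx (concat w al) (size w + k) = w ++ pfx al k.
Proof. by rewrite prefix_cat concat_prefix dshift_concat. Qed.

Lemma concat_dshift al k : concat (pfx al k) (dshift k al) = al.
Proof.
apply/funext=> n; rewrite /concat /dshift size_pw; case: ltnP=> nk; first by rewrite nth_mkseq.
by rewrite subnKC.
Qed.

Lemma subshift_dshift A al k : subshift A al -> subshift A (dshift k al).
Proof. by move=> h l; rewrite /dshift addnS. Qed.

(** Admissibility at the junction concerns only the last letter of [v] and the letter [i], so one
    admissible continuation of [v] by [i] allows every admissible tail that starts with [i]. *)
Lemma subshift_concat A v i al be : subshift A al -> pfx al (size v).+1 = rcons v i ->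
  subshift A be -> be 0%N = i -> subshift A (concat v be).
Proof.
move=> sa pa sb b0 l.
have an n : (n < size v)%N -> nth ord0 v n = al n.
 move=> nv; have := congr1 (fun s=> nth ord0 s n) pa; rewrite nth_mkseq; last exact: ltnW.
 by rewrite nth_rcons nv.
have ai : al (size v) = i.
 have := congr1 (fun s=> nth ord0 s (size v)) pa; rewrite nth_mkseq// nth_rcons ltnn eqxx; exact.
rewrite /concat; case: (ltngtP l.+1 (size v))=> h.
- rewrite (an _ (ltnW h)) (an _ h); exact: sa.
- by rewrite subSn//.
- by rewrite h subnn b0 an ?h// -ai -h.
Qed.

Lemma subshift_ultra A (U : set_system nat) (al_ : nat -> Sp) al : UltraFilter U ->
  (forall j, U [set k | pfx (al_ k) j = pfx al j]) ->
  (forall k, subshift A (al_ k)) -> subshift A al.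
Proof.
move=> UU h sa l; have [k /pfxP hk] := filter_ex (h l.+2).
by have := sa k l; rewrite !hk.
Qed.

Lemma measurable_subshift A : measurable (subshift A : set (borel Sp)).
Proof.
rewrite (_ : subshift A = \bigcap_l (\bigcup_(w in [set w | size w = l.+2 /\ A (nth ord0 w l) (nth ord0 w l.+1)]) cyl w)).
 apply: bigcap_measurable=> [|l _]//.
 apply: (@open_borel); apply: bigcup_open=> w _; exact: cyl_open.
apply/seteqP; split=> al.
 move=> h l _; exists (pfx al l.+2); last exact: cyl_prefix.
 by split; [exact: size_pw|rewrite !nth_mkseq//; exact: h].
move=> h l; have [w [sw aw] cw] := h l I; move: aw.
by rewrite -cw sw !nth_mkseq.
Qed.

End concatenation.

(** * Distortion of branches and the coding map *)

Section iterated_maps.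
Context (R : realType) (M : nat).
Notation pl := (plane R).
Notation X := (closed_square R).
Notation Sp := (shift_space M).
Implicit Types (al be : Sp) (w v u : seq 'I_M.+1) (x y z : pl).
Variable S : 'I_M.+1 -> pl -> pl.

Lemma word_map_cat u v z : word_map S (u ++ v) z = word_map S u (word_map S v z).
Proof. by elim: u=> //= i u ->. Qed.

Lemma word_map_rcons u i z : word_map S (rcons u i) z = word_map S u (S i z).
Proof. by rewrite -cats1 word_map_cat. Qed.

(** What is kept of bounded distortion: [lam w] is comparable to both Lipschitz constants of the
    branch, and [kappa] and [r] control its decrease by one letter, so that words can be stopped at
    a given scale up to a fixed factor. *)
Definition lip_bounds (L r kappa : R) (lam : seq 'I_M.+1 -> R) :=
  [/\ 1 <= L, 0 <= r < 1, 0 < kappa & [/\ lam [::] = 1, forall w, 0 < lam w,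
    forall w x y, X x -> X y -> cdist (word_map S w x) (word_map S w y) <= lam w * cdist x y,
    forall w x y, X x -> X y -> lam w / L * cdist x y <= cdist (word_map S w x) (word_map S w y) &
    forall w i, kappa * lam w <= lam (rcons w i) <= r * lam w]].

Hypothesis hS : conformal_system S.

Lemma word_map_X w z : X z -> X (word_map S w z).
Proof. by move=> Xz; elim: w=> //= i w; case: hS=> h _ _ _; exact: h. Qed.

Let p0 : pl := complex.Complex 0 0.
Let p1 : pl := complex.Complex 1 0.
Let Xp0 : X p0. by split; rewrite /= lexx ler01. Qed.
Let Xp1 : X p1. by split; rewrite /= lexx ler01. Qed.
Let d01 : cdist p0 p1 = 1.
by rewrite cdistE /= sub0r subrr expr0n addr0 sqrrN expr1n sqrtr1. Qed.
Let p01 : p0 <> p1.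
by move=> h; have := d01; rewrite h cdistxx=> /eqP; rewrite eq_sym oner_eq0. Qed.

Let le_sup (T : pl -> pl) x y : X x -> X y -> x <> y -> ((cdist (T x) (T y) / cdist x y)%:E <= lip_sup T)%E.
by move=> Xx Xy xy; apply: ereal_sup_ubound; exists x, y. Qed.

Let ge_inf (T : pl -> pl) x y : X x -> X y -> x <> y -> (lip_inf T <= (cdist (T x) (T y) / cdist x y)%:E)%E.
by move=> Xx Xy xy; apply: ereal_inf_lbound; exists x, y. Qed.

Let d_gt0 x y : x <> y -> 0 < cdist x y.
by move=> xy; rewrite lt_neqAle cdist_ge0 andbT eq_sym; apply/eqP=> /cdist_eq0. Qed.

Lemma lip_bounds_exist : exists L r kappa lam, lip_bounds L r kappa lam.
Proof.
have [_ h1 _ [L L1 hL]] := hS.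
have L0 : 0 < L by lra.
have bd w : (0 < lip_inf (word_map S w) /\ lip_sup (word_map S w) <= L%:E * lip_inf (word_map S w))%E.
 by have := hL (ext_word w) (size w); rewrite prefix_ext.
have sup_inf (T : pl -> pl) : (lip_inf T <= lip_sup T)%E.
 apply: le_trans (le_sup T Xp0 Xp1 p01); exact: ge_inf.
have rate i : exists2 ri : R, 0 < 1 - ri & forall x y, X x -> X y -> cdist (S i x) (S i y) <= ri * cdist x y.
 have s0 : (0 < lip_sup (S i))%E by have [h _] := bd [:: i]; exact: (lt_le_trans h (sup_inf _)).
 have fs : lip_sup (S i) \is a fin_num.
  by rewrite ge0_fin_numE ?(ltW s0)//; apply: (lt_trans (h1 i)); rewrite ltry.
 exists (fine (lip_sup (S i))); first by rewrite subr_gt0 -lte_fin fineK.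
 move=> x y Xx Xy; have [->|/eqP xy] := eqVneq x y; first by rewrite !cdistxx mulr0.
 rewrite -ler_pdivrMr ?d_gt0// -lee_fin fineK//; exact: le_sup.
pose ri i := projT1 (cid2 (rate i)).
have ri1 i : 0 < 1 - ri i by rewrite /ri; case: cid2.
have riP i x y : X x -> X y -> cdist (S i x) (S i y) <= ri i * cdist x y by rewrite /ri; case: cid2=> c _ /= h; exact: h.
have [c c0 cr] := pos_lower_bound ri1.
pose r := 1 - c.
have rP i x y : X x -> X y -> cdist (S i x) (S i y) <= r * cdist x y.
 move=> Xx Xy; apply: (le_trans (riP i x y Xx Xy)); rewrite ler_wpM2r ?cdist_ge0//.
 have := cr i; rewrite /r; lra.
have r0 : 0 <= r by have := rP ord0 p0 p1 Xp0 Xp1; rewrite d01 mulr1; apply: le_trans; exact: cdist_ge0.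
have contr w x y : X x -> X y -> cdist (word_map S w x) (word_map S w y) <= cdist x y.
 move=> Xx Xy; elim: w=> //= i w IH; apply: (le_trans (rP i _ _ (word_map_X w Xx) (word_map_X w Xy))).
 apply: le_trans IH; rewrite ler_piMl ?cdist_ge0// /r; lra.
have fs w : lip_sup (word_map S w) \is a fin_num.
 have s0 : (0 < lip_sup (word_map S w))%E by have [h _] := bd w; exact: (lt_le_trans h (sup_inf _)).
 rewrite ge0_fin_numE ?(ltW s0)//; apply: (@le_lt_trans _ _ 1%:E); last by rewrite ltry.
 apply: ge_ereal_sup=> _ [x [y [Xx Xy xy ->]]].
 rewrite lee_fin ler_pdivrMr ?d_gt0// mul1r; exact: contr.
pose lam w := fine (lip_sup (word_map S w)).
have lamE w : (lam w)%:E = lip_sup (word_map S w) by rewrite /lam fineK.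
have lam0 w : 0 < lam w by rewrite -lte_fin lamE; have [h _] := bd w; exact: (lt_le_trans h (sup_inf _)).
have up w x y : X x -> X y -> cdist (word_map S w x) (word_map S w y) <= lam w * cdist x y.
 move=> Xx Xy; have [->|/eqP xy] := eqVneq x y; first by rewrite !cdistxx mulr0.
 rewrite -ler_pdivrMr ?d_gt0// -lee_fin lamE; exact: le_sup.
have low w x y : X x -> X y -> lam w / L * cdist x y <= cdist (word_map S w x) (word_map S w y).
 move=> Xx Xy; have [->|/eqP xy] := eqVneq x y; first by rewrite !cdistxx mulr0.
 rewrite -ler_pdivlMr ?d_gt0// ler_pdivrMr// mulrC -lee_fin lamE.
 have [_ h] := bd w; apply: (le_trans h); rewrite EFinM lee_pmul2l//; exact: ge_inf.
have q0 i : 0 < cdist (S i p0) (S i p1).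
 by apply: lt_le_trans (low [:: i] p0 p1 Xp0 Xp1); rewrite d01 mulr1 divr_gt0.
(* The least distance between the images of two corners under one letter bounds from below what a
   further letter leaves of the scale; distortion divides it by [L]. *)
have [k k0 kP] := pos_lower_bound q0.
exists L, r, (k / L), lam; split=> //.
- rewrite r0 /r; lra.
- by rewrite divr_gt0.
split=> //.
 apply: EFin_inj; rewrite lamE; apply/eqP; rewrite eq_le; apply/andP; split.
  apply: ge_ereal_sup=> _ [x [y [Xx Xy xy ->]]] /=.
  by rewrite divff// gt_eqF ?d_gt0.
 by have := le_sup (word_map S [::]) Xp0 Xp1 p01; rewrite /= d01 divr1.
move=> w i; apply/andP; split.
 have := up (rcons w i) p0 p1 Xp0 Xp1; rewrite d01 mulr1; apply: le_trans.
 have XS z : X z -> X (S i z) by case: hS=> h _ _ _; exact: h.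
 rewrite !word_map_rcons; apply: le_trans (low w _ _ (XS _ Xp0) (XS _ Xp1)).
 rewrite mulrAC [k * _]mulrC mulrAC ler_pM2l ?divr_gt0//; exact: kP.
rewrite -lee_fin lamE; apply: ge_ereal_sup=> _ [x [y [Xx Xy xy ->]]].
have XS z : X z -> X (S i z) by case: hS=> h _ _ _; exact: h.
rewrite lee_fin ler_pdivrMr ?d_gt0// !word_map_rcons; apply: (le_trans (up w _ _ (XS _ Xx) (XS _ Xy))).
rewrite [r * _]mulrC -mulrA ler_pM2l//; exact: rP.
Qed.

Section coding_map.
Variables (L r kappa : R) (lam : seq 'I_M.+1 -> R).
Hypothesis bounds : lip_bounds L r kappa lam.

Let L1 : 1 <= L. by case: bounds. Qed.
Let r01 : 0 <= r < 1. by case: bounds. Qed.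
Let lam0 w : 0 < lam w. by case: bounds=> _ _ _ []. Qed.
Let up w x y : X x -> X y -> cdist (word_map S w x) (word_map S w y) <= lam w * cdist x y.
by case: bounds=> _ _ _ [_ _ h _ _]; exact: h. Qed.
Let low w x y : X x -> X y -> lam w / L * cdist x y <= cdist (word_map S w x) (word_map S w y).
by case: bounds=> _ _ _ [_ _ _ h _]; exact: h. Qed.

Lemma lam_cat_le u v : lam (u ++ v) <= lam u.
Proof.
elim/last_ind: v=> [|v i IH]; first by rewrite cats0.
rewrite -rcons_cat; have [_ _ _ [_ _ _ _ h]] := bounds; have /andP[_ h2] := h (u ++ v) i.
apply: (le_trans h2); apply: le_trans IH; rewrite ler_piMl ?(ltW (lam0 _))//.
by case/andP: r01=> _ /ltW.
Qed.

Lemma lam_expr w : lam w <= r ^+ size w.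
Proof.
have [_ _ _ [l1 _ _ _ h]] := bounds.
elim/last_ind: w=> [|w i IH]; first by rewrite l1.
have /andP[_ h2] := h w i; apply: (le_trans h2); rewrite size_rcons exprS.
by rewrite ler_wpM2l//; case/andP: r01.
Qed.

Let rn_small (e : R) : 0 < e -> exists n, 2 * r ^+ n < e.
Proof.
move=> e0; have /andP[r0 r1] := r01.
have /cvgrPdist_lt/(_ (e / 2)) : r ^+ n @[n --> \oo] --> 0 by apply: cvg_expr; rewrite ger0_norm.
rewrite divr_gt0// => /(_ isT)[n _ /(_ n (leqnn _))] /=.
rewrite sub0r normrN ger0_norm ?exprn_ge0// => h; exists n.
lra.
Qed.

Let in_all al (z : pl) := forall k, (1 <= k)%N -> (word_map S (pfx al k) @` X) z.

Let in_all_exists al : exists z, in_all al z.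
Proof.
have [U [UU Uoo]] := free_ultrafilter.
have [z Xz hz] := square_ultra UU (fun k=> word_map_X (pfx al k) Xp0).
exists z=> n _.
(* Membership in the piece of level [n] requires a preimage; the preimages of the approximating
   points also converge along the ultrafilter. *)
pose x k := word_map S (pfx (dshift n al) k) p0.
have [x' Xx' hx] := square_ultra UU (fun k=> word_map_X (pfx (dshift n al) (k - n)) Xp0).
exists x'=> //; apply: cdist_small=> e e0.
have e2 : 0 < e / 2 by lra.
have e3 : 0 < e / 2 / lam (pfx al n) by rewrite divr_gt0.
have Un : U [set k | (n <= k)%N] by apply: Uoo; exists n.
have [k [[h1 h2] h3]] := filter_ex (filterI (filterI (hz _ e2) (hx _ e3)) Un).
rewrite /= in h1 h2 h3.
rewrite cdistC; apply: (le_trans (cdist_triangle (word_map S (pfx al k) p0) _ _)).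
rewrite [e]splitr lerD// 1?cdistC ?(ltW h1)//.
have -> : pfx al k = pfx al n ++ pfx (dshift n al) (k - n).
 by rewrite -prefix_cat subnKC.
rewrite cdistC word_map_cat; apply: (le_trans (up _ (word_map_X _ Xp0) Xx')).
by rewrite mulrC -ler_pdivlMr// ltW.
Qed.

Lemma codingP al k : (word_map S (pfx al k) @` X) (coding S al).
Proof.
have h : in_all al (coding S al).
 rewrite /coding; set B := \bigcap_(k in _) _.
 have : B (get B).
  have [z hz] := in_all_exists al; apply: getPex; exists z=> n; exact: hz.
 by [].
case: k=> [|k]; last exact: h.
have [x Xx <-] := h 1%N isT; exists (word_map S (pfx al 1) x)=> //; exact: word_map_X.
Qed.

Lemma coding_X al : X (coding S al).
Proof. by have [x Xx <-] := codingP al 0. Qed.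

Let piece_le w x y : (word_map S w @` X) x -> (word_map S w @` X) y -> cdist x y <= 2 * lam w.
Proof.
move=> [x' Xx <-] [y' Xy <-]; apply: (le_trans (up w Xx Xy)).
rewrite mulrC ler_pM2r//; exact: cdist_sq.
Qed.

Lemma coding_unique al z : (forall n, exists2 k, (n <= k)%N & (word_map S (pfx al k) @` X) z) ->
  z = coding S al.
Proof.
move=> h; apply: cdist_small=> e e0; have [n hn] := rn_small e0; have [k nk hk] := h n.
apply: le_trans (ltW hn); apply: (le_trans (piece_le hk (codingP al k))).
rewrite ler_pM2l//; apply: (le_trans (lam_expr _)); rewrite size_pw.
by case/andP: r01=> r0 r1; rewrite ler_wiXn2l// ltW.
Qed.

Lemma coding_concat w al : coding S (concat w al) = word_map S w (coding S al).
Proof.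
apply/esym/coding_unique=> n; exists (size w + n)%N; first by rewrite leq_addl.
have [x Xx xe] := codingP al n; exists x=> //.
by rewrite concat_prefix_add word_map_cat xe.
Qed.

Lemma coding_prefix al k : coding S al = word_map S (pfx al k) (coding S (dshift k al)).
Proof. by rewrite -coding_concat concat_dshift. Qed.

Lemma coding_close al be k : pfx al k = pfx be k ->
  cdist (coding S al) (coding S be) <= 2 * r ^+ k.
Proof.
move=> h; have h1 := codingP al k; have h2 := codingP be k; rewrite -h in h2.
apply: (le_trans (piece_le h1 h2)); rewrite ler_pM2l//.
by apply: (le_trans (lam_expr _)); rewrite size_pw.
Qed.

Lemma coding_nbhs e : 0 < e -> exists k, forall al be, pfx al k = pfx be k ->
  cdist (coding S al) (coding S be) < e.
Proof. by move=> /rn_small[k hk]; exists k=> al be /coding_close/le_lt_trans; exact. Qed.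

Lemma coding_continuous : continuous (coding S : Sp -> pl).
Proof.
apply: plane_continuous=> al e e0; have [k hk] := coding_nbhs e0.
by apply: filterS (prefix_nbhs al k)=> be h; apply: hk.
Qed.

Lemma measurable_coding : meas_fun (coding S : borel Sp -> borel pl).
Proof. by apply: continuous_borel; exact: coding_continuous. Qed.

Lemma coding_ultra (U : set_system nat) (al_ : nat -> Sp) al e : UltraFilter U ->
  (forall j, U [set k | pfx (al_ k) j = pfx al j]) -> 0 < e ->
  U [set k | cdist (coding S (al_ k)) (coding S al) < e].
Proof. by move=> UU h /coding_nbhs[k hk]; apply: filterS (h k)=> j /= /hk. Qed.

Section separation.
Variable A : 'M[bool]_M.+1.
Hypothesis hA : strong_separation S A.

(** Compactness turns disjointness into a positive distance: a limit of ever closer pairs would put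
    one point into the pieces of two different letters, which are incomparable words. *)
Lemma separation_gap : exists2 d : R, 0 < d & forall al be, subshift A al -> subshift A be ->
  al 0%N <> be 0%N -> d <= cdist (coding S al) (coding S be).
Proof.
apply: contrapT=> h.
have bad (n : nat) : exists p : Sp * Sp, [/\ subshift A p.1, subshift A p.2, p.1 0%N <> p.2 0%N &
  cdist (coding S p.1) (coding S p.2) < n.+1%:R^-1].
 apply: contrapT=> hn; apply: h; exists n.+1%:R^-1=> //.
 by move=> al be sa sb ab; rewrite leNgt; apply/negP=> hd; apply: hn; exists (al, be).
pose p n := projT1 (cid (bad n)).
have pP n : [/\ subshift A (p n).1, subshift A (p n).2, (p n).1 0%N <> (p n).2 0%N &
  cdist (coding S (p n).1) (coding S (p n).2) < n.+1%:R^-1] by rewrite /p; case: cid.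
have [U [UU Uoo]] := free_ultrafilter.
have [al ha] := seq_ultra (fun n=> (p n).1) UU.
have [be hb] := seq_ultra (fun n=> (p n).2) UU.
have sa : subshift A al by apply: (subshift_ultra UU ha)=> k; case: (pP k).
have sb : subshift A be by apply: (subshift_ultra UU hb)=> k; case: (pP k).
have ab : al 0%N <> be 0%N.
 have [k [h1 h2]] := filter_ex (filterI (ha 1%N) (hb 1%N)); rewrite /= in h1 h2.
 move: h1 h2=> /pfxP/(_ 0%N isT) <- /pfxP/(_ 0%N isT) <-.
 by case: (pP k).
have eqc : coding S al = coding S be.
 apply: cdist_small=> e e0.
 have e3 : 0 < e / 3 by lra.
 have Un : U [set n | n.+1%:R^-1 < e / 3] by apply: Uoo; near=> n; rewrite /=; near: n; exact: near_infty_natSinv_lt (PosNum e3).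
 have [k [[h1 h2] h3]] := filter_ex (filterI (filterI (coding_ultra UU ha e3) (coding_ultra UU hb e3)) Un).
 rewrite /= in h1 h2 h3; have [_ _ _ h4] := pP k.
 apply: (le_trans (cdist_triangle (coding S (p k).1) _ _)); rewrite cdistC.
 have := cdist_triangle (coding S (p k).2) (coding S (p k).1) (coding S be).
 move: (lt_trans h4 h3) h1 h2; lra.
have := hA (k := 1) (l := 1) sa sb; rewrite /incomparable /pfx /mkseq /=.
have -> : ~~ infix [:: al 0%N] [:: be 0%N] && ~~ infix [:: be 0%N] [:: al 0%N].
 have ne : al 0%N == be 0%N = false by apply/eqP.
 have ne' : be 0%N == al 0%N = false by rewrite eq_sym.
 by rewrite /= ne ne'.
move=> /(_ isT) hh; have : (set0 : set pl) (coding S al)=> //.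
by rewrite -hh; split; [exact: (codingP al 1)|rewrite eqc; exact: (codingP be 1)].
Unshelve. all: by end_near. Qed.

Variable d0 : R.
Hypotheses (d00 : 0 < d0) (gap : forall al be, subshift A al -> subshift A be ->
  al 0%N <> be 0%N -> d0 <= cdist (coding S al) (coding S be)).

(** At a first disagreement after [m <= n] letters the gap is scaled by at least [lam] of the common
    prefix over [L], and [lam] decreases along prefixes. *)
Lemma close_prefix al be n : subshift A al -> subshift A be ->
  cdist (coding S al) (coding S be) < d0 * lam (pfx al n) / L ->
  pfx be n.+1 = pfx al n.+1.
Proof.
move=> sa sb h.
suff H m : (m <= n.+1)%N -> pfx be m = pfx al m by exact: H.
elim: m=> // m IH mn; have {}IH := IH (ltnW mn).
have [|ab] := eqVneq (be m) (al m); first by move=> ab; rewrite !pfxS IH ab.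
exfalso; move: h; apply/negP; rewrite -leNgt.
rewrite (coding_prefix al m) (coding_prefix be m) IH.
apply: le_trans (low _ (coding_X _) (coding_X _)).
have g : d0 <= cdist (coding S (dshift m al)) (coding S (dshift m be)).
 by apply: gap; [exact: subshift_dshift|exact: subshift_dshift|rewrite /dshift addn0=> /esym/eqP; apply/negP].
rewrite -mulrA mulrC; apply: ler_pM=> //.
- by rewrite divr_ge0// ?(ltW (lam0 _))// (le_trans _ L1).
- by rewrite ltW.
rewrite ler_pM2r ?invr_gt0 ?(lt_le_trans _ L1)//.
have -> : pfx al n = pfx al m ++ pfx (dshift m al) (n - m).
 by rewrite -prefix_cat subnKC.
exact: lam_cat_le.
Qed.

Lemma closed_piece i : closed (limit_piece S A i).
Proof.
move=> z hz.
have bad (n : nat) : exists al : Sp, [/\ subshift A al, al 0%N = i & cdist z (coding S al) < n.+1%:R^-1].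
 have [z' [[al [sa ai] <-] h]] : limit_piece S A i `&` [set z' | cdist z z' < n.+1%:R^-1] !=set0.
  by apply: hz; apply: (@nbhs_plane _ _ _ n.+1%:R^-1)=> //; rewrite invr_gt0.
 by exists al.
pose p n := projT1 (cid (bad n)).
have pP n : [/\ subshift A (p n), (p n) 0%N = i & cdist z (coding S (p n)) < n.+1%:R^-1] by rewrite /p; case: cid.
have [U [UU Uoo]] := free_ultrafilter.
have [al ha] := seq_ultra p UU.
have sa : subshift A al by apply: (subshift_ultra UU ha)=> k; case: (pP k).
exists al; first split=> //=.
 have [k] := filter_ex (ha 1%N); rewrite /= => /pfxP/(_ 0%N isT) <-.
 by case: (pP k).
apply/esym/cdist_small=> e e0.
have e3 : 0 < e / 2 by lra.
have Un : U [set n | n.+1%:R^-1 < e / 2] by apply: Uoo; near=> n; rewrite /=; near: n; exact: near_infty_natSinv_lt (PosNum e3).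
have [k [h1 h3]] := filter_ex (filterI (coding_ultra UU ha e3) Un).
rewrite /= in h1 h3; have [_ _ h4] := pP k.
have := cdist_triangle (coding S (p k)) z (coding S al).
move: (lt_trans h4 h3) h1; lra.
Unshelve. all: by end_near. Qed.

End separation.
End coding_map.
End iterated_maps.

(** * Quasi-Bernoulli property of Gibbs measures *)

Section gibbs_ratio.
Context (R : realType) (M : nat).
Notation Sp := (shift_space M).
Implicit Types (al be : Sp) (w v u : seq 'I_M.+1).
Variables (A : 'M[bool]_M.+1) (phi : Sp -> R) (m : probability (borel Sp) R).
Hypothesis hm : gibbs A phi m.

Let fullA : m (subshift A) = 1%E. by case: hm. Qed.

Lemma gibbs_full (E : set (borel Sp)) : measurable E -> m (subshift A `&` E) = m E.
Proof.
move=> mE; have mA := measurable_subshift A.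
apply: prob_ae_eq=> //; first exact: measurableI.
by apply: (ae_mono (prob1_ae mA fullA))=> al sa; split=> [[]|].
Qed.

Definition mass w : R := fine (m (cyl w)).

Lemma massE w : mass w = fine (m (cylinder A w)).
Proof. by rewrite /mass -gibbs_full; [by []|exact: cylM]. Qed.

Lemma mass_ge0 w : 0 <= mass w.
Proof. by rewrite fine_ge0. Qed.

Let shiftE n al : iter n left_shift al = dshift n al.
by elim: n=> //= n ->; apply/funext=> l; rewrite /left_shift /dshift addSnnS. Qed.

Lemma mass_gt0 al n : subshift A al -> 0 < mass (pfx al n).
Proof.
move=> sa; case: hm=> _ [C1 [C2 [c1 c2 h]]]; have /andP[h1 _] := h al n sa.
rewrite massE lt_neqAle fine_ge0// andbT; apply/eqP=> h0.
nra.
Qed.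

Lemma mass0 w : ~ (exists2 al, subshift A al & pfx al (size w) = w) -> mass w = 0.
Proof.
move=> h; rewrite massE (_ : cylinder A w = set0) ?measure0//.
by apply/seteqP; split=> // al [sa pa]; apply: h; exists al.
Qed.

(* Both quotients are comparable to exp of the same Birkhoff sum, along one and the same point. *)
Lemma mass_ratio : exists2 C : R, 1 <= C & forall al v i w, subshift A al ->
  pfx al (size v).+1 = rcons v i ->
  mass (v ++ i :: w) * mass [:: i] <= C * (mass (i :: w) * mass (rcons v i)) /\
  mass (i :: w) * mass (rcons v i) <= C * (mass (v ++ i :: w) * mass [:: i]).
Proof.
case: hm=> _ [C1 [C2 [c1 c2 h]]].
have c12 : C1 <= C2.
 have [al sa] : exists al, subshift A al.
  apply: contrapT=> hn; have : m (subshift A) = 0%E; last by rewrite fullA=> /eqP; rewrite onee_eq0.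
  by rewrite (_ : subshift A = set0)//; apply/seteqP; split=> // al sa; apply: hn; exists al.
 have /andP[h1 h2] := h al 0%N sa; exact: le_trans h2.
(* Two masses are bounded from above and two from below. *)
pose C := (C2 / C1) ^+ 2.
have C1' : 1 <= C2 / C1 by rewrite ler_pdivlMr// mul1r.
exists C; first by rewrite /C mulr_ege1.
move=> al v i w sa pa.
(* If [i :: w] is not admissible, both products contain a zero factor. *)
have [[be sb pb]|nb] := EM (exists2 be, subshift A be & pfx be (size w).+1 = i :: w); last first.
 rewrite (@mass0 (i :: w))// (@mass0 (v ++ i :: w)) ?(mul0r, mulr0)//.
 move=> [be sb]; rewrite size_cat prefix_cat=> /eqP; rewrite eqseq_cat ?size_pw// => /andP[_ /eqP pb].
 apply: nb; exists (dshift (size v) be)=> //; exact: subshift_dshift.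
have b0 : be 0%N = i by case: pb.
pose ga := concat v be.
have sg : subshift A ga by exact: (subshift_concat sa pa).
pose E n x := expR (birkhoff_sum phi n x - n%:R * pressure A phi).
have E0 n x : 0 < E n x by exact: expR_gt0.
have hE n x : subshift A x -> C1 * E n x <= mass (pfx x n) <= C2 * E n x.
 by move=> sx; have := h x n sx; rewrite -massE ler_pdivlMr ?ler_pdivrMr ?expR_gt0.
have p1 : pfx ga (size v + (size w).+1) = v ++ i :: w by rewrite concat_prefix_add pb.
have p2 : pfx ga (size v).+1 = rcons v i.
 by rewrite -[X in pfx _ X]addn1 concat_prefix_add -cats1 /pfx /mkseq /= b0.
have p3 : pfx be 1 = [:: i] by rewrite /pfx /mkseq /= b0.
have cocycle : E (size v + (size w).+1)%N ga * E 1%N be = E (size w).+1 be * E (size v).+1 ga.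
 rewrite /E -!expRD; congr expR.
 have bsD n k x : birkhoff_sum phi (n + k) x = birkhoff_sum phi n x + birkhoff_sum phi k (dshift n x).
  rewrite /birkhoff_sum big_split_ord/=; congr (_ + _); apply: eq_bigr=> l _.
  by rewrite !shiftE; congr phi; apply/funext=> j; rewrite /dshift addnA [(n + l)%N]addnC addnC [(j + _)%N]addnC.
 rewrite bsD -[X in birkhoff_sum phi X ga - _ * _]addn1 bsD dshift_concat; ring.
have /andP[a1 a2] := hE (size v + (size w).+1)%N ga sg; rewrite p1 in a1 a2.
have /andP[b1 b2] := hE (size v).+1 ga sg; rewrite p2 in b1 b2.
have /andP[d1 d2] := hE (size w).+1 be sb; rewrite pb in d1 d2.
have /andP[e1 e2] := hE 1%N be sb; rewrite p3 in e1 e2.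
have CE (x y : R) : C2 * x * (C2 * y) = C * (C1 * x * (C1 * y)) by rewrite /C; field; rewrite gt_eqF.
have nn (c x : R) : 0 < c -> 0 < x -> 0 <= c * x by move=> ? ?; rewrite ltW// mulr_gt0.
have C0 : 0 <= C by rewrite sqr_ge0.
split.
 via (C2 * E (size v + (size w).+1)%N ga * (C2 * E 1%N be)).
  apply: ler_pM=> //; exact: mass_ge0.
 rewrite CE ler_wpM2l// mulrACA cocycle mulrACA; apply: ler_pM=> //; exact: nn.
via (C2 * E (size w).+1 be * (C2 * E (size v).+1 ga)).
 apply: ler_pM=> //; exact: mass_ge0.
rewrite CE ler_wpM2l// mulrACA -cocycle mulrACA; apply: ler_pM=> //; exact: nn.
Qed.

End gibbs_ratio.

Import ComplexField.Normc.

(** * Limits of conformal maps *)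

Section circle_mean.
Context (R : realType) (tau : R).
Hypothesis tau0 : 0 < tau.
Notation circle := (uniform_prob tau0 : probability (measurableTypeR R) R).
Implicit Types (G : R -> R).

Lemma primitive G (c : R) : continuous G -> exists Ga : R -> R,
  forall x : R, -1 < x < c -> is_derive x (1 : R) Ga (G x).
Proof.
move=> cG; exists (fun x=> \int[lebesgue_measure]_(t in [set` Interval (BLeft (-1)) (BRight x)]) G t)%R.
(* The base point -1 of the integral leaves 0 in the open interval of differentiability. *)
move=> x /andP[x1 xc].
have iG : lebesgue_measure.-integrable [set` Interval (BLeft (-1)) (BRight c)] (EFin \o G).
 apply: continuous_compact_integrable; first exact: segment_compact.
 exact: continuous_subspaceT.
have [h1 h2] := continuous_FTC1_closed xc iG x1 (cG x).
rewrite derive1E in h2; exact: (DeriveDef h1 h2).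
Qed.

Lemma is_derive_continuous (F : R -> R) x d : is_derive x (1 : R) F d -> {for x, continuous F}.
Proof. by move=> [h _]; apply: differentiable_continuous; apply/derivable1_diffP. Qed.

Lemma segment_bound G c : 0 <= c -> continuous G -> exists K, forall x, 0 <= x <= c -> `|G x| <= K.
Proof.
move=> c0 cG; have [|y _ h] := @EVT_max R (fun x=> `|G x|) 0 c c0.
 apply: continuous_subspaceT=> x; apply: cvg_norm; exact: cG.
by exists `|G y| => x hx; apply: h.
Qed.

Lemma continuous_shift G h : continuous G -> continuous (fun x => G (x + h)).
Proof.
move=> cG x; apply: (@continuous_comp _ _ _ (fun y : R=> y + h) G x); last exact: cG.
by apply: cvgD; [by []|exact: cvg_cst].
Qed.

(* Retracts the line onto a period, so that continuous functions become bounded. *)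
Definition arc (x : R) : R := Num.max 0 (Num.min tau x).

Lemma arc_itv x : 0 <= arc x <= tau.
Proof. by rewrite /arc le_max lexx ge_max (ltW tau0) ge_min lexx. Qed.

Lemma arc_id x : 0 <= x <= tau -> arc x = x.
Proof. by move=> /andP[x0 x1]; rewrite /arc (min_r x1) (max_r x0). Qed.

Lemma bmf_arc G : continuous G -> bmf (G \o arc : measurableTypeR R -> R).
Proof.
move=> cG; split.
 apply: (@measurableT_comp _ _ _ _ _ _ (G : measurableTypeR R -> R)).
  exact: continuous_measurable_fun.
 apply: measurable_maxr=> //.
 by apply: measurable_minr=> //.
have [K hK] := segment_bound (ltW tau0) cG.
exists K=> x; apply: hK; exact: arc_itv.
Qed.

Definition rmean G : R := Ex circle (G \o arc).

(** Both means are increments of one primitive over intervals of length [tau], and periodicity makes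
    such an increment constant. *)
Lemma rmean_turn G h : continuous G -> (forall x, G (x + tau) = G x) -> 0 < h <= tau ->
  rmean (fun x => G (x + h)) = rmean G.
Proof.
move=> cG per /andP[h0 h1]; have tp : 0 < tau by exact: tau0.
have [|K GK] := @segment_bound G (tau + tau) _ cG; first by rewrite addr_ge0// ltW.
(* Adding a bound makes the function nonnegative, as the integral formula for the uniform law
   demands. *)
pose H x := G x + K.
have cH : continuous H by move=> x; apply: cvgD; [exact: cG|exact: cvg_cst].
have [Ha dH] := primitive (tau + tau + 1) cH.
have dHs (k x : R) : 0 <= k <= tau -> -1 < x -> x <= tau -> is_derive x (1 : R) (fun y=> Ha (y + k)) (H (x + k)).
 move=> /andP[k0 k1] x0 x1; rewrite -[X in is_derive _ _ _ X]mulr1.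
 have hd : is_derive (x + k) (1 : R) Ha (H (x + k)) by apply: dH; apply/andP; split; lra.
 have sh : is_derive x (1 : R) (fun y : R=> y + k) 1 by rewrite -[X in _ X]addr0; apply: is_deriveD.
 exact: (@is_derive1_comp _ Ha (fun y=> y + k) x _ _ hd sh).
have val (k : R) : 0 <= k <= tau -> rmean (fun x=> H (x + k)) = tau^-1 * (Ha (tau + k) - Ha k).
 move=> kt; have cHk := @continuous_shift H k cH; have [mHk _] := bmf_arc cHk.
 rewrite /rmean /Ex /Rintegral integral_uniform; last 2 first.
 - exact/measurable_EFinP.
 - move=> x; rewrite lee_fin /H /= -lerBlDr sub0r; have /andP[a0 a1] := arc_itv x.
  have /GK : 0 <= arc x + k <= tau + tau by lra.
  by rewrite ler_norml=> /andP[].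
 rewrite (eq_integral (fun x : measurableTypeR R=> (H ((x : R) + k))%:E)); last by move=> x; rewrite inE /=/= => hx; rewrite arc_id.
 rewrite (@continuous_FTC2 _ _ (fun y=> Ha (y + k))) ?subr0 ?add0r//.
 - exact: continuous_subspaceT.
 - split.
  + by move=> x; rewrite in_itv/= => /andP[x0 x1]; apply: ex_derive; apply: dHs=> //; lra.
  + by apply: cvg_at_right_filter; apply: is_derive_continuous; apply: dHs=> //; lra.
  + by apply: cvg_at_left_filter; apply: is_derive_continuous; apply: dHs=> //; lra.
 - move=> x; rewrite in_itv/= => /andP[x0 x1]; rewrite derive1E; apply: derive_val; apply: dHs=> //; lra.
have HK k : 0 <= k -> rmean (fun x=> H (x + k)) = rmean (fun x=> G (x + k)) + K.
 move=> k0; rewrite -[X in _ = _ + X](Ex_cst circle) -ExD//; [exact/bmf_arc/continuous_shift|tame].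
have G0 : rmean G = rmean (fun x=> G (x + 0)) by congr rmean; apply/funext=> x; rewrite addr0.
apply: (addIr K); rewrite G0 -!HK ?(ltW h0)// !val ?lexx ?(ltW h0) ?(ltW tau0)//; congr (_ * _).
have dP (x : R) : 0 <= x <= h -> is_derive x (1 : R) (fun y=> Ha (y + tau) - Ha y) 0.
 move=> /andP[x0 x1]; have -> : (0 : R) = H (x + tau) - H x by rewrite /H per subrr.
 apply: is_deriveB; first by apply: dHs=> //; lra.
 apply: dH; lra.
have [c _] := @MVT _ (fun y=> Ha (y + tau) - Ha y) (fun=> 0) 0 h h0
 (fun x hx=> dP x ltac:(by move: hx; rewrite in_itv/= => /andP[/ltW -> /ltW ->]))
 ltac:(by apply: derivable_within_continuous=> x; rewrite in_itv/= => hx; apply: ex_derive; exact: dP).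
by rewrite mul0r !add0r addr0 ![_ + tau]addrC=> /eqP; rewrite subr_eq0=> /eqP.
Qed.

End circle_mean.

(** * Means over a circle and Cauchy's formula *)

Section complex_means.
Context (R : realType).
Notation C := (R[i]).
Notation Rez := (@complex.Re R).
Notation Imz := (@complex.Im R).
Notation normc := (@normc R).
Implicit Types (F G : R -> C) (u : nat -> C) (z w : C).

Lemma normc_ge0 z : 0 <= normc z.
Proof. by case: z=> a b; exact: sqrtr_ge0. Qed.

Lemma normcD z w : normc (z + w) <= normc z + normc w.
Proof. exact: le_normcD. Qed.

Lemma normcN z : normc (- z) = normc z.
Proof. exact: complex.normcN. Qed.

Lemma normc_gt0 z : z != 0 -> 0 < normc z.
Proof.
move=> z0; rewrite lt_neqAle normc_ge0 andbT eq_sym; apply: contra z0=> /eqP h.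
apply/eqP; exact: eq0_normc.
Qed.

Lemma normc_Re z : `|Rez z| <= normc z.
Proof. by case: z=> a b; rewrite -sqrtr_sqr ler_wsqrtr// lerDl sqr_ge0. Qed.

Lemma normc_Im z : `|Imz z| <= normc z.
Proof. by case: z=> a b; rewrite -sqrtr_sqr ler_wsqrtr// lerDr sqr_ge0. Qed.

Lemma normc_le z : normc z <= `|Rez z| + `|Imz z|.
Proof.
case: z=> a b; rewrite -[leRHS]ger0_norm// -sqrtr_sqr ler_wsqrtr//= sqrrD !real_normK ?num_real//.
by rewrite addrAC lerDl//.
Qed.

Lemma normc_real (x : R) : normc x%:C%C = `|x|.
Proof. by rewrite /= expr0n addr0 sqrtr_sqr. Qed.

Let reD z w : Rez (z + w) = Rez z + Rez w. lra. Qed.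
Let imD z w : Imz (z + w) = Imz z + Imz w. lra. Qed.
Let reB z w : Rez (z - w) = Rez z - Rez w. lra. Qed.
Let imB z w : Imz (z - w) = Imz z - Imz w. lra. Qed.
Let reM z w : Rez (z * w) = Rez z * Rez w - Imz z * Imz w. by case: z=> ? ?; case: w. Qed.
Let imM z w : Imz (z * w) = Rez z * Imz w + Imz z * Rez w. by case: z=> ? ?; case: w. Qed.

Section convergence.
Context (T : Type) (A : set_system T).
Hypothesis FA : Filter A.
Implicit Types (f g : T -> C).

Definition ccv f z := Rez (f x) @[x --> A] --> Rez z /\ Imz (f x) @[x --> A] --> Imz z.

Lemma ccvP f z : ccv f z <-> forall e : R, 0 < e -> \forall x \near A, normc (f x - z) <= e.
Proof.
split=> [[h1 h2] e e0|h].
 have e2 : 0 < e / 2 by lra.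
 move/cvgrPdist_le: h1=> /(_ _ e2) h1; move/cvgrPdist_le: h2=> /(_ _ e2) h2.
 apply: filterS2 h1 h2=> x h1 h2; apply: (le_trans (normc_le _)); rewrite reB imB [e]splitr.
 by apply: lerD; rewrite distrC.
split; apply/cvgrPdist_le=> e e0; apply: filterS (h e e0)=> x; apply: le_trans; rewrite distrC.
 rewrite -reB; exact: normc_Re.
rewrite -imB; exact: normc_Im.
Qed.

Lemma ccv_cst z : ccv (fun=> z) z.
Proof. by split; exact: cvg_cst. Qed.

Lemma ccvD f g z w : ccv f z -> ccv g w -> ccv (fun x => f x + g x) (z + w).
Proof.
move=> [f1 f2] [g1 g2]; split; first by rewrite reD (eq_cvg _ _ (fun=> reD _ _)); exact: cvgD.
rewrite imD (eq_cvg _ _ (fun=> imD _ _)); exact: cvgD.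
Qed.

Lemma ccvM f g z w : ccv f z -> ccv g w -> ccv (fun x => f x * g x) (z * w).
Proof.
move=> [f1 f2] [g1 g2]; split.
 rewrite reM (eq_cvg _ _ (fun=> reM _ _)); apply: cvgB; exact: cvgM.
rewrite imM (eq_cvg _ _ (fun=> imM _ _)); apply: cvgD; exact: cvgM.
Qed.

End convergence.

Notation ccvg := (ccv (\oo : set_system nat)).

Definition ccont F := forall x, ccv (nbhs x) F (F x).

Lemma ccont_cst z : ccont (fun=> z).
Proof. by move=> x; exact: ccv_cst. Qed.

Lemma ccontD F G : ccont F -> ccont G -> ccont (fun x => F x + G x).
Proof. by move=> cF cG x; apply: ccvD. Qed.

Lemma ccontM F G : ccont F -> ccont G -> ccont (fun x => F x * G x).
Proof. by move=> cF cG x; apply: ccvM. Qed.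

Lemma ccontB F G : ccont F -> ccont G -> ccont (fun x => F x - G x).
Proof.
move=> cF cG; have := ccontD cF (ccontM (ccont_cst (-1)) cG).
by congr ccont; apply/funext=> x; rewrite mulN1r.
Qed.

Lemma ccontV F (c : R) : 0 < c -> (forall x, c <= normc (F x)) -> ccont F -> ccont (fun x => (F x)^-1).
Proof.
move=> c0 Fc cF x; have F0 y : F y != 0 by apply: contraTneq (Fc y)=> ->; rewrite normc0 -ltNge.
apply/ccvP=> e e0; have /ccvP/(_ (e * (c * c))) := cF x; rewrite !mulr_gt0// => /(_ isT).
apply: filterS=> y h; have -> : (F y)^-1 - (F x)^-1 = - (F y - F x) * ((F y)^-1 * (F x)^-1).
 by field; rewrite !F0.
rewrite !normcM normcN !normcV.
via (e * (c * c) * (c^-1 * c^-1)); last by rewrite -mulrA mulrACA !mulfV ?gt_eqF// !mulr1.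
have V z : c <= normc z -> (normc z)^-1 <= c^-1 by move=> h'; rewrite lef_pV2 ?posrE// (lt_le_trans c0).
apply: ler_pM=> //; rewrite ?mulr_ge0 ?invr_ge0 ?normc_ge0//.
by apply: ler_pM=> //; rewrite ?invr_ge0 ?normc_ge0// V.
Qed.

Lemma ccont_lip (g : C -> C) (K : R) F : (forall z w, normc (g z - g w) <= K * normc (z - w)) ->
  ccont F -> ccont (g \o F).
Proof.
move=> gK cF x; apply/ccvP=> e e0.
have K0 : 0 < `|K| + 1 by [].
have /ccvP/(_ (e / (`|K| + 1))) := cF x; rewrite divr_gt0// => /(_ isT).
apply: filterS=> y h; apply: (le_trans (gK _ _)).
via ((`|K| + 1) * normc (F y - F x)).
 by rewrite ler_wpM2r ?normc_ge0// (le_trans (ler_norm K))// lerDl.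
by rewrite mulrC -ler_pdivlMr.
Qed.

Let ccont_re F : ccont F -> continuous (Rez \o F). by move=> cF x; case: (cF x). Qed.
Let ccont_im F : ccont F -> continuous (Imz \o F). by move=> cF x; case: (cF x). Qed.

Lemma ccont_shift F h : ccont F -> ccont (fun x => F (x + h)).
Proof. by move=> cF x; split; [exact: (continuous_shift (ccont_re cF))|exact: (continuous_shift (ccont_im cF))]. Qed.

Let tau : R := pi *+ 2.
Let tau0 : 0 < tau. by rewrite pmulrn_lgt0// pi_gt0. Qed.

Definition cmean F : C := complex.Complex (rmean tau0 (Rez \o F)) (rmean tau0 (Imz \o F)).

Let bre F : ccont F -> bmf (Rez \o F \o arc tau : measurableTypeR R -> R).
by move=> /ccont_re; exact: bmf_arc. Qed.
Let bim F : ccont F -> bmf (Imz \o F \o arc tau : measurableTypeR R -> R).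
by move=> /ccont_im; exact: bmf_arc. Qed.

Lemma cmeanD F G : ccont F -> ccont G -> cmean (fun x => F x + G x) = cmean F + cmean G.
Proof.
move=> cF cG; rewrite /cmean /rmean -[RHS]/(complex.Complex (_ + _) (_ + _)) -!ExD; try exact: bre; try exact: bim.
by congr complex.Complex; congr Ex; apply/funext=> x /=.
Qed.

Lemma cmeanZ z F : ccont F -> cmean (fun x => z * F x) = z * cmean F.
Proof.
move=> cF; have [b1 b2] := (bre cF, bim cF); case: z=> a b.
rewrite /cmean /rmean -[RHS]/(complex.Complex (a * _ - b * _) (a * _ + b * _)) -!ExZ// -ExB -?ExD; try exact: bmfZ.
by congr complex.Complex; congr Ex; apply/funext=> x /=.
Qed.

Lemma cmean_norm F (K : R) : ccont F -> (forall x, normc (F x) <= K) -> normc (cmean F) <= 2 * K.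
Proof.
move=> cF FK; apply: (le_trans (normc_le _)); rewrite mulr_natl mulr2n; apply: lerD; apply: Ex_normK=> [|x].
- tame.
- exact: le_trans (normc_Re _) (FK _).
- tame.
exact: le_trans (normc_Im _) (FK _).
Qed.

Lemma cmean_cst z : cmean (fun=> z) = z.
Proof. by rewrite /cmean /rmean !Ex_cst; case: z. Qed.

Lemma cmean_turn F h : ccont F -> (forall x, F (x + tau) = F x) -> 0 < h <= tau ->
  cmean (fun x => F (x + h)) = cmean F.
Proof.
move=> cF per hh; congr complex.Complex.
 by apply: (rmean_turn tau0 (ccont_re cF))=> // x /=; rewrite per.
by apply: (rmean_turn tau0 (ccont_im cF))=> // x /=; rewrite per.
Qed.

Lemma cmean_dct (F_ : nat -> R -> C) (K : R) : (forall n, ccont (F_ n)) -> (forall n x, normc (F_ n x) <= K) ->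
  (forall x, ccvg (F_ ^~ x) 0) -> ccvg (fun n => cmean (F_ n)) 0.
Proof.
move=> bF FK cF; split; rewrite /= -(Ex_cst (uniform_prob tau0 : probability _ R) 0); apply: (Ex_dct (K := K))=> [n|n x||].
- by case: (bre (bF n)).
- exact: le_trans (normc_Re _) (FK n _).
- tame.
- by apply: aeW=> x; case: (cF (arc tau x)).
- by case: (bim (bF n)).
- exact: le_trans (normc_Im _) (FK n _).
- tame.
- by apply: aeW=> x; case: (cF (arc tau x)).
Qed.

Definition cis (x : R) : C := complex.Complex (cos x) (sin x).

Lemma normc_cis x : normc (cis x) = 1.
Proof. by rewrite /= cos2Dsin2 sqrtr1. Qed.

Lemma ccont_cis : ccont cis.
Proof. by move=> x; split; [exact: continuous_cos|exact: continuous_sin]. Qed.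

Lemma cis_periodic x : cis (x + tau) = cis x.
Proof. by rewrite /cis cosD2pi sinD2pi. Qed.

Let trig_lip (f df : R -> R) : (forall x : R, is_derive x (1 : R) f (df x)) -> (forall x, `|df x| <= 1) ->
  forall x y, `|f x - f y| <= `|x - y|.
Proof.
move=> fd d1 x y; wlog xy : x y / y < x=> [H|].
 have [/H|/H|->] := ltgtP y x; rewrite ?subrr//.
 by rewrite distrC [`|y - x|]distrC.
have [c _ ->] := @MVT _ f df y x xy (fun t _=> fd t)
 ltac:(by apply: derivable_within_continuous=> t _; apply: ex_derive; exact: fd).
by rewrite normrM ler_piMl.
Qed.

Lemma cis_lip x y : normc (cis x - cis y) <= 2 * `|x - y|.
Proof.
apply: (le_trans (normc_le _)); rewrite mulr_natl mulr2n /=; apply: lerD.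
 apply: (@trig_lip cos (fun x=> - sin x))=> z; rewrite normrN ler_norml sin_geN1 sin_le1 //.
by apply: (@trig_lip sin cos)=> z; rewrite ler_norml cos_geN1 cos_le1.
Qed.

Let natSinv_cvg : (n.+1%:R^-1 : R) @[n --> \oo] --> 0.
exact: cvge_harmonic || exact: cvg_harmonic. Qed.

Let diff_quot (f : R -> R) (x d : R) : is_derive x (1 : R) f d ->
  n.+1%:R * (f (x + n.+1%:R^-1) - f x) @[n --> \oo] --> d.
Proof.
move=> [df <-]; have := df; rewrite /derivable=> /cvg_ex [l hl].
have -> : 'D_1 f x = l by apply: cvg_lim hl.
have := (cvgr_dnbhsP _ _ _).1 hl (fun n=> n.+1%:R^-1).
rewrite /= => H; have /H : (forall n, (n.+1%:R^-1 : R) != 0) /\ (n.+1%:R^-1 : R) @[n --> \oo] --> 0.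
 by [].
apply: cvg_trans; apply: near_eq_cvg; near=> n.
by rewrite invrK -[_%:A]/(n.+1%:R^-1 * 1) mulr1 [_ + x]addrC.
Unshelve. all: by end_near. Qed.

Lemma cis_derive x : ccvg (fun n => (n.+1%:R)%:C%C * (cis (x + n.+1%:R^-1) - cis x)) ('i%C * cis x).
Proof.
split.
 rewrite (_ : Rez _ = - sin x); last by rewrite /= mul0r mul1r sub0r.
 rewrite (_ : (fun n=> _) = (fun n=> n.+1%:R * (cos (x + n.+1%:R^-1) - cos x))); first exact: diff_quot.
 by apply/funext=> n /=; rewrite mul0r subr0.
rewrite (_ : Imz _ = cos x); last by rewrite /= mul0r mul1r add0r.
rewrite (_ : (fun n=> _) = (fun n=> n.+1%:R * (sin (x + n.+1%:R^-1) - sin x))); first exact: diff_quot.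
by apply/funext=> n /=; rewrite mul0r addr0.
Qed.

(** First-order approximation on a full neighbourhood, which composes without the case distinctions
    of difference quotients. *)
Definition cderiv (g : C -> C) z d := forall e : R, 0 < e -> exists2 del : R, 0 < del &
  forall k, normc k < del -> normc (g (z + k) - g z - d * k) <= e * normc k.

Lemma cderiv_chain g z d (h : nat -> R) (k : nat -> C) v : cderiv g z d ->
  (forall n, h n != 0) -> h n @[n --> \oo] --> 0 -> ccvg (fun n => ((h n)^-1)%:C%C * k n) v ->
  ccvg (fun n => ((h n)^-1)%:C%C * (g (z + k n) - g z)) (d * v).
Proof.
move=> gd h0 h_0 kv.
have -> : d * v = 0 + d * v by rewrite add0r.
rewrite (_ : (fun n=> _) = (fun n=> ((h n)^-1)%:C%C * (g (z + k n) - g z - d * k n) + d * (((h n)^-1)%:C%C * k n))); last first.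
 apply/funext=> n; ring.
apply: ccvD; last by apply: ccvM=> //; exact: ccv_cst.
have [K [K0 hK]] : exists K : R, 0 < K /\ \forall n \near \oo, normc (((h n)^-1)%:C%C * k n) <= K.
 exists (normc v + 1); split; first by rewrite ltr_wpDl// normc_ge0.
 have /ccvP/(_ 1 ltr01) := kv; apply: filterS=> n hn.
 by rewrite -[_ * k n](subrK v) addrC; apply: (le_trans (normcD _ _)); rewrite lerD2l.
apply/ccvP=> e e0; have [del del0 hdel] := gd (e / K) (divr_gt0 e0 K0).
have /cvgrPdist_lt/(_ (del / K)) := h_0; rewrite divr_gt0// => /(_ isT) hs.
near=> n; rewrite subr0 normcM normc_real normfV.
have hn : 0 < `|h n| by rewrite normr_gt0.
have kn : normc (k n) <= K * `|h n|.
 have : normc (((h n)^-1)%:C%C * k n) <= K by near: n.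
 by rewrite normcM normc_real normfV mulrC ler_pdivrMr.
have hd : `|h n| < del / K.
 have h5 : `|0 - h n| < del / K by near: n.
 by move: h5; rewrite sub0r normrN.
rewrite mulrC ler_pdivrMr//; apply: (le_trans (hdel _ _)).
 by apply: (le_lt_trans kn); rewrite mulrC -ltr_pdivlMr.
by rewrite -ler_pdivlMl ?divr_gt0//// invf_div mulrA divfK ?gt_eqF.
Unshelve. all: by end_near. Qed.

Section identity.
Variables (g : C -> C) (K rad : R) (z0 w : C).
Hypotheses (gK : forall z z', normc (g z - g z') <= K * normc (z - z')) (rad0 : 0 < rad)
  (gd : forall z, normc (z - z0) <= rad -> exists d, cderiv g z d) (wr : normc (w - z0) < rad).

Definition gam (x : R) : C := z0 + rad%:C%C * cis x.
(** Cauchy's kernel dz / (z - w) in the angular parameter, up to the factor i. *)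
Definition ker (x : R) : C := (gam x - z0) / (gam x - w).

Let K0 : 0 <= K.
Proof.
have := gK 1 0; rewrite subr0 normc1 mulr1.
apply: le_trans; exact: normc_ge0.
Qed.

Let gam_z0 x : normc (gam x - z0) = rad.
by rewrite /gam addrC addKr normcM normc_cis mulr1 normc_real gtr0_norm. Qed.

Let gam_w x : rad - normc (w - z0) <= normc (gam x - w).
Proof.
rewrite lerBlDr -(gam_z0 x) (_ : gam x - z0 = (gam x - w) + (w - z0)); last by rewrite addrA subrK.
exact: normcD.
Qed.

Let gap0 : 0 < rad - normc (w - z0). by rewrite subr_gt0. Qed.

Let gam_w0 x : gam x - w != 0.
by apply: contraTneq (gam_w x)=> ->; rewrite normc0 -ltNge. Qed.

Lemma ker_bound x : normc (ker x) <= rad / (rad - normc (w - z0)).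
Proof.
rewrite /ker normcM normcV gam_z0 ler_pM2l//.
by rewrite lef_pV2 ?posrE// (lt_le_trans gap0).
Qed.

Lemma ccont_gam : ccont gam.
Proof. by apply: ccontD; [exact: ccont_cst|apply: ccontM; [exact: ccont_cst|exact: ccont_cis]]. Qed.

Lemma ccont_ker : ccont ker.
Proof.
apply: ccontM; first by apply: ccontB; [exact: ccont_gam|exact: ccont_cst].
by apply: (ccontV gap0)=> //; apply: ccontB; [exact: ccont_gam|exact: ccont_cst].
Qed.

(** Contraction of the circle to [w] along segments; it stays in the disc on which [g] is
    differentiable. *)
Let path t x : C := w + t%:C%C * (gam x - w).

Let ccont_path t : ccont (path t).
Proof.
apply: ccontD; first exact: ccont_cst.
by apply: ccontM; [exact: ccont_cst|apply: ccontB; [exact: ccont_gam|exact: ccont_cst]].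
Qed.

Let ccont_gpath t : ccont (g \o path t). exact: (ccont_lip gK). Qed.

Let path_in t x : 0 <= t <= 1 -> normc (path t x - z0) <= rad.
Proof.
move=> /andP[t0 t1].
have -> : path t x - z0 = (1 - t)%:C%C * (w - z0) + t%:C%C * (gam x - z0).
 rewrite /path; ring.
apply: (le_trans (normcD _ _)); rewrite !normcM !normc_real gam_z0 !ger0_norm ?subr_ge0//.
have := ltW wr; nra.
Qed.

Let phi t : C := cmean (fun x => g (path t x) * ker x).

Let incr t t' x : C := (g (path t' x) - g (path t x)) * ker x.

Let ccont_incr t t' : ccont (incr t t').
by apply: ccontM; [apply: ccontB; exact: ccont_gpath|exact: ccont_ker]. Qed.

Let incr_bound t t' x : normc (incr t t' x) <= K * rad * `|t' - t|.
Proof.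
rewrite normcM.
via (K * normc (path t' x - path t x) * normc (ker x)).
 by rewrite ler_wpM2r ?normc_ge0.
have -> : path t' x - path t x = (t' - t)%:C%C * (gam x - w) by rewrite /path; ring.
have e1 : normc (gam x - w) * normc (ker x) = rad.
 by rewrite -normcM /ker mulrC divfK//.
rewrite normcM normc_real -e1 le_eqVlt; apply/orP; left; apply/eqP; ring.
Qed.

Let phi_diff t t' : phi t' - phi t = cmean (incr t t').
Proof.
apply: (addIr (phi t)); rewrite subrK -cmeanD//; last by apply: ccontM; [exact: ccont_gpath|exact: ccont_ker].
congr cmean; apply/funext=> x; rewrite /incr; ring.
Qed.

Let phi_lip t t' : normc (phi t' - phi t) <= 2 * (K * rad * `|t' - t|).
by rewrite phi_diff; apply: cmean_norm=> // x. Qed.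

Let cc_phi : ccont phi.
Proof.
move=> t; apply/ccvP=> e e0; have M0 : 0 < 2 * (K * rad) + 1 by rewrite ltr_wpDl// !mulr_ge0// ltW.
have h : \forall y \near t, `|t - y| < e / (2 * (K * rad) + 1).
 by apply: (@nbhsx_ballx _ R^o t); rewrite divr_gt0.
apply: filterS h=> y h; apply: (le_trans (phi_lip t y)).
rewrite mulrA distrC; via ((2 * (K * rad) + 1) * `|t - y|).
 by rewrite ler_wpM2r// lerDl.
by rewrite mulrC -ler_pdivlMr// ltW.
Qed.

Let turn t n x : C := (n.+1%:R)%:C%C * (g (path t (x + n.+1%:R^-1)) - g (path t x)).

Let turn_bound t n x : normc (turn t n x) <= K * (`|t| * (rad * 2)).
Proof.
rewrite normcM normc_real ger0_norm//.
have n0 : 0 < n.+1%:R :> R by [].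
rewrite mulrC -ler_pdivlMr// -mulrA; apply: (le_trans (gK _ _)); rewrite ler_wpM2l//.
have -> : path t (x + n.+1%:R^-1) - path t x = t%:C%C * (rad%:C%C * (cis (x + n.+1%:R^-1) - cis x)).
 rewrite /path /gam; ring.
rewrite !normcM !normc_real -!mulrA ler_wpM2l// (gtr0_norm rad0) ler_wpM2l ?(ltW rad0)//.
by apply: (le_trans (cis_lip _ _)); rewrite addrC addKr ger0_norm.
Qed.

Let cc_turn t n : ccont (turn t n).
Proof.
apply: ccontM; first exact: ccont_cst.
have cS := @ccont_shift _ n.+1%:R^-1 (@ccont_gpath t).
by apply: ccontB; [tame|exact: ccont_gpath].
Qed.

Let turn_mean t n : cmean (turn t n) = 0.
Proof.
have tau1 : 1 <= tau by have := pi_ge2 R; rewrite /tau mulr2n; lra.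
have cS := @ccont_shift _ n.+1%:R^-1 (@ccont_gpath t).
have cB := ccontB cS (@ccont_gpath t); rewrite /turn cmeanZ//.
apply/eqP; rewrite mulf_eq0; apply/orP; right; apply/eqP; apply: (addIr (cmean (g \o path t))).
rewrite add0r -cmeanD//.
rewrite (_ : (fun x=> _) = (fun x=> (g \o path t) (x + n.+1%:R^-1))); last by apply/funext=> x /=; rewrite subrK.
apply: cmean_turn=> // [x|]; first by rewrite /path /gam /= cis_periodic.
by rewrite invr_gt0 ltr0n (le_trans _ tau1)// invf_le1// ler1n.
Qed.

(* The derivative of [path] in [t] is proportional to its derivative along the
   circle, and the latter has mean zero. *)
Let phi_derive t (u : nat -> R) : 0 < t < 1 -> (forall n, u n != 0) -> u n @[n --> \oo] --> 0 ->
  ccvg (fun n => ((u n)^-1)%:C%C * (phi (t + u n) - phi t)) 0.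
Proof.
move=> /andP[t0 t1] u0 u_0.
(* The derivative of [path] in [t] times the kernel is gam - z0, which is 1/(it) times its
   derivative in [x]. Adding the opposite multiple of [turn], whose mean is 0, makes the integrand
   tend to 0 pointwise. *)
pose c : C := - ('i%C * t%:C%C)^-1.
have t0' : t%:C%C != 0 :> C by rewrite eq_complex /= gt_eqF.
have i0 : 'i%C != 0 :> C by rewrite eq_complex /= eqxx oner_eq0.
pose Q n x : C := ((u n)^-1)%:C%C * incr t (t + u n) x.
have cQ n : ccont (Q n) by apply: ccontM=> //; exact: ccont_cst.
have cT n : ccont (fun x=> c * turn t n x) by apply: ccontM; [exact: ccont_cst|tame].
rewrite (_ : (fun n=> _) = (fun n=> cmean (fun x=> Q n x + c * turn t n x))); last first.
 by apply/funext=> n; rewrite cmeanD// (cmeanZ c (@cc_turn t n)) turn_mean cmeanZ// mulr0 addr0 phi_diff.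
apply: (@cmean_dct _ (K * rad + normc c * (K * (`|t| * (rad * 2))))).
- move=> n; exact: ccontD.
- move=> n x; apply: (le_trans (normcD _ _)); apply: lerD; last first.
  by rewrite normcM ler_wpM2l ?normc_ge0.
 rewrite /Q normcM normc_real normfV mulrC ler_pdivrMr ?normr_gt0//.
 by apply: (le_trans (incr_bound t (t + u n) x)); rewrite addrC addKr.
have h01 : 0 <= t <= 1 by lra.
move=> x; have [d hd] := gd (path_in x h01).
have -> : (0 : C) = (d * (gam x - w)) * ker x + c * (d * (t%:C%C * (rad%:C%C * ('i%C * cis x)))).
 have -> : d * (gam x - w) * ker x = d * (gam x - z0) by rewrite /ker; field; exact: gam_w0.
 rewrite /c.
 have -> : gam x - z0 = rad%:C%C * cis x by rewrite /gam addrC addKr.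
 by field; rewrite t0'.
apply: ccvD.
 rewrite (_ : (fun n=> _) = (fun n=> ((u n)^-1)%:C%C * (g (path t x + (u n)%:C%C * (gam x - w)) - g (path t x)) * ker x)); last first.
  apply/funext=> n; rewrite /Q /incr mulrA; congr (_ * (g _ - _) * _).
  rewrite /path; ring.
 apply: ccvM; last exact: ccv_cst.
 apply: (cderiv_chain hd u0 u_0).
 rewrite (_ : (fun n=> _) = (fun=> gam x - w)); first exact: ccv_cst.
 apply/funext=> n; rewrite mulrA -rmorphM mulVf// rmorph1 mul1r //.
apply: ccvM; first exact: ccv_cst.
have sn n : (n.+1%:R^-1 : R) != 0 by [].
have := @cderiv_chain g (path t x) d (fun n=> n.+1%:R^-1) (fun n=> t%:C%C * (rad%:C%C * (cis (x + n.+1%:R^-1) - cis x))) _ hd sn natSinv_cvg.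
rewrite (_ : (fun n=> ((n.+1%:R^-1)^-1)%:C%C * (g (_ + _) - _)) = (fun n=> turn t n x)); last first.
 apply/funext=> n; rewrite invrK /turn; congr (_ * (g _ - _)).
 rewrite /path /gam; ring.
apply; rewrite (_ : (fun n=> _) = (fun n=> t%:C%C * (rad%:C%C * ((n.+1%:R)%:C%C * (cis (x + n.+1%:R^-1) - cis x))))); last first.
 apply/funext=> n; rewrite invrK; ring.
apply: ccvM; first exact: ccv_cst.
by apply: ccvM; [exact: ccv_cst|exact: cis_derive].
Qed.

Let const_of (F : R -> R) : continuous F ->
  (forall t (u : nat -> R), 0 < t < 1 -> (forall n, u n != 0) -> u n @[n --> \oo] --> 0 ->
     (u n)^-1 * (F (t + u n) - F t) @[n --> \oo] --> 0) -> F 1 = F 0.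
Proof.
move=> cF dF.
have dF0 (t : R) : 0 < t < 1 -> is_derive t (1 : R) F 0.
 move=> t01; have hl : h^-1 *: ((F \o shift t) (h *: (1 : R)) - F t) @[h --> 0^'] --> (0 : R).
  apply/cvgr_dnbhsP=> u [u0 u_0]; apply: cvg_trans (dF t u t01 u0 u_0); apply: near_eq_cvg; near=> n.
  by rewrite /= -[_%:A]/(u n * 1) mulr1 [_ + t]addrC.
 apply: DeriveDef; first by apply/cvg_ex; exists 0.
 exact: cvg_lim hl.
have [c _] := @MVT _ F (fun=> 0) 0 1 ltr01
 (fun x hx=> dF0 x ltac:(by move: hx; rewrite in_itv/=))
 ltac:(by apply: continuous_subspaceT; exact: cF).
lra.
Unshelve. all: by end_near. Qed.

(** The mean over the contracted loop has zero derivative in [t], so its values at the circle and at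
    [w] agree. The Lipschitz bound dominates the difference quotients, so pointwise
    differentiability suffices. The mean of the kernel is left unevaluated. *)
Lemma cauchy_identity : cmean (fun x => g (gam x) * ker x) = g w * cmean ker.
Proof.
have p1 : phi 1 = cmean (fun x=> g (gam x) * ker x).
 by congr cmean; apply/funext=> x; rewrite /path mul1r addrC subrK.
have p0 : phi 0 = g w * cmean ker.
 by rewrite -cmeanZ; [congr cmean; apply/funext=> x; rewrite /path mul0r addr0|exact: ccont_ker].
rewrite -p1 -p0; apply/eqP; rewrite eq_complex; apply/andP; split; apply/eqP.
 apply: (@const_of (Rez \o phi))=> [|t u t01 u0 u_0]; first tame.
 have [h _] := phi_derive t01 u0 u_0.
 by apply: cvg_trans h; apply: near_eq_cvg; apply: nearW=> n; rewrite reM reB /= mul0r subr0.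
apply: (@const_of (Imz \o phi))=> [|t u t01 u0 u_0]; first tame.
have [_ h] := phi_derive t01 u0 u_0.
by apply: cvg_trans h; apply: near_eq_cvg; apply: nearW=> n; rewrite imM imB /= mul0r addr0.
Qed.

End identity.

Section conformal_limit.
Variables (f : C -> C) (K rad : R) (z0 : C).
Hypotheses (fK : forall z z', normc (f z - f z') <= K * normc (z - z')) (rad0 : 0 < rad)
  (approx : forall e : R, 0 < e -> exists g : C -> C,
     [/\ forall z z', normc (g z - g z') <= K * normc (z - z'),
         forall z, normc (z - z0) <= rad -> exists d, cderiv g z d &
         forall z, normc (g z - f z) <= e]).

Let gm := gam rad z0.
Let kr := ker rad z0.

Let K0 : 0 <= K.
Proof.
have := fK 1 0; rewrite subr0 normc1 mulr1.
apply: le_trans; exact: normc_ge0.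
Qed.

Let gm_z0 x : normc (gm x - z0) = rad.
by rewrite /gm /gam addrC addKr normcM normc_cis mulr1 normc_real gtr0_norm. Qed.

Let cc_f : ccont (f \o gm).
by apply: (ccont_lip fK); exact: ccont_gam. Qed.

Lemma limit_identity w : normc (w - z0) < rad ->
  cmean (fun x => f (gm x) * kr w x) = f w * cmean (kr w).
Proof.
move=> wr; have gap0 : 0 < rad - normc (w - z0) by rewrite subr_gt0.
have kb x : normc (kr w x) <= rad / (rad - normc (w - z0)) by exact: ker_bound.
have ck : ccont (kr w) by exact: ccont_ker.
set k0 := rad / (rad - normc (w - z0)) in kb.
have k00 : 0 <= k0 by rewrite divr_ge0// ltW.
set I := cmean _; set J := cmean (kr w).
suff h (e : R) : 0 < e -> normc (I - f w * J) <= e * (2 * k0 + 2 * k0).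
 apply/eqP; rewrite -subr_eq0; apply/eqP; apply: eq0_normc.
 apply/eqP; rewrite eq_le normc_ge0 andbT; apply/ler_addgt0Pl=> e e0; rewrite addr0.
 have d0 : 0 < 2 * k0 + 2 * k0 + 1 by lra.
 apply: (le_trans (h (e / (2 * k0 + 2 * k0 + 1)) (divr_gt0 e0 d0))).
 by rewrite mulrAC ler_pdivrMr// ler_pM2l// lerDl.
move=> e0; have [g [gK gd gf]] := approx e0.
have id := cauchy_identity gK rad0 gd wr; rewrite -/gm -/kr -/J in id.
have cg : ccont (g \o gm) by apply: (ccont_lip gK); exact: ccont_gam.
have -> : I - f w * J = (I - cmean (fun x=> g (gm x) * kr w x)) + (g w - f w) * J.
 rewrite id; ring.
apply: (le_trans (normcD _ _)); rewrite mulrDr; apply: lerD; last first.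
 rewrite normcM; apply: ler_pM; rewrite ?normc_ge0//.
 exact: cmean_norm.
have db x : normc (f (gm x) * kr w x - g (gm x) * kr w x) <= e * k0.
 rewrite -mulrBl normcM; apply: ler_pM; rewrite ?normc_ge0//.
 by rewrite -normcN opprB.
have cd : ccont (fun x=> f (gm x) * kr w x - g (gm x) * kr w x) by apply: ccontB; exact: ccontM.
have -> : I = cmean (fun x=> f (gm x) * kr w x - g (gm x) * kr w x) + cmean (fun x=> g (gm x) * kr w x).
 by rewrite -cmeanD//; [congr cmean; apply/funext=> x; rewrite subrK|exact: ccontM].
rewrite addrK mulrCA; exact: cmean_norm.
Qed.

(** Cauchy's identity survives uniform limits and expresses [f] near [z0] by means over a fixed
    circle; expanding the kernel in [k] leaves an error of second order. *)
Lemma limit_cderiv : exists d, cderiv f z0 d.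
Proof.
have gz x : gm x - z0 != 0 by apply: contraTneq rad0=> h; rewrite -(gm_z0 x) h normc0 ltxx.
have cgz : ccont (fun x=> gm x - z0) by apply: ccontB; [exact: ccont_gam|exact: ccont_cst].
have cfz : ccont (fun x=> f (gm x) - f z0) by apply: ccontB=> //; exact: ccont_cst.
have fz x : normc (f (gm x) - f z0) <= K * rad by apply: (le_trans (fK _ _)); rewrite gm_z0.
have cgzV : ccont (fun x=> (gm x - z0)^-1) by apply: (ccontV rad0)=> // x; rewrite gm_z0.
have gzV x : normc (gm x - z0)^-1 = rad^-1 by rewrite normcV gm_z0.
pose q x := (f (gm x) - f z0) * (gm x - z0)^-1.
have cq : ccont q by exact: ccontM.
have qb x : normc (q x) <= K.
 by rewrite normcM gzV ler_pdivrMr.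
(* Cauchy's integral for the derivative, with [f z0] subtracted so that the integrand is bounded by
   [K]. *)
pose a := cmean q; exists a.
(* The constant 8 arises from two error terms, each at most 4 K / rad times the square of the
   modulus of [k]. *)
have main k : normc k <= rad / 2 -> normc (f (z0 + k) - f z0 - a * k) <= 8 * K / rad * (normc k * normc k).
 move=> kr2; set w := z0 + k.
 have wk : w - z0 = k by rewrite /w addrC addKr.
 have wr : normc (w - z0) < rad by rewrite wk; apply: (le_lt_trans kr2); rewrite ltr_pdivrMr// ltr_pMr// ltr1n.
 have gw x : rad / 2 <= normc (gm x - w).
  have : rad <= normc (gm x - w) + normc k.
   by rewrite -(gm_z0 x) -wk (_ : gm x - z0 = (gm x - w) + (w - z0)) ?normcD// addrA subrK.
  lra.
 have r2 : 0 < rad / 2 by rewrite divr_gt0.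
 have gw0 x : gm x - w != 0 by apply: contraTneq (gw x)=> ->; rewrite normc0 -ltNge.
 have cgw : ccont (fun x=> (gm x - w)^-1).
  by apply: (ccontV r2)=> //; apply: ccontB; [exact: ccont_gam|exact: ccont_cst].
 have gwV x : normc (gm x - w)^-1 <= 2 / rad.
  by rewrite normcV -[2 / rad]invf_div lef_pV2 ?posrE// (lt_le_trans r2).
 have kE x : kr w x = 1 + k * (gm x - w)^-1.
  by rewrite /kr /ker -/gm -{1}wk; field.
 have cZ (z : C) F : ccont F -> ccont (fun x=> z * F x) by apply: ccontM; exact: ccont_cst.
 have JE : cmean (kr w) = 1 + k * cmean (fun x=> (gm x - w)^-1).
  rewrite -cmeanZ// -{1}(cmean_cst 1) -cmeanD//; [|exact: ccont_cst|tame].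
  by congr cmean; apply/funext=> x.
 have id := limit_identity wr.
 have wr0 : normc (z0 - z0) < rad by rewrite subrr normc0.
 have id0 := limit_identity wr0.
 have k1 x : kr z0 x = 1 by rewrite /kr /ker divff//.
 pose p x := q x * (gm x - w)^-1.
 have cp : ccont p by exact: ccontM.
 have pb x : normc (p x) <= K * (2 / rad).
  by rewrite normcM; apply: ler_pM; rewrite ?normc_ge0.
 have fE x : f (gm x) * kr w x = f (gm x) + (f z0 * (k * (gm x - w)^-1) + (k * q x + (k * k) * p x)).
  by rewrite kE /p /q; rewrite -[k in X in _ = _ + (_ + (_ + k * X * _))]wk; rewrite -wk; field; rewrite gw0 gz.
 have f0E : cmean (fun x=> f (gm x)) = f z0.
  have <- : cmean (fun x=> f (gm x) * kr z0 x) = cmean (fun x=> f (gm x)).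
   by congr cmean; apply/funext=> x; rewrite k1 mulr1.
  rewrite id0 (_ : kr z0 = fun=> 1) ?cmean_cst ?mulr1//; by apply/funext=> x; exact: k1.
 set V := cmean (fun x=> (gm x - w)^-1) in JE.
 have e1 : f z0 + (f z0 * (k * V) + (k * a + k * k * cmean p)) = f w * (1 + k * V).
  have cV := cZ k _ cgw; have cfV := cZ (f z0) _ cV; have cS := ccontD (cZ k _ cq) (cZ (k * k) _ cp).
  rewrite -JE -id -{1}f0E /a /V -(cmeanZ k cgw) -(cmeanZ (f z0) cV) -(cmeanZ k cq) -(cmeanZ (k * k) cp).
  rewrite -(cmeanD (cZ k _ cq) (cZ (k * k) _ cp)) -(cmeanD cfV cS) -(cmeanD cc_f (ccontD cfV cS)).
  by congr cmean; apply/funext=> x.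
 have -> : f w - f z0 - a * k = k * k * cmean p - (f w - f z0) * (k * V).
  have : f w = f z0 + (f z0 * (k * V) + (k * a + k * k * cmean p)) - f w * (k * V) by rewrite e1; ring.
  move=> {1}->; ring.
 have Vb : normc V <= 2 * (2 / rad) by exact: cmean_norm.
 have Pb : normc (cmean p) <= 2 * (K * (2 / rad)) by exact: cmean_norm.
 have fw : normc (f w - f z0) <= K * normc k by rewrite -wk.
 apply: (le_trans (normcD _ _)); rewrite normcN !normcM.
 have kk0 : 0 <= normc k * normc k by rewrite mulr_ge0 ?normc_ge0.
 via (normc k * normc k * (2 * (K * (2 / rad))) + K * normc k * (normc k * (2 * (2 / rad)))).
  apply: lerD; first by rewrite ler_wpM2l.
  by apply: ler_pM; rewrite ?mulr_ge0 ?normc_ge0// ler_wpM2l ?normc_ge0.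
 rewrite le_eqVlt; apply/orP; left; apply/eqP; field; rewrite gt_eqF//.
move=> e e0; exists (Num.min (rad / 2) (e / (8 * K / rad + 1))).
 have h : 0 < 8 * K / rad + 1 by rewrite ltr_wpDl// divr_ge0 ?mulr_ge0// ltW.
 by rewrite lt_min !divr_gt0.
move=> k; rewrite lt_min=> /andP[k1 k2]; apply: (le_trans (main k (ltW k1))).
rewrite mulrA ler_wpM2r ?normc_ge0//.
have h : 0 < 8 * K / rad + 1 by rewrite ltr_wpDl// divr_ge0 ?mulr_ge0// ltW.
move: k2; rewrite ltr_pdivlMr// => k2; apply: le_trans (ltW k2); rewrite mulrC ler_wpM2l ?normc_ge0//.
lra.
Qed.

End conformal_limit.
End complex_means.

Section complex_derivative.
Context (R : realType).
Notation normc := (@normc R).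
Implicit Types (f : plane R -> plane R) (z d : plane R).

Let dnear (Q : plane R -> Prop) : (\forall h \near (0 : plane R)^', Q h) <->
  exists2 del : R, 0 < del & forall h : plane R, h != 0 -> normc h < del -> Q h.
Proof.
have cd0 (h : plane R) : cdist 0 h = normc h by rewrite /cdist sub0r; exact: normcN.
split=> [|[del del0 hQ]].
 rewrite /dnbhs /within /= => /plane_nbhs[e e0 he]; exists e=> // h h0 hh.
 by apply: he=> //; rewrite cd0.
rewrite /dnbhs /within /=; apply: (nbhs_plane del0)=> h; rewrite cd0=> hd h0; exact: hQ.
Qed.

Lemma cderivP f z d : cderiv f z d <-> (h^-1 *: (f (h *: (1 : R[i]) + z) - f z) @[h --> (0 : plane R)^'] --> d).
Proof.
have qE (h : R[i]) : h != 0 -> h^-1 *: (f (h *: (1 : R[i]) + z) - f z) - d = h^-1 * (f (z + h) - f z - d * h) :> R[i].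
 move=> h0; rewrite -[h *: 1]/(h * 1 : R[i]) mulr1 [h + z]addrC -[h^-1 *: _]/(h^-1 * _ : R[i]).
 by rewrite [RHS]mulrBr [h^-1 * (d * h)]mulrCA mulVf// mulr1.
split=> [hd|hl].
 apply/cvgrPdist_le=> e; rewrite ltcE/= => /andP[/eqP e2 e0].
 have -> : e = (complex.Re e)%:C%C by case: e e2 {e0} => a c /= ->.
 have [del del0 hdel] := hd _ e0; apply: (proj2 (dnear _)); exists del=> // h h0 hh.
 rewrite distrC -[`|_|]/((normc _)%:C%C) lecR qE// normcM normcV.
 rewrite mulrC ler_pdivrMr ?normc_gt0//; exact: hdel.
move=> e e0; have e0' : 0 < e%:C%C :> R[i] by rewrite ltcR.
have /cvgrPdist_le/(_ _ e0') hn := hl; have [del del0 hdel] := proj1 (dnear _) hn; exists del=> // h hh.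
have [->|h0] := eqVneq h 0; first by rewrite addr0 subrr mulr0 subr0 normc0 mulr0.
have := hdel h h0 hh; rewrite distrC -[`|_|]/((normc _)%:C%C) lecR qE// normcM normcV.
by rewrite mulrC ler_pdivrMr ?normc_gt0.
Qed.

Lemma derivable_cderiv f z : derivable f z 1 <-> exists d, cderiv f z d.
Proof.
split=> [/cvg_ex[d hd]|[d /cderivP hd]]; first by exists d; apply/cderivP.
by apply/cvg_ex; exists d.
Qed.

Lemma cderiv_val f z d : cderiv f z d -> 'D_1 f z = d.
Proof. by move=> /cderivP hd; apply: cvg_lim hd. Qed.

End complex_derivative.

Section cderiv_calculus.
Context (R : realType).
Notation C := (R[i]).
Notation Rez := (@complex.Re R).
Notation normc := (@ComplexField.Normc.normc R).
Implicit Types (f g h : C -> C) (z d k : C).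

Lemma cderiv_comp g h z d d' : cderiv g z d -> cderiv h (g z) d' -> cderiv (h \o g) z (d' * d).
Proof.
move=> gd hd e e0.
have d0 := normc_ge0 d; have d0' := normc_ge0 d'.
have p1 : 0 < e / (2 * (normc d' + 1)) by rewrite divr_gt0// mulr_gt0// ltr_wpDl.
have p2 : 0 < e / (2 * (normc d + 1)) by rewrite divr_gt0// mulr_gt0// ltr_wpDl.
set e1 := Num.min 1 (e / (2 * (normc d' + 1))).
have e10 : 0 < e1 by rewrite lt_min ltr01.
have [r1 r10 h1] := gd e1 e10; have [r2 r20 h2] := hd _ p2.
exists (Num.min r1 (r2 / (normc d + 1))); first by rewrite lt_min r10 divr_gt0// ltr_wpDl.
move=> k; rewrite lt_min=> /andP[k1 k2]; have {}h1 := h1 k k1.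
pose kap := g (z + k) - g z.
have kapb : normc kap <= (normc d + 1) * normc k.
 rewrite -[kap](subrK (d * k)); apply: (le_trans (normcD _ _)).
 rewrite normcM mulrDl mul1r addrC lerD2l.
 by apply: (le_trans h1); rewrite ler_piMl ?normc_ge0// ge_min lexx.
have {}h2 : normc (h (g z + kap) - h (g z) - d' * kap) <= e / (2 * (normc d + 1)) * normc kap.
 by apply: h2; apply: (le_lt_trans kapb); rewrite mulrC -ltr_pdivlMr// ltr_wpDl.
have -> : (h \o g) (z + k) - (h \o g) z - d' * d * k =
  (h (g z + kap) - h (g z) - d' * kap) + d' * (g (z + k) - g z - d * k).
 rewrite /kap [g z + _]addrC subrK /=; ring.
apply: (le_trans (normcD _ _)); rewrite normcM.
via (e / (2 * (normc d + 1)) * ((normc d + 1) * normc k) + normc d' * (e1 * normc k)).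
 apply: lerD; first by apply: (le_trans h2); rewrite ler_wpM2l// ltW.
 by rewrite ler_wpM2l.
have -> : e / (2 * (normc d + 1)) * ((normc d + 1) * normc k) = e / 2 * normc k.
 by field; rewrite gt_eqF// ltr_wpDl.
rewrite mulrA -mulrDl ler_wpM2r ?normc_ge0// [leRHS]splitr lerD2l.
via ((normc d' + 1) * (e / (2 * (normc d' + 1)))).
 by apply: ler_pM; rewrite ?(ltW e10)// ?lerDl// ge_min lexx orbT.
have -> : (normc d' + 1) * (e / (2 * (normc d' + 1))) = e / 2 by field; rewrite gt_eqF// ltr_wpDl.
by [].
Qed.

Lemma cderiv_local g h z d (r : R) : 0 < r -> (forall w, normc (w - z) < r -> g w = h w) ->
  cderiv g z d -> cderiv h z d.
Proof.
move=> r0 gh gd e e0; have [r1 r10 h1] := gd e e0.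
exists (Num.min r r1); first by rewrite lt_min r0.
move=> k; rewrite lt_min=> /andP[k1 k2]; rewrite -!gh ?h1//.
 by rewrite subrr normc0.
by rewrite addrC addKr.
Qed.

Lemma cderiv_affine (a c : C) z : cderiv (fun w => a * w + c) z a.
Proof.
move=> e e0; exists 1=> // k _; rewrite (_ : _ - _ = 0); last by ring.
by rewrite normc0 mulr_ge0 ?normc_ge0// ltW.
Qed.

(** A nonzero derivative allows a small step that strictly lowers the real part in the direction
    [om], so the lower bound is not attained at [z]. This stands in for the open mapping theorem. *)
Lemma cderiv_open g z d om (c r : R) : cderiv g z d -> d != 0 -> normc om = 1 -> 0 < r ->
  (forall k, normc k < r -> 0 <= Rez (om * g (z + k)) + c) -> 0 < Rez (om * g z) + c.
Proof.
move=> gd d0 om1 r0 H; rewrite ltNge; apply/negP=> neg.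
have nd := normc_gt0 d0.
have om0 : om != 0 by apply: contraTneq (ltr01 : 0 < 1 :> R)=> om0; rewrite -om1 om0 normc0 ltxx.
have [del del0 hdel] := gd (normc d / 2) (divr_gt0 nd (ltr0n _ _ : 0 < 2)).
set m := Num.min r del; have m0 : 0 < m by rewrite lt_min r0.
pose t := normc d * (m / 2); have t0 : 0 < t by rewrite mulr_gt0 ?divr_gt0.
pose k : C := - (t%:C%C / (om * d)).
have nk : normc k = m / 2.
 rewrite normcN normcM normcV normcM om1 mul1r normc_real.
 by rewrite gtr0_norm// /t mulrAC mulfV ?gt_eqF// mul1r.
have km : normc k < m by lra.
have [kr kd] : normc k < r /\ normc k < del by move: km; rewrite lt_min=> /andP[].
have h1 := H k kr; have h2 := hdel k kd.
set err := g (z + k) - g z - d * k in h2.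
have e1 : om * g (z + k) = om * g z - t%:C%C + om * err.
 have : om * (d * k) = - t%:C%C by rewrite /k; field; rewrite d0.
 move=> <-; rewrite /err; ring.
have e2 : Rez (om * g (z + k)) = Rez (om * g z) - t + Rez (om * err).
 rewrite e1; case: (om * g z)=> ? ?; case: (om * err)=> ? ? //.
have e3 : Rez (om * err) <= t / 2.
 apply: (le_trans (ler_norm _)); apply: (le_trans (normc_Re _)).
 rewrite normcM om1 mul1r; apply: (le_trans h2); rewrite nk /t.
 by rewrite le_eqVlt; apply/orP; left; apply/eqP; field.
move: h1; lra.
Qed.

End cderiv_calculus.

(** * Interior points under conformal branches *)

Section interior.
Context (R : realType).
Notation pl := (plane R).
Notation X := (closed_square R).
Notation Q := (open_square R).

Lemma open_square_ball (z : pl) : Q z -> exists2 r : R, 0 < r & forall w, cdist w z < r -> Q w.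
Proof.
case: z=> x y [/= /andP[x0 x1] /andP[y0 y1]].
exists (Num.min (Num.min x (1 - x)) (Num.min y (1 - y))).
 by rewrite !lt_min x0 y0 !subr_gt0 x1.
move=> [a c]; rewrite !lt_min=> /andP[/andP[h1 h2] /andP[h3 h4]].
have hr := le_Re (complex.Complex a c : pl) (complex.Complex x y); have hi := le_Im (complex.Complex a c : pl) (complex.Complex x y).
move: hr hi; rewrite /= !ler_norml=> /andP[a1 a2] /andP[c1 c2].
split=> /=; lra.
Qed.

Lemma open_closed (z : pl) : Q z -> X z.
Proof.
move=> [/andP[a1 a2] /andP[c1 c2]].
by split; rewrite ?(ltW a1) ?(ltW a2) ?(ltW c1) ?(ltW c2).
Qed.

Lemma open_half (z : pl) : Q z -> half_open_square R z.
Proof. by move=> [/andP[a1 a2] /andP[c1 c2]]; split; rewrite ?(ltW a1) ?(ltW c1). Qed.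

(** The four sides of the square correspond to the directions 1, -1, -i and i in [cderiv_open]. *)
Lemma conformal_interior (T : pl -> pl) z : (forall w, X w -> X (T w)) -> conformal_on Q T -> Q z -> Q (T z).
Proof.
move=> TX cT Qz; have [/derivable_cderiv[d hd] D0] := cT z Qz.
have d0 : d != 0 by move: D0; rewrite (cderiv_val hd).
have [r r0 rQ] := open_square_ball Qz.
have XT k : ComplexField.Normc.normc k < r -> X (T (z + k)).
 by move=> kr; apply: TX; apply: open_closed; apply: rQ; rewrite /cdist addrC addKr.
have reE (w : R[i]) : [/\ complex.Re (1 * w) = complex.Re w, complex.Re (-1 * w) = - complex.Re w,
  complex.Re (- 'i%C * w) = complex.Im w & complex.Re ('i%C * w) = - complex.Im w].
 by case: w=> a c; split; rewrite /= ?oppr0 ?mul0r ?mul1r ?mulN1r ?subr0 ?sub0r ?opprK.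
have n1 : ComplexField.Normc.normc (1 : R[i]) = 1 by exact: normc1.
have n2 : ComplexField.Normc.normc (-1 : R[i]) = 1 by rewrite normcN.
have n3 : ComplexField.Normc.normc ('i%C : R[i]) = 1 by rewrite /= expr0n add0r expr1n sqrtr1.
have n4 : ComplexField.Normc.normc (- 'i%C : R[i]) = 1 by rewrite normcN.
have p1 := @cderiv_open R T z d 1 0 r hd d0 n1 r0; have p2 := @cderiv_open R T z d (-1) 1 r hd d0 n2 r0.
have p3 := @cderiv_open R T z d (- 'i%C) 0 r hd d0 n4 r0; have p4 := @cderiv_open R T z d 'i%C 1 r hd d0 n3 r0.
split; apply/andP; split.
- have [e _ _ _] := reE (T z); rewrite -e -[ltRHS]addr0; apply: p1=> k /XT[/andP[h _] _].
 by have [-> _ _ _] := reE (T (z + k)); rewrite addr0.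
- have [_ e _ _] := reE (T z); rewrite -subr_gt0 addrC -e; apply: p2=> k /XT[/andP[_ h] _].
 by have [_ -> _ _] := reE (T (z + k)); rewrite addrC subr_ge0.
- have [_ _ e _] := reE (T z); rewrite -e -[ltRHS]addr0; apply: p3=> k /XT[_ /andP[h _]].
 by have [_ _ -> _] := reE (T (z + k)); rewrite addr0.
- have [_ _ _ e] := reE (T z); rewrite -subr_gt0 addrC -e; apply: p4=> k /XT[_ /andP[_ h]].
 by have [_ _ _ ->] := reE (T (z + k)); rewrite addrC subr_ge0.
Qed.

Lemma word_map_cderiv (M : nat) (S : 'I_M.+1 -> pl -> pl) w z : conformal_system S -> Q z ->
  Q (word_map S w z) /\ exists d, cderiv (word_map S w) z d.
Proof.
move=> [SX _ cS _]; elim: w=> [|i w IH] Qz /=.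
 split=> //; exists 1; apply: (@cderiv_local _ (fun w : R[i]=> 1 * w + 0) _ z 1 1)=> // [w _|].
  by rewrite mul1r addr0.
 exact: cderiv_affine.
have [Qw [d hd]] := IH Qz; split; first exact: (conformal_interior (SX i) (cS i)).
have [/derivable_cderiv[d' hd'] _] := cS i _ Qw.
exists (d' * d); exact: (cderiv_comp hd hd').
Qed.

End interior.

Lemma ae_support (R : realType) (M : nat) (P : probability (borel (shift_space M)) R) :
  {ae P, forall al, forall k, P (cyl (pfx al k)) != 0%E}.
Proof.
have h (w : seq 'I_M.+1) : {ae P, forall al : shift_space M, P (cyl w) = 0%E -> ~ cyl w al}.
 have [Pw|Pw] := eqVneq (P (cyl w)) 0%E; last by apply: aeW=> al Pw0; move: Pw; rewrite Pw0 eqxx.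
 by exists (cyl w); split=> //; [exact: cylM|move=> al /= /not_implyP[_ /contrapT]].
apply: (ae_mono (ae_forallc h))=> al hal k; apply/eqP=> /hal; apply; exact: cyl_prefix.
Qed.

(** * Magnified translates as affine maps *)

Section affine_zoom.
Context (R : realType) (b : nat).
Hypothesis hb : (1 < b)%N.
Notation X := (closed_square R).
Notation digit := ('I_(b ^ 2).-1.+1).
Let bR : 0 < b%:R :> R. by rewrite ltr0n ltnW. Qed.
Let bnR n : 0 < b%:R ^+ n :> R. exact: exprn_gt0. Qed.

(** The translates are shrunk by the factor [b] before magnification, whence the division. *)
Definition zoom_rate (u : seq digit) : R := b%:R ^+ size u / b%:R.

Lemma zoom_rate_ge u : b%:R^-1 <= zoom_rate u.
Proof. by rewrite /zoom_rate ler_peMl// exprn_ege1// ler1n ltnW. Qed.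

Lemma zoom_rate_gt0 u : 0 < zoom_rate u.
Proof. by rewrite divr_gt0. Qed.

Definition zoom N (t : offset b N) (u : seq digit) (z : R[i]) : R[i] :=
  (zoom_rate u)%:C%C * z + ((b%:R ^+ size u)%:C%C *
    complex.Complex (t.1%:R / b%:R ^+ (N * 2).+1) (t.2%:R / b%:R ^+ (N * 2).+1) -
    complex.Complex (key u).1%:R (key u).2%:R).

Lemma zoom_dist N (t : offset b N) u z w : cdist (zoom t u z) (zoom t u w) = zoom_rate u * cdist z w.
Proof.
rewrite /cdist -[RHS](_ : ComplexField.Normc.normc ((zoom_rate u)%:C%C * (z - w)) = _); last first.
 by rewrite normcM normc_real gtr0_norm// zoom_rate_gt0.
congr ComplexField.Normc.normc; rewrite /zoom; ring.
Qed.

Lemma zoomE N (t : offset b N) u z : X z ->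
  zoom t u z = bcube_map b (size u) (key u) (shrink t z).
Proof.
move=> [h1 h2]; rewrite /zoom /bcube_map /shrink /shrinkR !clampR_id//.
case: z h1 h2=> x y /= _ _; apply/eqP; rewrite eq_complex /= /zoom_rate.
by apply/andP; split; apply/eqP; field; rewrite !gt_eqF.
Qed.

Lemma zoom_gdig N (t : offset b N) u z : X z -> pfx (gdig t z) (size u) = u ->
  zoom t u z = pt R (dshift (size u) (gdig t z)).
Proof.
move=> Xz gu; rewrite (pt_dshift R hb) gu zoomE// pt_digits//; exact: shrink_half.
Qed.

Lemma zoom_half N (t : offset b N) u z : X z -> half_open_square R (zoom t u z) ->
  pfx (gdig t z) (size u) = u.
Proof.
move=> Xz; rewrite zoomE// => -[]; rewrite /bcube_map /= !mul0r !subr0 !addr0=> /andP[a1 a2] /andP[c1 c2].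
have : bcube b (size u) (key u) (shrink t z).
 rewrite /bcube /= !ler_pdivrMr// !ltr_pdivlMr// -!natr1 /=.
 lra.
by rewrite bcube_key// => -[_].
Qed.

End affine_zoom.

(** * Limits of rescaled branches *)

Section ultra_limits.
Context (R : realType) (U : set_system nat).
Hypothesis UU : UltraFilter U.
Implicit Types (u : nat -> R) (a c : R).

Lemma ultra_le u a c : u @ U --> a -> U [set k | u k <= c] -> a <= c.
Proof.
move=> ua uc; apply/ler_addgt0Pl=> e e0; move/cvgrPdist_le: ua=> /(_ _ e0) h.
have [k [/= h1 h2]] := filter_ex (filterI h uc).
move: h1; rewrite ler_norml=> /andP[_]; move: h2; lra.
Qed.

Lemma ultra_ge u a c : u @ U --> a -> U [set k | c <= u k] -> c <= a.
Proof.
move=> ua uc; apply/ler_addgt0Pl=> e e0; move/cvgrPdist_le: ua=> /(_ _ e0) h.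
have [k [/= h1 h2]] := filter_ex (filterI h uc).
move: h1; rewrite ler_norml=> /andP[+ _]; move: h2; lra.
Qed.

Lemma ultra_unique u a c : u @ U --> a -> u @ U --> c -> a = c.
Proof.
move=> ua uc; have vz : (fun k=> u k - u k) @ U --> a - c by exact: cvgB.
by apply/eqP; rewrite -subr_eq0 eq_le (ultra_le vz) ?(ultra_ge vz)//; apply: filterS filterT=> k _ /=; rewrite subrr.
Qed.

End ultra_limits.

Lemma lip_continuousR (R : realType) (h : plane R -> R) (H : R) : 0 <= H ->
  (forall z w, `|h z - h w| <= H * cdist z w) -> continuous h.
Proof.
move=> H0 hH z; apply: ((@cvgrPdist_lt R R^o (plane R) (nbhs z) _ _ _).2)=> e e0.
have H1 : 0 < H + 1 by lra.
apply: (@nbhs_plane _ _ _ (e / (H + 1))); first by rewrite divr_gt0.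
move=> w zw; apply: (le_lt_trans (hH z w)); apply: (@le_lt_trans _ _ ((H + 1) * cdist z w)).
 by rewrite ler_wpM2r ?cdist_ge0// lerDl.
by rewrite mulrC -ltr_pdivlMr.
Qed.

(** * Compactness of rescaled branches and conditioned Gibbs measures *)

Section limit_map.
Context (R : realType) (b : nat).
Hypothesis hb : (1 < b)%N.
Notation pl := (plane R).
Notation X := (closed_square R).
Notation Q := (open_square R).
Notation D := (b ^ 2).-1.
Notation digit := ('I_D.+1).
Notation Om := (shift_space D.*2.+1).
Notation Y := (shift_space D).
Notation T := (@tailT D).
Notation pt := (@pt R b).
Notation Phi := (@Phi R b hb).

Context (M : nat).
Notation Sp := (shift_space M).
Variables (S : 'I_M.+1 -> pl -> pl) (A : 'M[bool]_M.+1) (phi : Sp -> R)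
  (ms : probability (borel Sp) R) (mu : probability (borel pl) R).
Hypotheses (hS : conformal_system S) (hms : gibbs A phi ms)
  (hmu : forall E : set (borel pl), measurable E -> mu E = ms (subshift A `&` coding S @^-1` E)).
Variables (L r kappa : R) (lam : seq 'I_M.+1 -> R) (d0 : R).
Hypotheses (bounds : lip_bounds S L r kappa lam) (d00 : 0 < d0)
  (gap : forall al be, subshift A al -> subshift A be -> al 0%N <> be 0%N ->
     d0 <= cdist (coding S al) (coding S be)).
Implicit Types (om : Om) (y : Y) (al be : Sp).

Notation cod := (coding S).
Notation mass := (mass ms).

Let bR : 0 < b%:R :> R. by rewrite ltr0n ltnW. Qed.
Let L0 : 0 < L. by case: bounds=> L1 _ _ _; exact: lt_le_trans L1. Qed.
Let r01 : 0 <= r < 1. by case: bounds. Qed.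
Let kap0 : 0 < kappa. by case: bounds. Qed.
Let lam0 w : 0 < lam w. by case: bounds=> _ _ _ []. Qed.
Let up w (z z' : pl) : X z -> X z' -> cdist (word_map S w z) (word_map S w z') <= lam w * cdist z z'.
by case: bounds=> _ _ _ [_ _ h _ _]; exact: h. Qed.
Let low w (z z' : pl) : X z -> X z' -> lam w / L * cdist z z' <= cdist (word_map S w z) (word_map S w z').
by case: bounds=> _ _ _ [_ _ _ h _]; exact: h. Qed.
Let lam_step w i : kappa * lam w <= lam (rcons w i).
by case: bounds=> _ _ _ [_ _ _ _ h]; case/andP: (h w i). Qed.
Let cX al : X (cod al) := coding_X hS bounds al.
Let mcod := measurable_coding hS bounds.

Lemma coded_law (E : set (borel pl)) : measurable E -> mu E = ms (cod @^-1` E).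
Proof.
move=> mE; rewrite hmu//; apply: (gibbs_full hms).
premeas; exact: mcod.
Qed.

Lemma coded_square : mu X = 1%E.
Proof.
rewrite coded_law; last by apply: closed_borel; exact: closed_closed_square.
rewrite (_ : _ @^-1` _ = setT) ?probability_setT//.
apply/seteqP; split=> al // _; exact: cX.
Qed.

Lemma Ex_coded (F : pl -> R) : bmf (F : borel pl -> R) -> Ex mu F = Ex ms (F \o cod).
Proof. by move=> bF; rewrite (Ex_push mcod coded_law). Qed.

(** One magnification of a translate, given by offset, word and digits, together with a symbolic
    point and the length at which its branch is stopped. *)
Record stage := Stage {sN : nat; st : offset b sN; su : seq digit; sy : Y; sal : Sp; sn : nat}.

Definition scode (s : stage) : Om := iter (size (su s)) T (splice (fam_code mu (st s)) (sy s)).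
Definition sword (s : stage) := pfx (sal s) (sn s).
Definition smap (s : stage) (z : pl) : pl := zoom (st s) (su s) z.

(** The code agrees with [om0] to depth [k], the stopped branch has rescaled size [eta1] up to the
    factor [kappa], and the marked point of the attractor lies in the small cell [w0] of the
    magnified square, close to [zs]. *)
Definition stageP (om0 : Om) (zs : pl) (w0 : seq digit) (eta1 : R) (k : nat) (s : stage) :=
  [/\ pfx (sy s) (size (su s)) = su s, 0 < wt R (fam_code mu (st s)) [::] (su s),
      pfx (scode s) k = pfx om0 k & subshift A (sal s)] /\
  [/\ pfx (gdig (st s) (cod (sal s))) (size (su s ++ w0)) = su s ++ w0,
      kappa * eta1 <= zoom_rate R (su s) * lam (sword s) <= eta1 &
      cdist (smap s (cod (sal s))) zs <= 2 * b%:R ^- size w0].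

Definition approached om := forall k, exists N (t : offset b N) u y,
  [/\ pfx y (size u) = u, 0 < wt R (fam_code mu t) [::] u &
      pfx (iter (size u) T (splice (fam_code mu t) y)) k = pfx om k].

Lemma stages_exist om0 : {ae digit_law R om0, forall y, varying y} -> approached om0 ->
  exists zs del w0 eta1 (s : nat -> stage),
    [/\ 0 < del, forall z, cdist z zs < del -> Q z, 0 < eta1, eta1 <= del / 8 &
        [/\ 2 * b%:R ^- size w0 < Num.min (d0 * (kappa * eta1) / L) (del / 4),
            0 < wt R om0 [::] w0 & forall k, stageP om0 zs w0 eta1 k (s k)]].
Proof.
move=> vom ap.
have [y [vy py]] := ae_ex (ae_and vom (ae_support (digit_law R om0))).
have [del del0 hdel] := open_square_ball (varying_interior R hb vy).
(* With del / 8 the image of the square under the rescaled branch has diameter at most del / 4; the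
   bound 1 / (2b), below every zoom rate, ensures that the empty word is not already stopped. *)
set zs := pt y in hdel; pose eta1 := Num.min (del / 8) (2 * b%:R)^-1.
have eta0 : 0 < eta1 by rewrite lt_min divr_gt0//= invr_gt0 mulr_gt0.
(* The cell [w0] is taken so small that, by the scaled gap, a point of the attractor falling in it
   cannot leave the stopped cylinder. *)
have g0 : 0 < Num.min (d0 * (kappa * eta1) / L) (del / 4) / 2.
 by rewrite divr_gt0// lt_min !divr_gt0// !mulr_gt0.
have [n0 hn0] := expb_small hb g0.
pose w0 := pfx y n0; have w00 : 0 < wt R om0 [::] w0.
 rewrite lt_neqAle wt_ge0 andbT eq_sym; have := py n0; rewrite digit_lawE.
 by [].
have uw := @ucont_wt R D [::] w0.
have [k0 hk0] := uw (wt R om0 [::] w0 / 2) (divr_gt0 w00 (ltr0n _ _ : 0 < 2)).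
exists zs, del, w0, eta1.
suff h k : exists s, stageP om0 zs w0 eta1 k s.
 exists (fun k=> projT1 (cid (h k))); split=> //; first by rewrite /eta1 ge_min lexx.
 split=> //; last by move=> k; exact: projT2 (cid (h k)).
 by rewrite size_pw -ltr_pdivlMl// mulrC.
have [N [t [u [y' [yu wu pk]]]]] := ap (maxn k k0).
pose om := iter (size u) T (splice (fam_code mu t) y').
have pk1 : pfx om k = pfx om0 k by apply: prefix_le pk; exact: leq_maxl.
have wom : 0 < wt R om [::] w0.
 have := hk0 om om0 (prefix_le (leq_maxr k k0) pk); rewrite ler_norml=> /andP[h _].
 lra.
have wuw : 0 < wt R (fam_code mu t) [::] (u ++ w0).
 rewrite wt_cat mulr_gt0//; move: wom; rewrite /om wt_iter xs_splice yu.
 by rewrite (wt_samebits _ _ _ (samebits_splice _ _)).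
have mE : measurable (gdig t @^-1` cyl (u ++ w0) : set (borel pl)).
 premeas; apply: (measurable_gdig hb)=> //; exact: cylM.
have [al [sal_ cal]] : exists al, subshift A al /\ cyl (u ++ w0) (gdig t (cod al)).
 apply: contrapT=> hn; move: wuw; rewrite (fam_wt hb) hmu//.
 rewrite (_ : _ `&` _ = set0) ?measure0 ?ltxx//.
 by apply/seteqP; split=> // al [sa ca]; apply: hn; exists al.
have [n hn] : exists n, zoom_rate R u * lam (pfx al n) <= eta1.
 have e0 : 0 < eta1 / zoom_rate R u by rewrite divr_gt0// zoom_rate_gt0.
 have [n hn] := expr_small r01 e0; exists n.
 rewrite mulrC -ler_pdivlMr ?zoom_rate_gt0//; apply: le_trans (ltW (hn n (leqnn n))).
 by apply: (le_trans (lam_expr bounds _)); rewrite size_pw.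
pose P n := zoom_rate R u * lam (pfx al n) <= eta1.
have exP : exists n, P n by exists n.
(* The first length at which the scale drops to [eta1]; the preceding length yields the lower bound
   with [kappa]. *)
have [m Pm minm] := ex_minnP exP.
have m1 : (0 < m)%N.
 case: m Pm {minm} => // P0; move: P0; rewrite /P /= leNgt=> /negP; case.
 have [_ _ _ [-> _ _ _ _]] := bounds; rewrite mulr1.
 apply: lt_le_trans (zoom_rate_ge R hb u); rewrite /eta1 gt_min; apply/orP; right.
 by rewrite ltf_pV2 ?posrE ?mulr_gt0// ltr_pMl// ltr1n.
exists (@Stage N t u y' al m); split; split=> //=.
- apply/andP; split=> //.
 case: m m1 Pm minm=> // m _ Pm minm.
 have : ~~ P m by apply/negP=> /minm; rewrite ltnn.
 rewrite /P -ltNge=> hm; rewrite /sword /= pfxS.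
 via (zoom_rate R u * (kappa * lam (pfx al m))).
  by rewrite mulrCA ler_pM2l// ltW.
 by rewrite ler_pM2l ?zoom_rate_gt0.
rewrite /smap /=.
have gu : pfx (gdig t (cod al)) (size u) = u.
 have := cyl_sub cal; rewrite /cyl /= => -> //.
rewrite (zoom_gdig hb)//; apply: (le_trans (pt_close R hb _ (n := n0))); last by rewrite size_pw.
have := cal; rewrite /cyl /= size_cat prefix_cat=> /eqP; rewrite eqseq_cat ?size_pw// => /andP[_ /eqP].
by exact.
Qed.

Section limit.
Variables (om0 : Om) (zs : pl) (del eta1 : R) (w0 : seq digit) (s : nat -> stage) (U : set_system nat).
Hypotheses (del0 : 0 < del) (hdel : forall z, cdist z zs < del -> Q z) (eta10 : 0 < eta1)
  (eta1del : eta1 <= del / 8)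
  (fine0 : 2 * b%:R ^- size w0 < Num.min (d0 * (kappa * eta1) / L) (del / 4))
  (wt0 : 0 < wt R om0 [::] w0) (sP : forall k, stageP om0 zs w0 eta1 k (s k))
  (UU : UltraFilter U) (Uoo : (\oo : set_system nat) `<=` U).

Notation wd k := (sword (s k)).
Notation uk k := (su (s k)).
Notation fk k := (fam_code mu (st (s k))).
Notation ak k := (sal (s k)).

Let scal k : R := zoom_rate R (uk k) * lam (wd k).

Let scal_itv k : kappa * eta1 <= scal k <= eta1.
by case: (sP k)=> _ []. Qed.

Definition branch k (z : pl) : pl := smap (s k) (word_map S (wd k) (clamp z)).

Lemma branch_lip k z w : cdist (branch k z) (branch k w) <= eta1 * cdist z w.
Proof.
rewrite /branch /smap zoom_dist//.
via (zoom_rate R (uk k) * (lam (wd k) * cdist z w)).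
 rewrite ler_pM2l ?zoom_rate_gt0//; apply: (le_trans (up _ (clampX z) (clampX w))).
 rewrite ler_pM2l//; exact: clamp_lip.
by rewrite mulrA ler_wpM2r ?cdist_ge0//; case/andP: (scal_itv k).
Qed.

Lemma branch_low k z w : X z -> X w -> kappa * eta1 / L * cdist z w <= cdist (branch k z) (branch k w).
Proof.
move=> Xz Xw; rewrite /branch /smap zoom_dist// !clamp_id//.
via (zoom_rate R (uk k) * (lam (wd k) / L * cdist z w)).
 rewrite !mulrA ler_wpM2r ?cdist_ge0// ler_wpM2r ?invr_ge0 ?(ltW L0)//.
 by case/andP: (scal_itv k).
rewrite ler_pM2l ?zoom_rate_gt0//; exact: low.
Qed.

Lemma branch_coding k al : branch k (cod al) = smap (s k) (cod (concat (wd k) al)).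
Proof. by rewrite /branch clamp_id// (coding_concat hS bounds). Qed.

(** The marked point is within del / 4 of [zs], and the image has diameter at most del / 4. *)
Lemma branch_near k z : cdist (branch k z) zs <= del / 2.
Proof.
have [_ [_ _ h]] := sP k.
have e : smap (s k) (cod (ak k)) = branch k (cod (dshift (sn (s k)) (ak k))).
 by rewrite branch_coding concat_dshift.
have Cz : branch k z = branch k (clamp z) by rewrite /branch (clamp_id (clampX z)).
rewrite Cz; apply: (le_trans (cdist_triangle (smap (s k) (cod (ak k))) _ _)).
have h1 : cdist (branch k (clamp z)) (smap (s k) (cod (ak k))) <= eta1 * 2.
 rewrite e; apply: (le_trans (branch_lip k _ _)); rewrite ler_pM2l//; apply: cdist_sq; [exact: clampX|tame].
move: fine0; rewrite lt_min=> /andP[_ h2]; move: h h1 h2 eta1del; lra.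
Qed.

Lemma branch_open k z : Q (branch k z).
Proof. by apply: hdel; apply: (le_lt_trans (branch_near k z)); rewrite ltr_pdivrMr// ltr_pMr// ltr1n. Qed.

Let limit_exists z : exists2 z', X z' & forall e, 0 < e -> U [set k | cdist (branch k z) z' < e].
by apply: square_ultra=> // k; apply: open_closed; exact: branch_open. Qed.

Let branch_clamp k z : branch k (clamp z) = branch k z.
by rewrite /branch (clamp_id (clampX z)). Qed.

(** The limit is chosen at the clamped point, so that the map is defined and Lipschitz on the whole
    plane. *)
Definition limit_map z : pl := projT1 (cid2 (limit_exists (clamp z))).

Lemma limit_mapP z e : 0 < e -> U [set k | cdist (branch k z) (limit_map z) < e].
Proof.
rewrite /limit_map; case: cid2=> z' _ h /h /=.
by apply: filterS=> k /=; rewrite branch_clamp.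
Qed.

Let limit_clamp z : limit_map (clamp z) = limit_map z.
by rewrite /limit_map (clamp_id (clampX z)). Qed.

Let limit_le (c : R) (d : nat -> R) (d' : R) : (forall e, 0 < e -> U [set k | d' <= d k + e]) ->
  (forall k, d k <= c) -> d' <= c.
Proof.
move=> h dc; apply/ler_addgt0Pl=> e e0; have [k /= hk] := filter_ex (h e e0).
by rewrite addrC; apply: (le_trans hk); rewrite lerD2r.
Qed.

Lemma limit_map_lip z w : cdist (limit_map z) (limit_map w) <= eta1 * cdist z w.
Proof.
apply: (@limit_le _ (fun k=> cdist (branch k z) (branch k w)))=> [e e0|k]; last exact: branch_lip.
have e2 : 0 < e / 2 by lra.
apply: filterS2 (limit_mapP z e2) (limit_mapP w e2)=> k /= h1 h2.
have := cdist_triangle (branch k z) (limit_map z) (limit_map w).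
have := cdist_triangle (branch k w) (branch k z) (limit_map w).
move: h1 h2; rewrite [cdist (limit_map z) (branch k z)]cdistC; lra.
Qed.

Lemma limit_map_low z w : X z -> X w -> kappa * eta1 / L * cdist z w <= cdist (limit_map z) (limit_map w).
Proof.
move=> Xz Xw; rewrite -lerN2; apply: (@limit_le _ (fun k=> - cdist (branch k z) (branch k w)))=> [e e0|k]; last first.
 rewrite lerN2; exact: branch_low.
have e2 : 0 < e / 2 by lra.
apply: filterS2 (limit_mapP z e2) (limit_mapP w e2)=> k /= h1 h2.
have := cdist_triangle (limit_map z) (branch k z) (branch k w).
have := cdist_triangle (limit_map w) (limit_map z) (branch k w).
move: h1 h2; rewrite [cdist (limit_map w) (branch k w)]cdistC; lra.
Qed.

Lemma limit_map_near z : cdist (limit_map z) zs <= del / 2.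
Proof.
apply: (@limit_le _ (fun k=> cdist (branch k z) zs))=> [e e0|k]; last exact: branch_near.
apply: filterS (limit_mapP z e0)=> k /= h1.
have := cdist_triangle (branch k z) (limit_map z) zs.
move: h1; rewrite cdistC; lra.
Qed.

(** Arzela-Ascoli along an ultrafilter: points where uniformity fails would converge to some [z],
    and equicontinuity would contradict convergence at [z]. *)
Lemma limit_map_uniform e : 0 < e -> U [set k | forall z, cdist (branch k z) (limit_map z) <= e].
Proof.
move=> e0; have [//|] := in_ultra_setVsetC [set k | forall z, cdist (branch k z) (limit_map z) <= e] UU.
move=> Uc; exfalso.
have bad k : exists z, X z /\ ((~` [set k | forall z, cdist (branch k z) (limit_map z) <= e]) k ->
  e < cdist (branch k z) (limit_map z)).
 have [h|h] := EM ([set k | forall z, cdist (branch k z) (limit_map z) <= e] k).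
  by exists (clamp 0); split; [exact: clampX|by []].
 have [z hz] : exists z, ~ (cdist (branch k z) (limit_map z) <= e).
  by apply: contrapT=> hn; apply: h=> z; apply: contrapT=> hz; apply: hn; exists z.
 exists (clamp z); split=> [|_]; first exact: clampX.
 by rewrite branch_clamp limit_clamp ltNge; apply/negP.
pose zk k := projT1 (cid (bad k)).
have zkP k : X (zk k) /\ ((~` [set k | forall z, cdist (branch k z) (limit_map z) <= e]) k ->
  e < cdist (branch k (zk k)) (limit_map (zk k))) by rewrite /zk; case: cid.
have [z Xz hz] := square_ultra UU (fun k=> (zkP k).1).
have e4 : 0 < e / 4 by lra.
have [k [[Vk h1] h2]] := filter_ex (filterI (filterI Uc (hz _ (divr_gt0 e4 eta10))) (limit_mapP z e4)).
rewrite /= in h1 h2; have := (zkP k).2 Vk.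
rewrite ltr_pdivlMr// mulrC in h1.
have := cdist_triangle (branch k z) (branch k (zk k)) (limit_map (zk k)).
have := cdist_triangle (limit_map z) (branch k z) (limit_map (zk k)).
have := branch_lip k (zk k) z; have := limit_map_lip z (zk k).
rewrite [cdist z (zk k)]cdistC; move: h1 h2 e4; lra.
Qed.

Variable i : 'I_M.+1.
Notation starts k := (sal (s k) (sn (s k)) = i).
Hypothesis Ui : U [set k | starts k].

(** Fixing the letter after the stopped word makes the set of admissible tails the same at every
    stage. *)
Let block k : set Sp := cyl (rcons (wd k) i).
Let weight k : R := mass (rcons (wd k) i).
Let tailk k : Sp -> Sp := dshift (size (wd k)).
Let mblock k : measurable (block k : set (borel Sp)). exact: cylM. Qed.

Let ushift_tailk k : ushift (tailk k). exact: ushift_dshift. Qed.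

Let start k : starts k -> pfx (ak k) (size (wd k)).+1 = rcons (wd k) i.
by move=> <-; rewrite pfxS /sword size_pw. Qed.

Let sub_sal k : subshift A (ak k). by case: (sP k)=> [[]]. Qed.

Let weight_ge0 k : 0 <= weight k. exact: mass_ge0. Qed.

Let weight_gt0 k : starts k -> 0 < weight k.
by move=> ki; rewrite /weight -(start ki); exact: (mass_gt0 hms). Qed.

(** Mean under the Gibbs measure conditioned on the block and read from the end of the stopped word,
    the letter [i] included. *)
Let cm k (F : Sp -> R) : R := (weight k)^-1 * Ex ms (fun be => \1_(block k) be * F (tailk k be)).

Let bcm k F : ucont F -> bmf ((fun be => \1_(block k) be * F (tailk k be)) : borel Sp -> R).
by move=> uF; apply: ucont_bmf; apply: ucontM; [exact: ucont_cyl|exact: (ucont_comp uF)]. Qed.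

Let mean_cm k : starts k -> mean (cm k).
Proof.
move=> /weight_gt0 w0'; split=> [F G uF uG|c F uF|F G e uF uG FG].
- rewrite /cm -mulrDr -ExD; [|tame|tame].
 by congr (_ * Ex _ _); apply/funext=> x; rewrite mulrDr.
- rewrite /cm mulrCA -(ExZ ms c (bcm k uF)).
 by congr (_ * Ex _ _); apply/funext=> x; rewrite mulrCA.
rewrite /cm -mulrBr -ExB; [|tame|tame].
rewrite normrM ger0_norm ?invr_ge0// mulrC ler_pdivrMr//.
apply: (le_trans (Ex_norm _ _)); first tame.
rewrite -[weight k]/(fine (ms (block k))) -Ex_indic// -ExZ; last tame.
apply: Ex_le.
- tame.
- tame.
move=> x; rewrite -mulrBr normrM ger0_norm// mulrC.
by rewrite ler_wpM2r.
Qed.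

Let cm_cyl_itv k w : 0 <= cm k \1_(cyl w) <= 1.
Proof.
have b1 : bmf ((fun be=> \1_(block k) be * \1_(cyl w) (tailk k be)) : borel Sp -> R) by tame.
have h0 : 0 <= Ex ms (fun be=> \1_(block k) be * \1_(cyl w) (tailk k be)).
 by apply: Ex_ge0=> x.
have h1 : Ex ms (fun be=> \1_(block k) be * \1_(cyl w) (tailk k be)) <= weight k.
 rewrite -[weight k]/(fine (ms (block k))) -Ex_indic//; apply: Ex_le=> //; first tame.
 by move=> x; rewrite ler_piMr// (le_trans (ler_norm _))//.
rewrite /cm mulr_ge0 ?invr_ge0//=; have := weight_ge0 k; rewrite le_eqVlt=> /predU1P[<-|w0'].
 lra.
by rewrite mulrC ler_pdivrMr// mul1r.
Qed.

Let p w : R := lim (cm k \1_(cyl w) @[k --> U]).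

Let p_cvg w : cm k \1_(cyl w) @[k --> U] --> p w.
Proof.
apply: (@ultra_cvg _ _ _ 1)=> k; have /andP[h0 h1] := cm_cyl_itv k w.
by rewrite ger0_norm.
Qed.

Let p_eq w c : U [set k | cm k \1_(cyl w) = c] -> p w = c.
Proof.
move=> h; have H := @ultra_unique R U UU _ (p w) c (@p_cvg w).
by apply: H; apply: cvg_near_cst.
Qed.

Let p_le w c : U [set k | cm k \1_(cyl w) <= c] -> p w <= c.
move=> h; have H := @ultra_le R U UU _ (p w) c (@p_cvg w); exact: H. Qed.

Let p_ge w c : U [set k | c <= cm k \1_(cyl w)] -> c <= p w.
move=> h; have H := @ultra_ge R U UU _ (p w) c (@p_cvg w); exact: H. Qed.

Let p_ge0 w : 0 <= p w.
by apply: p_ge; apply: filterS filterT=> k _ /=; case/andP: (cm_cyl_itv k w). Qed.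

Let p1 : p [::] = 1.
Proof.
apply: p_eq; apply: filterS Ui=> k ki /=; rewrite /cm cyl_nil.
rewrite (_ : (fun be=> _) = \1_(block k)); last by apply/funext=> be; rewrite indicT mulr1.
by rewrite Ex_indic// mulVf// gt_eqF// weight_gt0.
Qed.

Let pS w : p w = \sum_j p (rcons w j).
Proof.
have H := @ultra_unique R U UU _ (p w) (\sum_j p (rcons w j)) (@p_cvg w); apply: H.
have h : (fun k=> \sum_j cm k \1_(cyl (rcons w j))) @ U --> \sum_j p (rcons w j).
 by apply: cvg_sumr=> j.
apply: cvg_trans h; apply: near_eq_cvg; apply: filterS filterT=> k _ /=.
rewrite /cm -mulr_sumr -Ex_sum; last tame.
by congr (_ * Ex _ _); apply/funext=> be; rewrite -mulr_sumr indic_cyl_children.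
Qed.

Lemma limit_law_exists : exists m : probability (borel Sp) R, forall w, m (cyl w) = (p w)%:E.
Proof. exact: (tree_measure p_ge0 p1 pS). Qed.

Definition limit_law : probability (borel Sp) R := projT1 (cid limit_law_exists).

Let m := limit_law.

Let mE w : m (cyl w) = (p w)%:E. exact: projT2 (cid limit_law_exists) w. Qed.

Let cm_cvg F : ucont F -> cm k F @[k --> U] --> Ex m F.
Proof.
apply: (@mean_cvg _ _ U cm (Ex m)).
- apply: filterS Ui=> k; exact: mean_cm.
- exact: mean_Ex.
- move=> w; rewrite Ex_indic ?mE; tame.
Qed.

Let cm_block k w : cm k \1_(cyl (i :: w)) = (weight k)^-1 * mass (sword (s k) ++ i :: w).
Proof.
rewrite /cm; congr (_ * _); rewrite /mass -Ex_indic; last tame.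
congr Ex; apply/funext=> be; rewrite !indicE -natrM mulnb; congr (_%:R); congr nat_of_bool.
rewrite cyl_cat; apply/andP/idP; rewrite !inE.
 by move=> [h1 h2]; split=> //; move: h1; rewrite /block -cats1=> /cyl_sub.
move=> [h1 h2]; split=> //; rewrite /block -cats1 cyl_cat; split=> //; exact: (@cyl_sub _ [:: i] w).
Qed.

Lemma limit_law_start : m (cyl [:: i]) = 1%E.
Proof.
rewrite mE; congr (_%:E); apply: p_eq; apply: filterS Ui=> k ki /=.
by rewrite cm_block cats1 mulVf// gt_eqF// weight_gt0.
Qed.

(** The quasi-Bernoulli inequalities compare the conditional mass of [i :: w] with its mass
    uniformly in the stage, hence also in the limit. *)
Lemma limit_law_mass : exists2 C : R, 0 < C & forall w,
  fine (m (cyl (i :: w))) <= C * mass (i :: w) /\ mass (i :: w) <= C * fine (m (cyl (i :: w))).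
Proof.
have [C C1 hC] := mass_ratio hms; have C0 : 0 < C by exact: lt_le_trans C1.
have [k0 k0i] := filter_ex Ui.
have mi : 0 < mass [:: i].
 have := mass_gt0 hms 1 (subshift_dshift (sn (s k0)) (sub_sal k0)).
 by rewrite /pfx /mkseq /= /dshift addn0 k0i.
(* The two estimates carry the factors [(mass [:: i])^-1] and [mass [:: i]]; their sum covers
   both. *)
exists (C * (mass [:: i] + (mass [:: i])^-1)); first by rewrite mulr_gt0// addr_gt0// invr_gt0.
have M1 := mass_ge0 ms.
move=> w; rewrite mE; split.
 via (C * (mass [:: i])^-1 * mass (i :: w)).
  apply: p_le; apply: filterS Ui=> k ki /=; rewrite cm_block.
  have [h _] := hC _ _ _ w (sub_sal k) (start ki).
  rewrite mulrC ler_pdivrMr ?weight_gt0// -(ler_pM2r mi); apply: (le_trans h).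
  by rewrite /weight le_eqVlt; apply/orP; left; apply/eqP; field; rewrite gt_eqF.
 by rewrite ler_wpM2r// ler_wpM2l ?(ltW C0)// lerDr.
via (C * mass [:: i] * p (i :: w)); last first.
 by rewrite ler_wpM2r// ler_wpM2l ?(ltW C0)// lerDl invr_ge0.
rewrite -ler_pdivrMl ?mulr_gt0//; apply: p_ge; apply: filterS Ui=> k ki /=; rewrite cm_block.
have [_ h] := hC _ _ _ w (sub_sal k) (start ki).
rewrite ler_pdivrMl ?mulr_gt0// mulrCA ler_pdivlMl ?weight_gt0// mulrC.
by apply: (le_trans h); rewrite -mulrA [mass (_ ++ _) * _]mulrC.
Qed.

(** The first term is the scaled gap between cylinders; the second keeps the neighbourhood inside
    the ball around [zs]. *)
Let g1 : R := Num.min (d0 * (kappa * eta1) / L) (del / 4).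

Let g10 : 0 < g1.
by rewrite lt_min !divr_gt0// !mulr_gt0. Qed.

(** Half of [g1] is spent here; the other half absorbs the distance between a branch and its
    limit. *)
Definition region : set pl := [set z | exists al, [/\ subshift A al, al 0%N = i &
  cdist z (limit_map (cod al)) < g1 / 2]].

Lemma region_limit al : subshift A al -> al 0%N = i -> region (limit_map (cod al)).
Proof. by move=> sa ai; exists al; rewrite cdistxx divr_gt0. Qed.

Lemma region_open : open region.
Proof.
rewrite openE=> z [al [sa ai h]].
apply: (@nbhs_plane _ _ _ (g1 / 2 - cdist z (limit_map (cod al)))); first by rewrite subr_gt0.
move=> w hw; exists al; split=> //.
have := cdist_triangle z w (limit_map (cod al)); move: hw; rewrite cdistC; lra.
Qed.

Lemma region_square : region `<=` Q.
Proof.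
move=> z [al [_ _ h]]; apply: hdel.
have := cdist_triangle (limit_map (cod al)) z zs.
have := limit_map_near (cod al).
have : g1 <= del / 4 by rewrite /g1 ge_min lexx orbT.
move: h del0; lra.
Qed.

Let scal_cdist k z w : cdist (smap (s k) z) (smap (s k) w) = zoom_rate R (uk k) * cdist z w.
exact: zoom_dist. Qed.

(* Points of the attractor mapped near the limit piece lie in the stopped cylinder. *)
Let same_block k al be : subshift A al -> subshift A be ->
  pfx al (size (wd k)) = sword (s k) ->
  cdist (smap (s k) (cod al)) (smap (s k) (cod be)) < g1 ->
  pfx be (size (wd k)).+1 = pfx al (size (wd k)).+1.
Proof.
move=> sa sb pa h; apply: (close_prefix hS bounds d00 gap sa sb); rewrite pa.
have rt := zoom_rate_gt0 R hb (uk k) : 0 < zoom_rate R (uk k).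
rewrite scal_cdist in h; rewrite -(ltr_pM2l rt); apply: (lt_le_trans h).
via (d0 * (kappa * eta1) / L); first by rewrite /g1 ge_min lexx.
rewrite !mulrA ler_pM2r ?invr_gt0// [_ * d0]mulrC -!mulrA ler_pM2l//.
by have /andP[h1 _] := scal_itv k; move: h1; rewrite /scal /zoom_rate -mulrA.
Qed.

(** A point of the region is close to the limit image of an admissible tail, hence to its image
    under the branch; the scaled gap then forces the common block. *)
Let capture k be : starts k ->
  (forall z, cdist (branch k z) (limit_map z) <= g1 / 2) ->
  subshift A be -> region (smap (s k) (cod be)) -> block k be.
Proof.
move=> ki hu sb [al [sa ai h]].
have sc : subshift A (concat (wd k) al) by exact: (subshift_concat (sub_sal k) (start ki) sa ai).
have h1 := hu (cod al); rewrite branch_coding in h1.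
rewrite /block /cyl /= size_rcons (same_block sc sb); first last.
- by have := cdist_triangle (limit_map (cod al)) (smap (s k) (cod (concat (wd k) al))) (smap (s k) (cod be));
  move: h h1; rewrite [cdist (limit_map _) (smap _ (cod be))]cdistC; lra.
- by rewrite concat_prefix.
by rewrite pfxS concat_prefix /concat ltnn subnn ai.
Qed.

Let block_branch k be : block k be -> smap (s k) (cod be) = branch k (cod (tailk k be)).
Proof.
move=> kb; rewrite branch_coding; congr (smap _ (cod _)).
have pv : pfx be (size (wd k)) = sword (s k).
 by move: kb; rewrite /block -cats1=> /cyl_sub.
by rewrite /tailk -{1}(concat_dshift be (size (wd k))) pv.
Qed.

Let block_gdig k be : block k be -> pfx (gdig (st (s k)) (cod be)) (size (uk k)) = su (s k).
Proof.
move=> kb; apply: (zoom_half hb)=> //; apply: open_half.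
rewrite -/(smap (s k) (cod be)) (block_branch kb); exact: branch_open.
Qed.

(** Share of the stopped block in the magnified cell; its limit is the constant of proportionality
    between the typical measure and the image law. *)
Let quot k : R := weight k / wt R (fk k) [::] (uk k).

Let wtu k : 0 < wt R (fk k) [::] (uk k). by case: (sP k)=> [[]]. Qed.

Let mgd k w : measurable (cod @^-1` (gdig (st (s k)) @^-1` cyl w) : set (borel Sp)).
Proof.
premeas; apply: mcod=> //.
premeas; apply: (measurable_gdig hb)=> //; exact: cylM.
Qed.

Let fam_ms k w : wt R (fk k) [::] w = fine (ms (cod @^-1` (gdig (st (s k)) @^-1` cyl w))).
Proof.
rewrite (fam_wt hb) coded_law//.
premeas; apply: (measurable_gdig hb)=> //; exact: cylM.
Qed.

Let quot_itv k : 0 <= quot k <= 1.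
Proof.
rewrite /quot divr_ge0 ?(ltW (wtu k))//= ler_pdivrMr// mul1r fam_ms /weight /mass.
apply: fine_le; rewrite ?fin_num_measure//; first tame.
by apply: le_measure; rewrite ?inE//; [tame|move=> be /block_gdig].
Qed.

(** Points of the subshift coded in the cell [w0] are close to the marked one and so belong to the
    block; hence the share does not vanish in the limit. *)
Let quot_ge k : starts k -> wt R (scode (s k)) [::] w0 <= quot k.
Proof.
move=> ki; have [[yu _ _ _] [cal _ _]] := sP k.
rewrite /quot ler_pdivlMr//.
have -> : wt R (scode (s k)) [::] w0 * wt R (fk k) [::] (uk k) =
  wt R (fk k) [::] (su (s k) ++ w0).
 rewrite wt_cat mulrC /scode wt_iter xs_splice yu.
 by rewrite (wt_samebits _ _ _ (samebits_splice _ _)).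
rewrite fam_ms /weight /mass -(gibbs_full hms (mgd k _)).
apply: fine_le; rewrite ?fin_num_measure//; [apply: measurableI=> //; exact: measurable_subshift|tame|].
apply: le_measure; rewrite ?inE//; [apply: measurableI=> //; exact: measurable_subshift|tame|].
move=> be [sb cb]; rewrite /cyl /= size_rcons -(start ki).
have pal : pfx (ak k) (size (wd k)) = sword (s k) by rewrite {2}/sword /sword size_pw.
apply: (same_block (sub_sal k) sb pal).
have split w (h : pfx w (size (su (s k) ++ w0)) = su (s k) ++ w0) :
  pfx w (size (uk k)) = su (s k) /\ pfx (dshift (size (uk k)) w) (size w0) = w0.
 move: h; rewrite size_cat prefix_cat=> /eqP; rewrite eqseq_cat ?size_pw// => /andP[/eqP h1 /eqP h2].
 by split.
have [c1 c2] := split _ cal; have [c3 c4] := split _ cb.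
rewrite /smap !(zoom_gdig hb)//; apply: (le_lt_trans (pt_close R hb _ (n := size w0))); first by rewrite c4.
by [].
Qed.

Let c0 : R := lim (quot k @[k --> U]).

Let c0_cvg : quot k @[k --> U] --> c0.
by apply: (@ultra_cvg _ _ _ 1)=> k; have /andP[h0 h1] := quot_itv k; rewrite ger0_norm. Qed.

Let near_om0 F : ucont F -> F (scode (s k)) @[k --> U] --> (F om0 : R).
Proof.
move=> uF; apply/cvgrPdist_le=> e e0; have [k0 hk0] := uF e e0.
have Uk : U [set k | (k0 <= k)%N] by apply: Uoo; exists k0.
apply: filterS Uk=> k kk /=; apply: hk0.
have [[_ _ pk _] _] := sP k; exact: (prefix_le kk (esym pk)).
Qed.

Lemma constant_gt0 : 0 < c0.
Proof.
apply: (lt_le_trans wt0); have h := near_om0 (@ucont_wt R D [::] w0).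
have UF : Filter U by exact: ultra_proper.
have l1 := @cvgB _ _ _ _ UF _ _ _ _ c0_cvg h; rewrite -subr_ge0.
have H := @ultra_ge R U UU _ _ 0 l1.
by apply: H; apply: filterS Ui=> k /quot_ge /=; rewrite subr_ge0.
Qed.

Section test_function.
Variables (h : pl -> R) (H : R).
Hypotheses (H0 : 0 <= H) (hH : forall z w, `|h z - h w| <= H * cdist z w)
  (hO : forall z, ~ region z -> h z = 0).

Let ch : {within X, continuous h}. exact/continuous_subspaceT/(lip_continuousR H0 hH). Qed.

Let uh (g : pl -> pl) : (forall z w, cdist (g z) (g w) <= eta1 * cdist z w) -> ucont (h \o g \o cod : Sp -> R).
Proof.
move=> gl e e0; have K1 : 0 < H * eta1 + 1 by rewrite ltr_wpDl// mulr_ge0// ltW.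
have [k hk] := coding_nbhs hS bounds (divr_gt0 e0 K1).
exists k=> al be ab; apply: (le_trans (hH _ _)).
via ((H * eta1 + 1) * cdist (cod al) (cod be)).
 via (H * (eta1 * cdist (cod al) (cod be))); first by rewrite ler_wpM2l.
 by rewrite mulrA ler_wpM2r ?cdist_ge0// lerDl.
by rewrite mulrC -ler_pdivlMr// ltW// hk.
Qed.

Let F : Om -> R := h \o pt \o @xs D.
Let uF : ucont F. by apply: ucont_xs; exact: (ucont_pt hb ch). Qed.

(** Only the block contributes: a point of the attractor whose image meets the support of [h] lies
    in it by [capture], and there the magnified point is the branch applied to the tail. *)
Let stage_integral k : starts k ->
  (forall z, cdist (branch k z) (limit_map z) <= g1 / 2) ->
  cexp (scode (s k)) F = quot k * cm k (h \o branch k \o cod).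
Proof.
move=> ki hu; have [[yu _ _ _] _] := sP k.
set om := fk k; set u := su (s k) in yu *.
have e1 : cexp (scode (s k)) F = cexp (iter (size u) T (splice om (ext_word u))) F.
 apply: cexp_samebits=> //; rewrite /scode -/om -/u; apply: samebits_iter; last by rewrite !xs_splice prefix_ext.
 by move=> j; rewrite !bits_splice.
have e2 := cexp_node om u uF; rewrite -e1 in e2.
have uG : ucont (fun x : Om=> \1_(cyl u) (xs x) * F (iter (size u) T x) : R).
 apply: ucontM; first by apply: ucont_xs; exact: ucont_cyl.
 apply: ucont_comp=> //; apply: ushift_iter; exact: ushift_tailT.
have e3 := fam_cexp hb mu (st (s k)) uG; rewrite Ex_coded in e3; last first.
 have [m1 [K hK]] := ucont_bmf (ucont_splice om uG).
 by split; [exact: (measurableT_comp m1 (measurable_gdig hb (st (s k))))|exists K=> z; exact: hK].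
rewrite -/om in e3; rewrite e3 in e2.
have w0' := lt0r_neq0 (weight_gt0 ki); rewrite /quot /cm mulrACA divff// mul1r.
apply: (mulfI (lt0r_neq0 (wtu k))); rewrite mulrA divff ?(lt0r_neq0 (wtu k))// mul1r -/om -/u -e2.
apply: Ex_ae.
- have [m1 [K hK]] := ucont_bmf (ucont_splice om uG).
 split; last by exists K=> z; exact: hK.
 exact: (measurableT_comp m1 (measurableT_comp (measurable_gdig hb (st (s k))) mcod)).
- apply: bcm; apply: uh; exact: branch_lip.
have fA : ms (subshift A) = 1%E by case: hms.
apply: (ae_mono (prob1_ae (@measurable_subshift _ A) fA))=> be sb /=.
rewrite xs_splice.
have -> : F (iter (size u) T (splice om (gdig (st (s k)) (cod be)))) =
  h (pt (dshift (size u) (gdig (st (s k)) (cod be)))).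
 by rewrite /F /=; congr (h (pt _)); apply/funext=> n; rewrite xs_iter xs_splice.
rewrite !indicE; have [kb|kb] := EM (block k be).
 rewrite (mem_set kb) mem_set; last exact: (block_gdig kb).
 rewrite !mul1r -(zoom_gdig hb (cX be) (block_gdig kb)) -/(smap (s k) (cod be)).
 by rewrite (block_branch kb).
rewrite [in RHS]memNset// mul0r; case: (boolP (_ \in cyl u))=> [|_]; last by rewrite mul0r.
rewrite inE=> cb; rewrite mul1r -(zoom_gdig hb (cX be) cb) hO// => rg.
tame.
Qed.

Lemma limit_integral : Ex (digit_law R om0) (h \o pt) = c0 * Ex m (h \o limit_map \o cod).
Proof.
have -> : Ex (digit_law R om0) (h \o pt) = cexp om0 F.
 by rewrite /cexp; congr Ex; apply/funext=> y; rewrite /F /= xs_splice.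
have Hu := @ultra_unique R U UU _ _ (c0 * Ex m (h \o limit_map \o cod)) (near_om0 (ucont_cexp uF)); apply: Hu.
have UF : Filter U by exact: ultra_proper.
have l1 := @cvgM _ _ _ UF _ _ _ _ c0_cvg (cm_cvg (uh limit_map_lip)).
apply/cvgrPdist_le=> e e0; have e2 : 0 < e / 2 by rewrite divr_gt0.
move/cvgrPdist_le: l1=> /(_ _ e2) h1.
have H1 : 0 < H + 1 by rewrite ltr_wpDl.
have d1 : 0 < Num.min (g1 / 2) (e / 2 / (H + 1)) by rewrite lt_min !divr_gt0.
have h2 := limit_map_uniform d1.
apply: filterS3 h1 h2 Ui=> k /= h1 h2 ki.
rewrite stage_integral//; last by move=> z; apply: (le_trans (h2 z)); rewrite ge_min lexx.
have [_ _ mc] := mean_cm ki.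
have h3 : `|cm k (h \o limit_map \o cod) - cm k (h \o branch k \o cod)| <= e / 2.
 apply: mc=> [||x /=]; [exact: uh limit_map_lip|by apply: uh; exact: branch_lip|].
 apply: (le_trans (hH _ _)); rewrite cdistC.
 via ((H + 1) * (e / 2 / (H + 1))); last by rewrite mulrC divfK ?gt_eqF.
 apply: ler_pM=> //; rewrite ?cdist_ge0// ?lerDl//.
 by apply: (le_trans (h2 _)); rewrite ge_min lexx orbT.
have /andP[q0 q1] := quot_itv k.
rewrite -(subrK (quot k * cm k (h \o limit_map \o cod)) (c0 * _)) -addrA -mulrBr.
apply: (le_trans (ler_normD _ _)); rewrite [e]splitr; apply: lerD=> //.
rewrite normrM (ger0_norm q0); apply: le_trans h3; rewrite ler_piMl//.
Qed.

End test_function.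

Let measurable_limit : meas_fun (limit_map \o cod : borel Sp -> borel pl).
Proof.
apply: (@measurableT_comp _ _ _ (borel Sp) (borel pl) (borel pl) (limit_map : borel pl -> borel pl))=> //.
apply: continuous_borel; exact: (lip_continuous limit_map_lip).
Qed.

Let gap_to (G : set pl) (z : pl) : R := inf [set cdist z w | w in ~` G].

(** Lipschitz functions built from the distance to the complement of [G] vanish off the region and
    converge to the indicator of [G]. *)
Let limit_open (G : set pl) : open G -> G `<=` region ->
  fine (Phi om0 G) = c0 * fine (m ((limit_map \o cod) @^-1` G)).
Proof.
move=> oG Gr.
have ne z : [set cdist z w | w in ~` G] !=set0.
 exists (cdist z 0); exists 0=> //; move=> /Gr/region_square[/andP[]]; by rewrite ltxx.
have lb z : has_lbound [set cdist z w | w in ~` G] by exists 0=> _ [w _ <-]; exact: cdist_ge0.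
have gl z w : gap_to G z <= gap_to G w + cdist z w.
 rewrite -lerBlDr; apply: lb_le_inf=> // _ [v Gv <-]; rewrite lerBlDr addrC.
 via (cdist z v); last exact: cdist_triangle.
 by apply: ge_inf=> //; exists v.
have g_ge0 z : 0 <= gap_to G z by apply: lb_le_inf=> // _ [v _ <-]; exact: cdist_ge0.
have goff z : ~ G z -> gap_to G z = 0.
 move=> Gz; apply/eqP; rewrite eq_le g_ge0 andbT; apply: ge_inf=> //.
 by exists z=> //; rewrite cdistxx.
have gon z : G z -> 0 < gap_to G z.
 move=> Gz; have [e e0 he] := plane_nbhs (open_nbhs_nbhs (conj oG Gz)).
 apply: (lt_le_trans e0); apply: lb_le_inf=> // _ [v Gv <-].
 by rewrite leNgt; apply/negP=> /he.
pose h j z := clampR (j%:R * gap_to G z).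
have hl j z w : `|h j z - h j w| <= j%:R * cdist z w.
 apply: (le_trans (clampR_lip _ _)); rewrite -mulrBr normrM ger0_norm// ler_wpM2l//.
 have := gl z w; have := gl w z; rewrite [cdist w z]cdistC ler_norml=> h1 h2; apply/andP; split; lra.
have h0 j z : ~ region z -> h j z = 0.
 move=> rz; rewrite /h goff ?mulr0; last by move=> /Gr.
 by rewrite clampR_id// lexx ler01.
have hc z : h j z @[j --> \oo] --> (\1_G z : R).
 rewrite indicE; have [Gz|Gz] := EM (G z); last first.
  rewrite memNset//; apply: cvg_near_cst; near=> j; rewrite /h goff// mulr0 clampR_id//.
  by rewrite lexx ler01.
 rewrite mem_set//; apply: cvg_near_cst; near=> j; rewrite /h /clampR.
 have : 1 <= j%:R * gap_to G z.
  rewrite -ler_pdivrMr ?gon//; near: j; exact: nbhs_infty_ger.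
 by move=> h1; rewrite h1 leNgt (lt_le_trans ltr01 h1).
have hn j z : `|h j z| <= 1 by have /andP[a1 a2] := clampR_itv (j%:R * gap_to G z); rewrite ger0_norm.
have mh j : meas_fun (h j : borel pl -> R).
 apply: measurable_continuous; exact: (lip_continuousR (ler0n _ j) (hl j)).
have mG : measurable (G : set (borel pl)) by exact: open_borel.
have mpt := @measurable_pt R _ hb.
have m1 : measurable (pt @^-1` G : set (borel Y)) by premeas; exact: mpt.
have m2 : measurable ((limit_map \o cod) @^-1` G : set (borel Sp)).
 premeas; exact: measurable_limit.
have c1 : Ex (digit_law R om0) (h j \o pt) @[j --> \oo] --> Ex (digit_law R om0) (\1_(pt @^-1` G) : borel Y -> R).
 apply: (Ex_dct (K := 1))=> [j|j y||].
 - exact: (measurableT_comp (mh j) mpt).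
 - exact: hn.
 - tame.
 - by apply: aeW=> y; have := hc (pt y); rewrite !indicE.
have c2 : Ex m (h j \o limit_map \o cod) @[j --> \oo] --> Ex m (\1_((limit_map \o cod) @^-1` G) : borel Sp -> R).
 apply: (Ex_dct (K := 1))=> [j|j y||].
 - exact: (measurableT_comp (mh j) measurable_limit).
 - exact: hn.
 - tame.
 - by apply: aeW=> y; have := hc (limit_map (cod y)); rewrite !indicE.
rewrite PhiE -!Ex_indic//; move: c1; rewrite [X in X @ _](_ : _ = (fun j=> c0 * Ex m (h j \o limit_map \o cod))); last first.
 apply/funext=> j; apply: (@limit_integral _ j%:R)=> // z; exact: h0.
move=> c1; rewrite -(cvg_lim (@Rhausdorff R) c1); apply: cvg_lim=> //.
exact: (@cvgM _ _ _ _ _ _ _ _ (cvg_cst c0) c2).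
Unshelve. all: by end_near. Qed.

Lemma limit_region (E : set (borel pl)) : measurable E -> E `<=` region ->
  fine (Phi om0 E) = c0 * fine (m ((limit_map \o cod) @^-1` E)).
Proof.
move=> mE' Er; have mr : measurable (region : set (borel pl)) by apply: open_borel; exact: region_open.
pose c0' : {nonneg R} := NngNum (ltW constant_gt0).
pose n1 : {measure set (borel pl) -> \bar R} := mrestr (Phi om0) mr.
pose n2 : {measure set (borel pl) -> \bar R} := mscale c0' (mrestr (pushP m measurable_limit) mr).
have n2E G : n2 G = (c0%:E * m ((limit_map \o cod) @^-1` (G `&` region)))%E.
 by rewrite /n2 /= /mscale /= /mrestr pushPE.
have opens G : open G -> n1 G = n2 G.
 move=> oG; rewrite n2E /n1 /= /mrestr.
 have oGr : open (G `&` region) by apply: openI=> //; exact: region_open.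
 have mGr : measurable (G `&` region : set (borel pl)) by exact: open_borel.
 have m2 : measurable ((limit_map \o cod) @^-1` (G `&` region) : set (borel Sp)).
  premeas; exact: measurable_limit.
 rewrite -[LHS](@fineK _ (Phi om0 (G `&` region))) ?fin_num_measure//.
 rewrite -[X in (_ * X)%E](@fineK _ (m _)) ?fin_num_measure//; congr (_%:E).
 by apply: limit_open=> //.
have := @measure_unique _ R (borel pl) (@open pl) (fun=> setT) erefl (@openI pl) (fun=> openT) (@bigcup_const _ _ [set: nat] setT (ex_intro _ 0%N I)) n1 n2 opens _ E mE'.
have EI : E `&` region = E by apply/setIidPl.
rewrite n2E /n1 /= /mrestr EI=> -> //=.
 rewrite fineM// fin_num_measure//; premeas; exact: measurable_limit.
by move=> _; rewrite setTI; apply: (le_lt_trans (probability_le1 _ mr)); rewrite ltry.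
Qed.

Lemma branch_cderiv k z : Q z -> exists d, cderiv (branch k) z d.
Proof.
move=> Qz; have [r0 r00 hr] := open_square_ball Qz.
have [_ [d hd]] := word_map_cderiv (wd k) hS Qz.
exists ((zoom_rate R (uk k))%:C%C * d).
apply: (@cderiv_local _ (smap (s k) \o word_map S (wd k)) _ z _ r0)=> //.
 move=> w wz; rewrite /branch /= clamp_id//; apply: open_closed; exact: hr.
apply: cderiv_comp=> //; exact: cderiv_affine.
Qed.

(** Differentiability comes from Cauchy's formula on a disc around the point; a zero derivative
    would violate the lower Lipschitz bound inherited from the branches. *)
Lemma limit_conformal : conformal_on Q limit_map.
Proof.
move=> z Qz; have [r0 r00 hr] := open_square_ball Qz.
have rr : 0 < r0 / 2 by lra.
have [d hd] : exists d, cderiv limit_map z d.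
 apply: (@limit_cderiv _ limit_map eta1 (r0 / 2) z)=> //; first exact: limit_map_lip.
 move=> e e0; have [k hk] := filter_ex (limit_map_uniform e0); exists (branch k); split=> //.
  exact: branch_lip.
 move=> w wz; apply: branch_cderiv; apply: hr; apply: (le_lt_trans wz).
 lra.
split; first by apply/derivable_cderiv; exists d.
rewrite (cderiv_val hd); apply/eqP=> d0'.
have l0 : 0 < kappa * eta1 / L by rewrite divr_gt0// mulr_gt0.
have [del' del0' hdel'] := hd (kappa * eta1 / L / 2) (divr_gt0 l0 (ltr0n _ _ : 0 < 2)).
set t := Num.min r0 del' / 2; have mt : 0 < Num.min r0 del' by rewrite lt_min r00.
have t0 : 0 < t by rewrite divr_gt0.
have tm : t < Num.min r0 del' by rewrite ltr_pdivrMr// ltr_pMr// ltr1n.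
have [tr td] : t < r0 /\ t < del' by move: tm; rewrite lt_min=> /andP[].
have nt : ComplexField.Normc.normc (t%:C%C) = t by rewrite normc_real gtr0_norm.
have := hdel' t%:C%C; rewrite nt d0' mul0r subr0=> /(_ td).
have zt : cdist (z + t%:C%C) z = t by rewrite /cdist addrC addKr.
have Qt : Q (z + t%:C%C) by apply: hr; rewrite zt.
have := limit_map_low (open_closed Qt) (open_closed Qz); rewrite zt /cdist=> h1 h2.
have := le_trans h1 h2; rewrite ler_pM2r// => h3.
lra.
Qed.

End limit.

Theorem limit_exists om0 : {ae digit_law R om0, forall y, varying y} -> approached om0 ->
  exists i (f : pl -> pl) (m : probability (borel Sp) R) (O : set pl) (C c : R),
  [/\ conformal_on Q f /\ exists K : R, forall z w, cdist (f z) (f w) <= K * cdist z w,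
      forall z, Q (f z),
      m (cyl [:: i]) = 1%E,
      0 < C /\ forall w, fine (m (cyl (i :: w))) <= C * mass (i :: w) /\ mass (i :: w) <= C * fine (m (cyl (i :: w))) &
      [/\ open O, O `<=` Q, forall al, subshift A al -> al 0%N = i -> O (f (cod al)), 0 < c &
          forall E : set (borel pl), measurable E -> E `<=` O ->
            fine (Phi om0 E) = c * fine (m ((f \o cod) @^-1` E))]].
Proof.
move=> v0 a0; have [zs [del [w0 [eta1 [s [del0 hdel eta10 eta1del [fine0 wt0 sP]]]]]]] := stages_exist v0 a0.
have [U [UU Uoo]] := free_ultrafilter.
have [i Ui] := ultra_pick (fun k=> sal (s k) (sn (s k))) UU.
have [C C0 hC] := limit_law_mass sP UU Ui.
exists i, (limit_map del0 hdel eta10 eta1del fine0 sP UU), (limit_law sP UU Ui).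
exists (region del0 hdel eta10 eta1del fine0 sP UU i), C; eexists; split=> //.
- by split; [exact: limit_conformal|exists eta1; exact: limit_map_lip].
- move=> z; apply: (hdel); apply: (le_lt_trans (limit_map_near del0 hdel eta10 eta1del fine0 sP UU z)).
 lra.
- exact: limit_law_start.
- split; [exact: region_open|exact: region_square|exact: region_limit|exact: (constant_gt0 del0 hdel eta10 eta1del fine0 wt0 sP UU Uoo Ui)|].
 by move=> E mE EO; apply: limit_region.
Qed.

End limit_map.

(** * Sceneries and the main theorem *)

Section cylinder_domination.
Context (R : realType) (M : nat).
Notation Sp := (shift_space M).

Lemma finite_cyl_children (P : {measure set (borel Sp) -> \bar R}) w : (P setT < +oo)%E ->
  fine (P (cyl w)) = \sum_c fine (P (cyl (rcons w c))).
Proof.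
move=> Poo; have fP (E : set (borel Sp)) : measurable E -> P E \is a fin_num.
 by move=> mE; rewrite ge0_fin_numE// (le_lt_trans _ Poo)// le_measure ?inE.
apply: EFin_inj; rewrite fineK; last tame.
rewrite -sumEFin (eq_bigr (fun c=> P (cyl (rcons w c))))=> [|c _]; last by rewrite fineK ?fP//; exact: cylM.
rewrite -measure_bigsetU_ord=> [|c|]; [congr (P _)|tame|].
- apply/seteqP; split=> be.
  move=> cb; rewrite (bigD1 (be (size w)))//=; left.
  by rewrite /cyl /= size_rcons pfxS cb.
 elim/big_ind : _=> [//|U V hU hV [/hU|/hV]//|c _].
 rewrite -cats1; exact: cyl_sub.
- apply/trivIsetP=> c c' _ _ cc'; apply/seteqP; split=> // be [].
 rewrite /cyl /= !size_rcons !pfxS=> /rcons_inj[_ h] /rcons_inj[_ h'].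
 by move: cc'; rewrite -h -h' eqxx.
Qed.

(** The differences between [C + 1] times the masses of [Q] and those of [P] are nonnegative and
    consistent on cylinders, hence come from a measure; so domination holds on all Borel sets. The
    extra 1 keeps the total mass [C + 1 - a] positive for normalisation. *)
Lemma cyl_domination (P : {measure set (borel Sp) -> \bar R}) (Q : probability (borel Sp) R) (C : R) :
  (P setT < +oo)%E -> (forall w, fine (P (cyl w)) <= C * fine (Q (cyl w))) ->
  forall E : set (borel Sp), measurable E -> Q E = 0%E -> P E = 0%E.
Proof.
move=> Poo PQ.
have fP (E : set (borel Sp)) : measurable E -> P E \is a fin_num.
 by move=> mE; rewrite ge0_fin_numE// (le_lt_trans _ Poo)// le_measure ?inE.
pose a := fine (P setT); have a0 : 0 <= a by rewrite fine_ge0.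
have aC : a <= C by have := PQ [::]; rewrite cyl_nil probability_setT mulr1.
have C1 : 0 < C + 1 - a by lra.
pose p w := ((C + 1) * fine (Q (cyl w)) - fine (P (cyl w))) / (C + 1 - a).
have [||w|N NE] := @tree_measure R M p.
- move=> w; rewrite divr_ge0 ?(ltW C1)// subr_ge0; apply: (le_trans (PQ w)).
 by rewrite ler_wpM2r ?fine_ge0// lerDl.
- by rewrite /p cyl_nil probability_setT mulr1 divff// gt_eqF.
- rewrite /p -mulr_suml sumrB -mulr_sumr -cyl_children -finite_cyl_children//.
pose c1 : {nonneg R} := NngNum (ltW C1).
have C0 : 0 <= C + 1 by lra.
pose m1 : {measure set (borel Sp) -> \bar R} := measure_add P (mscale c1 N).
pose m2 : {measure set (borel Sp) -> \bar R} := mscale (NngNum C0) Q.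
have m1E E : m1 E = (P E + (C + 1 - a)%:E * N E)%E by rewrite [LHS](measure_addE P (mscale c1 N)).
have eq12 : forall E : set (borel Sp), measurable E -> m1 E = m2 E.
 apply: shift_measure_unique.
  by rewrite m1E probability_setT lte_add_pinfty// ltry.
 move=> w; rewrite m1E /m2 /mscale /= NE -[X in (X + _)%E](fineK (fP _ (cylM w))).
 have QE : Q (cyl w) = (fine (Q (cyl w)))%:E by rewrite fineK// fin_num_measure//; exact: cylM.
 by rewrite /mscale /= QE -EFinD /p mulrC divfK ?gt_eqF// addrC subrK.
move=> E mE QE; have m2E : m2 E = 0%E by transitivity ((C + 1)%:E * Q E)%E=> //; rewrite QE mule0.
have := eq12 E mE; rewrite m1E m2E=> h.
by apply/eqP; rewrite eq_le measure_ge0 -h leeDl// mule_ge0// ltW.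
Qed.

End cylinder_domination.

Lemma dominatesP d (T : measurableType d) (R : realType) (m1 m2 : set T -> \bar R) :
  (forall E, measurable E -> m2 E = 0%E -> m1 E = 0%E) -> m1 `<< m2.
Proof. by move=> h A A0 E mE EA; apply: h=> //; exact: A0. Qed.

Section empirical_averages.
Context (R : realType).
Implicit Types (u v : nat -> R).

Lemma mean_tail u v (l : R) n0 : (forall n, (n0 <= n)%N -> u n = v n) ->
  n%:R^-1 * \sum_(i < n) v i @[n --> \oo] --> l -> n%:R^-1 * \sum_(i < n) u i @[n --> \oo] --> l.
Proof.
move=> uv vl; pose c := \sum_(i < n0) (u i - v i).
have c0 : n%:R^-1 * c @[n --> \oo] --> (0 : R).
 apply/cvgrPdist_le=> e e0; exists (Num.truncn (`|c| / e)).+1=> // n /= hn.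
 have n1 : 0 < n%:R :> R by rewrite ltr0n; exact: leq_trans hn.
 rewrite sub0r normrN normrM ger0_norm// mulrC ler_pdivrMr// mulrC -ler_pdivrMr//.
 by rewrite (le_trans (ltW (truncnS_gt _)))// ler_nat.
suff : \forall n \near \oo, n%:R^-1 * \sum_(i < n) v i + n%:R^-1 * c = n%:R^-1 * \sum_(i < n) u i.
 move=> h; rewrite -(addr0 l); apply: cvg_trans (cvgD vl c0); exact: near_eq_cvg.
exists n0=> // n /= nn; rewrite -mulrDr; congr (_ * _).
have -> : c = \sum_(i < n) u i - \sum_(i < n) v i; last by lra.
rewrite -sumrB -[in RHS](subnKC nn) big_split_ord /= [X in _ + X]big1 ?addr0// => i _.
by rewrite uv ?subrr// leq_addr.
Qed.

Definition empirical_law (T : ptopologicalType) (x : nat -> T) (N : nat) : {measure set (borel T) -> \bar R} :=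
  mscale (N%:R^-1 : R)%:nng (msum (fun n => \d_(x n : borel T)) N).

Lemma integral_empirical (T : ptopologicalType) (x : nat -> T) (f : T -> R) N :
  meas_fun (f : borel T -> R) ->
  (\int[empirical_law x N]_y (f y)%:E =
   (N%:R^-1 * \sum_(n < N) f (x n))%:E)%E.
Proof.
move=> mf.
have key (g : T -> R) : meas_fun (g : borel T -> R) -> (forall y, 0 <= g y) ->
  (\int[empirical_law x N]_y (g y)%:E =
   (N%:R^-1 * \sum_(n < N) g (x n))%:E)%E.
 move=> mg g0; have mg' : meas_fun (fun y : borel T=> (g y)%:E) by exact/measurable_EFinP.
 rewrite ge0_integral_mscale//=; last by move=> y _; rewrite lee_fin.
 rewrite ge0_integral_measure_sum//; last by move=> y _; rewrite lee_fin.
 rewrite EFinM -sumEFin; congr (_ * _)%E; apply: eq_bigr=> n _.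
 by rewrite integral_dirac// diracT mul1e.
rewrite integralE (eq_integral (fun y : borel T=> (Num.max (f y) 0)%:E)); last by move=> y _; rewrite funeposE -EFin_max.
rewrite [X in (_ - X)%E](eq_integral (fun y : borel T=> (Num.max (- f y) 0)%:E)); last first.
 by move=> y _; rewrite funenegE -EFin_max.
have max0 (g : T -> R) y : 0 <= Num.max (g y) 0 by rewrite le_max lexx orbT.
have mmax (g : T -> R) : meas_fun (g : borel T -> R) ->
  meas_fun ((fun y=> Num.max (g y) 0) : borel T -> R).
 by move=> mg; apply: measurable_maxr=> //.
have nf : meas_fun ((fun y=> - f y) : borel T -> R) by exact: measurableT_comp.
rewrite (key _ (mmax _ mf) (max0 f)) (key _ (mmax _ nf) (max0 (fun y=> - f y))).
rewrite -EFinB -mulrBr -sumrB; congr (_ * _)%:E; apply: eq_bigr=> n _ /=.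
have [h|h] := leP 0 (f (x n)).
 have h' : - f (x n) <= 0 by lra.
 by rewrite (max_r h') subr0.
have h' : 0 <= - f (x n) by lra.
by rewrite (max_l h') sub0r opprK.
Qed.

End empirical_averages.

(** * Sceneries of a measure locally proportional to a coded one *)

Section scenery_of_a_code.
Context (R : realType) (b : nat).
Hypothesis hb : (1 < b)%N.
Notation pl := (plane R).
Notation X := (closed_square R).
Notation Q := (open_square R).
Notation half := (half_open_square R).
Notation SP := (square_prob R).
Notation D := (b ^ 2).-1.
Notation Om := (shift_space D.*2.+1).
Notation Y := (shift_space D).
Notation T := (@tailT D).
Notation Phi := (@Phi R b hb).
Notation pt := (@pt R b).
Notation digits := (@digits R b).
Notation good := (@good R b).
Implicit Types (om : Om) (y : Y).

Lemma weakly_converges_orbit (nu : SP) (z : pl) q (om : Om) (Pq : probability (borel Om) R) n0 :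
  (0 < q)%N -> generic (iter q T) Pq om ->
  (forall n, (n0 <= n)%N -> sim (scenery b nu z n) (Phi (iter n T om))) ->
  weakly_converges (empirical b nu q z) (component_law hb Pq).
Proof.
move=> q0 gen hs F cF [K [_ hK]].
have mF : meas_fun (F : borel SP -> R) by exact: measurable_continuous.
have bF : bmf (F : borel SP -> R).
 by split=> //; exists (K + 1)=> x; apply: hK; rewrite ?ltrDl.
have uF : ucont (F \o Phi).
 by apply: continuous_ucont=> om'; apply: continuous_comp; [exact: Phi_continuous|exact: cF].
have -> : (\int[component_law hb Pq]_x (F x)%:E = (Ex Pq (F \o Phi))%:E)%E.
 by rewrite EFin_Ex ?Ex_pushP.
rewrite (_ : (fun N=> _) = (fun N=> (N%:R^-1 * \sum_(n < N) F (scenery b nu z (q * n)))%:E)); last first.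
 apply/funext=> N; exact: integral_empirical.
apply: cvg_EFin; first by exact: nearW.
suff h : N%:R^-1 * \sum_(n < N) F (scenery b nu z (q * n)) @[N --> \oo] --> (Ex Pq (F \o Phi) : R) by exact: h.
apply: (@mean_tail _ (fun n=> F (scenery b nu z (q * n))) (fun n=> F (Phi (iter (q * n) T om))) _ n0)=> [n nn|].
 by apply: sim_continuous=> //; apply: hs; rewrite (leq_trans nn)// leq_pmull.
have := gen _ uF; rewrite /avg /bsum; apply: cvg_trans; apply: near_eq_cvg; apply: nearW=> N.
congr (_ * _); apply: eq_bigr=> n _ /=; congr (F (Phi _)).
by rewrite mulnC iterM.
Qed.

(** The definition of generation includes [q = 0], where every term of the empirical average is the
    magnification at level 0. *)
Lemma weakly_converges_still (nu : SP) (z : pl) : half z ->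
  weakly_converges (empirical b nu 0 z) (\d_(magnify b nu 0 (0%N, 0%N) : borel SP) : probability _ R).
Proof.
move=> hz F cF _.
have mF : meas_fun (F : borel SP -> R) by exact: measurable_continuous.
rewrite integral_dirac//; last exact/measurable_EFinP.
rewrite diracT mul1e (_ : (fun N=> _) = (fun N=> (N%:R^-1 * \sum_(n < N) F (scenery b nu z (0 * n)))%:E)); last first.
 apply/funext=> N; exact: integral_empirical.
apply: cvg_EFin; first by exact: nearW.
have z0 : bcube_index b 0 z = (0%N, 0%N) by rewrite bcube_index_digits.
apply: cvg_near_cst; exists 1%N=> // N /= N0.
under eq_bigr do rewrite mul0n /scenery z0.
by rewrite sumr_const card_ord -[X in _ * X]mulr_natl mulKf// pnatr_eq0 -lt0n.
Qed.

Variables (om0 : Om) (nu : SP) (O : set pl) (c0 : R).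
Hypotheses (g0 : good om0) (oO : open O) (OQ : O `<=` Q) (nuO : nu O = 1%E) (c00 : 0 < c0)
  (nuE : forall E : set (borel pl), measurable E -> E `<=` O -> fine (Phi om0 E) = c0 * fine (nu E)).

Let mO : measurable (O : set (borel pl)). exact: open_borel. Qed.

(** Proportionality on [O], which carries [nu], transfers null sets from the coded law to [nu]. *)
Lemma ae_digits (G : Y -> Prop) : {ae digit_law R om0, forall y, G y} -> {ae nu, forall z, O z /\ G (digits z)}.
Proof.
move=> [N [mN N0 GN]]; pose E : set (borel pl) := O `&` digits @^-1` N.
have mE : measurable E.
 apply: measurableI=> //; premeas; exact: (measurable_digits hb).
have PE0 : Phi om0 E = 0%E.
 rewrite PhiE; apply/eqP; rewrite eq_le measure_ge0 andbT -N0.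
 have mpE : measurable (pt @^-1` E : set (borel Y)) by premeas; exact: (@measurable_pt R _ hb).
 have -> : digit_law R om0 (pt @^-1` E) = digit_law R om0 (pt @^-1` E `&` N).
  apply: prob_ae_eq=> //; first exact: measurableI.
  by apply: (ae_mono g0)=> y gy; split=> [[Oy Ny]|[]//]; split=> //; move: Ny; rewrite /= gy.
 apply: le_measure; rewrite ?inE//; exact: measurableI.
have nE0 : nu E = 0%E.
 have := nuE mE (@subIsetl _ _ _); rewrite PE0 /= => /esym/eqP.
 rewrite mulf_eq0 gt_eqF//= => /eqP h.
 by rewrite -(@fineK _ (nu E)) ?fin_num_measure// h.
have aeO := prob1_ae mO nuO.
have aeE : {ae nu, forall z, ~ E z} by exists E; split=> // z /=; exact: contrapT.
apply: (ae_mono (ae_and aeO aeE))=> z [Oz Ez]; split=> //.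
by apply: contrapT=> nG; apply: Ez; split=> //; apply: GN.
Qed.

(** Once the cell of a point lies inside [O], the two measures are proportional on it and have the
    same magnification, which is that of the node reached by the orbit of the code. *)
Lemma scenery_orbit : {ae nu, forall z, [/\ O z, half z & exists n0, forall n, (n0 <= n)%N ->
  sim (scenery b nu z n) (Phi (iter n T (splice om0 (digits z))))]}.
Proof.
apply: (ae_mono (ae_digits (@ae_support R D (digit_law R om0))))=> z [Oz sz].
have hz : half z by apply: open_half; exact: OQ.
split=> //; have [e e0 he] := plane_nbhs (open_nbhs_nbhs (conj oO Oz)).
have b1 : 0 < b%:R^-1 :> R by rewrite invr_gt0 ltr0n ltnW.
have e2 : 0 < e / 2 by lra.
have [n0 hn0] := @expb_small R b hb _ e2.
exists n0=> n nn; rewrite /scenery bcube_index_digits//.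
set u := pfx (digits z) n; have su : size u = n by rewrite size_pw.
have cellO : bcube b n (key u) `<=` O.
 move=> w; rewrite -{1}su (bcube_key R hb)=> -[hw /= cw]; apply: he.
 rewrite -(pt_digits hb hz) -(pt_digits hb hw); apply: le_lt_trans (pt_close R hb (n := n) _) _.
  by rewrite -[in RHS]su.
 rewrite mulrC -ltr_pdivlMr//; apply: le_lt_trans hn0.
 by rewrite lef_pV2 ?posrE ?exprn_gt0 ?ltr0n ?(ltnW hb)// ler_eXn2l// ltr1n.
have wu : 0 < wt R om0 [::] u.
 rewrite lt_neqAle wt_ge0 andbT eq_sym -eqe -digit_lawE; exact: sz.
have mB : measurable (bcube b n (key u) : set (borel pl)) by exact: measurable_bcube.
have PB : Phi om0 (bcube b n (key u)) = (wt R om0 [::] u)%:E by rewrite -{1}su Phi_bcube.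
have nB : fine (nu (bcube b n (key u))) = wt R om0 [::] u / c0.
 by apply: (mulfI (lt0r_neq0 c00)); rewrite -nuE// PB /= mulrC divfK ?gt_eqF.
have step1 : sim (magnify b nu n (key u)) (magnify b (Phi om0) n (key u)).
 move=> E mE; rewrite !magnifyE; last 2 first.
 - by rewrite PB gt_eqF.
 - by rewrite -fine_eq0 ?fin_num_measure// nB gt_eqF// divr_gt0.
 have mBE := measurable_blowup b n (key u) mE.
 have := nuE mBE (subset_trans (@subIsetr _ _ _) cellO).
 rewrite nB PB /= -[X in (X * _)%E = _](@fineK _ (nu _)) ?fin_num_measure//.
 rewrite -[X in _ -> _ = (X * _)%E](@fineK _ (Phi om0 _)) ?fin_num_measure// => ->.
 by rewrite invf_div; congr (_%:E); rewrite mulrA [_ * c0]mulrC.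
have step2 : sim (magnify b (Phi om0) n (key u)) (Phi (node om0 u)).
 rewrite -{1}su; exact: magnify_Phi.
have step3 : sim (Phi (node om0 u)) (Phi (iter n T (splice om0 (digits z)))).
 rewrite /u -node_splice; apply: Phi_samebits.
 by have := samebits_node (splice om0 (digits z)) n; rewrite xs_splice.
by move=> E mE; rewrite step1// step2// step3.
Qed.

Lemma scenery_generates (P0 : probability (borel Om) R) :
  {ae kap R om0, forall om, generic T P0 om} ->
  (forall q, (0 < q)%N -> exists Pq : probability (borel Om) R, {ae kap R om0, forall om, generic (iter q T) Pq om}) ->
  generates b nu (component_law hb P0).
Proof.
move=> gen1 genq.
have generate q (Pq : probability (borel Om) R) : (0 < q)%N ->
  {ae kap R om0, forall om, generic (iter q T) Pq om} ->
  {ae nu, forall z, weakly_converges (empirical b nu q z) (component_law hb Pq)}.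
 move=> q0 /ae_pushP/ae_digits ag.
 apply: (ae_mono (ae_and ag scenery_orbit))=> z [[_ gz] [_ _ [n0 hn0]]].
 exact: weakly_converges_orbit gz hn0.
split; [|exact: generate|case=> [|q]].
- apply/eqP; rewrite eq_le probability_le1 /=; last exact: measurable_half.
 rewrite -nuO le_measure ?inE//; first exact: measurable_half.
 by move=> z /OQ/open_half.
- exists (\d_(magnify b nu 0 (0%N, 0%N) : borel SP)).
 apply: (ae_mono scenery_orbit)=> z [_ hz _]; exact: weakly_converges_still.
have [Pq hq] := genq q.+1 (ltn0Sn q); exists (component_law hb Pq).
exact: generate.
Qed.

End scenery_of_a_code.

Lemma hausdorff_dim_ge0 (R : realType) (E : set (plane R)) : (0 <= hausdorff_dim E)%E.
Proof. by apply: le_ereal_inf_tmp=> _ [s [s0 _] <-]; rewrite lee_fin. Qed.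

Lemma cp_dim_ge0 (R : realType) (Q : probability (borel (square_prob R)) R) : (0 <= cp_dim Q)%E.
Proof.
apply: integral_ge0=> nu _; apply: le_ereal_inf_tmp=> _ [E _ <-]; exact: hausdorff_dim_ge0.
Qed.

(** The two families of inequalities meet at the entropy [H]; a real [s] strictly between [y] and
    [x] would contradict them. *)
Lemma le_cp_dim (R : realType) (b : nat) (x y : \bar R) (H : R) : (1 < b)%N -> (0 <= y)%E ->
  (forall s : R, 0 <= s -> (s%:E < x)%E -> s * ln b%:R <= H) ->
  (forall s : R, s < H -> ((s / ln b%:R)%:E <= y)%E) -> (x <= y)%E.
Proof.
move=> hb y0 hx hy; have l0 : 0 < ln b%:R :> R by rewrite ln_gt0// ltr1n.
rewrite leNgt; apply/negP=> yx.
have yfin : y \is a fin_num by rewrite ge0_fin_numE// (lt_le_trans yx)// leey.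
have [s ys sx] : exists2 s : R, fine y < s & (s%:E < x)%E.
 case: x yx {hx} => [x||] yx //.
 - exists ((fine y + x) / 2); move: yx; rewrite -[in X in X -> _](fineK yfin) !lte_fin; lra.
 - by exists (fine y + 1); rewrite ?ltrDl// ltry.
 - by move: yx; rewrite ltNge leNye.
have s0 : 0 <= s by rewrite (le_trans _ (ltW ys))// fine_ge0.
have h1 := hx s s0 sx; pose t := (fine y + s) / 2.
have ts : t < s by rewrite /t; lra.
have := hy (t * ln b%:R) (lt_le_trans _ h1); rewrite ltr_pM2r// mulfK ?gt_eqF// => /(_ ts).
rewrite -(fineK yfin) lee_fin /t; lra.
Qed.

Section typical_point.
Context (R : realType) (b : nat).
Hypothesis hb : (1 < b)%N.
Notation pl := (plane R).
Notation D := (b ^ 2).-1.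
Notation Om := (shift_space D.*2.+1).
Notation T := (@tailT D).
Variables (mu : probability (borel pl) R) (P0 : probability (borel Om) R).
Hypotheses (TP : preserves T P0) (KP : disint P0) (GP : {ae P0, forall om, generic T P0 om})
  (VP : {ae P0, forall om, {ae digit_law R om, forall y, varying y}})
  (AP : forall a, P0 (cyl a) != 0%E -> exists N (t : offset b N) (u : seq 'I_D.+1) y,
        [/\ pfx y (size u) = u, 0 < wt R (fam_code mu t) [::] u &
            cyl a (iter (size u) T (splice (fam_code mu t) y))]).

Lemma ae_good : {ae P0, forall om, @good R b om}.
Proof.
apply: (ae_mono VP)=> om vom; apply: (ae_mono vom)=> y; exact: varying_digits.
Qed.

(** The almost sure properties hold at one common code; it is approached because all cylinders
    around almost every code are charged. *)
Lemma typical_point : exists om0,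
  [/\ {ae digit_law R om0, forall y, varying y}, approached mu om0,
      {ae kap R om0, forall om, generic T P0 om} &
      forall q, (0 < q)%N -> exists Pq : probability (borel Om) R, {ae kap R om0, forall om, generic (iter q T) Pq om}].
Proof.
have A := ae_and (ae_and VP (@ae_support _ _ P0)) (ae_and (ae_fibre KP GP) (skeleton_generic TP KP)).
have [om0 [[v0 s0] [g0 q0]]] := ae_ex A.
exists om0; split=> // k; have [N [t [u [y [yu w0 cy]]]]] := AP (s0 k).
by exists N, t, u, y; split=> //; apply/cylP.
Qed.

End typical_point.

(** * Equivalence with the restricted Gibbs measure *)

Section transported_measure.
Context (R : realType) (M : nat).
Notation pl := (plane R).
Notation Sp := (shift_space M).
Variables (S : 'I_M.+1 -> pl -> pl) (A : 'M[bool]_M.+1) (phi : Sp -> R) (ms : probability (borel Sp) R)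
  (mu : probability (borel pl) R).
Hypotheses (hS : conformal_system S) (hms : gibbs A phi ms)
  (hmu : forall E : set (borel pl), measurable E -> mu E = ms (subshift A `&` coding S @^-1` E)).
Variables (L r kappa : R) (lam : seq 'I_M.+1 -> R) (d0 : R).
Hypotheses (bounds : lip_bounds S L r kappa lam) (d00 : 0 < d0)
  (gap : forall al be, subshift A al -> subshift A be -> al 0%N <> be 0%N ->
     d0 <= cdist (coding S al) (coding S be)).
Variables (m : probability (borel Sp) R) (i : 'I_M.+1) (C : R).
Hypotheses (mi : m (cyl [:: i]) = 1%E) (C0 : 0 < C)
  (hC : forall w, fine (m (cyl (i :: w))) <= C * mass ms (i :: w) /\ mass ms (i :: w) <= C * fine (m (cyl (i :: w)))).

Let mcyl : measurable (cyl [:: i] : set (borel Sp)). by tame. Qed.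

Let cyl_disjoint (j : 'I_M.+1) (w : seq 'I_M.+1) : j != i -> cyl (j :: w) `&` cyl [:: i] = set0.
Proof.
move=> ji; apply/seteqP; split=> // al [].
by rewrite /cyl /= /pfx /mkseq /= => -[aj _] [ai]; move: ji; rewrite -aj -ai eqxx.
Qed.

Let m_other (j : 'I_M.+1) (w : seq 'I_M.+1) : j != i -> m (cyl (j :: w)) = 0%E.
Proof.
move=> ji; have -> : m (cyl (j :: w)) = m (cyl (j :: w) `&` cyl [:: i]).
 apply: prob_ae_eq; [tame|by apply: measurableI=> //; exact: cylM|].
 by apply: (ae_mono (prob1_ae mcyl mi))=> al ai; split=> [ci|[]].
by rewrite cyl_disjoint//.
Qed.

Lemma limit_law_ac (E : set (borel Sp)) : measurable E -> ms E = 0%E -> m E = 0%E.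
Proof.
apply: (@cyl_domination _ _ m ms (C + 1)); first exact: prob_ltoo.
case=> [|j w].
 rewrite cyl_nil probability_setT mulr1 [X in fine X <= _](_ : _ = 1%E) ?lerDr ?ltW//.
 exact: probability_setT.
have [->|ji] := eqVneq j i.
 apply: (le_trans (hC w).1); rewrite ler_wpM2r ?fine_ge0// lerDl ler01//.
have mj := m_other w ji; rewrite [X in fine X <= _]mj mulr_ge0 ?fine_ge0// addr_ge0// ltW//.
Qed.

Lemma piece_law_ac (E : set (borel Sp)) : measurable E -> m E = 0%E -> ms (E `&` cyl [:: i]) = 0%E.
Proof.
apply: (@cyl_domination _ _ (mrestr ms mcyl) m (C + 1)).
 by rewrite /= /mrestr setTI (le_lt_trans (probability_le1 _ mcyl))// ltry.
case=> [|j w]; rewrite /= /mrestr.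
 rewrite cyl_nil setTI probability_setT mulr1; apply: (le_trans (hC [::]).2).
 by rewrite mi mulr1 lerDl.
have [->|ji] := eqVneq j i; last by rewrite cyl_disjoint// measure0 mulr_ge0 ?fine_ge0// addr_ge0// ltW.
rewrite (_ : cyl (i :: w) `&` cyl [:: i] = cyl (i :: w)).
 apply: (le_trans (hC w).2); rewrite ler_wpM2r ?fine_ge0// lerDl ler01//.
apply/setIidPl; exact: (@cyl_sub _ [:: i] w).
Qed.

(** By the gap, pieces with different first letters are disjoint, so a point of the subshift coded
    in the piece [i] starts with [i]. *)
Lemma piece_mass (E : set (borel pl)) : measurable E ->
  mu (E `&` limit_piece S A i) = ms (coding S @^-1` E `&` cyl [:: i]).
Proof.
move=> mE; have mco := measurable_coding hS bounds.
have mcE : measurable (coding S @^-1` E : set (borel Sp)) by premeas; exact: mco.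
have mL : measurable (limit_piece S A i : set (borel pl)) by apply: closed_borel=> z; exact: (closed_piece hS bounds).
rewrite hmu; last exact: measurableI.
rewrite -(gibbs_full hms (measurableI _ _ mcE mcyl)); congr (ms _); apply/seteqP; split=> al.
 move=> [sal [Eal [be [sb bi] bal]]]; split=> //; split=> //.
 rewrite /cyl /= /pfx /mkseq /=; congr [:: _].
 apply: contrapT=> ali; have := gap sb sal; rewrite bal cdistxx bi=> h.
 by move: d00; rewrite ltNge=> /negP; apply; apply: h=> e; apply: ali.
move=> [sal [Eal]]; rewrite /cyl /= /pfx /mkseq /= => -[ai].
by split=> //; split=> //; exists al.
Qed.

Lemma limit_law_shift : {ae m, forall al, subshift A al /\ al 0%N = i}.
Proof.
have mA := @measurable_subshift _ A.
have a1 : {ae m, forall al, subshift A al}.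
 exists (~` subshift A); split=> //; first exact: measurableC.
 apply: limit_law_ac; first exact: measurableC.
 by have [fA _] := hms; rewrite probability_setC// fA subee.
apply: (ae_mono (ae_and a1 (prob1_ae mcyl mi)))=> al [sal].
by rewrite /cyl /= /pfx /mkseq /= => -[ai].
Qed.

End transported_measure.

Theorem theorem2p3 (R : realType) (b : nat) (hb : (1 < b)%N) (M : nat)
    (S : 'I_M.+1 -> plane R -> plane R) (hS : conformal_system S)
    (A : 'M[bool]_M.+1) (hA : strong_separation S A)
    (mu : probability (borel (plane R)) R) (hmu : gibbs_for S A mu) :
  exists (f : plane R -> plane R) (i : 'I_M.+1)
      (mu0 : {measure set (borel (plane R)) -> \bar R})
      (nu : square_prob R)
      (P : probability (cp_path R) R)
      (Q : probability (borel (square_prob R)) R),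
    let mu_i := (fun E : set (borel (plane R)) => mu (E `&` limit_piece S A i))
    in
    [/\ conformal_on (open_square R) f /\
          {within closed_square R, continuous f},
        mu0 `<< mu_i /\ mu_i `<< mu0,
        (forall E : set (borel (plane R)), measurable E ->
           nu E = mu0 (closed_square R `&` f @^-1` E)),
        [/\ cp_chain b P, cp_ergodic P, measure_component P Q &
            generates b nu Q] &
        (measure_dim mu <= cp_dim Q)%E].
Proof.
have [phi [ms [_ _ hms muE]]] := hmu.
have [L [r [kappa [lam bounds]]]] := lip_bounds_exist hS.
have [d0 d00 gap] := separation_gap hS bounds hA.
have mco := measurable_coding hS bounds.
have muX := coded_square hS hms muE bounds.
have [P0 [TP KP GP VP [dimP AP]]] := typical_chain hb muX.
have [om0 [v0 a0 g0 q0]] := typical_point TP KP GP VP AP.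
have [i [f [m [V [C [c hl]]]]]] := limit_exists hb hS hms muE bounds d00 gap v0 a0.
case: hl=> -[cf [K lf]] fQ mi [C0 hC] [oV VQ Vf c0 Phi_m].
have mf : meas_fun (f : borel (plane R) -> borel (plane R)).
 apply: continuous_borel; exact: lip_continuous lf.
have mfc : meas_fun (f \o coding S : borel (shift_space M) -> borel (plane R)).
 exact: (@measurableT_comp _ _ _ (borel (shift_space M)) (borel (plane R)) (borel (plane R)) (f : borel (plane R) -> borel (plane R))).
have mX : measurable (closed_square R : set (borel (plane R))) by apply: closed_borel; exact: closed_closed_square.
pose nu0 : probability (borel (plane R)) R := pushP m mfc.
have nuX : nu0 (closed_square R) = 1%E.
 rewrite /nu0 pushPE (_ : _ @^-1` _ = setT) ?probability_setT//.
 apply/seteqP; split=> // al _; apply: open_closed; exact: fQ.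
(* [mu0] is the image of the limit law under the coding map and [nu] its further image under [f], so
   the relation between them holds by construction. *)
exists f, i, (pushP m mco), (SquareProb nuX), (chain_law hb P0), (component_law hb P0)=> mu_i.
have gP := ae_good hb VP.
split.
- split=> //; apply: continuous_subspaceT; exact: lip_continuous lf.
- have mpre (E : set (borel (plane R))) : measurable E -> measurable (coding S @^-1` E : set (borel (shift_space M))).
  move=> mE; premeas; exact: mco.
 have mci : measurable (cyl [:: i] : set (borel (shift_space M))) by tame.
 split; apply: dominatesP=> E mE; have mcE := mpre _ mE.
  rewrite /mu_i (piece_mass hS hms muE bounds d00 gap)// => h.
  rewrite [LHS]pushPE -(limit_law_ac mi C0 hC (measurableI _ _ mcE mci) h).
  apply: prob_ae_eq=> //; first exact: measurableI.
  by apply: (ae_mono (prob1_ae mci mi))=> al ai; split=> [|[]].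
 move=> h; rewrite /mu_i (piece_mass hS hms muE bounds d00 gap)//.
 apply: (piece_law_ac mi C0 hC)=> //.
 by rewrite -h [RHS]pushPE.
- move=> E mE; rewrite [LHS]pushPE [RHS]pushPE; congr (m _).
 apply/seteqP; split=> al; last by case.
 move=> Eal; split=> //; exact: (coding_X hS bounds).
- split.
 + exact: chain_law_cp.
 + by apply: chain_law_ergodic=> //; apply: generic_ergodic=> //; exact: ushift_tailT.
 + exact: chain_law_component.
 + have go : @good R b om0 by apply: (ae_mono v0)=> y; exact: varying_digits.
  apply: (@scenery_generates R b hb om0 (SquareProb nuX) V c)=> //.
   rewrite [LHS]pushPE; apply: prob_ae1.
    premeas; apply: (mfc)=> //; exact: open_borel.
   apply: (ae_mono (limit_law_shift hms mi C0 hC))=> al [sal ai]; exact: Vf.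
  by move=> E mE EO; rewrite Phi_m// [in RHS]pushPE.
apply: (@le_cp_dim R b _ _ (Ex P0 (@entropy R (b ^ 2).-1)))=> //; first exact: cp_dim_ge0.
move=> s hs; exact: chain_dim_ge.
Qed.
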